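(* Let $[\rho]\in\mathcal{M}(\Gamma_2)\smallsetminus\mathcal{M}^0_+(\Gamma_2)$ be the class of a non-Fuchsian representation, i.e. $[\rho]\in\mathcal{M}^{1}(\Gamma_2)\cup\mathcal{M}^{-1}(\Gamma_2)\cup\mathcal{M}^0_-(\Gamma_2)$. Then $\rho$ sends some simple closed curve to a non-hyperbolic element of $\mathrm{PSL}_2(\mathbb{R})$.
   Context: $\Sigma_2$ is a compact connected oriented surface of genus $2$ without boundary and $\Gamma_2=\pi_1(\Sigma_2)=\langle a_1,b_1,a_2,b_2\mid [a_1,b_1][a_2,b_2]\rangle$. A representation $\rho\in\mathrm{Hom}(\Gamma_2,\mathrm{PSL}_2(\mathbb{R}))$ is non-elementary if its image is Zariski dense in $\mathrm{PSL}_2(\mathbb{R})=\mathrm{Isom}^+(\mathbb{H}^2)$. $\mathcal{M}(\Gamma_2)$ is the quotient of the set of non-elementary representations by conjugation by $\mathrm{PSL}_2(\mathbb{R})$. The Euler class $\mathrm{eu}(\rho)\in\mathbb{Z}$ is obtained by choosing arbitrary lifts of $\rho(a_i),\rho(b_i)$ to the universal cover $\widetilde{\mathrm{PSL}}_2(\mathbb{R})$ and computing the product of commutators of these lifts corresponding to the relator; it lies in the kernel of $\widetilde{\mathrm{PSL}}_2(\mathbb{R})\to\mathrm{PSL}_2(\mathbb{R})$, identified with $\mathbb{Z}$. One has $|\mathrm{eu}(\rho)|\le 2$, with equality exactly for Fuchsian (faithful and discrete) representations. $\mathcal{M}^k(\Gamma_2)$ is the set of classes in $\mathcal{M}(\Gamma_2)$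 with Euler class $k$. Let $\mathrm{Aut}^+(\Gamma_2)$ be the group of automorphisms fixing the fundamental class in $H_2(\Gamma_2,\mathbb{Z})$, $\mathrm{Mod}(\Sigma_2)=\mathrm{Aut}^+(\Gamma_2)/\mathrm{Inn}(\Gamma_2)$, let $\varphi$ be the hyperelliptic involution (the only non-trivial element of the center of $\mathrm{Mod}(\Sigma_2)$), and $\bar\varphi\in\mathrm{Aut}^+(\Gamma_2)$ a lift of $\varphi$. $\mathcal{M}^0(\Gamma_2)$ is the disjoint union of two $\mathrm{Mod}(\Sigma_2)$-invariant open subsets: $\mathcal{M}^0_+(\Gamma_2)$ (resp. $\mathcal{M}^0_-(\Gamma_2)$) is the set of $[\rho]\in\mathcal{M}^0(\Gamma_2)$ such that $\rho$ and $\rho\circ\bar\varphi$ are conjugated by an orientation-preserving (resp. orientation-reversing) isometry of $\mathbb{H}^2$. Simple closed curves are understood to be non-trivial in $\Gamma_2$ (not null-homotopic). An element $\pm A\in\mathrm{PSL}_2(\mathbb{R})$ is hyperbolic if $|\mathrm{Tr}(A)|>2$. *)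

(* Defs.v *)
From Stdlib Require Import Relation_Operators.
From HB Require Import structures.
From mathcomp Require Import all_boot all_order all_algebra.
From mathcomp Require Import generic_quotient.
From mathcomp Require Import boolp classical_sets functions reals topology.
From mathcomp Require Import normedtype exp trigo.
From mathcomp Require Import complex freeg.
(* mpoly is not imported: its notations clash with those of MathComp-Analysis. *)
From mathcomp Require mpoly.

Set Implicit Arguments.
Unset Strict Implicit.
Unset Printing Implicit Defensive.

Import Order.TTheory GRing.Theory Num.Theory.
Import numFieldNormedType.Exports.

Local Open Scope ring_scope.
Local Open Scope classical_set_scope.
Local Open Scope complex_scope.
Local Open Scope quotient_scope.

(* Quotient of T by the equivalence relation generated by r. *)
Section GeneratedQuotient.
Variables (T : choiceType) (r : T -> T -> Prop).

Definition gen_equiv : rel T := fun x y => `[< clos_refl_sym_trans T r x y >].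

Lemma gen_equiv_refl : reflexive gen_equiv.
Proof. by move=> x; apply/asboolP; exact: rst_refl. Qed.

Lemma gen_equiv_sym : symmetric gen_equiv.
Proof. by move=> x y; apply/asboolP/asboolP => ?; exact: rst_sym. Qed.

Lemma gen_equiv_trans : transitive gen_equiv.
Proof.
move=> y x z /asboolP xy /asboolP yz; apply/asboolP; exact: rst_trans xy yz.
Qed.

Canonical gen_equiv_equivRel :=
  EquivRel gen_equiv gen_equiv_refl gen_equiv_sym gen_equiv_trans.

Definition gen_quot : Type := {eq_quot gen_equiv}.
HB.instance Definition _ := EqQuotient.on gen_quot.
HB.instance Definition _ := Choice.on gen_quot.

Lemma gen_quotP x y :
  reflect (clos_refl_sym_trans T r x y) (\pi_gen_quot x == \pi_gen_quot y).
Proof. by rewrite eqmodE; exact: asboolP. Qed.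

End GeneratedQuotient.

(* The letters (i, true) and (i, false) stand for the i-th generator and its
   inverse; the generators 0, 1, 2, 3 are a_1, b_1, a_2, b_2. *)
Definition letter : Type := ('I_4 * bool)%type.
Definition word : Type := seq letter.
HB.instance Definition _ := Choice.on letter.
HB.instance Definition _ := Choice.on word.

Definition ia1 : 'I_4 := @Ordinal 4 0 isT.
Definition ib1 : 'I_4 := @Ordinal 4 1 isT.
Definition ia2 : 'I_4 := @Ordinal 4 2 isT.
Definition ib2 : 'I_4 := @Ordinal 4 3 isT.

Definition linv (l : letter) : letter := (l.1, ~~ l.2).
Definition winv (w : word) : word := rev (map linv w).

(* [a_1, b_1][a_2, b_2] with [a, b] = a b a^-1 b^-1 *)
Definition relator : word :=
  [:: (ia1, true); (ib1, true); (ia1, false); (ib1, false);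
      (ia2, true); (ib2, true); (ia2, false); (ib2, false)].

Definition wstep (u v : word) : Prop :=
  exists p s q : word,
    [/\ s = relator \/ (exists l, s = [:: l; linv l]),
        u = p ++ s ++ q & v = p ++ q].

(* Gamma_2 = < a_1, b_1, a_2, b_2 | [a_1, b_1][a_2, b_2] > *)
Definition Gamma2 : Type := gen_quot wstep.
HB.instance Definition _ := EqQuotient.on Gamma2.
HB.instance Definition _ := Choice.on Gamma2.

Definition cls (w : word) : Gamma2 := \pi w.

Section Gamma2Group.

Local Notation weq := (clos_refl_sym_trans word wstep).

Lemma clsP u v : reflect (weq u v) (cls u == cls v).
Proof. exact: gen_quotP. Qed.

Lemma weq_cat p q u v : weq u v -> weq (p ++ u ++ q) (p ++ v ++ q).
Proof.
elim=> [x y [p' [s [q' [hs -> ->]]]]|x|x y _|x y z _ + _].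
- apply: rst_step; exists (p ++ p'), s, (q' ++ q).
  by split => //; rewrite !catA.
- exact: rst_refl.
- exact: rst_sym.
- exact: rst_trans.
Qed.

Lemma linvK : involutive linv.
Proof. by case=> i b; rewrite /linv /= negbK. Qed.

Lemma winvK : involutive winv.
Proof.
by move=> w; rewrite /winv map_rev revK -map_comp map_id_in// => l _; exact: linvK.
Qed.

Lemma winv_cat u v : winv (u ++ v) = winv v ++ winv u.
Proof. by rewrite /winv map_cat rev_cat. Qed.

Lemma weq_mulV w : weq (w ++ winv w) [::].
Proof.
elim/last_ind: w => [|w l ih]; first exact: rst_refl.
apply: rst_trans ih; apply: rst_step; exists w, [:: l; linv l], (winv w).
by split; [right; exists l| rewrite -cats1 winv_cat -!catA|].
Qed.

Lemma weq_Vmul w : weq (winv w ++ w) [::].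
Proof. by rewrite -{2}[w]winvK; exact: weq_mulV. Qed.

Lemma weq_inv u v : weq u v -> weq (winv u) (winv v).
Proof.
move=> uv.
have h1 : weq (winv u ++ v ++ winv v) (winv u).
  by have := weq_cat (winv u) [::] (weq_mulV v); rewrite !cats0.
have h2 : weq (winv u ++ u ++ winv v) (winv u ++ v ++ winv v).
  exact: weq_cat.
have h3 : weq (winv u ++ u ++ winv v) (winv v).
  by rewrite catA; exact: (weq_cat [::] (winv v) (weq_Vmul u)).
exact: (rst_trans _ _ _ _ _ (rst_sym _ _ _ _ (rst_trans _ _ _ _ _ h2 h1)) h3).
Qed.

Definition gamma_one : Gamma2 := cls [::].
Definition gamma_mul (x y : Gamma2) : Gamma2 := cls (repr x ++ repr y).
Definition gamma_inv (x : Gamma2) : Gamma2 := cls (winv (repr x)).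

Lemma weq_repr w : weq (repr (cls w)) w.
Proof. by apply/clsP; rewrite /cls reprK. Qed.

Lemma cls_repr x : cls (repr x) = x.
Proof. exact: reprK. Qed.

Lemma gamma_mulE u v : gamma_mul (cls u) (cls v) = cls (u ++ v).
Proof.
apply/eqP/clsP; apply: rst_trans (weq_cat [::] (repr (cls v)) (weq_repr u)) _.
by have := weq_cat u [::] (weq_repr v); rewrite !cats0.
Qed.

Lemma gamma_invE u : gamma_inv (cls u) = cls (winv u).
Proof. by apply/eqP/clsP/weq_inv/weq_repr. Qed.

Lemma gamma_mulA : associative gamma_mul.
Proof.
move=> x y z; rewrite -(cls_repr x) -(cls_repr y) -(cls_repr z).
by rewrite !gamma_mulE catA.
Qed.

Lemma gamma_mul1 : left_id gamma_one gamma_mul.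
Proof. by move=> x; rewrite -(cls_repr x) gamma_mulE. Qed.

Lemma gamma_mulr1 : right_id gamma_one gamma_mul.
Proof. by move=> x; rewrite -(cls_repr x) gamma_mulE cats0. Qed.

Lemma gamma_mulV : left_inverse gamma_one gamma_inv gamma_mul.
Proof.
move=> x; rewrite -(cls_repr x) gamma_invE gamma_mulE.
by apply/eqP/clsP/weq_Vmul.
Qed.

Lemma gamma_mulrV : right_inverse gamma_one gamma_inv gamma_mul.
Proof.
move=> x; rewrite -(cls_repr x) gamma_invE gamma_mulE.
by apply/eqP/clsP/weq_mulV.
Qed.

End Gamma2Group.

HB.instance Definition _ := isGroup.Build Gamma2
  gamma_mulA gamma_mul1 gamma_mulr1 gamma_mulV gamma_mulrV.

Definition gamma_gen (i : 'I_4) : Gamma2 := cls [:: (i, true)].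

Definition gcomm {G : groupType} (x y : G) : G := (x * y * x^-1 * y^-1)%g.

(* Group homology in degree 2, computed by the (inhomogeneous) bar complex. *)
Section BarComplex.
Variable G : groupType.

Definition bar_d2 : {freeg (G * G)%type} -> {freeg G} :=
  fglift (fun x => << x.2 >> - << (x.1 * x.2)%g >> + << x.1 >>).

Definition bar_d3 : {freeg (G * G * G)%type} -> {freeg (G * G)%type} :=
  fglift (fun x => let: (g, h, k) := x in
    << (h, k) >> - << ((g * h)%g, k) >> + << (g, (h * k)%g) >> - << (g, h) >>).

Definition homologous (z z' : {freeg (G * G)%type}) : Prop :=
  exists c, z - z' = bar_d3 c.

Definition bar_map2 (f : G -> G) : {freeg (G * G)%type} -> {freeg (G * G)%type} :=
  fglift (fun x => << (f x.1, f x.2) >>).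

End BarComplex.

(* Fundamental class of H_2(Gamma_2, Z): the 2-cycle attached to the relator
   l_0 ... l_7 by Fox calculus, where a positive letter l_i = x contributes
   [l_0 ... l_(i-1) | x] and a negative letter l_i = x^-1 contributes
   - [l_0 ... l_i | x]. *)
Definition fundamental_cycle : {freeg (Gamma2 * Gamma2)%type} :=
  \sum_(i < size relator)
    let l := nth (ia1, true) relator i in
    if l.2 then << (cls (take i relator), gamma_gen l.1) >>
    else - << (cls (take i.+1 relator), gamma_gen l.1) >>.

Lemma bar_d2B (G : groupType) : additive (@bar_d2 G).
Proof. exact: lift_is_additive. Qed.

HB.instance Definition _ (G : groupType) :=
  GRing.isAdditive.Build _ _ (@bar_d2 G) (@bar_d2B G).

Lemma fundamental_cycleP : bar_d2 fundamental_cycle = 0.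
Proof.
have d2U (p x : Gamma2) :
    bar_d2 << (p, x) >> = << x >> - << (p * x)%g >> + << p >>.
  by rewrite /bar_d2 liftU scale1r.
have mulE u v : (cls u * cls v)%g = cls (u ++ v) by exact: gamma_mulE.
have d2T (w : word) (i : nat) : (i < size w)%N ->
    bar_d2 (let l := nth (ia1, true) w i in
      if l.2 then << (cls (take i w), gamma_gen l.1) >>
      else - << (cls (take i.+1 w), gamma_gen l.1) >>)
    = (let l := nth (ia1, true) w i in
       if l.2 then << gamma_gen l.1 >> else - << gamma_gen l.1 >>)
      - (<< cls (take i.+1 w) >> - << cls (take i w) >>).
  move=> hi; rewrite (take_nth (ia1, true) hi).
  case: (nth _ _ _) => x [] /=.
    by rewrite d2U mulE cats1 opprB addrAC addrA.
  rewrite raddfN /= d2U mulE cat_rcons.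
  have -> : cls (take i w ++ [:: (x, false); (x, true)]) = cls (take i w).
    apply/eqP/clsP/rst_step.
    exists (take i w), [:: (x, false); (x, true)], [::].
    by split; [right; exists (x, false)| |rewrite cats0].
  by rewrite -addrA opprD; congr (_ - _); rewrite addrC.
rewrite raddf_sum.
rewrite (eq_bigr _ (fun (i : 'I_(size relator)) _ => d2T relator i (ltn_ord i))).
rewrite big_split /= sumrN.
rewrite -(big_mkord xpredT
  (fun i => << cls (take i.+1 relator) >> - << cls (take i relator) >>)).
rewrite telescope_sumr//. rewrite take_oversize// take0.
have -> : cls relator = cls [::].
  apply/eqP/clsP/rst_step; exists [::], relator, [::].
  by split; [left| |].
rewrite subrr subr0 !big_ord_recl big_ord0 /=.
rewrite addr0.
set a := << gamma_gen ia1 >>; set b := << gamma_gen ib1 >>.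
set c := << gamma_gen ia2 >>; set d := << gamma_gen ib2 >>.
by rewrite (addrCA b) !addNKr (addrCA d) addNKr subrr.
Qed.

Definition is_inner (f : Gamma2 -> Gamma2) : Prop :=
  exists g, forall x, f x = (g * x * g^-1)%g.

(* Aut^+(Gamma_2) *)
Definition aut_plus (f : {multiplicative Gamma2 -> Gamma2}) : Prop :=
  bijective f /\ homologous (bar_map2 f fundamental_cycle) fundamental_cycle.

(* f is a lift to Aut^+(Gamma_2) of a non-trivial element of the center of
   Mod(Sigma_2) = Aut^+(Gamma_2) / Inn(Gamma_2). *)
Definition hyperelliptic_lift (f : {multiplicative Gamma2 -> Gamma2}) : Prop :=
  [/\ aut_plus f, ~ is_inner f &
      forall h : {multiplicative Gamma2 -> Gamma2}, aut_plus h ->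
        exists g, forall x, f (h x) = (g * h (f x) * g^-1)%g].

Section PSL2.
Variable R : realType.

Definition SL2 : Type := {A : 'M[R]_2 | \det A == 1}.
Local Notation mkSL2 := (@exist 'M[R]_2 (fun A => \det A == 1) _).
HB.instance Definition _ := SubType.on SL2.
HB.instance Definition _ := Choice.on SL2.

Lemma SL2_det (A : SL2) : \det (val A) = 1.
Proof. exact/eqP/(valP A). Qed.

Lemma SL2_unit (A : SL2) : val A \is a GRing.unit.
Proof. by rewrite -[_ \is a _]/(val A \in unitmx) unitmxE SL2_det unitr1. Qed.

Definition SL2_one : SL2 := mkSL2 (introT eqP (det1 R 2)).

Lemma SL2_mul_subproof (A B : SL2) : \det (val A * val B) == 1.
Proof. by rewrite -mulmxE det_mulmx !SL2_det mulr1. Qed.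
Definition SL2_mul (A B : SL2) : SL2 := mkSL2 (SL2_mul_subproof A B).

Lemma SL2_inv_subproof (A : SL2) : \det (val A)^-1 == 1.
Proof. by rewrite -[_^-1]/(invmx _) det_inv SL2_det invr1. Qed.
Definition SL2_inv (A : SL2) : SL2 := mkSL2 (SL2_inv_subproof A).

Lemma SL2_mulA : associative SL2_mul.
Proof. by move=> A B C; apply: val_inj; rewrite /= mulrA. Qed.
Lemma SL2_mul1 : left_id SL2_one SL2_mul.
Proof. by move=> A; apply: val_inj; rewrite /= mul1r. Qed.
Lemma SL2_mulr1 : right_id SL2_one SL2_mul.
Proof. by move=> A; apply: val_inj; rewrite /= mulr1. Qed.
Lemma SL2_mulV : left_inverse SL2_one SL2_inv SL2_mul.
Proof. by move=> A; apply: val_inj; rewrite /= mulVr// SL2_unit. Qed.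
Lemma SL2_mulrV : right_inverse SL2_one SL2_inv SL2_mul.
Proof. by move=> A; apply: val_inj; rewrite /= mulrV// SL2_unit. Qed.

HB.instance Definition _ := isGroup.Build SL2
  SL2_mulA SL2_mul1 SL2_mulr1 SL2_mulV SL2_mulrV.

Definition sign_rel : rel SL2 :=
  fun A B => (val A == val B) || (val A == - val B).

Lemma sign_refl : reflexive sign_rel.
Proof. by move=> A; rewrite /sign_rel eqxx. Qed.
Lemma sign_sym : symmetric sign_rel.
Proof. by move=> A B; rewrite /sign_rel eq_sym -eqr_oppLR (eq_sym (- _)). Qed.
Lemma sign_trans : transitive sign_rel.
Proof.
move=> B A C /orP[] /eqP e1 /orP[] /eqP e2; apply/orP; rewrite e1 e2 ?opprK;
  by [left|right].
Qed.

Canonical sign_equivRel := EquivRel sign_rel sign_refl sign_sym sign_trans.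

Definition PSL2 : Type := {eq_quot sign_rel}.
HB.instance Definition _ := EqQuotient.on PSL2.
HB.instance Definition _ := Choice.on PSL2.

Definition psl (A : SL2) : PSL2 := \pi A.

Lemma pslP A B : reflect (val A = val B \/ val A = - val B) (psl A == psl B).
Proof.
by rewrite eqmodE; apply: (iffP orP) => -[/eqP|/eqP] ?; [left|right|left|right].
Qed.

Lemma psl_repr x : psl (repr x) = x.
Proof. exact: reprK. Qed.

Lemma repr_psl A : val (repr (psl A)) = val A \/ val (repr (psl A)) = - val A.
Proof. by apply/pslP; rewrite psl_repr. Qed.

Definition psl_one : PSL2 := psl 1%g.
Definition psl_mul (x y : PSL2) : PSL2 := psl (repr x * repr y)%g.
Definition psl_inv (x : PSL2) : PSL2 := psl (repr x)^-1%g.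

Lemma psl_mulE A B : psl_mul (psl A) (psl B) = psl (A * B)%g.
Proof.
apply/eqP/pslP => /=.
case: (repr_psl A) => ->; case: (repr_psl B) => ->;
  rewrite ?mulNr ?mulrN ?opprK; by [left|right].
Qed.

Lemma psl_invE A : psl_inv (psl A) = psl A^-1%g.
Proof.
apply/eqP/pslP => /=.
by case: (repr_psl A) => ->; rewrite ?invrN; [left|right].
Qed.

Lemma psl_mulA : associative psl_mul.
Proof.
move=> x y z; rewrite -(psl_repr x) -(psl_repr y) -(psl_repr z).
by rewrite !psl_mulE mulgA.
Qed.
Lemma psl_mul1 : left_id psl_one psl_mul.
Proof. by move=> x; rewrite -(psl_repr x) psl_mulE mul1g. Qed.
Lemma psl_mulr1 : right_id psl_one psl_mul.
Proof. by move=> x; rewrite -(psl_repr x) psl_mulE mulg1. Qed.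
Lemma psl_mulV : left_inverse psl_one psl_inv psl_mul.
Proof. by move=> x; rewrite -(psl_repr x) psl_invE psl_mulE mulVg. Qed.
Lemma psl_mulrV : right_inverse psl_one psl_inv psl_mul.
Proof. by move=> x; rewrite -(psl_repr x) psl_invE psl_mulE mulgV. Qed.

HB.instance Definition _ := isGroup.Build PSL2
  psl_mulA psl_mul1 psl_mulr1 psl_mulV psl_mulrV.

Definition hyperbolic (x : PSL2) : Prop := 2 < `| \tr (val (repr x)) |.

(* The algebraic group PSL_2 = SL_2 / {1, -1} carries the quotient of the
   Zariski topology of SL_2, a closed subvariety of the space of matrices. *)
Definition SL2_zariski_closed (C : set SL2) : Prop :=
  exists I : set (mpoly.mpoly (2 * 2) R),
    C = [set A | forall P, I P -> mpoly.meval (mxvec (val A) 0) P = 0].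

Definition zariski_closed (C : set PSL2) : Prop :=
  SL2_zariski_closed (psl @^-1` C).

Definition zariski_dense (S : set PSL2) : Prop :=
  forall C, zariski_closed C -> S `<=` C -> C = setT.

Definition non_elementary (rho : {multiplicative Gamma2 -> PSL2}) : Prop :=
  zariski_dense (range rho).

(* The universal cover of PSL_2(R): the homeomorphisms of R lifting the action
   of some element of PSL_2(R) on the projective line P^1(R), covered by R via
   theta |-> [cos theta : sin theta], which has period pi. *)
Definition proj_vec (t : R) : 'cV[R]_2 :=
  \col_i (if i == 0 then cos t else sin t).

Definition lifts_action (x : PSL2) (f : R -> R) : Prop :=
  forall t, exists2 c : R, c != 0 &
    val (repr x) *m proj_vec t = c *: proj_vec (f t).

Record ucover := UCover {
  uc_proj : PSL2;
  uc_fun :> R -> R;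
  uc_funinv : R -> R;
  uc_funK : cancel uc_fun uc_funinv;
  uc_funinvK : cancel uc_funinv uc_fun;
  uc_continuous : continuous uc_fun;
  uc_inv_continuous : continuous uc_funinv;
  uc_covers : lifts_action uc_proj uc_fun }.

HB.instance Definition _ := gen_eqMixin ucover.
HB.instance Definition _ := gen_choiceMixin ucover.

Lemma coversE A f : lifts_action (psl A) f <->
  forall t, exists2 c : R, c != 0 & val A *m proj_vec t = c *: proj_vec (f t).
Proof.
split=> h t; have [c c0 hc] := h t; case: (repr_psl A) => e.
- by exists c; rewrite // -e.
- by exists (- c); rewrite ?oppr_eq0// scaleNr -hc e mulNmx opprK.
- by exists c; rewrite // e.
- by exists (- c); rewrite ?oppr_eq0// scaleNr -hc e mulNmx.
Qed.

Lemma ucover_eq (f g : ucover) :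
  uc_proj f = uc_proj g -> uc_fun f = uc_fun g -> uc_funinv f = uc_funinv g ->
  f = g.
Proof.
case: f g => [? ? ? ? ? ? ? ?] [? ? ? ? ? ? ? ?] /= e1 e2 e3.
by subst; congr UCover; exact: Prop_irrelevance.
Qed.

Lemma covers1 : lifts_action 1%g id.
Proof. by apply/coversE => t; exists 1; rewrite ?oner_eq0// mul1mx scale1r. Qed.

Lemma coversM x y f g :
  lifts_action x f -> lifts_action y g -> lifts_action (x * y)%g (f \o g).
Proof.
rewrite -(psl_repr x) -(psl_repr y) => /coversE hf /coversE hg.
rewrite [(_ * _)%g]psl_mulE; apply/coversE => t.
have [c c0 hc] := hg t; have [d d0 hd] := hf (g t).
exists (c * d); first by rewrite mulf_neq0.
by rewrite /= -mulmxE -mulmxA hc -scalemxAr hd scalerA.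
Qed.

Lemma coversV x f g : cancel g f -> lifts_action x f -> lifts_action x^-1%g g.
Proof.
move=> gK; rewrite -(psl_repr x) => /coversE hf.
rewrite [(_^-1)%g]psl_invE; apply/coversE => t.
have [c c0] := hf (g t); rewrite gK => hc.
exists c^-1; first by rewrite invr_eq0.
apply: (scalerI c0); rewrite scalerA mulfV// scale1r scalemxAr -hc mulmxA.
by rewrite mulmxE /= mulVr ?SL2_unit// mul1mx.
Qed.

Definition uc_one : ucover :=
  @UCover 1%g id id (fun=> erefl) (fun=> erefl)
    (fun=> cvg_id) (fun=> cvg_id) covers1.

Definition uc_mul (f g : ucover) : ucover :=
  @UCover (uc_proj f * uc_proj g)%g (f \o g) (uc_funinv g \o uc_funinv f)
    (can_comp (uc_funK f) (uc_funK g))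
    (can_comp (uc_funinvK g) (uc_funinvK f))
    (fun t => continuous_comp (@uc_continuous g t) (@uc_continuous f _))
    (fun t => continuous_comp (@uc_inv_continuous f t) (@uc_inv_continuous g _))
    (coversM (@uc_covers f) (@uc_covers g)).

Definition uc_inv (f : ucover) : ucover :=
  @UCover (uc_proj f)^-1%g (uc_funinv f) f (uc_funinvK f) (uc_funK f)
    (@uc_inv_continuous f) (@uc_continuous f)
    (coversV (uc_funinvK f) (@uc_covers f)).

Lemma uc_mulA : associative uc_mul.
Proof. by move=> f g h; apply: ucover_eq => //=; rewrite mulgA. Qed.
Lemma uc_mul1 : left_id uc_one uc_mul.
Proof. by move=> f; apply: ucover_eq => //=; rewrite mul1g. Qed.
Lemma uc_mulr1 : right_id uc_one uc_mul.
Proof. by move=> f; apply: ucover_eq => //=; rewrite mulg1. Qed.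
Lemma uc_mulV : left_inverse uc_one uc_inv uc_mul.
Proof.
move=> f; apply: ucover_eq => /=; first by rewrite mulVg.
- by apply/funext => t /=; rewrite uc_funK.
- by apply/funext => t /=; rewrite uc_funK.
Qed.
Lemma uc_mulrV : right_inverse uc_one uc_inv uc_mul.
Proof.
move=> f; apply: ucover_eq => /=; first by rewrite mulgV.
- by apply/funext => t /=; rewrite uc_funinvK.
- by apply/funext => t /=; rewrite uc_funinvK.
Qed.

HB.instance Definition _ := isGroup.Build ucover
  uc_mulA uc_mul1 uc_mulr1 uc_mulV uc_mulrV.

(* The kernel of uc_proj consists of the translations by k * pi, k in Z. *)
Definition euler_class (rho : {multiplicative Gamma2 -> PSL2}) (k : int) : Prop :=
  exists l : 'I_4 -> ucover,
    (forall i, uc_proj (l i) = rho (gamma_gen i)) /\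
    forall t, (gcomm (l ia1) (l ib1) * gcomm (l ia2) (l ib2))%g t = t + k%:~R * pi.

(* The upper half-plane model of the hyperbolic plane. *)
Definition Hplane : set R[i] := [set z | 0 < complex.Im z].

Definition hdist (z w : R[i]) : R :=
  2 * ln ((Normc.normc (z - w) + Normc.normc (z - conjc w))
          / (2 * Num.sqrt (complex.Im z * complex.Im w))).

Definition hisometry (g : R[i] -> R[i]) : Prop :=
  [/\ set_fun Hplane Hplane g, set_surj Hplane Hplane g &
      forall z w, Hplane z -> Hplane w -> hdist (g z) (g w) = hdist z w].

Definition moebius (x : PSL2) (z : R[i]) : R[i] :=
  let A := val (repr x) in
  ((A 0 0)%:C * z + (A 0 1)%:C) / ((A 1 0)%:C * z + (A 1 1)%:C).

(* Orientation-preserving isometries are those given by PSL_2(R); the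
   orientation-reversing ones are the other isometries. *)
Definition orientation_preserving (g : R[i] -> R[i]) : Prop :=
  exists x : PSL2, forall z, Hplane z -> g z = moebius x z.

(* Classes in M(Gamma_2) are represented by representations: the conditions
   below are invariant under conjugation by PSL_2(R). *)
Definition Mk (k : int) (rho : {multiplicative Gamma2 -> PSL2}) : Prop :=
  non_elementary rho /\ euler_class rho k.

(* The last condition does not depend on the choice of the lift phi, as two
   lifts differ by an inner automorphism. *)
Definition M0_minus (rho : {multiplicative Gamma2 -> PSL2}) : Prop :=
  Mk 0 rho /\
  exists2 phi : {multiplicative Gamma2 -> Gamma2}, hyperelliptic_lift phi &
    exists g : R[i] -> R[i],
      [/\ hisometry g, ~ orientation_preserving g &
          forall x z, Hplane z ->
            g (moebius (rho x) z) = moebius (rho (phi x)) (g z)].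

(* Sigma_2 is the closed disc with boundary subdivided into eight edges, read
   counterclockwise as a_1 b_1 a_1^-1 b_1^-1 a_2 b_2 a_2^-1 b_2^-1 and glued
   accordingly. *)
Definition disc : set (R * R)%type := [set z | z.1 ^+ 2 + z.2 ^+ 2 <= 1].

Lemma boundary_subproof (s : R) :
  (cos (s * pi / 4), sin (s * pi / 4)) \in disc.
Proof. by rewrite inE /disc /= cos2Dsin2. Qed.

(* The k-th edge is oct_boundary (k + t) for 0 <= t <= 1. *)
Definition oct_boundary (s : R) : set_type disc :=
  @exist _ (fun z => z \in disc) _ (boundary_subproof s).

Definition edge_start (i : 'I_4) : R := nth 0 [:: 0; 1; 4; 5] i.

Definition edge_glue (x y : set_type disc) : Prop :=
  exists i t, [/\ 0 <= t <= 1, x = oct_boundary (edge_start i + t)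
                & y = oct_boundary (edge_start i + 2 + (1 - t))].

Definition Sigma2 : Type := quotient_topology (gen_quot edge_glue).
HB.instance Definition _ := Topological.on Sigma2.
HB.instance Definition _ := Quotient.on Sigma2.

(* Closed curves are maps on the circle R / Z. *)
Definition closed_curve (c : R -> Sigma2) : Prop :=
  continuous c /\ forall t, c (t + 1) = c t.

Definition simple_closed_curve (c : R -> Sigma2) : Prop :=
  closed_curve c /\ forall s t, c s = c t -> exists n : int, s - t = n%:~R.

Definition freely_homotopic (c c' : R -> Sigma2) : Prop :=
  exists H : (R * R)%type -> Sigma2,
    [/\ continuous H, forall s t, H (s, t + 1) = H (s, t),
        forall t, H (0, t) = c t & forall t, H (1, t) = c' t].

Definition letter_path (l : letter) (t : R) : Sigma2 :=
  \pi_Sigma2 (oct_boundary (edge_start l.1 + if l.2 then t else 1 - t)).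

(* On [k / n, (k + 1) / n] the loop attached to a word of length n runs along
   the edge attached to its k-th letter; all the vertices of the octagon are
   identified in Sigma2. *)
Definition word_loop (w : word) (t : R) : Sigma2 :=
  let u := t * (size w)%:R in
  let k := Num.floor u in
  letter_path (nth (ia1, true) w `|(k %% size w)%Z|%N) (u - k%:~R).

(* The free homotopy class of c is the conjugacy class of g. *)
Definition represents (c : R -> Sigma2) (g : Gamma2) : Prop :=
  exists2 w, cls w = g & freely_homotopic (word_loop w) c.

End PSL2.

(* Main.v *)
(* Suppose that every simple closed curve is sent to a hyperbolic element.

   Dehn twists along simple curves cut out by chords of the octagon, and its
   half turn, are homeomorphisms of the surface; so every tuple of generators
   in the orbit of (a_1, b_1, a_2, b_2) under the corresponding automorphisms
   has its first entry u and the commutator [u, v] of its first two entries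
   represented by simple closed curves.

   Lifts of the generators to SL_2 satisfy [A_1, B_1][A_2, B_2] = (-1)^k, where
   k is the Euler class.  A descent on the traces of the handles (the Markoff
   equation of a one-holed torus) and on the trace of [A_1, B_1] (twists along
   curves crossing both handles) produces a non-hyperbolic simple curve unless k
   is even and tr [A_1, B_1] < -2.

   In that case k = 0 and the boundary z = [a_1, b_1], lifted to the universal
   cover, moves some point by an odd multiple j pi of pi.  A central f in
   Aut^+ / Inn commutes with the half twist D^(1/2) along z, and bending a representation
   along z (traces polynomial in the bending parameter) shows that f z is conjugate to a
   power z^n; commutation with the two twists of the handle forces f to act on the
   homology of the handle by a scalar c, hence n = c^2 >= 0 in a Heisenberg
   quotient.  If f is realised by an orientation reversing isometry, f z moves some
   point by -j pi, and it also moves a point by n j pi: both displacements are equal,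
   which is impossible. *)
Require Import Defs.
From Stdlib Require Import Relation_Operators.
From HB Require Import structures.
From mathcomp Require Import all_boot all_order all_algebra.
From mathcomp Require Import generic_quotient.
From mathcomp Require Import boolp classical_sets functions reals topology.
From mathcomp Require Import normedtype realfun exp trigo.
From mathcomp Require Import complex freeg.
From mathcomp Require Import ring lra zify.

Set Implicit Arguments.
Unset Strict Implicit.
Unset Printing Implicit Defensive.

Import Order.TTheory GRing.Theory Num.Theory.
Import numFieldNormedType.Exports.

(** * The presentation of the surface group and orbits of generating tuples *)

Module SurfaceGroup.
Local Open Scope quotient_scope.

Notation a1 := (gamma_gen ia1).
Notation b1 := (gamma_gen ib1).
Notation a2 := (gamma_gen ia2).
Notation b2 := (gamma_gen ib2).

(** Traces alone cannot exclude [e = 1] together with tr [A_1, B_1] < -2, since Fuchsian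
    representations satisfy both; this is where the hyperelliptic condition enters. Its definition
    gives centrality and no formula, so the effect of f on z has to be deduced from commutation with
    explicit automorphisms.

    The trace descent rests on one move along a_2 a_1, preceded by suitable half twists along z: it
    lowers |tr [A_1, B_1]| by at least 1, while hyperbolicity keeps this number above 2. Half twists
    shift a ratio g / h by powers of L^2, where L is the larger modulus of an eigenvalue of
    [A_1, B_1], and the estimate of the move requires g / h to avoid a bad window. For a given curve
    of the second handle every shift may miss the good range; the geometry of pairs of pants keeps
    the ratios of two curves of that handle apart, so that one of the two always works.

    The surface is a quotient of a disc. Each twist is therefore built there as a continuous
    injective map, and its effect on the edges of the octagon is computed up to homotopy before
    traces can say anything about simple curves. *)

Lemma ord4P (P : 'I_4 -> Prop) : P ia1 -> P ib1 -> P ia2 -> P ib2 -> forall i, P i.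
Proof.
move=> h0 h1 h2 h3 [[|[|[|[|//]]]] hi].
- by rewrite (_ : Ordinal hi = ia1) //; apply: val_inj.
- by rewrite (_ : Ordinal hi = ib1) //; apply: val_inj.
- by rewrite (_ : Ordinal hi = ia2) //; apply: val_inj.
- by rewrite (_ : Ordinal hi = ib2) //; apply: val_inj.
Qed.

Section GroupMorphisms.
Variables (G H : groupType) (f : {multiplicative G -> H}).
Local Open Scope group_scope.

Lemma morM x y : f (x * y) = f x * f y.
Proof. exact: gmulfM. Qed.

Lemma mor1 : f 1 = 1.
Proof. by apply: (@mulgI _ (f 1)); rewrite -morM !mulg1. Qed.

Lemma morV x : f x^-1 = (f x)^-1.
Proof. by apply: (@mulgI _ (f x)); rewrite -morM !mulgV mor1. Qed.

Lemma mor_comm x y : f (gcomm x y) = gcomm (f x) (f y).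
Proof. by rewrite /gcomm !morM !morV. Qed.

End GroupMorphisms.

Section WordEvaluation.
Variable G : groupType.
Local Open Scope group_scope.
Implicit Types (s : 'I_4 -> G) (w : word).

Definition leval s (l : letter) : G := if l.2 then s l.1 else (s l.1)^-1.
Definition weval s w : G := foldr (fun l x => leval s l * x) 1 w.

Lemma weval_cat s u v : weval s (u ++ v) = weval s u * weval s v.
Proof. by elim: u => [|l u ih] /=; rewrite ?mul1g // ih mulgA. Qed.

Lemma leval_linv s l : leval s (linv l) = (leval s l)^-1.
Proof. by case: l => i []; rewrite /leval /= ?invgK. Qed.

Lemma weval_winv s w : weval s (winv w) = (weval s w)^-1.
Proof.
elim: w => [|l w ih]; first by rewrite /= invg1.
rewrite -cat1s winv_cat !weval_cat ih /= !mulg1 leval_linv -invgM.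
by [].
Qed.

Definition surface_relation s :=
  gcomm (s ia1) (s ib1) * gcomm (s ia2) (s ib2) = 1.

Lemma weval_wstep s u v : surface_relation s ->
  clos_refl_sym_trans _ wstep u v -> weval s u = weval s v.
Proof.
move=> hs; elim=> // [x y|x y z _ -> _ -> //].
case=> p [r [q [hr -> ->]]]; rewrite !weval_cat.
suff -> : weval s r = 1 by rewrite mul1g.
case: hr => [->|[l ->]]; last by rewrite /= mulg1 leval_linv mulgV.
by rewrite -[RHS]hs /= /leval /= /gcomm !mulg1 !mulgA.
Qed.

Lemma multiplicative_cls (f : {multiplicative Gamma2 -> G}) w :
  f (cls w) = weval (fun i => f (gamma_gen i)) w.
Proof.
elim: w => [|[i b] w ih]; first exact: mor1.
rewrite -cat1s -gamma_mulE [LHS]morM ih /=; congr (_ * _).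
case: b => //; rewrite /leval /= -morV; congr (f _).
by rewrite [RHS]gamma_invE.
Qed.

Lemma multiplicative_ext (f g : {multiplicative Gamma2 -> G}) :
  (forall i, f (gamma_gen i) = g (gamma_gen i)) -> f =1 g.
Proof.
move=> fg x; rewrite -(cls_repr x) !multiplicative_cls.
by congr (weval _ _); apply/funext.
Qed.

Section Extension.
Variables (s : 'I_4 -> G) (hs : surface_relation s).
Definition gamma_ext (x : Gamma2) : G := weval s (repr x).
Lemma gamma_extE w : gamma_ext (cls w) = weval s w.
Proof. exact/weval_wstep/weq_repr. Qed.
Lemma gamma_extM : {morph gamma_ext : x y / x * y}.
Proof.
move=> x y; rewrite -(cls_repr x) -(cls_repr y) [(_ * _)%g]gamma_mulE.
by rewrite !gamma_extE weval_cat.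
Qed.
HB.instance Definition _ := isMultiplicative.Build Gamma2 G gamma_ext gamma_extM.
Lemma gamma_ext_subproof :
  exists f : {multiplicative Gamma2 -> G}, forall i, f (gamma_gen i) = s i.
Proof.
exists gamma_ext => i; rewrite [LHS]gamma_extE /=.
by rewrite /leval /= mulg1.
Qed.
End Extension.

Lemma gamma_ext_ex s : surface_relation s ->
  exists f : {multiplicative Gamma2 -> G}, forall i, f (gamma_gen i) = s i.
Proof. exact: gamma_ext_subproof. Qed.

End WordEvaluation.

Lemma weval_gen w : weval gamma_gen w = cls w.
Proof.
elim: w => [|[i b] w ih] //; rewrite /= ih.
have -> : leval gamma_gen (i, b) = cls [:: (i, b)].
  by case: b => //; rewrite /leval /=; exact: gamma_invE.
exact: gamma_mulE.
Qed.

Lemma weval_relator (G : groupType) (s : 'I_4 -> G) :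
  weval s relator = (gcomm (s ia1) (s ib1) * gcomm (s ia2) (s ib2))%g.
Proof. by rewrite /= /leval /= /gcomm !mulg1 !mulgA. Qed.

Lemma gamma_relation : surface_relation gamma_gen.
Proof.
rewrite /surface_relation -weval_relator weval_gen.
apply/eqP/clsP/rst_step; exists [::], relator, [::].
by split => //; exact: or_introl.
Qed.

Section Orbits.
Local Open Scope group_scope.

(* The moves are two Dehn twists of the first handle, the exchange of the two
   handles, and the twist along a simple curve in the class of a_2 a_1. *)
Inductive horbit (G : groupType) (x1 y1 x2 y2 : G) : G -> G -> G -> G -> Prop :=
| horbit_refl : horbit x1 y1 x2 y2 x1 y1 x2 y2
| horbit_Ta a b c d : horbit x1 y1 x2 y2 a b c d -> horbit x1 y1 x2 y2 a (b * a) c d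
| horbit_TaV a b c d : horbit x1 y1 x2 y2 a b c d -> horbit x1 y1 x2 y2 a (b * a^-1) c d
| horbit_Tb a b c d : horbit x1 y1 x2 y2 a b c d -> horbit x1 y1 x2 y2 (a * b) b c d
| horbit_TbV a b c d : horbit x1 y1 x2 y2 a b c d -> horbit x1 y1 x2 y2 (a * b^-1) b c d
| horbit_swap a b c d : horbit x1 y1 x2 y2 a b c d -> horbit x1 y1 x2 y2 c d a b
| horbit_Tc a b c d : horbit x1 y1 x2 y2 a b c d ->
    horbit x1 y1 x2 y2 a ((c * a)^-1 * b) c ((a * c)^-1 * d).

Variables (G : groupType) (x1 y1 x2 y2 : G).
Local Notation orb := (horbit x1 y1 x2 y2).

Lemma horbit_E a b c d : orb a b c d -> orb (a * b) a^-1 c d.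
Proof.
move/horbit_Tb/horbit_TaV; suff -> : b * (a * b)^-1 = a^-1 by [].
by rewrite invgM mulgA mulgV mul1g.
Qed.

Lemma horbit_EV a b c d : orb a b c d -> orb b^-1 (b * a) c d.
Proof.
move/horbit_Ta/horbit_TbV; suff -> : a * (b * a)^-1 = b^-1 by [].
by rewrite invgM mulgA mulgV mul1g.
Qed.

Lemma gcomm_Ta (a b : G) : gcomm a (b * a) = gcomm a b.
Proof. by rewrite /gcomm !gnorm. Qed.
Lemma gcomm_TaV (a b : G) : gcomm a (b * a^-1) = gcomm a b.
Proof. by rewrite /gcomm !gnorm. Qed.
Lemma gcomm_Tb (a b : G) : gcomm (a * b) b = gcomm a b.
Proof. by rewrite /gcomm !gnorm. Qed.
Lemma gcomm_TbV (a b : G) : gcomm (a * b^-1) b = gcomm a b.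
Proof. by rewrite /gcomm !gnorm. Qed.
Lemma gcomm_E (a b : G) : gcomm (a * b) a^-1 = gcomm a b.
Proof. by rewrite /gcomm !gnorm. Qed.
Lemma gcomm_EV (a b : G) : gcomm b^-1 (b * a) = gcomm a b.
Proof. by rewrite /gcomm !gnorm. Qed.
(** The twist alters both commutators but only conjugates their product, so a central value of the
    product is preserved along the orbit. *)
Lemma gcomm_Tc (a b c d : G) :
  gcomm a ((c * a)^-1 * b) * gcomm c ((a * c)^-1 * d) =
  (a * c)^-1 * (gcomm a b * gcomm c d) * (a * c).
Proof. by rewrite /gcomm !gnorm. Qed.

(** [E] acts on the homology of the handle with order six. Its cube acts as -1 and fixes the
    boundary: it is the half twist along [a, b]. The second entry stays implicit because only its
    commutator with the first is used afterwards. *)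
Lemma horbit_half_twist a b c d : orb a b c d ->
  exists2 b', orb (gcomm a b * a^-1) b' c d & gcomm (gcomm a b * a^-1) b' = gcomm a b.
Proof.
move/horbit_E/horbit_E/horbit_E.
have -> : a * b * a^-1 * (a * b)^-1 = gcomm a b * a^-1 by rewrite /gcomm !gnorm.
move=> h; exists (a * b * a^-1)^-1 => //.
by rewrite /gcomm !gnorm.
Qed.

Lemma horbit_half_twistV a b c d : orb a b c d ->
  exists2 b', orb (a^-1 * gcomm a b) b' c d & gcomm (a^-1 * gcomm a b) b' = gcomm a b.
Proof.
move/horbit_EV/horbit_EV/horbit_EV.
have -> : (b * a * b^-1)^-1 = a^-1 * gcomm a b by rewrite /gcomm !gnorm.
move=> h; exists (b * a * b^-1 * (b * a)^-1) => //.
by rewrite /gcomm !gnorm.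
Qed.

End Orbits.

Lemma horbit_map (G H : groupType) (f : {multiplicative G -> H}) x1 y1 x2 y2 a b c d :
  horbit x1 y1 x2 y2 a b c d ->
  horbit (f x1) (f y1) (f x2) (f y2) (f a) (f b) (f c) (f d).
Proof.
elim=> [|*|*|*|*|*|*]; rewrite ?morM ?morV ?morM; first exact: horbit_refl.
- exact: horbit_Ta.
- exact: horbit_TaV.
- exact: horbit_Tb.
- exact: horbit_TbV.
- exact: horbit_swap.
- exact: horbit_Tc.
Qed.

Definition tup (G : groupType) (x0 x1 x2 x3 : G) (i : 'I_4) : G := nth 1%g [:: x0; x1; x2; x3] i.

(** [s'] lists the images under the inverse; a left inverse is enough for injectivity. *)
Lemma auto_ex (s s' : 'I_4 -> Gamma2) : surface_relation s -> surface_relation s' ->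
  (forall g : {multiplicative Gamma2 -> Gamma2}, (forall i, g (gamma_gen i) = s' i) ->
    forall i, g (s i) = gamma_gen i) ->
  exists t : {multiplicative Gamma2 -> Gamma2}, injective t /\ forall i, t (gamma_gen i) = s i.
Proof.
move=> hs hs' h; have [t ht] := gamma_ext_ex hs; have [g hg] := gamma_ext_ex hs'.
exists t; split => //; apply: (can_inj (g := g)) => x.
apply: (multiplicative_ext (f := g \o t) (g := idfun)) => i /=.
by rewrite ht h.
Qed.

End SurfaceGroup.
Import SurfaceGroup.

(** * Descent on the trace triples of a one-holed torus *)

Module MarkoffDescent.
Local Open Scope ring_scope.

Section MarkoffDescent.
Variables (R : realType) (T : R -> R -> R -> Prop) (kappa : R).
Hypothesis T_rot : forall x y z, T x y z -> T z x y.
Hypothesis T_flip : forall x y z, T x y z -> T (x * y - z) y x.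
Hypothesis T_kappa : forall x y z, T x y z ->
  x ^+ 2 + y ^+ 2 + z ^+ 2 - x * y * z - 2 = kappa.

Lemma T_largest x y z : T x y z -> exists x' y' z',
  [/\ T x' y' z', `|x'| <= `|z'|, `|y'| <= `|z'|,
      x' * y' * z' = x * y * z &
      `|x'| + `|y'| + `|z'| = `|x| + `|y| + `|z|].
Proof.
move=> h; have h1 := T_rot h; have h2 := T_rot h1.
have [xz|xz] := leP `|x| `|z|; have [yz|yz] := leP `|y| `|z|.
- by exists x, y, z.
- exists z, x, y; split => //; [exact: ltW|lra|ring|ring].
- exists y, z, x; split => //; [lra|exact: ltW|ring|ring].
- have [xy|xy] := leP `|x| `|y|.
  + by exists z, x, y; split => //; [lra|ring|ring].
  + by exists y, z, x; split => //; [lra|lra|ring|ring].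
Qed.

(* The decrease of the Markoff flip is bounded below, so the descent stops. *)
Lemma markoff_induction (P : R -> R -> R -> Prop) (d : R) : 0 < d ->
  (forall x y z, T x y z -> `|x| <= `|z| -> `|y| <= `|z| ->
     P x y z \/ `|x * y - z| <= `|z| - d) ->
  forall x y z, T x y z -> exists x' y' z',
    [/\ T x' y' z', `|x'| <= `|z'|, `|y'| <= `|z'| & P x' y' z'].
Proof.
move=> d0 hP x y z hT.
have [n hn] : exists n : nat, `|x| + `|y| + `|z| <= n%:R * d.
  exists (Num.bound ((`|x| + `|y| + `|z|) / d)).
  rewrite -ler_pdivrMr //; apply/ltW/archi_boundP.
  by rewrite divr_ge0 ?addr_ge0 // ltW.
elim: n x y z hT hn => [|n ih] x y z /T_largest[x' [y' [z' [h xz yz _ <-]]]] hn.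
- have z0 : `|z'| <= 0 by have := normr_ge0 x'; have := normr_ge0 y'; lra.
  have [hp|hp] := hP _ _ _ h xz yz; first by exists x', y', z'.
  by have := normr_ge0 (x' * y' - z'); lra.
- have [hp|hp] := hP _ _ _ h xz yz; first by exists x', y', z'.
  apply: ih (T_flip h) _; rewrite -addn1 natrD mulrDl mul1r in hn.
  by lra.
Qed.

(** Under the hypothesis x y and z have no opposite signs, so the flip can be studied on absolute
    values. *)
Lemma normr_flip (x y z : R) : 0 <= x * y * z ->
  `|x * y - z| = `| `|x| * `|y| - `|z| |.
Proof.
move=> p0; apply/eqP; rewrite -(@eqrXn2 _ 2) // !real_normK ?num_real //.
have p : `|x| * `|y| * `|z| = x * y * z by rewrite -!normrM ger0_norm.
have sq (u : R) : `|u| ^+ 2 = u ^+ 2 by rewrite real_normK ?num_real.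
have -> : (`|x| * `|y| - `|z|) ^+ 2 =
  `|x| ^+ 2 * `|y| ^+ 2 - 2 * (`|x| * `|y| * `|z|) + `|z| ^+ 2 by ring.
by rewrite !sq p; apply/eqP; ring.
Qed.

(** [c] and [a * b - c] are the roots of Q(t) = t^2 - a b t + a^2 + b^2 + k - 2. For a <= b, if the
    second root exceeded c - 1, both would be at least b and Q(b) >= 0. But Q(b) = a^2 + k - 2 - b^2
    (a - 2) is negative when a^2 > k - 2 and 4 < a <= b. *)
Lemma fuchsian_flip_decreases (a b c k : R) : 4 < a -> 4 < b -> a <= c -> b <= c ->
  k - 2 < a ^+ 2 -> k - 2 < b ^+ 2 ->
  a * b * c = a ^+ 2 + b ^+ 2 + c ^+ 2 + k - 2 -> a * b <= 2 * c - 1.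
Proof.
wlog ab : a b / a <= b.
  move=> hw a4 b4 ac bc ka kb e; have [ab|/ltW ba] := leP a b; first exact: hw.
  by rewrite mulrC; apply: hw => //; rewrite (mulrC b) e; ring.
move=> a4 b4 ac bc ka kb e; rewrite leNgt; apply/negP => h.
have h1 : 0 <= (c - b) * (a * b - c - b) by apply: mulr_ge0; nra.
have h2 : 2 * b ^+ 2 <= b ^+ 2 * (a - 2) by nra.
by nra.
Qed.

(** If all traces were that large, each flip would lower the largest one by 1 without end. The bound
    18 < k makes k - 2 exceed 16, hence every trace exceed 4, as the flip estimate requires. *)
Lemma fuchsian_torus_short k : kappa = - k -> 18 < k ->
  (forall x y z, T x y z -> k - 2 < x ^+ 2) -> forall x y z, ~ T x y z.
Proof.
move=> hk k18 big x y z hT.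
have [] := @markoff_induction (fun _ _ _ => False) 1 _ _ _ _ _ hT => //; last first.
  by move=> ? [? [? []]].
move=> {x y z hT} x y z h xz yz; right.
have hx := big _ _ _ h; have hz := big _ _ _ (T_rot h).
have hy := big _ _ _ (T_rot (T_rot h)).
have e := T_kappa h.
have p0 : 0 <= x * y * z by nra.
rewrite (normr_flip p0).
have p : `|x| * `|y| * `|z| = x * y * z by rewrite -!normrM ger0_norm.
have sq (u : R) : `|u| ^+ 2 = u ^+ 2 by rewrite real_normK ?num_real.
rewrite -(sq x) in hx e; rewrite -(sq y) in hy e; rewrite -(sq z) -p in hz e.
have gt4 (u : R) : k - 2 < `|u| ^+ 2 -> 4 < `|u|.
  move=> hu; rewrite ltNge; apply/negP => u4.
  by have := normr_ge0 u; nra.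
have x4 := gt4 _ hx; have y4 := gt4 _ hy; have z4 := gt4 _ hz.
rewrite ler_norml; apply/andP; split; last first.
  suff : `|x| * `|y| <= 2 * `|z| - 1 by lra.
  by apply: (@fuchsian_flip_decreases _ _ _ k) => //; lra.
by nra.
Qed.

(** The trace relation amounts to (2 c - a b)^2 = (a^2 - 4)(b^2 - 4) + 4 (k - 2), which bounds |2 c
    - a b| below by 2 d. That 2 c - a b is positive comes from evaluating at b the quadratic with
    roots c and a b - c. *)
Lemma goldman_flip_decreases (a b c k d : R) : 2 < a -> 2 < b -> a <= c -> b <= c ->
  a ^+ 2 + b ^+ 2 + c ^+ 2 - a * b * c - 2 = k -> 2 < k ->
  d ^+ 2 <= k - 2 -> 0 <= d -> a * b <= 2 * c - 2 * d.
Proof.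
wlog ab : a b / a <= b.
  move=> hw a2 b2 ac bc e; have [ab|/ltW ba] := leP a b; first exact: hw.
  by rewrite mulrC; apply: hw => //; rewrite -e; ring.
move=> a2 b2 ac bc e k2 hd d0.
have h : a * b < 2 * c.
  rewrite ltNge; apply/negP => h.
  have h1 : 0 <= (c - b) * (a * b - c - b) by apply: mulr_ge0; nra.
  have h2 : 0 < (a - 2) * (b ^+ 2 - a - 2) by apply: mulr_gt0; nra.
  by nra.
have h1 : (2 * d) ^+ 2 <= (2 * c - a * b) ^+ 2.
  have : 0 <= (a ^+ 2 - 4) * (b ^+ 2 - 4) by apply: mulr_ge0; nra.
  by nra.
have : 2 * d <= 2 * c - a * b.
  rewrite -(@ler_pXn2r _ 2) ?nnegrE //; lra.
by lra.
Qed.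

(** While the product is nonnegative, a flip lowers the largest trace by a fixed amount; the descent
    can thus only stop at a negative product, as for the three boundary curves of a pair of
    pants. *)
Lemma goldman_reduction : 2 < kappa -> (forall x y z, T x y z -> 2 < `|x|) ->
  forall x y z, T x y z -> exists x' y' z',
    [/\ T x' y' z', `|x'| <= `|z'|, `|y'| <= `|z'| & x' * y' * z' < 0].
Proof.
move=> k2 big.
(* The drop must stay below |x| |y| > 4 to control the flipped trace from below, and below the
   square root of kappa - 2 to control it from above. *)
pose d := Num.min 4 (Num.sqrt (kappa - 2)).
have s0 : 0 < Num.sqrt (kappa - 2) by rewrite sqrtr_gt0; lra.
have d0 : 0 < d by rewrite lt_min s0 andbT; lra.
have d4 : d <= 4 by rewrite ge_min lexx.
have d2 : d ^+ 2 <= kappa - 2.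
  rewrite -[leRHS]sqr_sqrtr; last by lra.
  by rewrite ler_pXn2r ?nnegrE ?(ltW d0) ?(ltW s0) // ge_min lexx orbT.
apply: (@markoff_induction _ d d0) => x y z h xz yz.
have hx := big _ _ _ h; have hz := big _ _ _ (T_rot h).
have hy := big _ _ _ (T_rot (T_rot h)).
have hf := big _ _ _ (T_flip h).
have e := T_kappa h.
have [p0|p0] := leP 0 (x * y * z); last by left.
right; rewrite (normr_flip p0).
have p : `|x| * `|y| * `|z| = x * y * z by rewrite -!normrM ger0_norm.
have sq (u : R) : `|u| ^+ 2 = u ^+ 2 by rewrite real_normK ?num_real.
rewrite -(sq x) -(sq y) -(sq z) -p in e.
have h1 := goldman_flip_decreases hx hy xz yz e k2 d2 (ltW d0).
by rewrite ler_norml; apply/andP; split; nra.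
Qed.

End MarkoffDescent.

End MarkoffDescent.
Import MarkoffDescent.

(** * Matrix entries in SL_2(R) *)

Module MatrixEntries.
Local Open Scope ring_scope.

Section SL2Entries.
Variable R : realType.
Local Notation SL2 := (SL2 R).
Implicit Types A B C : SL2.

Definition ea A : R := val A 0 0.
Definition eb A : R := val A 0 1.
Definition ec A : R := val A 1 0.
Definition ed A : R := val A 1 1.
Definition tr2 A : R := \tr (val A).

Lemma sum_ord2 (F : 'I_2 -> R) : \sum_i F i = F 0 + F 1.
Proof.
by rewrite !big_ord_recl big_ord0 addr0; congr (_ + F _); apply: val_inj.
Qed.

Lemma tr2E A : tr2 A = ea A + ed A.
Proof. exact: sum_ord2. Qed.

Lemma det2E (M : 'M[R]_2) : \det M = M 0 0 * M 1 1 - M 0 1 * M 1 0.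
Proof.
rewrite (expand_det_row _ 0) sum_ord2 /cofactor !det_mx11 !mxE /=.
rewrite expr0 mul1r expr1 mulN1r mulrN.
by congr (_ * M _ _ - M _ _ * M _ _); apply: val_inj.
Qed.

Lemma SL2_ext A B : ea A = ea B -> eb A = eb B -> ec A = ec B -> ed A = ed B -> A = B.
Proof.
move=> h0 h1 h2 h3; apply: val_inj; apply/matrixP => i j.
by case: i => [[|[|//]] ?]; case: j => [[|[|//]] ?];
  [move: h0|move: h1|move: h2|move: h3] => h; apply: etrans (etrans _ h) _;
  rewrite /ea /eb /ec /ed; congr (fun_of_matrix _ _ _); apply: val_inj.
Qed.

Lemma detE A : ea A * ed A - eb A * ec A = 1.
Proof. by have := SL2_det A; rewrite det2E. Qed.

Lemma mulE A B : [/\ ea (A * B)%g = ea A * ea B + eb A * ec B,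
  eb (A * B)%g = ea A * eb B + eb A * ed B,
  ec (A * B)%g = ec A * ea B + ed A * ec B &
  ed (A * B)%g = ec A * eb B + ed A * ed B].
Proof.
have E i j : val (A * B)%g i j = val A i 0 * val B 0 j + val A i 1 * val B 1 j.
  by rewrite /= -mulmxE mxE sum_ord2.
by split; exact: E.
Qed.

Lemma oneE : [/\ ea 1%g = 1, eb 1%g = 0, ec 1%g = 0 & ed 1%g = 1].
Proof. by split; rewrite /ea /eb /ec /ed /= mxE. Qed.

Lemma mk2_subproof (a b c d : R) : a * d - b * c = 1 ->
  \det (\matrix_(i, j) (if i == 0 then (if j == 0 then a else b)
                        else (if j == 0 then c else d)) : 'M[R]_2) == 1.
Proof. by move=> h; rewrite det2E !mxE /= h. Qed.
Definition mk2 (a b c d : R) (h : a * d - b * c = 1) : SL2 :=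
  @exist 'M[R]_2 (fun M => \det M == 1) _ (mk2_subproof h).

Lemma mk2E a b c d h : [/\ ea (@mk2 a b c d h) = a, eb (@mk2 a b c d h) = b,
  ec (@mk2 a b c d h) = c & ed (@mk2 a b c d h) = d].
Proof. by split; rewrite /ea /eb /ec /ed /= mxE. Qed.

Lemma invE A : [/\ ea A^-1%g = ed A, eb A^-1%g = - eb A,
  ec A^-1%g = - ec A & ed A^-1%g = ea A].
Proof.
have h : ed A * ea A - (- eb A) * (- ec A) = 1 by rewrite -(detE A); ring.
suff -> : A^-1%g = mk2 h by exact: mk2E.
apply: (@mulgI _ A); rewrite mulgV; have [? ? ? ?] := mk2E h.
have D := detE A.
have [? ? ? ?] := mulE A (mk2 h); have [? ? ? ?] := oneE.
by apply: SL2_ext; nra.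
Qed.

Definition entE A B := (mulE A B, oneE).
End SL2Entries.

End MatrixEntries.
Import MatrixEntries.

(** * Effect of a balanced flip on the boundary trace *)

Module BalancedFlips.
Local Open Scope ring_scope.

Section Flip.
Variables (R : realType) (L k : R).
Hypotheses (L1 : 1 < L) (hk : k = L + L^-1) (k18 : 18 < k).
Implicit Types (a b g h : R).

Lemma L_gt : 17 < L.
Proof.
move: (L1) (hk) (k18) => L1' hk' k18'.
have : L^-1 < 1 by rewrite invf_lt1 //; lra.
by lra.
Qed.

(* [5/2 <= g/h <= L^2/(5/2)]: the twist parameter is far from its bad value. *)
Definition balanced g h := 5 / 2 * h ^+ 2 <= g * h /\ 5 / 2 * g ^+ 2 <= L ^+ 2 * (g * h).

(** With r = g / h the middle term is g h (r / L + L / r). Its minimum 2 g h is reached at r = L; by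
    convexity its maximum on 5/2 <= r <= 2 L^2 / 5 is reached at the ends, where the factor is 5 /
    (2 L) + 2 L / 5. For L > 17 this is at most 41/100 of k. *)
Lemma balanced_bounds g h : 0 < g * h -> balanced g h ->
  2 * (g * h) <= g ^+ 2 / L + L * h ^+ 2 <= 41 / 100 * k * (g * h).
Proof.
move=> G0 [h1 h2]; have L17 := L_gt; move: (hk) (k18) => hk' k18'.
have L0 : 0 < L by lra.
have Lne : L != 0 by rewrite gt_eqF.
have K : L * L^-1 = 1 by rewrite mulfV //; lra.
have I0 : 0 < L^-1 by rewrite invr_gt0.
have I1 : L^-1 < 1 by rewrite invf_lt1 //; lra.
apply/andP; split.
  suff : 0 <= L^-1 * (g - L * h) ^+ 2.
    have -> : L^-1 * (g - L * h) ^+ 2 =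
      g ^+ 2 / L + L * h ^+ 2 * (L * L^-1) - 2 * (g * h) * (L * L^-1) by ring.
    by rewrite K !mulr1; lra.
  by rewrite mulr_ge0 ?sqr_ge0 // ltW.
have h0 : h != 0 by apply: contraTneq G0 => ->; rewrite mulr0 ltxx.
have hh : 0 < h ^+ 2 by rewrite exprn_even_gt0.
have gg : 0 < g ^+ 2.
  by rewrite exprn_even_gt0 //; apply: contraTneq G0 => ->; rewrite mul0r ltxx.
have p1 : 5 / 2 * h ^+ 2 <= g * h by [].
have key : g ^+ 2 + L ^+ 2 * h ^+ 2 <= (5 / 2 + L ^+ 2 * 2 / 5) * (g * h).
  have : 0 <= (g * h - 5 / 2 * h ^+ 2) * (L ^+ 2 * (g * h) - 5 / 2 * g ^+ 2).
    by apply: mulr_ge0; lra.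
  have -> : (g * h - 5 / 2 * h ^+ 2) * (L ^+ 2 * (g * h) - 5 / 2 * g ^+ 2) =
    (g * h) * (5 / 2) * ((5 / 2 + L ^+ 2 * 2 / 5) * (g * h)
                         - (g ^+ 2 + L ^+ 2 * h ^+ 2)) by field.
  rewrite pmulr_rge0; first by lra.
  by rewrite pmulr_rgt0 //; lra.
have -> : g ^+ 2 / L + L * h ^+ 2 = L^-1 * (g ^+ 2 + L ^+ 2 * h ^+ 2).
  by field.
apply: (@le_trans _ _ (L^-1 * ((5 / 2 + L ^+ 2 * 2 / 5) * (g * h)))).
  by rewrite ler_pM2l.
rewrite mulrA ler_pM2r //.
have -> : L^-1 * (5 / 2 + L ^+ 2 * 2 / 5) = 5 / 2 * L^-1 + L * 2 / 5 by field.
by rewrite hk; nra.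
Qed.

(** Put A = a^2 / (k - 2), B = b^2 / (k + 2) and U = g^2 / L + L h^2. Inserting g h = (1 + A)(1 - B)
    reduces the quantity to -2 A - 2 B + k A B - U, where U is controlled by [balanced_bounds]. *)
Lemma odd_flip a b g h :
  a ^+ 2 <= k - 2 -> 4 < b ^+ 2 -> 4 * b ^+ 2 <= k + 2 ->
  g * h = (1 + a ^+ 2 / (k - 2)) * (1 - b ^+ 2 / (k + 2)) -> balanced g h ->
  `|a ^+ 2 - b ^+ 2 + k - (g + h) * (g / L + L * h)| <= k - 1.
Proof.
move=> ha hb4 hb e bal.
have L17 := L_gt; move: (hk) (k18) => hk' k18'.
set A := a ^+ 2 / (k - 2) in e; set B := b ^+ 2 / (k + 2) in e.
have eA : a ^+ 2 = A * (k - 2) by rewrite /A divfK //; lra.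
have eB : b ^+ 2 = B * (k + 2) by rewrite /B divfK //; lra.
have A0 : 0 <= A by rewrite /A divr_ge0 ?sqr_ge0 //; lra.
have A1 : A <= 1 by rewrite /A ler_pdivrMr; lra.
have B0 : 0 <= B by rewrite /B divr_ge0 ?sqr_ge0 //; lra.
have B1 : B <= 1 / 4 by rewrite /B ler_pdivrMr; lra.
have G0 : 0 < g * h by rewrite e; apply: mulr_gt0; lra.
have /andP[u1 u2] := balanced_bounds G0 bal.
have -> : (g + h) * (g / L + L * h) = g ^+ 2 / L + L * h ^+ 2 + (g * h) * k.
  by rewrite hk; ring.
set U := _ + _ in u1 u2 *.
rewrite eA eB e in u1 u2 *; rewrite ler_norml.
have AB : 0 <= A * B by exact: mulr_ge0.
have AB1 : A * B <= B by rewrite ler_piMl.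
have kAB : 0 <= k * (A * B) by apply: mulr_ge0 => //; lra.
have kB : 0 <= (k - 18) * B by apply: mulr_ge0; lra.
have kA : 0 <= (k - 18) * (1 - A) by apply: mulr_ge0; lra.
have kAB1 : 0 <= (k - 18) * (B - A * B) by apply: mulr_ge0; lra.
by apply/andP; split; lra.
Qed.

(** With A and B both normalised by k + 2, U = g^2 / L + L h^2 and V = g / L + L h - g - h, the
    quantity is 2 A + 2 B + (k - 4) A B + U + E V. The cross term is bounded through E^2 = 4 A B <=
    1/4 and V^2 = (k - 2)(U - 2 g h). *)
Lemma even_flip a b g h E :
  4 * a ^+ 2 <= k + 2 -> 4 * b ^+ 2 <= k + 2 ->
  g * h = (1 - a ^+ 2 / (k + 2)) * (1 - b ^+ 2 / (k + 2)) ->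
  E = 2 * (a * b) / (k + 2) -> balanced g h ->
  a ^+ 2 + b ^+ 2 - k - (E + g + h) * (E - g / L - L * h) <= k - 1.
Proof.
move=> ha hb e eE bal.
have L17 := L_gt; move: (hk) (k18) => hk' k18'.
set A := a ^+ 2 / (k + 2) in e; set B := b ^+ 2 / (k + 2) in e.
have eA : a ^+ 2 = A * (k + 2) by rewrite /A divfK //; lra.
have eB : b ^+ 2 = B * (k + 2) by rewrite /B divfK //; lra.
have A0 : 0 <= A by rewrite /A divr_ge0 ?sqr_ge0 //; lra.
have A1 : A <= 1 / 4 by rewrite /A ler_pdivrMr; lra.
have B0 : 0 <= B by rewrite /B divr_ge0 ?sqr_ge0 //; lra.
have B1 : B <= 1 / 4 by rewrite /B ler_pdivrMr; lra.
have G0 : 0 < g * h by rewrite e; apply: mulr_gt0; lra.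
have /andP[u1 u2] := balanced_bounds G0 bal.
have kne : k + 2 != 0 by rewrite gt_eqF //; lra.
have E2 : E ^+ 2 = 4 * (A * B).
  by rewrite eE /A /B !exprMn; field.
pose V := g / L + L * h - g - h.
have Lne : L != 0 by rewrite gt_eqF //; lra.
have V2 : V ^+ 2 = (k - 2) * (g ^+ 2 / L + L * h ^+ 2 - 2 * (g * h)).
  by rewrite /V hk; field.
have -> : a ^+ 2 + b ^+ 2 - k - (E + g + h) * (E - g / L - L * h) =
  a ^+ 2 + b ^+ 2 - k + (g ^+ 2 / L + L * h ^+ 2) + (g * h) * k + E * V - E ^+ 2.
  by rewrite /V hk; field.
set U := g ^+ 2 / L + _ in u1 u2 V2 *.
have AB0 : 0 <= A * B by exact: mulr_ge0.
have AB1 : A * B <= (A + B) / 8 by nra.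
have G1 : g * h <= 1 by rewrite e; nra.
have hEV : E * V <= 33 / 100 * k.
  have : (E * V) ^+ 2 <= (33 / 100 * k) ^+ 2.
    rewrite exprMn E2 V2.
    have w1 : 4 * (A * B) <= 1 / 4 by nra.
    have w2 : (k - 2) * (U - 2 * (g * h)) <= k * (41 / 100 * k).
      have : 41 / 100 * k * (g * h) <= 41 / 100 * k by rewrite ler_piMr //; lra.
      by move=> ?; apply: ler_pM; lra.
    have w3 : 0 <= (k - 2) * (U - 2 * (g * h)) by apply: mulr_ge0; lra.
    apply: (@le_trans _ _ (1 / 4 * (k * (41 / 100 * k)))); last by nra.
    by apply: ler_pM => //; lra.
  move=> hs; rewrite leNgt; apply/negP => hlt.
  by move: hs; rewrite leNgt => /negP; apply; nra.
rewrite e in u1 u2 G1 *; rewrite eA eB E2.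
have kAB : 0 <= k * ((A + B) / 8 - A * B) by apply: mulr_ge0; lra.
have kA : 0 <= (k - 18) * A by apply: mulr_ge0; lra.
have kB : 0 <= (k - 18) * B by apply: mulr_ge0; lra.
by lra.
Qed.

(** With V = g / L + L h - g - h, the excess over 2 is the square (E (k - 2) / 2 + V)^2 divided by k
    - 2. This keeps the new boundary trace positive, so that the pants case of the descent applies
    again. *)
Lemma even_flip_lower a b g h E :
  g * h = (1 - a ^+ 2 / (k + 2)) * (1 - b ^+ 2 / (k + 2)) ->
  E = 2 * (a * b) / (k + 2) ->
  2 <= a ^+ 2 + b ^+ 2 - k - (E + g + h) * (E - g / L - L * h).
Proof.
move=> e eE; have L17 := L_gt; move: (hk) (k18) => hk' k18'.
set A := a ^+ 2 / (k + 2) in e; set B := b ^+ 2 / (k + 2) in e.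
have eA : a ^+ 2 = A * (k + 2) by rewrite /A divfK //; lra.
have eB : b ^+ 2 = B * (k + 2) by rewrite /B divfK //; lra.
have kne : k + 2 != 0 by rewrite gt_eqF //; lra.
have Lne : L != 0 by rewrite gt_eqF //; lra.
have E2 : E ^+ 2 = 4 * (A * B).
  by rewrite eE /A /B !exprMn; field.
pose V := g / L + L * h - g - h.
have V2 : V ^+ 2 = (k - 2) * (g ^+ 2 / L + L * h ^+ 2 - 2 * (g * h)).
  by rewrite /V hk; field.
have -> : a ^+ 2 + b ^+ 2 - k - (E + g + h) * (E - g / L - L * h) =
  a ^+ 2 + b ^+ 2 - k + (g ^+ 2 / L + L * h ^+ 2) + (g * h) * k + E * V - E ^+ 2.
  by rewrite /V hk; field.
set U := g ^+ 2 / L + _ in V2 *.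
have sq : 0 <= (E * (k - 2) / 2 + V) ^+ 2 by exact: sqr_ge0.
have e1 : (E * (k - 2) / 2 + V) ^+ 2 =
   (k - 2) * (E ^+ 2 * (k - 2) / 4 + E * V + (U - 2 * (g * h))).
  by rewrite sqrrD V2; field.
have k20 : 0 < k - 2 by lra.
rewrite e1 (pmulr_rge0 _ k20) E2 e in sq.
by rewrite e eA eB E2; lra.
Qed.

Lemma balancedN g h : balanced g h -> balanced (- g) (- h).
Proof. by rewrite /balanced !sqrrN mulrNN. Qed.

End Flip.

End BalancedFlips.
Import BalancedFlips.

(** * Spacing of the twist ratios of two curves in a pair of pants *)

Module PantsSpacing.
Local Open Scope ring_scope.

Section Spacing.
Variables (R : realType) (L k : R).
Hypotheses (L1 : 1 < L) (hk : k = L + L^-1) (k18 : 18 < k).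

(** The positive number X / Y compares the ratios g / h of two curves of the handle. As 841/100 =
    (5/2 + 2/5)^2, the third bound puts X / Y outside (4/25, 25/4); the fourth keeps it away from
    the multiples of this window by nontrivial powers of L^2. *)
Lemma pants_spacing b1 b2 b3 X Y :
  2 < `|b1| -> 2 < `|b2| -> `|b1| <= `|b3| -> `|b2| <= `|b3| ->
  b1 * b2 * b3 < 0 ->
  b1 ^+ 2 + b2 ^+ 2 + b3 ^+ 2 - b1 * b2 * b3 - 2 = k ->
  X * Y = (1 - b1 ^+ 2 / (k + 2)) * (1 - b2 ^+ 2 / (k + 2)) ->
  X + Y = 2 * (b1 * b2) / (k + 2) - b3 ->
  [/\ 4 * b1 ^+ 2 <= k + 2, 4 * b2 ^+ 2 <= k + 2,
      841 / 100 * (X * Y) <= (X + Y) ^+ 2 &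
      25 / 4 * (X + Y) ^+ 2 <= L ^+ 2 * (X * Y)].
Proof.
move=> h1 h2 h13 h23 neg ek eXY eS; move: (hk) (k18) (L1) => hk' k18' L1'.
have sq (u : R) : u ^+ 2 = `|u| ^+ 2 by rewrite real_normK ?num_real.
have p : b1 * b2 * b3 = - (`|b1| * `|b2| * `|b3|).
  by rewrite -!normrM ltr0_norm // opprK.
have eS2 : (X + Y) ^+ 2 = (2 * (`|b1| * `|b2|) / (k + 2) + `|b3|) ^+ 2.
  have pp : (b1 * b2) * b3 = - (`|b1| * `|b2|) * `|b3| by rewrite p mulNr.
  have q : (b1 * b2) ^+ 2 = (`|b1| * `|b2|) ^+ 2 by rewrite !exprMn -!sq.
  rewrite eS.
  have -> : (2 * (b1 * b2) / (k + 2) - b3) ^+ 2 = (2 / (k + 2)) ^+ 2 * (b1 * b2) ^+ 2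
    - 2 * (2 / (k + 2)) * (b1 * b2 * b3) + b3 ^+ 2 by ring.
  by rewrite q pp (sq b3); ring.
rewrite (sq b1) (sq b2) (sq b3) p in ek; rewrite (sq b1) (sq b2) in eXY.
rewrite (sq b1) (sq b2) eS2 eXY {eS eS2 eXY p neg}.
(* Half traces are hyperbolic cosines of half lengths; in them the boundary relation reads t = u^2 +
   v^2 + w^2 + 2 u v w. *)
set u := `|b1| / 2; set v := `|b2| / 2; set w := `|b3| / 2; set t := (k + 2) / 4.
have eu : `|b1| = 2 * u by rewrite /u; field.
have ev : `|b2| = 2 * v by rewrite /v; field.
have ew : `|b3| = 2 * w by rewrite /w; field.
have et : k + 2 = 4 * t by rewrite /t; field.
rewrite eu ev ew et in h1 h2 h13 h23 ek *.
move: u v w t {eu ev ew} et h1 h2 h13 h23 ek => u v w t et h1 h2 h13 h23 ek.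
have et2 : t = u ^+ 2 + v ^+ 2 + w ^+ 2 + 2 * (u * v) * w by lra.
have t0 : 0 < t by lra.
have tne : t != 0 by rewrite gt_eqF.
have p0 : 1 < u * v by nra.
have uw : u ^+ 2 <= w ^+ 2 by nra.
have vw : v ^+ 2 <= w ^+ 2 by nra.
have pw : u * v <= u * v * w by nra.
have u1 : 1 < u by lra.
have v1 : 1 < v by lra.
have pu : u ^+ 2 <= u * v * w.
  have : 0 <= u * (v * w - u) by apply: mulr_ge0; nra.
  by lra.
have pv : v ^+ 2 <= u * v * w.
  have : 0 <= v * (u * w - v) by apply: mulr_ge0; nra.
  by lra.
have -> : (2 * u) ^+ 2 / (4 * t) = u ^+ 2 / t by field.
have -> : (2 * v) ^+ 2 / (4 * t) = v ^+ 2 / t by field.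
have -> : 2 * (2 * u * (2 * v)) / (4 * t) + 2 * w = 2 * (w + u * v / t) by field.
have u20 := sqr_ge0 u; have v20 := sqr_ge0 v.
have u4 : 4 * u ^+ 2 <= t by lra.
have v4 : 4 * v ^+ 2 <= t by lra.
set U := u ^+ 2 / t; set V := v ^+ 2 / t; set P := u * v / t.
have U1 : U <= 1 / 4 by rewrite /U ler_pdivrMr; lra.
have V1 : V <= 1 / 4 by rewrite /V ler_pdivrMr; lra.
have P1 : P <= 1 / 4 by rewrite /P ler_pdivrMr //; nra.
have P0 : 0 < P by rewrite /P divr_gt0 //; lra.
split; [lra|lra| |].
- have h : (1 - U) * (1 - V) <= (1 - P) ^+ 2.
    have e : U * V = P ^+ 2 by rewrite /U /V /P; field.
    have e2 : U + V - 2 * P = (u - v) ^+ 2 / t by rewrite /U /V /P; field.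
    have : 0 <= (u - v) ^+ 2 / t by rewrite divr_ge0 ?sqr_ge0 // ltW.
    by rewrite -e2; nra.
  suff : 29 / 10 * (1 - P) <= 2 * (w + P) by nra.
  suff : 29 / 10 * (t - u * v) <= 2 * (t * w + u * v).
    have eP : u * v = P * t by rewrite /P divfK.
    rewrite eP => hh; rewrite -(ler_pM2r t0); lra.
  (* From w = 145/100 on, 2 t w alone dominates 29/10 t. Below, t is eliminated by means of t w <= u
     v (w^3 + 3 w^2 + 1). *)
  have [w1|w1] := leP (145 / 100) w; first by nra.
  have h3 : w * (u ^+ 2 + v ^+ 2) <= (w ^+ 2 + 1) * (u * v).
    have : 0 <= (w * u - v) * (w * v - u) by apply: mulr_ge0; nra.
    by lra.
  have h4 : w * t <= (u * v) * (w ^+ 3 + 3 * w ^+ 2 + 1).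
    rewrite et2.
    have : 0 <= w ^+ 3 * (u * v - 1) by apply: mulr_ge0; [rewrite exprn_ge0|]; lra.
    by lra.
  have h5 : (145 / 100 - w) * (w ^+ 3 + 3 * w ^+ 2 + 1) <= 245 / 100 * w.
    (* Expanded at w = 1, the difference of the two sides has only positive coefficients. *)
    pose y := w - 1; have y0 : 0 <= y by rewrite /y; lra.
    have -> : (145 / 100 - w) * (w ^+ 3 + 3 * w ^+ 2 + 1) = 245 / 100 * w
      - (1 / 5 + 34 / 10 * y + 63 / 10 * y ^+ 2 + 555 / 100 * y ^+ 3 + y ^+ 4).
      by rewrite /y; field.
    have y2 := exprn_ge0 2 y0; have y3 := exprn_ge0 3 y0; have y4 := exprn_ge0 4 y0.
    by lra.
  have h6 : (145 / 100 - w) * (w * t) <= 245 / 100 * (w * (u * v)).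
    apply: (@le_trans _ _ ((145 / 100 - w) * ((u * v) * (w ^+ 3 + 3 * w ^+ 2 + 1)))).
      by rewrite ler_wpM2l //; lra.
    have : 0 <= (u * v) * (245 / 100 * w - (145 / 100 - w) * (w ^+ 3 + 3 * w ^+ 2 + 1)).
      by apply: mulr_ge0; lra.
    by lra.
  have w0 : 0 < w by lra.
  suff : 0 <= w * (2 * (t * w + u * v) - 29 / 10 * (t - u * v)).
    by rewrite pmulr_rge0 //; lra.
  by lra.
- have hw : (2 * (w + P)) ^+ 2 <= 4 * t.
    have : (w + P) ^+ 2 <= t by nra.
    by lra.
  have hL : k - 1 <= L.
    have : L^-1 < 1 by rewrite invf_lt1 //; lra.
    by lra.
  have S : 9 / 16 <= (1 - U) * (1 - V) by nra.
  have L2 : (4 * t - 3) ^+ 2 <= L ^+ 2 by rewrite ler_pXn2r ?nnegrE //; lra.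
  apply: (@le_trans _ _ ((4 * t - 3) ^+ 2 * (9 / 16))); first by nra.
  by apply: ler_pM => //; rewrite ?sqr_ge0 //; lra.
Qed.

End Spacing.

End PantsSpacing.
Import PantsSpacing.

(** * Choice of the twist power *)

Module TwistWindow.
Local Open Scope ring_scope.

Section Spacing.
Variables (R : realType) (L k : R).
Hypotheses (L1 : 1 < L) (hk : k = L + L^-1) (k18 : 18 < k).

Lemma power_window (K x : R) : 2 <= K -> 0 < x -> exists n : int, 1 <= K ^ n * x < K.
Proof.
move=> K2 x0.
have K0 : 0 < K by lra.
have Kne : K != 0 by rewrite gt_eqF.
have big (y : R) : exists i : nat, y < K ^+ i.
  exists (Num.bound y); apply: lt_le_trans (upper_nthrootP (leqnn _)) _.
  by rewrite lerXn2r ?nnegrE //; lra.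
have [x1|x1] := leP 1 x.
  have ex : exists i, x < K ^+ i by exact: big.
  have [[|i] hi hm] := find_ex_minn ex; first by move: hi; rewrite expr0; lra.
  exists (- i%:Z); rewrite -invr_expz -exprnP.
  have Ki : 0 < K ^+ i by rewrite exprn_gt0.
  rewrite mulrC ler_pdivlMr // mul1r ltr_pdivrMr // -exprS hi andbT.
  by rewrite leNgt; apply/negP => /hm; rewrite ltnn.
have ex : exists i, x^-1 <= K ^+ i.
  by have [i hi] := big x^-1; exists i; exact: ltW.
have [[|i] hi hm] := find_ex_minn ex.
  move: hi; rewrite expr0 => hi; exists 0; rewrite expr0z mul1r.
  by move: hi; rewrite invf_le1 //; lra.
exists i.+1%:Z; rewrite -exprnP -(ler_pdivrMr _ _ x0) mul1r hi /=.
rewrite exprS -mulrA gtr_pMr // -ltr_pdivlMr // mul1r ltNge.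
by apply/negP => /hm; rewrite ltnn.
Qed.

(** The power n multiplies g / h by L^(2 n), so each ratio can be moved into [2/5, 2 L^2 / 5), where
    only [2/5, 5/2) is bad. If both ratios were bad, their quotient would lie in (4/25, 25/4) up to
    a power of L^2, and the two inequalities exclude this. *)
Lemma two_choices g1 h1 g2 h2 : 0 < g1 * h1 -> 0 < g2 * h2 ->
  841 / 100 * (g1 * h2 * (h1 * g2)) <= (g1 * h2 + h1 * g2) ^+ 2 ->
  25 / 4 * (g1 * h2 + h1 * g2) ^+ 2 <= L ^+ 2 * (g1 * h2 * (h1 * g2)) ->
  exists n : int, balanced L (L ^ n * g1) (L ^ (- n) * h1) \/
                  balanced L (L ^ n * g2) (L ^ (- n) * h2).
Proof.
move=> p1 p2 lo hi; have L17 := L_gt L1 hk k18.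
have L0 : 0 < L by lra.
have Lne : L != 0 by rewrite gt_eqF.
have bal g h (n : int) : 0 < g * h ->
    2 / 5 <= (L ^+ 2) ^ n * (g / h) < L ^+ 2 * 2 / 5 ->
    5 / 2 <= (L ^+ 2) ^ n * (g / h) -> balanced L (L ^ n * g) (L ^ (- n) * h).
  move=> gh /andP[_ u] l.
  have hne : h != 0 by apply: contraTneq gh => ->; rewrite mulr0 ltxx.
  have hh : 0 < (L ^ (- n) * h) ^+ 2.
    by rewrite exprn_even_gt0 //= mulf_neq0 // expfz_neq0.
  have Ln : L ^ n != 0 by rewrite expfz_neq0.
  have e : (L ^+ 2) ^ n * (g / h) = (L ^ n * g) * (L ^ (- n) * h) / (L ^ (- n) * h) ^+ 2.
    have -> : (L ^+ 2) ^ n = (L ^ n) ^+ 2 by rewrite !exprnP !exprz_exp mulrC.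
    by rewrite -invr_expz; field; rewrite ?Ln ?hne.
  have e2 : (L ^ n * g) ^+ 2 =
    ((L ^ n * g) * (L ^ (- n) * h)) * ((L ^+ 2) ^ n * (g / h)).
    have -> : (L ^+ 2) ^ n = (L ^ n) ^+ 2 by rewrite !exprnP !exprz_exp mulrC.
    by rewrite -invr_expz; field; rewrite ?Ln ?hne.
  split.
    by move: l; rewrite e ler_pdivlMr.
  have gh' : 0 < (L ^ n * g) * (L ^ (- n) * h).
    have -> : (L ^ n * g) * (L ^ (- n) * h) = g * h by rewrite -invr_expz; field.
    by [].
  rewrite e2; move: u; set r := _ ^ n * _; nra.
have win g h : 0 < g * h -> exists n : int,
    2 / 5 <= (L ^+ 2) ^ n * (g / h) < L ^+ 2 * 2 / 5.
  move=> gh.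
  have hne : h != 0 by apply: contraTneq gh => ->; rewrite mulr0 ltxx.
  have r0 : 0 < g / h.
    have -> : g / h = g * h / h ^+ 2 by field.
    by apply: divr_gt0; rewrite ?exprn_even_gt0.
  have x0 : 0 < g / h * (5 / 2) by lra.
  have [|n hn] := @power_window (L ^+ 2) (g / h * (5 / 2)) _ x0; first by nra.
  exists n; move: hn; rewrite mulrA; set r := _ ^ n * _.
  by move=> /andP[? ?]; apply/andP; split; lra.
have [n1 w1] := win _ _ p1; have [n2 w2] := win _ _ p2.
have [s1|s1] := leP (5 / 2) ((L ^+ 2) ^ n1 * (g1 / h1)).
  by exists n1; left; exact: bal.
have [s2|s2] := leP (5 / 2) ((L ^+ 2) ^ n2 * (g2 / h2)).
  by exists n2; right; exact: bal.
exfalso; move: w1 w2 => /andP[w1 _] /andP[w2 _].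
have h1ne : h1 != 0 by apply: contraTneq p1 => ->; rewrite mulr0 ltxx.
have h2ne : h2 != 0 by apply: contraTneq p2 => ->; rewrite mulr0 ltxx.
have g2ne : g2 != 0 by apply: contraTneq p2 => ->; rewrite mul0r ltxx.
pose rho := (g1 * h2) / (h1 * g2).
have rho0 : 0 < rho.
  have -> : rho = (g1 * h1) * (g2 * h2) / (h1 * g2) ^+ 2 by rewrite /rho; field; rewrite g2ne h1ne.
  by apply: divr_gt0; [exact: mulr_gt0|rewrite exprn_even_gt0 //= mulf_neq0].
have Q2 : 0 < (h1 * g2) ^+ 2 by rewrite exprn_even_gt0 //= mulf_neq0.
have eP : g1 * h2 = rho * (h1 * g2) by rewrite /rho divfK // mulf_neq0.
rewrite eP in lo hi.
(* Since 841/100 - 2 = 25/4 + 4/25, this means that rho is at least 25/4 or at most 4/25. *)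
have lo' : 841 / 100 * rho <= (rho + 1) ^+ 2.
  by rewrite -(ler_pM2r Q2); move: lo; set q := h1 * g2; lra.
have hi' : 25 / 4 * (rho + 1) ^+ 2 <= L ^+ 2 * rho.
  by rewrite -(ler_pM2r Q2); move: hi; set q := h1 * g2; lra.
move: s1 s2 w1 w2.
have -> : (L ^+ 2) ^ n1 * (g1 / h1) =
    (L ^+ 2) ^ (n1 - n2) * rho * ((L ^+ 2) ^ n2 * (g2 / h2)).
  rewrite expfzDr ?expf_neq0 // -invr_expz /rho.
  by field; rewrite h2ne g2ne h1ne expfz_neq0 // expf_neq0.
set x := _ ^ n2 * _; move=> s1 s2 w1 w2.
have hK : 1 <= L ^+ 2 by nra.
have L20 : 0 < L ^+ 2 by lra.
have mon (a b : int) : a <= b -> (L ^+ 2) ^ a <= (L ^+ 2) ^ b.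
  by move=> ab; apply: ler_weXz2l.
have rl : rho < 4 / 25 * L ^+ 2 by rewrite -(ltr_pM2r rho0); nra.
have rl2 : 25 / 4 < L ^+ 2 * rho by nra.
have [m0|m0] := leP 0 (n1 - n2); have [r1|r1] := leP 1 rho.
- have : 1 <= (L ^+ 2) ^ (n1 - n2) by rewrite -(expr0z (L ^+ 2)) mon.
  have : 25 / 4 <= rho by nra.
  move: (_ ^ (n1 - n2)) s1 => z s1 hr hz.
  have : rho <= z * rho by nra.
  by nra.
- have : rho <= 4 / 25 by nra.
  have [m1|m1] := leP 1 (n1 - n2).
    have : L ^+ 2 <= (L ^+ 2) ^ (n1 - n2) by rewrite -[leLHS]expr1z mon.
    move: (_ ^ (n1 - n2)) s1 => z s1 hz hr.
    have : L ^+ 2 * rho <= z * rho by rewrite ler_pM2r.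
    by nra.
  have e0 : n1 - n2 = 0 by apply/eqP; rewrite eq_le m0 andbT -ltzD1.
  by move: w1; rewrite e0 expr0z mul1r => w1'; nra.
- have : (L ^+ 2) ^ (n1 - n2) <= (L ^+ 2) ^ (- 1) by rewrite mon // -ltzD1 addNr.
  rewrite exprN1; move: (_ ^ (n1 - n2)) w1 => z w1 hz.
  have : z * rho < 4 / 25.
    apply: (@le_lt_trans _ _ ((L ^+ 2)^-1 * rho)); first by rewrite ler_pM2r.
    by rewrite mulrC ltr_pdivrMr.
  by nra.
- have : (L ^+ 2) ^ (n1 - n2) <= 1 by rewrite -(expr0z (L ^+ 2)) mon // ltW.
  have : rho <= 4 / 25 by nra.
  move: (_ ^ (n1 - n2)) w1 => z w1 hr hz.
  have : z * rho <= rho by nra.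
  by nra.
Qed.

End Spacing.

End TwistWindow.
Import TwistWindow.

(** * Trace identities and diagonalisation *)

Module TraceIdentities.
Local Open Scope ring_scope.

Section Traces.
Variable R : realType.
Local Notation SL2 := (SL2 R).
Implicit Types A B C : SL2.

Lemma tr2_mulC A B : tr2 (A * B)%g = tr2 (B * A)%g.
Proof.
rewrite !tr2E; have [-> _ _ ->] := mulE A B; have [-> _ _ ->] := mulE B A.
by ring.
Qed.

Lemma tr2V A : tr2 A^-1%g = tr2 A.
Proof. by rewrite !tr2E; have [-> _ _ ->] := invE A; rewrite addrC. Qed.

Lemma tr2_mulV A B : tr2 (A * B^-1)%g = tr2 A * tr2 B - tr2 (A * B)%g.
Proof.
rewrite !tr2E; have [-> _ _ ->] := mulE A B; have [-> _ _ ->] := mulE A B^-1%g.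
have [-> -> -> ->] := invE B; by ring.
Qed.

Lemma tr2_conj P A : tr2 (P * A * P^-1)%g = tr2 A.
Proof. by rewrite tr2_mulC mulgA mulVg mul1g. Qed.

Lemma tr2_gcomm A B : tr2 (gcomm A B) =
  tr2 A ^+ 2 + tr2 B ^+ 2 + tr2 (A * B)%g ^+ 2 - tr2 A * tr2 B * tr2 (A * B)%g - 2.
Proof.
rewrite /gcomm tr2_mulV tr2_conj.
have -> : (A * B * A^-1 * B)%g = ((A * B) * (B^-1 * A)^-1)%g.
  by rewrite invgM invgK mulgA.
rewrite tr2_mulV [tr2 (B^-1 * A)%g]tr2_mulC tr2_mulV.
have -> : (A * B * (B^-1 * A))%g = (A * A^-1^-1)%g by rewrite !gnorm.
rewrite tr2_mulV mulgV tr2V.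
have -> : tr2 (1%g : SL2) = 2 by rewrite tr2E; have [-> _ _ ->] := oneE R.
by ring.
Qed.

(* [e] is the sign of the product of the two commutators. *)
Lemma tr2_flip (a b c d eps : SL2) (e : R) :
  (forall X, tr2 (eps * X)%g = e * tr2 X) -> (gcomm a b * gcomm c d = eps)%g ->
  tr2 (gcomm a ((c * a)^-1 * b))%g =
  tr2 a ^+ 2 + e * tr2 c ^+ 2 - tr2 (gcomm a b)
  - tr2 (a * c)%g * tr2 (a^-1 * gcomm a b * c)%g.
Proof.
move=> heps rel.
pose X := (b * a^-1 * b^-1)%g.
have eX : (a^-1 * gcomm a b = X)%g by rewrite /X /gcomm !gnorm.
have eZ : gcomm a b = (a * X)%g by rewrite -eX mulgA mulgV mul1g.
have -> : gcomm a ((c * a)^-1 * b)%g = (c^-1 * X * c * a)%g.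
  by rewrite /X /gcomm !gnorm.
have trX : tr2 X = tr2 a by rewrite /X tr2_conj tr2V.
have trc : tr2 (X * c * a)%g = e * tr2 c.
  have -> : tr2 (X * c * a)%g = tr2 (gcomm a b * c)%g.
    by rewrite eZ tr2_mulC mulgA.
  have -> : (gcomm a b * c = eps * (d * c * d^-1))%g.
    by rewrite -rel /gcomm !gnorm.
  by rewrite heps tr2_conj.
have -> : (c^-1 * X * c * a)%g = (c^-1 * (X * c * a))%g by rewrite !mulgA.
rewrite (tr2_mulC c^-1%g) (tr2_mulV _ c) trc.
have -> : (X * c * a * c)%g = ((X * c) * (a * c)^-1^-1)%g by rewrite invgK !mulgA.
rewrite tr2_mulV tr2V.
have -> : (X * c * (a * c)^-1)%g = (X * a^-1)%g by rewrite !gnorm.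
rewrite tr2_mulV trX [tr2 (X * a)%g]tr2_mulC eX -eZ.
by ring.
Qed.

(* A hyperbolic matrix of trace [l + l^-1] is diagonal in a suitable basis. *)
Lemma diagonalize (Z : SL2) (l : R) : l != 0 -> l != l^-1 -> tr2 Z = l + l^-1 ->
  exists P, [/\ ea (P * Z * P^-1)%g = l, eb (P * Z * P^-1)%g = 0,
               ec (P * Z * P^-1)%g = 0 & ed (P * Z * P^-1)%g = l^-1].
Proof.
move=> l0 l1; rewrite tr2E => trZ.
have D := detE Z.
suff [Q [h1 h2 h3 h4]] : exists Q : SL2,
  [/\ ea Z * ea Q + eb Z * ec Q = l * ea Q, ec Z * ea Q + ed Z * ec Q = l * ec Q,
      ea Z * eb Q + eb Z * ed Q = l^-1 * eb Q & ec Z * eb Q + ed Z * ed Q = l^-1 * ed Q].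
  exists Q^-1%g; rewrite invgK; have DQ := detE Q.
  have [-> -> -> ->] := mulE (Q^-1 * Z)%g Q.
  have [-> -> -> ->] := mulE Q^-1%g Z; have [-> -> -> ->] := invE Q.
  split.
  - have -> : (ed Q * ea Z + - eb Q * ec Z) * ea Q + (ed Q * eb Z + - eb Q * ed Z) * ec Q
      = ed Q * (ea Z * ea Q + eb Z * ec Q) - eb Q * (ec Z * ea Q + ed Z * ec Q) by ring.
    by rewrite h1 h2 -[RHS]mulr1 -DQ; ring.
  - have -> : (ed Q * ea Z + - eb Q * ec Z) * eb Q + (ed Q * eb Z + - eb Q * ed Z) * ed Q
      = ed Q * (ea Z * eb Q + eb Z * ed Q) - eb Q * (ec Z * eb Q + ed Z * ed Q) by ring.
    by rewrite h3 h4; ring.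
  - have -> : (- ec Q * ea Z + ea Q * ec Z) * ea Q + (- ec Q * eb Z + ea Q * ed Z) * ec Q
      = - ec Q * (ea Z * ea Q + eb Z * ec Q) + ea Q * (ec Z * ea Q + ed Z * ec Q) by ring.
    by rewrite h1 h2; ring.
  - have -> : (- ec Q * ea Z + ea Q * ec Z) * eb Q + (- ec Q * eb Z + ea Q * ed Z) * ed Q
      = - ec Q * (ea Z * eb Q + eb Z * ed Q) + ea Q * (ec Z * eb Q + ed Z * ed Q) by ring.
    by rewrite h3 h4 -[RHS]mulr1 -DQ; ring.
set m := l^-1 in l1 trZ *.
have lm : l * m = 1 by rewrite mulfV.
have lm0 : l - m != 0 by rewrite subr_eq0.
have [c0|c0] := eqVneq (ec Z) 0; last first.
  (* Writing (c, d) for the second row of [Z], the new basis consists of the eigenvectors (l - d, c)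
     and (m - d, c), the latter divided by c (l - m) so that the determinant is 1. *)
  pose D' := ec Z * (l - m); have D'0 : D' != 0 by rewrite mulf_neq0.
  have dq : (l - ed Z) * (ec Z / D') - ((m - ed Z) / D') * ec Z = 1.
    by rewrite /D'; field; rewrite c0 lm0.
  exists (mk2 dq); have [-> -> -> ->] := mk2E dq.
  have e1 : ea Z = l + m - ed Z by rewrite -trZ; ring.
  have e2 : eb Z * ec Z = (l + m - ed Z) * ed Z - l * m by rewrite lm -D e1; ring.
  split; rewrite ?e1.
  - by rewrite e2; ring.
  - by ring.
  - have -> : eb Z * (ec Z / D') = (eb Z * ec Z) / D' by ring.
    by rewrite e2; ring.
  - by ring.
have prod : (ea Z - l) * (ea Z - m) = 0.
  have -> : (ea Z - l) * (ea Z - m) = ea Z * (ea Z - (l + m)) + l * m by ring.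
  by rewrite lm -trZ; move: D; rewrite c0 mulr0 subr0 => <-; ring.
have /orP[/eqP e|/eqP e] : (ea Z - l == 0) || (ea Z - m == 0) by rewrite -mulf_eq0 prod.
- have eaZ : ea Z = l by rewrite -[l]addr0 -e; ring.
  have edZ : ed Z = m by move: trZ; rewrite eaZ => /addrI.
  have dq : 1 * 1 - (eb Z / (m - l)) * 0 = 1 :> R by ring.
  exists (mk2 dq); have [-> -> -> ->] := mk2E dq.
  rewrite eaZ edZ c0; split; try by ring.
  by field; rewrite -oppr_eq0 opprB.
- have eaZ : ea Z = m by rewrite -[m]addr0 -e; ring.
  have edZ : ed Z = l by move: trZ; rewrite eaZ addrC => /addIr.
  have dq : (eb Z / (l - m)) * 0 - (-1) * 1 = 1 :> R by ring.
  exists (mk2 dq); have [-> -> -> ->] := mk2E dq.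
  rewrite eaZ edZ c0; split; try by ring.
  by field.
Qed.
End Traces.

End TraceIdentities.
Import TraceIdentities.

(** * Handles in a basis diagonalising their boundary *)

Module HandleCoordinates.
Local Open Scope ring_scope.

Section Step.
Variable R : realType.
Local Notation SL2 := (SL2 R).

(* The shape of a matrix which is conjugate to its product with the inverse of
   the diagonal matrix of entries [l] and [l^-1]. *)
Definition half_handle (l s q r : R) (A : SL2) :=
  [/\ ea A = l * s, eb A = q, ec A = r & ed A = s].

(** For Z = [a, b] the element a^-1 Z = b a^-1 b^-1 has the trace of a. When Z is diagonal this is a
    single linear equation between the diagonal entries of a. *)
Lemma half_handleP (l : R) (A Z : SL2) : l != 1 -> l != 0 ->
  ea Z = l -> eb Z = 0 -> ec Z = 0 -> ed Z = l^-1 ->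
  tr2 (A^-1 * Z)%g = tr2 A -> half_handle l (ed A) (eb A) (ec A) A.
Proof.
move=> l1 l0 z1 z2 z3 z4; rewrite !tr2E.
have [-> _ _ ->] := mulE A^-1%g Z; have [-> -> -> ->] := invE A.
rewrite z1 z2 z3 z4 mulr0 mulr0 addr0 add0r => h; split=> //.
have : (l - 1) * (ea A - l * ed A) = 0.
  have -> : (l - 1) * (ea A - l * ed A) =
     l * (ea A + ed A - (ed A * l + ea A * l^-1)) by field.
  by rewrite h subrr mulr0.
by move/eqP; rewrite mulf_eq0 subr_eq0 (negbTE l1) /= subr_eq0 => /eqP.
Qed.

Lemma half_handle_trace l s q r A : half_handle l s q r A -> tr2 A = s * (l + 1).
Proof. by case=> h1 _ _ h4; rewrite tr2E h1 h4; ring. Qed.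

Lemma half_handle_det l s q r A : l != 0 -> l + l^-1 + 2 != 0 -> half_handle l s q r A ->
  q * r = tr2 A ^+ 2 / (l + l^-1 + 2) - 1.
Proof.
move=> l0 l2 h; rewrite (half_handle_trace h); case: h (detE A) => -> -> -> -> D.
have -> : (s * (l + 1)) ^+ 2 / (l + l^-1 + 2) = l * s * s.
  have e : (s * (l + 1)) ^+ 2 = l * s * s * (l + l^-1 + 2) by field.
  by rewrite e mulfK.
by rewrite -D; ring.
Qed.

Section Fixed.
Variables (x1 y1 x2 y2 : SL2).
Local Notation orb := (horbit x1 y1 x2 y2).

(** The half twist replaces a by Z a^-1, which keeps the diagonal entries and multiplies the
    off-diagonal ones by -l and its inverse. *)
Lemma twisted_orbit P Z c d l s q r :
  l != 0 ->
  ea (P * Z * P^-1)%g = l -> eb (P * Z * P^-1)%g = 0 ->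
  ec (P * Z * P^-1)%g = 0 -> ed (P * Z * P^-1)%g = l^-1 ->
  (exists a b, [/\ orb a b c d, gcomm a b = Z & half_handle l s q r (P * a * P^-1)%g]) ->
  forall n : int, exists a b, [/\ orb a b c d, gcomm a b = Z &
    half_handle l s ((- l) ^ n * q) ((- l) ^ (- n) * r) (P * a * P^-1)%g].
Proof.
move=> l0 z1 z2 z3 z4 h0.
have nl0 : - l != 0 by rewrite oppr_eq0.
have fwd q' r' :
    (exists a b, [/\ orb a b c d, gcomm a b = Z & half_handle l s q' r' (P * a * P^-1)%g]) ->
    exists a b, [/\ orb a b c d, gcomm a b = Z &
      half_handle l s (- l * q') ((- l)^-1 * r') (P * a * P^-1)%g].
  move=> [a [b [o eZ [ha hb hc hd]]]].
  have [b' o' e'] := horbit_half_twist o; rewrite eZ in o' e'.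
  exists (Z * a^-1)%g, b'; split => //.
  have -> : (P * (Z * a^-1) * P^-1)%g = ((P * Z * P^-1) * (P * a * P^-1)^-1)%g.
    by rewrite !gnorm.
  rewrite /half_handle.
  have [-> -> -> ->] := mulE (P * Z * P^-1)%g (P * a * P^-1)^-1%g.
  have [-> -> -> ->] := invE (P * a * P^-1)%g.
  by rewrite z1 z2 z3 z4 ha hb hc hd; split; field.
have bwd q' r' :
    (exists a b, [/\ orb a b c d, gcomm a b = Z & half_handle l s q' r' (P * a * P^-1)%g]) ->
    exists a b, [/\ orb a b c d, gcomm a b = Z &
      half_handle l s ((- l)^-1 * q') (- l * r') (P * a * P^-1)%g].
  move=> [a [b [o eZ [ha hb hc hd]]]].
  have [b' o' e'] := horbit_half_twistV o; rewrite eZ in o' e'.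
  exists (a^-1 * Z)%g, b'; split => //.
  have -> : (P * (a^-1 * Z) * P^-1)%g = ((P * a * P^-1)^-1 * (P * Z * P^-1))%g.
    by rewrite !gnorm.
  rewrite /half_handle.
  have [-> -> -> ->] := mulE (P * a * P^-1)^-1%g (P * Z * P^-1)%g.
  have [-> -> -> ->] := invE (P * a * P^-1)%g.
  by rewrite z1 z2 z3 z4 ha hb hc hd; split; field.
case=> n.
  elim: n => [|n /fwd ih]; first by rewrite oppr0 expr0z !mul1r.
  rewrite intS expfzDr // opprD expfzDr // expr1z exprN1.
  by move: ih; rewrite !mulrA.
rewrite NegzE opprK.
elim: n => [|n /bwd ih].
  by move/bwd: h0; rewrite exprN1 expr1z.
rewrite intS opprD expfzDr // (expfzDr 1) // expr1z exprN1.
by move: ih; rewrite !mulrA.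
Qed.

Variables (eps : SL2) (e : R).
Hypothesis e1 : e = 1 \/ e = -1.
Hypothesis eps_ent : [/\ ea eps = e, eb eps = 0, ec eps = 0 & ed eps = e].
Hypothesis rel : forall a b c d, orb a b c d -> (gcomm a b * gcomm c d = eps)%g.

Lemma eps_central X : (eps * X = X * eps)%g.
Proof.
case: eps_ent => h1 h2 h3 h4.
by apply: SL2_ext; case: (mulE eps X) => ? ? ? ?; case: (mulE X eps) => ? ? ? ?;
  nra.
Qed.

Lemma tr2_eps X : tr2 (eps * X)%g = e * tr2 X.
Proof.
case: eps_ent => h1 h2 h3 h4; rewrite !tr2E.
by have [-> _ _ ->] := mulE eps X; rewrite h1 h2 h3 h4; ring.
Qed.

Lemma e_sq : e * e = 1.
Proof. by case: e1 => ->; ring. Qed.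

Section Handles.
Variables (P : SL2) (L k : R).
Hypotheses (L1 : 1 < L) (hk : k = L + L^-1) (k18 : 18 < k).
Variables (a b c d : SL2).
Hypothesis o : orb a b c d.
Let Z := gcomm a b.
Hypothesis Z_diag : [/\ ea (P * Z * P^-1)%g = e * L, eb (P * Z * P^-1)%g = 0,
  ec (P * Z * P^-1)%g = 0 & ed (P * Z * P^-1)%g = (e * L)^-1].

Lemma eL_neq0 : e * L != 0.
Proof.
move: L1 => L1'; have Ln : L != 0 by rewrite gt_eqF //; lra.
by rewrite mulf_neq0 //; case: e1 => ->; rewrite ?oppr_eq0 oner_eq0.
Qed.

Lemma eL_neq1 : e * L != 1.
Proof.
move: L1 => ?; case: e1 => ->; first by rewrite mul1r gt_eqF.
by rewrite mulN1r lt_eqF //; lra.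
Qed.

Lemma eLV : (e * L)^-1 = e * L^-1.
Proof. by rewrite invfM; case: e1 => ->; rewrite ?invrN invr1. Qed.

(** After n half twists the traces of a' c and a'^-1 Z c are affine in the products q r' and r q'
    scaled by L^n and L^-n, and [tr2_flip] turns them into the expressions bounded by [odd_flip] and
    [even_flip]. The boundary of the second handle is diagonal in the same basis, with upper
    eigenvalue L^-1, because the product of the two commutators is the scalar e. *)
Lemma flip_balanced s q r s' q' r' (n : int) :
  half_handle (e * L) s q r (P * a * P^-1)%g ->
  half_handle L^-1 s' q' r' (P * c * P^-1)%g ->
  (e = -1 -> tr2 a ^+ 2 <= k - 2) -> (e = 1 -> 4 * tr2 a ^+ 2 <= k + 2) ->
  2 < `|tr2 c| -> 4 * tr2 c ^+ 2 <= k + 2 ->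
  balanced L (L ^ n * (q * r')) (L ^ (- n) * (r * q')) ->
  exists a' b' c' d', [/\ orb a' b' c' d',
    e = -1 -> `|tr2 (gcomm a' b')| <= k - 1 &
    e = 1 -> 2 <= tr2 (gcomm a' b') <= k - 1].
Proof.
move=> ha hc bo be c2 ck bal.
have [z1 z2 z3 z4] := Z_diag.
have h0 : exists a b, [/\ orb a b c d, gcomm a b = Z &
  half_handle (e * L) s q r (P * a * P^-1)%g] by exists a, b.
have [a' [b' [o' eZ' ha']]] := twisted_orbit eL_neq0 z1 z2 z3 z4 h0 n.
exists a', ((c * a')^-1 * b')%g, c, ((a' * c)^-1 * d)%g.
have Lne : L != 0 by move: L1 => ?; rewrite gt_eqF //; lra.
have kne : k + 2 != 0 by move: k18 => ?; rewrite gt_eqF //; lra.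
have k2ne : 2 - k != 0 by move: k18 => ?; rewrite lt_eqF //; lra.
have tra : tr2 a' = tr2 a.
  by rewrite -(tr2_conj P a') -(tr2_conj P a) (half_handle_trace ha') (half_handle_trace ha).
have trZ : tr2 Z = e * k.
  by rewrite -(tr2_conj P) tr2E z1 z4 eLV hk; ring.
(* A half twist scales by -e L, which contributes this sign besides L^n; [balanced] is insensitive
   to it. *)
pose u := (- e) ^ n.
have u2 : u * u = 1.
  rewrite /u -expfzMl mulrNN e_sq //; exact: exp1rz.
have ul : (- (e * L)) ^ n = u * L ^ n by rewrite -mulNr expfzMl.
have une : u != 0.
  by apply/eqP => u0; move: u2; rewrite u0 mul0r => /eqP; rewrite eq_sym oner_eq0.
have uV : u^-1 = u by apply: (@mulfI _ u) => //; rewrite mulfV ?u2.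
have ulN : (- (e * L)) ^ (- n) = u * L ^ (- n).
  by rewrite -mulNr expfzMl -invr_expz -/u uV.
rewrite ul ulN in ha'.
pose g := L ^ n * (q * r'); pose h := L ^ (- n) * (r * q').
have bal' : balanced L (u * g) (u * h).
  have : (u - 1) * (u + 1) = 0.
    have -> : (u - 1) * (u + 1) = u * u - 1 by ring.
    by rewrite u2 subrr.
  move/eqP; rewrite mulf_eq0 subr_eq0 addr_eq0 => /orP[]/eqP ->.
    by rewrite !mul1r.
  by rewrite !mulN1r; exact: balancedN.
have gh : (u * g) * (u * h) = (q * r) * (q' * r').
  have LL : L ^ n * L ^ (- n) = 1 by rewrite -invr_expz mulfV // expfz_neq0.
  have -> : (u * g) * (u * h) = (u * u) * (L ^ n * L ^ (- n)) * ((q * r) * (q' * r')).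
    by rewrite /g /h; ring.
  by rewrite u2 LL !mul1r.
have LV : L^-1 + L^-1^-1 + 2 = k + 2 by rewrite invrK hk; ring.
have qr' : q' * r' = tr2 c ^+ 2 / (k + 2) - 1.
  by rewrite -(tr2_conj P c) -LV; apply: half_handle_det hc; rewrite ?invr_eq0 ?LV.
have qr : q * r = tr2 a ^+ 2 / (e * k + 2) - 1.
  have E : e * L + (e * L)^-1 + 2 = e * k + 2 by rewrite eLV hk; ring.
  rewrite -(tr2_conj P a) -E; apply: half_handle_det ha; rewrite ?eL_neq0 ?E //.
  by case: e1 => ->; rewrite ?mul1r // mulN1r addrC.
rewrite qr qr' in gh.
have tr_ac : tr2 (a' * c)%g = (1 + e) * s * s' + u * g + u * h.
  have -> : tr2 (a' * c)%g = tr2 ((P * a' * P^-1) * (P * c * P^-1))%g.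
    by rewrite -(tr2_conj P (a' * c)%g); congr tr2; rewrite !gnorm.
  rewrite tr2E; have [-> _ _ ->] := mulE (P * a' * P^-1)%g (P * c * P^-1)%g.
  by case: ha' => -> -> -> ->; case: hc => -> -> -> ->; rewrite /g /h; field.
have tr_xc : tr2 (a'^-1 * Z * c)%g =
    (1 + e) * s * s' - (u * g) * (e * L^-1) - (u * h) * (e * L).
  have -> : tr2 (a'^-1 * Z * c)%g =
      tr2 (((P * a' * P^-1)^-1 * (P * Z * P^-1)) * (P * c * P^-1))%g.
    by rewrite -(tr2_conj P (a'^-1 * Z * c)%g); congr tr2; rewrite !gnorm.
  rewrite tr2E.
  have [-> _ _ ->] := mulE ((P * a' * P^-1)^-1 * (P * Z * P^-1))%g (P * c * P^-1)%g.
  have [-> -> -> ->] := mulE (P * a' * P^-1)^-1%g (P * Z * P^-1)%g.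
  have [-> -> -> ->] := invE (P * a' * P^-1)%g.
  rewrite z1 z2 z3 z4 eLV.
  case: ha' => -> -> -> ->; case: hc => -> -> -> ->; rewrite /g /h.
  have ee := e_sq.
  transitivity ((e + e * e) * s * s' - u * L ^ n * (q * r') * (e * L^-1)
     - u * L ^ (- n) * (r * q') * (e * L)); first by field.
  by rewrite ee; ring.
have tr' : tr2 (gcomm a' ((c * a')^-1 * b'))%g = tr2 a ^+ 2 + e * tr2 c ^+ 2 - e * k
   - ((1 + e) * s * s' + u * g + u * h) *
     ((1 + e) * s * s' - (u * g) * (e * L^-1) - (u * h) * (e * L)).
  rewrite (tr2_flip tr2_eps (rel o')) tra eZ' trZ tr_ac.
  by rewrite tr_xc.
move: (u * g) (u * h) bal' gh tr' => G H bal' gh tr'.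
have c4 : 4 < tr2 c ^+ 2.
  by rewrite -[tr2 c ^+ 2]real_normK ?num_real //; nra.
split; first exact: horbit_Tc.
- move=> eN; rewrite tr' eN.
  have := @odd_flip _ L k L1 hk k18 (tr2 a) (tr2 c) G H (bo eN) c4 ck _ bal'.
  have -> : tr2 a ^+ 2 + -1 * tr2 c ^+ 2 - -1 * k -
     ((1 + -1) * s * s' + G + H) * ((1 + -1) * s * s' - G * (-1 * L^-1) - H * (-1 * L)) =
     tr2 a ^+ 2 - tr2 c ^+ 2 + k - (G + H) * (G / L + L * H) by ring.
  apply; rewrite gh eN; field.
  by rewrite kne mulN1r (addrC (- k)) k2ne -oppr_eq0 opprB k2ne.
- move=> eP.
  have eE : 2 * s * s' = 2 * (tr2 a * tr2 c) / (k + 2).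
    rewrite -(tr2_conj P a) -(tr2_conj P c) (half_handle_trace ha) (half_handle_trace hc).
    rewrite eP hk; field; rewrite Lne gt_eqF //=.
    by move: L1 => ?; nra.
  have gh' : G * H = (1 - tr2 a ^+ 2 / (k + 2)) * (1 - tr2 c ^+ 2 / (k + 2)).
    by rewrite gh eP; field.
  have := @even_flip _ L k L1 hk k18 (tr2 a) (tr2 c) G H _ (be eP) ck gh' eE bal'.
  have := @even_flip_lower _ L k L1 hk k18 (tr2 a) (tr2 c) G H _ gh' eE.
  rewrite tr' eP.
  have -> : tr2 a ^+ 2 + 1 * tr2 c ^+ 2 - 1 * k -
     ((1 + 1) * s * s' + G + H) * ((1 + 1) * s * s' - G * (1 * L^-1) - H * (1 * L)) =
     tr2 a ^+ 2 + tr2 c ^+ 2 - k - (2 * s * s' + G + H) * (2 * s * s' - G / L - L * H).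
    by ring.
  by move=> -> ->.
Qed.

End Handles.
End Fixed.
End Step.

End HandleCoordinates.
Import HandleCoordinates.

(** * The descent on the boundary trace *)

Module TraceDescent.
Local Open Scope ring_scope.

Section Descent.
Variable R : realType.
Local Notation SL2 := (SL2 R).
Variables (x1 y1 x2 y2 : SL2).
Local Notation orb := (horbit x1 y1 x2 y2).
Variables (eps : SL2) (e : R).
Hypothesis e1 : e = 1 \/ e = -1.
Hypothesis eps_ent : [/\ ea eps = e, eb eps = 0, ec eps = 0 & ed eps = e].
Hypothesis rel0 : (gcomm x1 y1 * gcomm x2 y2 = eps)%g.
Hypothesis hyp : forall a b c d, orb a b c d ->
  2 < `|tr2 a| /\ 2 < `|tr2 (gcomm a b)|.

Lemma horbit_rel a b c d : orb a b c d -> (gcomm a b * gcomm c d = eps)%g.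
Proof.
have C := eps_central eps_ent.
elim=> // {a b c d} a b c d _ ih.
- by rewrite gcomm_Ta.
- by rewrite gcomm_TaV.
- by rewrite gcomm_Tb.
- by rewrite gcomm_TbV.
- have -> : gcomm a b = (eps * (gcomm c d)^-1)%g by rewrite -ih mulgK.
  by rewrite C mulgA mulgV mul1g.
- by rewrite gcomm_Tc ih -mulgA C mulgA mulVg mul1g.
Qed.

Lemma horbit_tr_swap a b c d : orb a b c d -> tr2 (gcomm c d) = e * tr2 (gcomm a b).
Proof.
move=> /horbit_rel h; have -> : gcomm c d = ((gcomm a b)^-1 * eps)%g by rewrite -h mulKg.
by rewrite -(eps_central eps_ent) (tr2_eps eps_ent) tr2V.
Qed.

Section Torus.
Variables (a0 b0 c d : SL2).
Hypothesis o0 : orb a0 b0 c d.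

(* The triples of traces of a pair of generators of the first handle. *)
Definition torus_triple (x y z : R) := exists a b,
  [/\ orb a b c d, gcomm a b = gcomm a0 b0, x = tr2 a, y = tr2 b & z = tr2 (a * b)%g].

Lemma torus_triple0 : torus_triple (tr2 a0) (tr2 b0) (tr2 (a0 * b0)%g).
Proof. by exists a0, b0. Qed.

Lemma torus_triple_rot x y z : torus_triple x y z -> torus_triple z x y.
Proof.
move=> [a [b [o eZ -> -> ->]]]; exists (a * b)%g, a^-1%g; split => //.
- exact: horbit_E.
- by rewrite gcomm_E.
- by rewrite tr2V.
- by rewrite tr2_conj.
Qed.

Lemma torus_triple_flip x y z : torus_triple x y z -> torus_triple (x * y - z) y x.
Proof.
move=> [a [b [o eZ -> -> ->]]]; exists (a * b^-1)%g, b; split => //.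
- exact: horbit_TbV.
- by rewrite gcomm_TbV.
- by rewrite tr2_mulV.
- by rewrite mulgVK.
Qed.

Lemma torus_triple_kappa x y z : torus_triple x y z ->
  x ^+ 2 + y ^+ 2 + z ^+ 2 - x * y * z - 2 = tr2 (gcomm a0 b0).
Proof. by move=> [a [b [o <- -> -> ->]]]; rewrite tr2_gcomm. Qed.

Lemma torus_triple_hyp x y z : torus_triple x y z -> 2 < `|x|.
Proof. by move=> [a [b [o _ -> _ _]]]; case: (hyp o). Qed.

Lemma fuchsian_handle k : tr2 (gcomm a0 b0) = - k -> 18 < k ->
  exists a b, [/\ orb a b c d, gcomm a b = gcomm a0 b0 & tr2 a ^+ 2 <= k - 2].
Proof.
move=> hk k18; apply: contrapT => hn.
apply: (@fuchsian_torus_short R torus_triple (- k) torus_triple_rot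
   torus_triple_flip _ k erefl k18 _ _ _ _ torus_triple0).
  by move=> x y z /torus_triple_kappa ->.
move=> x y z [a [b [o eZ -> _ _]]]; rewrite ltNge; apply/negP => h.
by apply: hn; exists a, b.
Qed.

Lemma pants_handle : 2 < tr2 (gcomm a0 b0) -> exists a b,
  [/\ orb a b c d, gcomm a b = gcomm a0 b0,
    [/\ 2 < `|tr2 a|, 2 < `|tr2 b| & 18 < tr2 (gcomm a0 b0)],
    [/\ `|tr2 a| <= `|tr2 (a * b)%g|, `|tr2 b| <= `|tr2 (a * b)%g| &
        4 * tr2 a ^+ 2 <= tr2 (gcomm a0 b0) + 2] &
    tr2 a * tr2 b * tr2 (a * b)%g < 0].
Proof.
move=> k2.
have [x [y [z [hT xz yz p]]]] := @goldman_reduction R torus_triple _ torus_triple_rot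
  torus_triple_flip torus_triple_kappa k2 torus_triple_hyp _ _ _ torus_triple0.
have hx := torus_triple_hyp hT.
have hz := torus_triple_hyp (torus_triple_rot hT).
have hy := torus_triple_hyp (torus_triple_rot (torus_triple_rot hT)).
have ek := torus_triple_kappa hT.
case: hT xz yz p hx hy hz ek => a [b [o eZ -> -> ->]] xz yz p hx hy hz ek.
exists a, b.
have sq (u : R) : u ^+ 2 = `|u| ^+ 2 by rewrite real_normK ?num_real.
have pe : tr2 a * tr2 b * tr2 (a * b)%g = - (`|tr2 a| * `|tr2 b| * `|tr2 (a * b)%g|).
  by rewrite -!normrM ltr0_norm // opprK.
suff [k18 k4] : 18 < tr2 (gcomm a0 b0) /\ 4 * tr2 a ^+ 2 <= tr2 (gcomm a0 b0) + 2 by [].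
rewrite -ek (sq (tr2 a)) (sq (tr2 b)) (sq (tr2 (a * b)%g)) pe.
move: `|tr2 a| `|tr2 b| `|tr2 (a * b)%g| hx hy hz xz => u v w hu hv hw uw.
have h1 : 4 < u * v by nra.
have h2 : 8 < u * v * w by nra.
have h3 : 2 * u ^+ 2 <= u * v * w.
  have : 0 <= u * (v * w - 2 * u) by apply: mulr_ge0; nra.
  by lra.
by split; nra.
Qed.
End Torus.

(** The candidates for the curve of the second handle are c and d^-1, with off-diagonal entries q1,
    r1 and q2, r2. Their ratios g / h are q r1 / (r q1) and q r2 / (r q2), whose quotient is Y / X
    for X = q1 r2 and Y = r1 q2; by [pants_spacing] one of the two can be balanced. *)
Lemma flip_step a b c d k :
  orb a b c d -> 18 < k -> tr2 (gcomm a b) = e * k ->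
  (e = -1 -> tr2 a ^+ 2 <= k - 2) -> (e = 1 -> 4 * tr2 a ^+ 2 <= k + 2) ->
  2 < `|tr2 c| -> 2 < `|tr2 d| -> `|tr2 c| <= `|tr2 (c * d)%g| ->
  `|tr2 d| <= `|tr2 (c * d)%g| -> tr2 c * tr2 d * tr2 (c * d)%g < 0 ->
  exists a' b' c' d', [/\ orb a' b' c' d',
    e = -1 -> `|tr2 (gcomm a' b')| <= k - 1 &
    e = 1 -> 2 <= tr2 (gcomm a' b') <= k - 1].
Proof.
move=> o k18 trZ bo be hc hd hcd hdd neg.
pose sq := Num.sqrt (k ^+ 2 - 4); pose L := (k + sq) / 2.
have sq0 : 0 <= sq by rewrite sqrtr_ge0.
have sq2 : sq ^+ 2 = k ^+ 2 - 4 by rewrite sqr_sqrtr //; nra.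
have L1 : 1 < L by rewrite /L; lra.
have Lne : L != 0 by rewrite gt_eqF //; lra.
have LV : L^-1 = (k - sq) / 2.
  apply: (@mulfI _ L) => //; rewrite mulfV // /L.
  have -> : (k + sq) / 2 * ((k - sq) / 2) = (k ^+ 2 - sq ^+ 2) / 4 by field.
  by rewrite sq2; field.
have hk : k = L + L^-1 by rewrite LV /L; field.
have kne : k + 2 != 0 by rewrite gt_eqF //; lra.
have eLVE : (e * L)^-1 = e * L^-1 by exact: eLV.
have LVlt : L^-1 < 1 by rewrite invf_lt1 //; lra.
have ee := e_sq e1.
have ene : e != 0.
  by apply/eqP => e0; move: ee; rewrite e0 mul0r => /eqP; rewrite eq_sym oner_eq0.
have [||P [z1 z2 z3 z4]] := @diagonalize R (gcomm a b) (e * L) (eL_neq0 e1 L1).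
- by rewrite eLVE (inj_eq (mulfI ene)) gt_eqF //; lra.
- by rewrite trZ eLVE hk; ring.
have ha : half_handle (e * L) (ed (P * a * P^-1)%g) (eb (P * a * P^-1)%g)
    (ec (P * a * P^-1)%g) (P * a * P^-1)%g.
  apply: half_handleP z1 z2 z3 z4 _; [exact: eL_neq1|exact: eL_neq0|].
  have -> : ((P * a * P^-1)^-1 * (P * gcomm a b * P^-1) =
     (P * b) * a^-1 * (P * b)^-1)%g by rewrite /gcomm !gnorm.
  by rewrite !tr2_conj tr2V.
pose W := (gcomm c d)%g.
have [w1 w2 w3 w4] : [/\ ea (P * W * P^-1)%g = L^-1, eb (P * W * P^-1)%g = 0,
    ec (P * W * P^-1)%g = 0 & ed (P * W * P^-1)%g = L^-1^-1].
  have -> : (P * W * P^-1 = eps * (P * gcomm a b * P^-1)^-1)%g.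
    have -> : W = (eps * (gcomm a b)^-1)%g.
      by rewrite (eps_central eps_ent) -(horbit_rel o) /W mulgA mulVg mul1g.
    move: (gcomm a b) => Z0.
    by rewrite !invgM invgK mulgA -(eps_central eps_ent P) !mulgA.
  have [-> -> -> ->] := mulE eps (P * gcomm a b * P^-1)^-1%g.
  have [-> -> -> ->] := invE (P * gcomm a b * P^-1)%g.
  case: eps_ent => -> -> -> ->; rewrite z1 z2 z3 z4 eLVE invrK.
  by split; rewrite ?mul0r ?mulr0 ?addr0 ?add0r ?oppr0 ?mulr0 // mulrA ee mul1r.
have L1V : L^-1 != 1 by rewrite lt_eqF.
have L0V : L^-1 != 0 by rewrite invr_eq0.
have hC : half_handle L^-1 (ed (P * c * P^-1)%g) (eb (P * c * P^-1)%g)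
    (ec (P * c * P^-1)%g) (P * c * P^-1)%g.
  apply: half_handleP w1 w2 w3 w4 _ => //.
  have -> : ((P * c * P^-1)^-1 * (P * W * P^-1) =
     (P * d) * c^-1 * (P * d)^-1)%g by rewrite /W /gcomm !gnorm.
  by rewrite !tr2_conj tr2V.
have hD : half_handle L^-1 (ed (P * d^-1 * P^-1)%g) (eb (P * d^-1 * P^-1)%g)
    (ec (P * d^-1 * P^-1)%g) (P * d^-1 * P^-1)%g.
  apply: half_handleP w1 w2 w3 w4 _ => //.
  have -> : ((P * d^-1 * P^-1)^-1 * (P * W * P^-1) =
     (P * d * c) * d * (P * d * c)^-1)%g.
    by rewrite /W /gcomm !gnorm.
  by rewrite !tr2_conj tr2V.
move: (ed (P * a * P^-1)%g) (eb (P * a * P^-1)%g) (ec (P * a * P^-1)%g) ha.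
move=> s q r ha.
move: (ed (P * c * P^-1)%g) (eb (P * c * P^-1)%g) (ec (P * c * P^-1)%g) hC.
move=> s1 q1 r1 hC.
move: (ed (P * d^-1 * P^-1)%g) (eb (P * d^-1 * P^-1)%g) (ec (P * d^-1 * P^-1)%g) hD.
move=> s2 q2 r2 hD.
have LVs : L^-1 + L^-1^-1 + 2 = k + 2 by rewrite invrK hk; ring.
have qr1 : q1 * r1 = tr2 c ^+ 2 / (k + 2) - 1.
  by rewrite -(tr2_conj P c) -LVs; apply: half_handle_det hC; rewrite ?LVs.
have qr2 : q2 * r2 = tr2 d ^+ 2 / (k + 2) - 1.
  by rewrite -(tr2V d) -(tr2_conj P d^-1%g) -LVs; apply: half_handle_det hD; rewrite ?LVs.
have qr : q * r = tr2 a ^+ 2 / (e * k + 2) - 1.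
  have E : e * L + (e * L)^-1 + 2 = e * k + 2 by rewrite eLVE hk; ring.
  rewrite -(tr2_conj P a) -E; apply: half_handle_det ha; rewrite ?eL_neq0 ?E //.
  by case: e1 => ->; rewrite ?mul1r // mulN1r addrC lt_eqF //; lra.
have qr0 : q * r < 0.
  rewrite qr; case: e1 => h; rewrite h.
    by rewrite mul1r subr_lt0 ltr_pdivrMr; have := be h; nra.
  have : tr2 a ^+ 2 / (-1 * k + 2) <= 0.
    by rewrite mulr_ge0_le0 ?sqr_ge0 // invr_le0; lra.
  by lra.
have kc : tr2 c ^+ 2 + tr2 d ^+ 2 + tr2 (c * d)%g ^+ 2 - tr2 c * tr2 d * tr2 (c * d)%g - 2 = k.
  by rewrite -tr2_gcomm (horbit_tr_swap o) trZ mulrA ee mul1r.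
have eXY : (q1 * r2) * (r1 * q2) =
    (1 - tr2 c ^+ 2 / (k + 2)) * (1 - tr2 d ^+ 2 / (k + 2)).
  have -> : (q1 * r2) * (r1 * q2) = (q1 * r1) * (q2 * r2) by ring.
  by rewrite qr1 qr2; ring.
have eS : q1 * r2 + r1 * q2 = 2 * (tr2 c * tr2 d) / (k + 2) - tr2 (c * d)%g.
  have e3 : tr2 (c * d^-1)%g = L^-1 * s1 * (L^-1 * s2) + q1 * r2 + r1 * q2 + s1 * s2.
    have -> : tr2 (c * d^-1)%g = tr2 ((P * c * P^-1) * (P * d^-1 * P^-1))%g.
      by rewrite -(tr2_conj P (c * d^-1)%g); congr tr2; rewrite !gnorm.
    rewrite tr2E; have [-> _ _ ->] := mulE (P * c * P^-1)%g (P * d^-1 * P^-1)%g.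
    by case: hC => -> -> -> ->; case: hD => -> -> -> ->; ring.
  have tc : tr2 c = s1 * (L^-1 + 1) by rewrite -(tr2_conj P c) (half_handle_trace hC).
  have td : tr2 d = s2 * (L^-1 + 1).
    by rewrite -(tr2V d) -(tr2_conj P d^-1%g) (half_handle_trace hD).
  have -> : q1 * r2 + r1 * q2 = tr2 (c * d^-1)%g - L^-1 * s1 * (L^-1 * s2) - s1 * s2.
    by rewrite e3; ring.
  rewrite tr2_mulV tc td hk; field.
  have L20 : 0 < L * L by apply: mulr_gt0; lra.
  by rewrite Lne gt_eqF //=; lra.
have [c4 d4 lo hi] := pants_spacing L1 hk k18 hc hd hcd hdd neg kc eXY eS.
have S0 (u : R) : 4 * u ^+ 2 <= k + 2 -> u ^+ 2 / (k + 2) - 1 < 0.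
  by move=> hu; rewrite subr_lt0 ltr_pdivrMr; have := sqr_ge0 u; lra.
have g1 : 0 < (q * r1) * (r * q1).
  have -> : (q * r1) * (r * q1) = (q * r) * (q1 * r1) by ring.
  by rewrite nmulr_rgt0 // qr1 S0.
have g2 : 0 < (q * r2) * (r * q2).
  have -> : (q * r2) * (r * q2) = (q * r) * (q2 * r2) by ring.
  by rewrite nmulr_rgt0 // qr2 S0.
have qr2p : 0 < (q * r) ^+ 2 by rewrite exprn_even_gt0 //= lt_eqF.
have [||n [bal|bal]] := @two_choices R L k L1 hk k18 _ _ _ _ g1 g2.
- have -> : 841 / 100 * (q * r1 * (r * q2) * (r * q1 * (q * r2))) =
    (q * r) ^+ 2 * (841 / 100 * (q1 * r2 * (r1 * q2))) by ring.
  have -> : (q * r1 * (r * q2) + r * q1 * (q * r2)) ^+ 2 =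
    (q * r) ^+ 2 * (q1 * r2 + r1 * q2) ^+ 2 by ring.
  by rewrite ler_pM2l.
- have -> : L ^+ 2 * (q * r1 * (r * q2) * (r * q1 * (q * r2))) =
    (q * r) ^+ 2 * (L ^+ 2 * (q1 * r2 * (r1 * q2))) by ring.
  have -> : 25 / 4 * (q * r1 * (r * q2) + r * q1 * (q * r2)) ^+ 2 =
    (q * r) ^+ 2 * (25 / 4 * (q1 * r2 + r1 * q2) ^+ 2) by ring.
  by rewrite ler_pM2l.
- exact: (flip_balanced e1 eps_ent horbit_rel L1 hk k18 o (And4 z1 z2 z3 z4) ha hC bo be hc c4 bal).
(* The pair (d^-1, d c) generates the same handle with the same boundary, and its first entry is the
   second candidate. *)
- have o2 : orb a b d^-1%g (d * c)%g by apply/horbit_swap/horbit_EV/horbit_swap.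
  apply: (flip_balanced e1 eps_ent horbit_rel L1 hk k18 o2 (And4 z1 z2 z3 z4) ha hD bo be _ _ bal);
    by rewrite tr2V.
Qed.

(** Each step lowers |tr [a, b]| by 1, whence the induction on a natural number bounding it. For e =
    -1 the boundary traces of the handles have opposite signs: after an exchange the first handle
    has trace below -2 and the second is of pants type. For e = 1 and a positive trace both handles
    are of pants type. *)
Theorem no_hyperbolic_horbit : e = 1 /\ tr2 (gcomm x1 y1) < -2.
Proof.
have notin (m : nat) a b c d : orb a b c d -> (e = 1 -> 2 < tr2 (gcomm a b)) ->
    `|tr2 (gcomm a b)| <= m%:R -> False.
  elim: m a b c d => [|m ih] a b c d o pos hm.
    by have [_] := hyp o; lra.
  have [h2 k2] := hyp o.
  have [k [hk [a' [b' [c' [d' [o' sN sP]]]]]]] : exists k, `|tr2 (gcomm a b)| = k /\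
    exists a' b' c' d', [/\ orb a' b' c' d', e = -1 -> `|tr2 (gcomm a' b')| <= k - 1 &
      e = 1 -> 2 <= tr2 (gcomm a' b') <= k - 1].
    case: e1 => he.
      have p1 := pos he.
      have [a' [b' [o1 eZ [h1 _ k18] [_ _ l1] _]]] := pants_handle o p1.
      have p2 : 2 < tr2 (gcomm c d) by rewrite (horbit_tr_swap o) he mul1r.
      have [c' [d' [/horbit_swap o2 eW [h3 h4 _] [l3 l4 _] n3]]] :=
        pants_handle (horbit_swap o1) p2.
      exists (tr2 (gcomm a b)); split; first by rewrite gtr0_norm //; lra.
      apply: (@flip_step a' b' c' d') => //; first by rewrite eZ he mul1r.
      by rewrite he; lra.
    have [a1 [b1 [c1 [d1 [o1 e1' n1]]]]] : exists a1 b1 c1 d1, [/\ orb a1 b1 c1 d1,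
        `|tr2 (gcomm a1 b1)| = `|tr2 (gcomm a b)| & tr2 (gcomm a1 b1) < -2].
      have [n0|p0] := ltP (tr2 (gcomm a b)) 0.
        by exists a, b, c, d; split => //; rewrite ltr0_norm // in k2; lra.
      exists c, d, a, b; split; first exact: horbit_swap.
        by rewrite (horbit_tr_swap o) he mulN1r normrN.
      by rewrite (horbit_tr_swap o) he mulN1r; rewrite ger0_norm // in k2; lra.
    have p2 : 2 < tr2 (gcomm c1 d1) by rewrite (horbit_tr_swap o1) he mulN1r; lra.
    have [c' [d' [/horbit_swap o2 eW [h3 h4 k18] [l3 l4 _] n3]]] :=
      pants_handle (horbit_swap o1) p2.
    have eC : tr2 (gcomm c1 d1) = `|tr2 (gcomm a b)|.
      by rewrite -e1' (horbit_tr_swap o1) he mulN1r ltr0_norm //; lra.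
    have trN : tr2 (gcomm a1 b1) = - `|tr2 (gcomm a b)|.
      by rewrite -eC (horbit_tr_swap o1) he mulN1r opprK.
    rewrite eC in k18.
    have [a' [b' [o3 eZ l1]]] := fuchsian_handle o2 trN k18.
    exists `|tr2 (gcomm a b)|; split => //.
    apply: (@flip_step a' b' c' d') => //; first by rewrite eZ he mulN1r.
    by rewrite he; lra.
  have [_ h2'] := hyp o'.
  have small : `|tr2 (gcomm a' b')| <= k - 1.
    case: e1 => he; last exact: sN.
    by have /andP[l1 l2] := sP he; rewrite ger0_norm //; lra.
  apply: (ih _ _ _ _ o').
    by move=> he; have /andP[l _] := sP he; rewrite ger0_norm // in h2'; lra.
  by rewrite -addn1 natrD in hm; lra.
have o0 := horbit_refl x1 y1 x2 y2.
have [m hm] : exists m : nat, `|tr2 (gcomm x1 y1)| <= m%:R.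
  by exists (Num.bound `|tr2 (gcomm x1 y1)|); rewrite ltW // archi_boundP.
case: (e1) => he; last by exfalso; apply: (notin m _ _ _ _ o0 _ hm); rewrite he; lra.
split => //; rewrite ltNge; apply/negP => hge.
apply: (notin m _ _ _ _ o0 _ hm) => _; have [_ h2] := hyp o0.
rewrite ltNge; apply/negP => hle; move: h2; rewrite ltNge ler_norml.
by rewrite hge hle.
Qed.
End Descent.

End TraceDescent.
Import TraceDescent.

(** * Automorphisms preserving the fundamental class *)

Module BarComplexAutomorphisms.
Local Open Scope ring_scope.

Section BarChains.
Variable G : groupType.
Local Notation bar x y := (<< (x%g, y%g) >> : {freeg (G * G)%type}).
Local Notation tri x y z := (<< (x%g, y%g, z%g) >> : {freeg (G * G * G)%type}).
Implicit Types a b c d g h k y z : G.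

Lemma bar_d3B : additive (@bar_d3 G).
Proof. exact: lift_is_additive. Qed.
Lemma bar_d3N (u : {freeg (G * G * G)%type}) : bar_d3 (- u) = - bar_d3 u.
Proof.
have z0 : @bar_d3 G 0 = 0 by have := bar_d3B 0 0; rewrite !subrr.
by have := bar_d3B 0 u; rewrite z0 !sub0r.
Qed.
Lemma bar_d3D (u v : {freeg (G * G * G)%type}) : bar_d3 (u + v) = bar_d3 u + bar_d3 v.
Proof. by rewrite -{1}[v]opprK bar_d3B bar_d3N opprK. Qed.

Lemma bar_d3U g h k : bar_d3 (tri g h k) = bar h k - bar (g * h) k + bar g (h * k) - bar g h.
Proof. by rewrite /bar_d3 liftU scale1r. Qed.

(** The Fox calculus chain of [a, b][c, d] for arbitrary elements; the relation has only been used
    to write 1 for the prefix of the last letter. *)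
Definition surface_chain a b c d : {freeg (G * G)%type} :=
  let z := gcomm a b in
  bar 1 a + bar a b - bar (a * b * a^-1) a - bar z b + bar z c + bar (z * c) d
  - bar (z * (c * d * c^-1)) c - bar 1 d.

Let gcomm_mul a b : (gcomm a b * b = a * b * a^-1)%g.
Proof. by rewrite /gcomm !gnorm. Qed.
Let conj_mul a b : (a * b * a^-1 * a = a * b)%g.
Proof. by rewrite !gnorm. Qed.

Ltac by_coeff := apply/eqP/freeg_eqP => p; rewrite ?(coeffD, coeffN); ring.

Lemma surface_chain_Ta a b c d :
  homologous (surface_chain a (b * a)%g c d) (surface_chain a b c d).
Proof.
(* Each simplex trades b for b * a in one of the two places where b occurs, with prefixes a and
   [a, b]. *)
exists (tri a b a - tri (gcomm a b) b a).
rewrite !(bar_d3D, bar_d3N) !bar_d3U /surface_chain gcomm_Ta gcomm_mul.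
have -> : (a * (b * a) * a^-1 = a * b)%g by rewrite !gnorm.
by by_coeff.
Qed.

Lemma surface_chain_Tb a b c d :
  homologous (surface_chain (a * b)%g b c d) (surface_chain a b c d).
Proof.
exists (tri 1 a b - tri (a * b * a^-1) a b).
rewrite !(bar_d3D, bar_d3N) !bar_d3U /surface_chain gcomm_Tb conj_mul !mul1g.
have -> : (a * b * b * (a * b)^-1 = a * b * a^-1)%g by rewrite !gnorm.
by by_coeff.
Qed.

(** In [surface_chain] the half belonging to the second handle is translated on the left by the
    commutator of the first. Exchanging the handles moves the translation to the other half, at the
    cost of the explicit boundary and of correction terms in y and z only. *)
Lemma translate_half y z a b : gcomm a b = z -> (y * z = 1)%g ->
  bar y a + bar (y * a) b - bar (y * (a * b * a^-1)) a - bar 1 b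
  + bar_d3 (tri y 1 a + tri y a b - tri y (a * b * a^-1) a - tri y z b) =
  bar 1 a + bar a b - bar (a * b * a^-1) a - bar z b - bar y 1 + bar y z.
Proof.
move=> <- h; rewrite !(bar_d3D, bar_d3N) !bar_d3U h gcomm_mul conj_mul mulg1 mul1g.
by by_coeff.
Qed.

Lemma surface_chain_swap a b c d : (gcomm a b * gcomm c d = 1)%g ->
  homologous (surface_chain c d a b) (surface_chain a b c d).
Proof.
move=> h; have h' : (gcomm c d * gcomm a b = 1)%g.
  move: h; move: (gcomm a b) (gcomm c d) => x y e.
  by rewrite -[y]mul1g -(mulVg x) -(mulgA x^-1%g) e mulg1 mulVg.
rewrite /homologous /surface_chain.
move ez : (gcomm a b) h h' => z; move ey : (gcomm c d) => y h h'.
have t1 := translate_half ez h'; have t2 := translate_half ey h.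
move: (tri y 1 a + _ - _ - _) t1 => D1 t1; move: (tri z 1 c + _ - _ - _) t2 => D2 t2.
exists (D2 - D1 + tri z y z + tri 1 1 z + tri y 1 1).
rewrite !bar_d3D bar_d3N !bar_d3U h h' !mulg1 !mul1g.
apply/eqP/freeg_eqP => p; move/(congr1 (coeff p)): t1; move/(congr1 (coeff p)): t2.
rewrite !(coeffD, coeffN); lra.
Qed.
End BarChains.

Lemma fundamental_cycleE : fundamental_cycle = surface_chain a1 b1 a2 b2.
Proof.
rewrite /fundamental_cycle !big_ord_recl big_ord0 /= addr0 /surface_chain.
have e (w : word) : cls w = weval gamma_gen w by rewrite weval_gen.
have r : cls relator = 1%g.
  by rewrite e weval_relator; exact: gamma_relation.
rewrite r !e /= /leval /= !mulg1 /gcomm.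
by rewrite ?mulgA !addrA.
Qed.

Lemma bar_map_surface (f : {multiplicative Gamma2 -> Gamma2}) a b c d :
  bar_map2 f (surface_chain a b c d) = surface_chain (f a) (f b) (f c) (f d).
Proof.
have fU x y : bar_map2 f << (x, y) >> = << (f x, f y) >> :> {freeg (Gamma2 * Gamma2)%type}.
  by rewrite /bar_map2 liftU scale1r.
have fD : additive (bar_map2 f) by exact: lift_is_additive.
have fN x : bar_map2 f (- x) = - bar_map2 f x by rewrite -[- x]sub0r fD -(subrr x) fD subrr sub0r.
have fA x y : bar_map2 f (x + y) = bar_map2 f x + bar_map2 f y.
  by rewrite -{1}[y]opprK fD fN opprK.
by rewrite /surface_chain !(fA, fN) !fU -mor_comm !(morM, morV, mor1).
Qed.

Lemma aut_plusP (f : {multiplicative Gamma2 -> Gamma2}) : bijective f ->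
  homologous (surface_chain (f a1) (f b1) (f a2) (f b2)) (surface_chain a1 b1 a2 b2) ->
  aut_plus f.
Proof. by move=> bf h; split => //; rewrite fundamental_cycleE bar_map_surface. Qed.

End BarComplexAutomorphisms.
Import BarComplexAutomorphisms.

(** * Alternating words in a group generated by two sides *)

Module AmalgamNormalForm.
Local Open Scope ring_scope.

Section Syllables.
Variables (G : groupType) (In : bool -> G -> Prop) (Z : G -> Prop).
Local Open Scope group_scope.
Hypothesis In1 : forall b, In b 1.
Hypothesis InM : forall b x y, In b x -> In b y -> In b (x * y).
Hypothesis InV : forall b x, In b x -> In b x^-1.
Hypothesis ZM : forall x y, Z x -> Z y -> Z (x * y).
Hypothesis ZV : forall x, Z x -> Z x^-1.
Hypothesis ZIn : forall b x, Z x -> In b x.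
Hypothesis Z1 : Z 1.
Hypothesis gen_ind : forall P : G -> Prop, P 1 ->
  (forall b x y, In b x -> P y -> P (x * y)) -> forall x, P x.

Fixpoint alt (b : bool) (l : seq G) : Prop :=
  if l is x :: l' then [/\ In b x, ~ Z x & alt (~~ b) l'] else True.
Fixpoint prodg (l : seq G) : G := if l is x :: l' then x * prodg l' else 1.

Lemma prodg_cat l l' : prodg (l ++ l') = prodg l * prodg l'.
Proof. by elim: l => [|x l ih] /=; rewrite ?mul1g // ih mulgA. Qed.

Lemma prodg_rcons l x : prodg (rcons l x) = prodg l * x.
Proof. by rewrite -cats1 prodg_cat /= mulg1. Qed.

Lemma alt_cat b l l' : alt b (l ++ l') <-> alt b l /\ alt (b (+) odd (size l)) l'.
Proof.
elim: l b => [|x l ih] b /=; first by rewrite addbF; tauto.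
have := ih (~~ b); rewrite addbN addNb => -[h1 h2].
by split=> [[hx nx /h1[]]|[[hx nx hl] hl']] //; split => //; exact: h2.
Qed.

Lemma ZVE x : ~ Z x -> ~ Z x^-1.
Proof. by move=> h /ZV; rewrite invgK. Qed.

Lemma ZMl x y : Z x -> ~ Z y -> ~ Z (x * y).
Proof. by move=> hx hy h; apply: hy; have := ZM (ZV hx) h; rewrite mulgA mulVg mul1g. Qed.

Definition invseq (l : seq G) := [seq x^-1 | x <- rev l].

Lemma prodg_inv l : prodg (invseq l) = (prodg l)^-1.
Proof.
rewrite /invseq; elim: l => [|x l ih]; first by rewrite /= invg1.
by rewrite rev_cons map_rcons prodg_rcons ih /= invgM.
Qed.

Lemma alt_inv b l : alt b l -> alt (b (+) odd (size l) (+) true) (invseq l).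
Proof.
rewrite /invseq; elim: l b => [|x l ih] b //= [hx nx hl].
rewrite rev_cons map_rcons -cats1; apply/alt_cat; split.
  by have := ih _ hl; rewrite addbN addNb.
rewrite /= size_map size_rev; split => //; last exact: ZVE.
by rewrite (_ : _ (+) _ = b); [exact: InV|case: (b); case: (odd _)].
Qed.

Lemma normal_form x : Z x \/ exists b l, [/\ l <> [::], alt b l & x = prodg l].
Proof.
elim/gen_ind: x => [|c x y hx [hy|[b [l [nl hl ->]]]]]; first by left.
  have hxy : In c (x * y) by apply: InM => //; exact: ZIn.
  have [h|h] := pselect (Z (x * y)); first by left.
  by right; exists c, [:: x * y]; rewrite /= mulg1.
have absorb u b' l' : Z u -> alt b' l' -> Z (u * prodg l') \/
    exists b l, [/\ l <> [::], alt b l & u * prodg l' = prodg l].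
  move=> hu; case: l' => [|s l'] /=; first by rewrite mulg1; left.
  move=> [h1 h2 h3]; right; exists b', (u * s :: l'); rewrite /= mulgA; split => //.
  by split => //; [apply: InM => //; exact: ZIn|exact: ZMl].
have [hz|nz] := pselect (Z x); first exact: absorb hz hl.
have [e|ne] := eqVneq c b; last first.
  right; exists c, (x :: l); split => //=; split => //.
  by rewrite (_ : ~~ c = b) //; case: (c) (b) ne => -[].
case: l nl hl => // s l _ [hs ns hl]; rewrite /= mulgA.
have hxs : In b (x * s) by apply: InM => //; rewrite -e.
have [h|h] := pselect (Z (x * s)); first exact: absorb h hl.
by right; exists b, (x * s :: l).
Qed.

(** In a word of odd length the two extreme syllables lie on the same side; conjugation by the last
    one merges them and shortens the word. *)
Lemma cyclic_normal_form x : exists g, (exists b, In b (g * x * g^-1)) \/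
  exists b l, [/\ l <> [::], ~~ odd (size l), alt b l & g * x * g^-1 = prodg l].
Proof.
have [hz|[b [l [nl hl ->]]]] := normal_form x.
  by exists 1; left; exists true; rewrite mul1g invg1 mulg1; exact: ZIn.
have [n] := ubnP (size l); elim: n b l nl hl => // n ih b l nl hl hn.
have [ol|el] := boolP (odd (size l)); last first.
  by exists 1; right; exists b, l; rewrite mul1g invg1 mulg1.
case: l nl hl ol hn => // s l _ [hs ns hl] /= ol hn.
case/lastP: l hl ol hn => [|m s'] hl ol hn.
  by exists 1; left; exists b; rewrite /= !mulg1 mul1g invg1 mulg1.
have [hm /= [hs' ns' _]] : alt (~~ b) m /\ alt (~~ b (+) odd (size m)) [:: s'].
  by apply/alt_cat; rewrite cats1.
rewrite size_rcons /= negbK in ol hn.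
have hs2 : In b s' by move: hs'; rewrite ol; case: (b).
have hss : In b (s' * s) by exact: InM.
have e : s' * (s * prodg (rcons m s')) * s'^-1 = s' * s * prodg m.
  by rewrite prodg_rcons !mulgA -(mulgA _ s') mulgV mulg1.
have [hz|nz] := pselect (Z (s' * s)); last first.
  exists s'; right; exists b, (s' * s :: m). rewrite e; split => //=.
  by rewrite ol.
case: m {hl hs'} hm ol hn e => // t m [ht nt hm] ol hn e.
have h1 : alt (~~ b) (s' * s * t :: m).
  by split => //; [apply: InM => //; exact: ZIn|exact: ZMl].
have [||g hg] := ih (~~ b) (s' * s * t :: m) _ h1 => //.
  by move: hn; rewrite /= !ltnS => /ltnW/leq_trans; apply.
exists (g * s').
have -> : g * s' * (s * prodg (rcons (t :: m) s')) * (g * s')^-1 =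
   g * (s' * (s * prodg (rcons (t :: m) s')) * s'^-1) * g^-1 by rewrite invgM !mulgA.
by rewrite e; move: hg; rewrite /= !mulgA.
Qed.

(** [K] stands for the elements whose trace is periodic under bending. [K_alt] takes the place of
    the normal form theorem of an amalgam: as [K] contains 1, it makes every nonempty even
    alternating product nontrivial. *)
Variable K : G -> Prop.
Hypothesis K1 : K 1.
Hypothesis K_conj : forall g x, K x -> K (g * x * g^-1).
Hypothesis K_alt : forall b l, l <> [::] -> ~~ odd (size l) -> alt b l -> ~ K (prodg l).

Lemma elliptic_conj x : K x -> exists g b, In b (g * x * g^-1).
Proof.
move=> kx; have [g [[b h]|[b [l [nl el hl e]]]]] := cyclic_normal_form x.
  by exists g, b.
by case: (K_alt nl el hl); rewrite -e; exact: K_conj.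
Qed.

(** In p = h q h^-1 with h alternating, an extreme syllable of h on the side of its neighbour p or q
    is absorbed by conjugation. When none is left, p^-1 h q h^-1 would be an even alternating
    product equal to 1, unless p or q lies in [Z]. *)
Lemma malnormal p q h : In true p -> In false q -> p = h * q * h^-1 ->
  exists g, Z (g * p * g^-1).
Proof.
have base p' q' : In true p' -> In false q' -> p' = q' -> Z p'.
  move=> hp hq e; apply: contrapT => np.
  apply: (@K_alt true [:: p'^-1; q']) => //=; last by rewrite e mulg1 mulVg.
  by split => //; [exact: InV|exact: ZVE|split => //; rewrite -e].
have [hz|[b [l [_ hl ->]]]] := normal_form h.
  move=> hp hq e; exists 1; rewrite mul1g invg1 mulg1; apply: base e => //.
  by apply: InM; [apply: InM => //; exact: ZIn|apply: InV; exact: ZIn].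
have [n] := ubnP (size l); elim: n b l p q hl => // n ih b l p q hl hn hp hq e.
case: l hl hn e => [|s l] hl hn e.
  by exists 1; rewrite mul1g invg1 mulg1; apply: base hp hq _; rewrite e /= mul1g invg1 mulg1.
case: b hl => hl.
  case: hl => hs ns hl.
  have hp' : In true (s^-1 * p * s) by apply: InM => //; apply: InM => //; exact: InV.
  have e' : s^-1 * p * s = prodg l * q * (prodg l)^-1 by rewrite e /= !gnorm.
  have [g hg] := ih _ l _ q hl hn hp' hq e'.
  exists (g * s^-1); move: hg; rewrite invgM invgK !mulgA; by [].
have [ol|el] := boolP (odd (size (s :: l))).
  move: (s :: l) hl hn e ol => {s}l; case/lastP: l => // l s.
  rewrite -cats1 => /alt_cat[hl [hs ns _]]; rewrite cats1 size_rcons => hn e ol.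
  have hs2 : In false s by move: hs; rewrite /= in ol; rewrite (negPf ol).
  apply: (ih _ l p (s * q * s^-1) hl hn hp).
    by apply: InM; [exact: InM|exact: InV].
  by rewrite e prodg_rcons invgM !mulgA.
have [zp|np] := pselect (Z p); first by exists 1; rewrite mul1g invg1 mulg1.
have [zq|nq] := pselect (Z q).
  exists (prodg (s :: l))^-1; move: (prodg _) e => X ->.
  by have -> : X^-1 * (X * q * X^-1) * X^-1^-1 = q by rewrite !gnorm.
exfalso; move: (s :: l) hl e el => {s hn}l hl e el.
apply: (@K_alt true (p^-1 :: l ++ q :: invseq l)) => //.
- by rewrite /= size_cat /= /invseq size_map size_rev addnS /= oddD addbb.
- split; [exact: InV|exact: ZVE|].
  apply/alt_cat; split => //=; rewrite (negPf el); split => //=.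
  by have := alt_inv hl; rewrite (negPf el).
rewrite /= prodg_cat /= prodg_inv.
have -> : prodg l * (q * (prodg l)^-1) = p by rewrite e mulgA.
by rewrite mulVg.
Qed.
End Syllables.

End AmalgamNormalForm.
Import AmalgamNormalForm.

(** * Bent representations and their trace polynomials *)

Module BentRepresentations.
Local Open Scope ring_scope.

Local Notation z := (gcomm a1 b1).

Inductive zpow : Gamma2 -> Prop :=
| zpow1 : zpow 1%g
| zpowz x : zpow x -> zpow (z * x)%g
| zpowzV x : zpow x -> zpow (z^-1 * x)%g.

Lemma zpowM x y : zpow x -> zpow y -> zpow (x * y)%g.
Proof.
move=> hx hy; elim: hx => [|u _ ih|u _ ih]; rewrite ?mul1g // -mulgA.
  exact: zpowz.
exact: zpowzV.
Qed.

Lemma zpowV x : zpow x -> zpow x^-1%g.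
Proof.
have zz : zpow z by rewrite -[z]mulg1; apply/zpowz/zpow1.
have zz' : zpow z^-1%g by have := zpowzV zpow1; rewrite mulg1.
elim=> [|u _ ih|u _ ih]; first by rewrite invg1; exact: zpow1.
  have -> : ((z * u)^-1 = u^-1 * z^-1)%g by exact: invgM.
  exact: zpowM.
have -> : ((z^-1 * u)^-1 = u^-1 * z^-1^-1)%g by exact: invgM.
by rewrite invgK; exact: zpowM.
Qed.

Definition first_side (l : letter) : bool := (l.1 < 2)%N.
Definition in_side (b : bool) (x : Gamma2) := exists2 w, cls w = x & all (fun l => first_side l == b) w.

Lemma in_side1 b : in_side b 1%g. Proof. by exists [::]. Qed.
Lemma in_sideM b x y : in_side b x -> in_side b y -> in_side b (x * y)%g.
Proof.
move=> [u <- hu] [v <- hv]; exists (u ++ v); last by rewrite all_cat hu.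
by symmetry; exact: gamma_mulE.
Qed.
Lemma in_sideV b x : in_side b x -> in_side b x^-1%g.
Proof.
move=> [u <- hu]; exists (winv u); first by symmetry; exact: gamma_invE.
by rewrite /winv all_rev all_map; apply: sub_all hu.
Qed.
Lemma in_side_gen (l : letter) : in_side (first_side l) (leval gamma_gen l).
Proof. by exists [:: l]; rewrite /= ?eqxx // -weval_gen /= mulg1. Qed.

Lemma comm_in_side b : in_side b z.
Proof.
have gc c x y : in_side c x -> in_side c y -> in_side c (gcomm x y).
  move=> hx hy; apply: in_sideM; last exact: in_sideV.
  by apply: in_sideM; [exact: in_sideM|exact: in_sideV].
case: b; first exact: (gc _ _ _ (in_side_gen (ia1, true)) (in_side_gen (ib1, true))).
have -> : z = (gcomm a2 b2)^-1%g.
  have := gamma_relation; rewrite /surface_relation; move: z (gcomm a2 b2) => x y e.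
  by rewrite -[x]mulg1 -(mulgV y) mulgA e mul1g.
apply: in_sideV; exact: (gc _ _ _ (in_side_gen (ia2, true)) (in_side_gen (ib2, true))).
Qed.

Lemma zpow_side b x : zpow x -> in_side b x.
Proof.
elim=> [|u _|u _]; first exact: in_side1.
  by apply: in_sideM; exact: comm_in_side.
by apply: in_sideM; apply: in_sideV; exact: comm_in_side.
Qed.

Lemma gamma_side_ind (P : Gamma2 -> Prop) : P 1%g ->
  (forall b x y, in_side b x -> P y -> P (x * y)%g) -> forall x, P x.
Proof.
move=> P1 PM x; rewrite -(cls_repr x) -weval_gen.
elim: (repr x) => [|l w ih] //=.
by apply: PM ih; exact: in_side_gen.
Qed.

Section Bending.
Variable R : realType.
Local Notation SL2 := (SL2 R).

Lemma matA_sub : 1 * 2 - 1 * 1 = 1 :> R. Proof. by ring. Qed.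
Lemma matB_sub : 1 * 2 - (-1) * (-1) = 1 :> R. Proof. by ring. Qed.
Lemma matU_sub (t : R) : 1 * 1 - t * 0 = 1. Proof. by ring. Qed.
Definition matA := mk2 matA_sub.
Definition matB := mk2 matB_sub.
Definition matU (t : R) := mk2 (matU_sub t).

(** The first handle is a once-punctured torus, the second the same one with exchanged generators,
    which inverts the commutator. This commutator is a sign times some [matU c], so it commutes with
    [matU t] and the relation survives conjugation of the second handle by [matU t]. *)
Definition bent_tup (t : R) : 'I_4 -> SL2 :=
  tup matB^-1 matA^-1 (matU t * matA^-1 * (matU t)^-1) (matU t * matB^-1 * (matU t)^-1).

Lemma ea_mk (a b c d : R) h : ea (@mk2 R a b c d h) = a. Proof. by case: (mk2E h). Qed.
Lemma eb_mk (a b c d : R) h : eb (@mk2 R a b c d h) = b. Proof. by case: (mk2E h). Qed.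
Lemma ec_mk (a b c d : R) h : ec (@mk2 R a b c d h) = c. Proof. by case: (mk2E h). Qed.
Lemma ed_mk (a b c d : R) h : ed (@mk2 R a b c d h) = d. Proof. by case: (mk2E h). Qed.
Lemma ea_mul (A B : SL2) : ea (A * B)%g = ea A * ea B + eb A * ec B. Proof. by case: (mulE A B). Qed.
Lemma eb_mul (A B : SL2) : eb (A * B)%g = ea A * eb B + eb A * ed B. Proof. by case: (mulE A B). Qed.
Lemma ec_mul (A B : SL2) : ec (A * B)%g = ec A * ea B + ed A * ec B. Proof. by case: (mulE A B). Qed.
Lemma ed_mul (A B : SL2) : ed (A * B)%g = ec A * eb B + ed A * ed B. Proof. by case: (mulE A B). Qed.
Lemma ea_inv (A : SL2) : ea A^-1%g = ed A. Proof. by case: (invE A). Qed.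
Lemma eb_inv (A : SL2) : eb A^-1%g = - eb A. Proof. by case: (invE A). Qed.
Lemma ec_inv (A : SL2) : ec A^-1%g = - ec A. Proof. by case: (invE A). Qed.
Lemma ed_inv (A : SL2) : ed A^-1%g = ea A. Proof. by case: (invE A). Qed.
Definition entr := (ea_inv, eb_inv, ec_inv, ed_inv, ea_mul, eb_mul, ec_mul, ed_mul, ea_mk, eb_mk, ec_mk, ed_mk).

Lemma matUD s t : (matU s * matU t)%g = matU (s + t).
Proof. by apply: SL2_ext; rewrite /matU !entr; ring. Qed.
Lemma matU0 : matU 0 = 1%g.
Proof. by have [? ? ? ?] := oneE R; apply: SL2_ext; rewrite /matU !entr. Qed.
Lemma matUV t : (matU t)^-1%g = matU (- t).
Proof. by apply: SL2_ext; rewrite /matU !entr ?oppr0. Qed.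

(* The monodromy of the boundary of the once-punctured torus is -U(6), up to sign. *)
Lemma comm_AB : exists2 c : R, c <> 0 & exists e : SL2, [/\ forall A, (e * A = A * e)%g &
  (gcomm matB^-1 matA^-1 = e * matU c)%g].
Proof.
pose w := (gcomm matB^-1 matA^-1)%g.
have he : -1 * -1 - 0 * 0 = 1 :> R by ring.
exists (- eb w); last first.
  exists (mk2 he); split.
    by move=> A; apply: SL2_ext; rewrite !entr; ring.
  by apply: SL2_ext; rewrite /w /gcomm /matU !entr; ring.
by rewrite /w /gcomm /matU !entr; lra.
Qed.

Lemma bent_relation t : surface_relation (bent_tup t).
Proof.
have [c _ [e [ce hc]]] := comm_AB.
rewrite /surface_relation /bent_tup /tup /=; move: hc.
move: matA^-1%g matB^-1%g => x y hc.
have -> : gcomm (matU t * x * (matU t)^-1) (matU t * y * (matU t)^-1) =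
  (matU t * (gcomm y x)^-1 * (matU t)^-1)%g by rewrite /gcomm !gnorm.
rewrite hc; have -> : (matU t * (e * matU c)^-1 * (matU t)^-1 = (e * matU c)^-1)%g.
  have cU : (matU t * (e * matU c) = e * matU c * matU t)%g.
    by rewrite mulgA -ce -!mulgA !matUD addrC.
  move: cU; move: (e * matU c)%g (matU t) => X Y h.
  by apply: (mulgI X); rewrite mulgV !mulgA -h -(mulgA Y) mulgV mulg1 mulgV.
exact: mulgV.
Qed.

Definition bent (t : R) : {multiplicative Gamma2 -> SL2} := projT1 (cid (gamma_ext_ex (bent_relation t))).
Lemma bent_gen t i : bent t (gamma_gen i) = bent_tup t i.
Proof. exact: (projT2 (cid (gamma_ext_ex (bent_relation t)))) i. Qed.

Definition bend (b : bool) t : SL2 := if b then 1%g else matU t.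

Lemma bent_side b x t : in_side b x -> bent t x = (bend b t * bent 0 x * (bend b t)^-1)%g.
Proof.
move=> [w <-]; rewrite -weval_gen; elim: w => [|l w ih] /=; first by rewrite !mor1 mulg1 mulgV.
case/andP=> hl /ih e; rewrite !morM e.
have -> : bent t (leval gamma_gen l) = (bend b t * bent 0 (leval gamma_gen l) * (bend b t)^-1)%g.
  suff gen (i : 'I_4) : (i < 2)%N == b -> bent t (gamma_gen i) = (bend b t * bent 0 (gamma_gen i) * (bend b t)^-1)%g.
    case: l hl => i []; rewrite /first_side /leval /= => hl; rewrite ?morV ?gen //.
    by rewrite !invgM invgK !mulgA.
  rewrite !bent_gen /bent_tup matU0; case: b {hl e ih} => /=; move: i; apply: ord4P => //= _.
  + by rewrite mul1g invg1 mulg1.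
  + by rewrite mul1g invg1 mulg1.
  + by rewrite /tup /= mul1g invg1 mulg1.
  + by rewrite /tup /= mul1g invg1 mulg1.
by rewrite !gnorm.
Qed.

Inductive gl := LA | LA' | LB | LB'.
Definition ggen (l : gl) : Gamma2 :=
  match l with LA => b1^-1%g | LA' => b1 | LB => a1^-1%g | LB' => a1 end.
Definition ginv (l : gl) := match l with LA => LA' | LA' => LA | LB => LB' | LB' => LB end.

Lemma ggen_inv l : (ggen (ginv l) = (ggen l)^-1)%g.
Proof. by case: l => /=; rewrite ?invgK. Qed.

(** Reduced words in the generators of the first handle, together with their leftmost letter. The
    letters are named after the matrices: [bent] sends [ggen LA] to [matA] and [ggen LB] to
    [matB]. *)
Inductive red : option gl -> Gamma2 -> Prop :=
| red0 : red None 1%g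
| redS o l p : red o p -> o <> Some (ginv l) -> red (Some l) (ggen l * p)%g.

Lemma side_red x : in_side true x -> exists o, red o x.
Proof.
move=> [w <-]; rewrite -weval_gen; elim: w => [|l w ih] /=; first by exists None; exact: red0.
case/andP=> hl /ih[o ho].
have [k ->] : exists k, leval gamma_gen l = ggen k.
  case: l hl => i [] /=; rewrite /leval /first_side /=; move: i; apply: ord4P => //= _.
  - by exists LB'.
  - by exists LA'.
  - by exists LB.
  - by exists LA.
have [e|ne] := pselect (o = Some (ginv k)); last by exists (Some k); exact: redS ne.
rewrite e in ho; inversion ho as [|o' l' p' hp' no' e1 e2].
by exists o'; rewrite ggen_inv mulgA mulgV mul1g.
Qed.

(** Ping-pong cones bounded by the lines x = 0, y = 0, x = y and x = - y. A reduced word with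
    leftmost letter l sends (1, 0) into the cone of l, up to the boundary lines treated by
    [ends]. *)
Definition reg (l : gl) (x y : R) := match l with
  | LA => 0 < x * y /\ x ^+ 2 < y ^+ 2
  | LB => x * y < 0 /\ x ^+ 2 < y ^+ 2
  | LA' => x * y < 0 /\ y ^+ 2 < x ^+ 2
  | LB' => 0 < x * y /\ y ^+ 2 < x ^+ 2 end.

Local Notation gA := (b1^-1)%g.
Local Notation gB := (a1^-1)%g.
Definition tail (u p : Gamma2) := exists2 s, zpow s & p = (u * s)%g.

(** The cones touch along the directions of the cusp, where strict ping-pong fails. On such a line
    the word itself is known: it is a final segment of z or z^-1 followed by a power of z, which the
    tails record. *)
Definition ends (l : gl) (x y : R) (p : Gamma2) := match l with
  | LA => (x = y /\ tail gA p) \/ (x = 0 /\ tail (gA * gB)%g p)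
  | LB => (x = 0 /\ tail (gB * gA)%g p) \/ (x = - y /\ tail gB p)
  | LA' => (x = - y /\ tail (b1 * gB * gA)%g p) \/ (y = 0 /\ zpow p)
  | LB' => (y = 0 /\ zpow p) \/ (x = y /\ tail (a1 * gA * gB)%g p) end.

Lemma tail_mul g u p : tail u p -> tail (g * u)%g (g * p)%g.
Proof. by move=> [s hs ->]; exists s => //; rewrite mulgA. Qed.
Lemma tail_z p : tail z p -> zpow p.
Proof. by move=> [s hs ->]; exact: zpowz. Qed.
Lemma tail_zV p : tail z^-1%g p -> zpow p.
Proof. by move=> [s hs ->]; exact: zpowzV. Qed.
Lemma tail1 g p : zpow p -> tail g (g * p)%g.
Proof. by exists p. Qed.

Definition vx p := ea (bent 0 p).
Definition vy p := ec (bent 0 p).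

Lemma v_step l p : vx (ggen l * p)%g = match l with LA => vx p + vy p | LB => vx p - vy p
     | LA' => 2 * vx p - vy p | LB' => 2 * vx p + vy p end /\
  vy (ggen l * p)%g = match l with LA => vx p + 2 * vy p | LB => - vx p + 2 * vy p
     | LA' => - vx p + vy p | LB' => vx p + vy p end.
Proof.
rewrite /vx /vy !morM; case: l => /=; rewrite ?morV !bent_gen /bent_tup /tup /= !entr;
  by split; ring.
Qed.

Lemma v_neq0 p : 0 < vx p ^+ 2 + vy p ^+ 2.
Proof.
rewrite lt_neqAle addr_ge0 ?sqr_ge0 // andbT eq_sym; apply/negP => /eqP h.
have x0 : vx p = 0 by have := sqr_ge0 (vx p); have := sqr_ge0 (vy p) => ? ?; apply/eqP; rewrite -sqrf_eq0; apply/eqP; lra.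
have y0 : vy p = 0 by have := sqr_ge0 (vx p); have := sqr_ge0 (vy p) => ? ?; apply/eqP; rewrite -sqrf_eq0; apply/eqP; lra.
by have := detE (bent 0 p); rewrite -/(vx p) -/(vy p) x0 y0 mulr0 mul0r subrr => /eqP; rewrite eq_sym oner_eq0.
Qed.

Lemma ping_pong o p : red o p ->
  if o is Some l then reg l (vx p) (vy p) \/ ends l (vx p) (vy p) p else p = 1%g.
Proof.
elim=> {o p} // o l p _ ih no; have n0 := v_neq0 p.
have [-> ->] := v_step l p; move: ih.
have [hx hy] : vx 1%g = 1 /\ vy 1%g = 0.
  by rewrite /vx /vy mor1; case: (oneE R).
case: o no => [k|] no; last first.
  move=> ->; rewrite hx hy mulg1; case: l {no} => /=.
  - by right; left; split; [lra|rewrite -[X in tail _ X]mulg1; exact/tail1/zpow1].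
  - by left; split; nra.
  - by right; right; split; [lra|rewrite -[X in tail _ X]mulg1; exact/tail1/zpow1].
  - by left; split; nra.
move: (vx p) (vy p) n0 => x y n0 {hx hy}.
have h1 := sqr_ge0 (x - y); have h2 := sqr_ge0 (x + y); have h3 := sqr_ge0 x; have h4 := sqr_ge0 y.
case=> [hreg|].
  by left; case: k hreg no => /= -[r1 r2]; case: l => //= _; split; nra.
case: k no => /= no [[e t]|[e t]]; case: l no => //= no; try (by left; subst; split; nra).
- by right; left; split; [lra|exact: tail_mul].
- by right; right; split; [lra|rewrite -mulgA; exact: tail_mul].
- right; left; split; [lra|apply: tail_z].
  have -> : z = (a1 * (b1 * gB * gA))%g by rewrite /gcomm !mulgA.
  exact: tail_mul.
- by right; right; split; [lra|exact: tail1].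
- by right; left; split; [lra|rewrite -mulgA; exact: tail_mul].
- by right; right; split; [lra|exact: tail_mul].
- by right; left; split; [lra|exact: tail1].
right; right; split; [lra|apply: tail_zV].
have -> : (z^-1 = b1 * (a1 * gA * gB))%g by rewrite /gcomm !gnorm.
exact: tail_mul.
Qed.

(** A vanishing lower left entry puts the image of (1, 0) on the line y = 0, where ping-pong leaves
    only powers of z. *)
Lemma cusp_first_side x : in_side true x -> ec (bent 0 x) = 0 -> zpow x.
Proof.
move=> /side_red[o /ping_pong h] e; have n0 := v_neq0 x.
have y0 : vy x = 0 by [].
case: o h => [l|->]; last exact: zpow1.
rewrite y0 in n0 *; move: (vx x) n0 => u n0.
case=> [|h]; first by case: l => /=; rewrite mulr0 ltxx => -[].
have u0 : u <> 0 by move=> e0; rewrite e0 in n0; lra.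
by case: l h => /= -[[h ?]|[h ?]] //; case: u0; lra.
Qed.

Lemma flip_ex : exists f : {multiplicative Gamma2 -> Gamma2},
  forall i, f (gamma_gen i) = tup b2 a2 b1 a1 i.
Proof.
apply: gamma_ext_ex; rewrite /surface_relation /tup /=.
have := gamma_relation; rewrite /surface_relation => h.
have -> : (gcomm b2 a2 * gcomm b1 a1 = (gcomm a1 b1 * gcomm a2 b2)^-1)%g by rewrite /gcomm !gnorm.
by rewrite h invg1.
Qed.

Lemma cusp b x : in_side b x -> ec (bent 0 x) = 0 -> zpow x.
Proof.
case: b => hx; first exact: cusp_first_side.
(* This exchange of the handles fixes z and preserves [bent 0], so it carries the result from the
   first side to the second. *)
have [f hf] := flip_ex.
have ff y : f (f y) = y.
  have := @multiplicative_ext _ (f \o f) idfun; apply => i /=.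
  by rewrite hf; move: i; apply: ord4P; rewrite /tup /= hf.
have bf : bent 0 (f x) = bent 0 x.
  have := @multiplicative_ext _ (bent 0 \o f) (bent 0); apply => i /=.
  by rewrite hf; move: i; apply: ord4P; rewrite /tup /= !bent_gen /bent_tup matU0 /tup /= ?mul1g ?invg1 ?mulg1.
have fz : f z = z.
  have -> : f z = (gcomm a2 b2)^-1%g by rewrite mor_comm !hf /tup /= /gcomm !gnorm.
  have := gamma_relation; rewrite /surface_relation; move: z (gcomm a2 b2) => u y e.
  by rewrite -[RHS]mulg1 -(mulgV y) mulgA e mul1g.
have fside : in_side true (f x).
  case: hx => w <-; rewrite -weval_gen; elim: w => [|l w ih] /=.
    by rewrite mor1 => _; exact: in_side1.
  case/andP => hl /ih h; rewrite morM; apply: in_sideM => //.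
  suff gen (i : 'I_4) : (i < 2)%N == false -> in_side true (f (gamma_gen i)).
    by case: l hl => i []; rewrite /leval /first_side /= => /gen // g; rewrite morV; exact: in_sideV.
  move: i; apply: ord4P => // _; rewrite hf /tup /=.
    exact: (in_side_gen (ib1, true)).
  exact: (in_side_gen (ia1, true)).
move=> h; have : zpow (f x) by apply: cusp_first_side => //; rewrite bf.
suff zf u : zpow u -> zpow (f u) by move/zf; rewrite ff.
elim=> [|v _ ih|v _ ih]; first by rewrite mor1; exact: zpow1.
  by rewrite (morM f z v) fz; exact: zpowz.
by rewrite (morM f z^-1%g v) (morV f z) fz; exact: zpowzV.
Qed.

(** [a] is the coefficient of degree n and may vanish, so that sums and products are handled
    uniformly. *)
Definition dg (n : nat) (f : R -> R) (a : R) :=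
  exists p : {poly R}, [/\ forall t, f t = p.[t], (size p <= n.+1)%N & p`_n = a].

Lemma dg_add n f g a b : dg n f a -> dg n g b -> dg n (fun t => f t + g t) (a + b).
Proof.
move=> [p [hp sp <-]] [q [hq sq <-]]; exists (p + q); split.
- by move=> t; rewrite hornerD hp hq.
- by apply: leq_trans (size_polyD _ _) _; rewrite geq_max sp sq.
- by rewrite coefD.
Qed.

Lemma dg_mul n m f g a b : dg n f a -> dg m g b -> dg (m + n) (fun t => f t * g t) (a * b).
Proof.
move=> [p [hp sp <-]] [q [hq sq <-]]; exists (p * q); split.
- by move=> t; rewrite hornerM hp hq.
- apply: leq_trans (size_polyMleq p q) _.
  by move: sp sq; move: (size p) (size q) => u v; lia.
- rewrite coefM (bigD1 (inord n : 'I_(m + n).+1)) //= inordK; last by lia.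
  rewrite addnK big1 ?addr0 // => i hi.
  have ne : (i : nat) != n by apply: contra hi => /eqP e; apply/eqP/val_inj; rewrite /= inordK //; lia.
  have [lt|le] := ltnP n i; first by rewrite (nth_default 0) ?mul0r //; apply: leq_trans sp _.
  rewrite [q`__](nth_default 0) ?mulr0 //; apply: leq_trans sq _; have := ltn_ord i; lia.
Qed.

Lemma dg_cst c : dg 0 (fun=> c) c.
Proof. by exists c%:P; split; [move=> t; rewrite hornerC|exact: size_polyC_leq1|rewrite coefC]. Qed.

Lemma dg_weak n f a : dg n f a -> dg n.+1 f 0.
Proof.
move=> [p [hp sp _]]; exists p; split => //; first exact: leqW.
by rewrite nth_default.
Qed.

Lemma dg_lin c d : dg 1 (fun t => c + d * t) d.
Proof.
exists (c%:P + d *: 'X); split.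
- by move=> t; rewrite hornerD hornerC hornerZ hornerX.
- apply: leq_trans (size_polyD _ _) _; rewrite geq_max.
  rewrite (leq_trans (size_polyC_leq1 _)) //= (leq_trans (size_scale_leq _ _)) //.
  by rewrite size_polyX.
- by rewrite coefD coefC coefZ coefX /= add0r mulr1.
Qed.

Lemma dg_ext n f g a : dg n f a -> (forall t, f t = g t) -> dg n g a.
Proof. by move=> [p [hp ? ?]] e; exists p; split => // t; rewrite -e. Qed.

Lemma dg_periodic n f a c : dg n.+1 f a -> c <> 0 -> (forall t, f t = f (t + c)) -> a = 0.
Proof.
move=> [p [hp sp <-]] c0 per; pose q := p - (f 0)%:P.
have per' (k : nat) : f (k%:R * c) = f 0.
  elim: k => [|k <-]; first by rewrite mul0r.
  by rewrite [RHS]per -natr1 mulrDl mul1r.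
suff q0 : q = 0.
  have -> : p = (f 0)%:P by apply/eqP; rewrite -subr_eq0 -/q q0.
  by rewrite coefC.
apply/eqP; apply: contraT => nq.
have := @max_poly_roots R q [seq k%:R * c | k <- iota 0 (size q)] nq.
rewrite size_map size_iota ltnn; apply.
  apply/allP => x /mapP[k _ ->]; rewrite /root /q hornerD hornerN hornerC -hp per' subrr.
  by [].
rewrite map_inj_uniq ?iota_uniq // => i j /mulIf e; apply/eqP; rewrite -(eqr_nat R); apply/eqP/e.
exact/eqP.
Qed.

Definition twistb (b : bool) t := ((bend b t)^-1 * bend (~~ b) t)%g.
Definition sgn (b : bool) : R := if b then 1 else -1.
Lemma twistbE b t : twistb b t = matU (sgn b * t).
Proof.
rewrite /twistb /bend /sgn; case: b => /=; first by rewrite invg1 mul1g mul1r.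
by rewrite mulg1 matUV mulN1r.
Qed.

Fixpoint bent_prod (b : bool) (l : seq Gamma2) t : SL2 :=
  if l is x :: l' then (bent 0 x * twistb b t * bent_prod (~~ b) l' t)%g else 1%g.

Local Notation alt := (alt in_side zpow).

Lemma bent_prodE b l t : alt b l ->
  bent t (prodg l) = (bend b t * bent_prod b l t * (bend (b (+) odd (size l)) t)^-1)%g.
Proof.
elim: l b => [|x l ih] b /=; first by rewrite mor1 addbF mulg1 mulgV.
move=> [hx _ /ih e]; rewrite morM e (@bent_side b x t hx) addbN -addNb /twistb.
by rewrite !gnorm.
Qed.

(** In the factor of a syllable x the part linear in t is supported on the second column, where it
    is, up to sign, the first column of [bent 0 x]. The top coefficient of the lower right entry is
    therefore, up to sign, the product of the lower left entries of all syllables, nonzero by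
    [cusp]. *)
Lemma bent_prod_degree b x l : alt b (x :: l) -> let n := (size l).+1 in
  exists p q r s, s <> 0 /\ [/\ dg n (fun t => ea (bent_prod b (x :: l) t)) 0,
   dg n (fun t => ec (bent_prod b (x :: l) t)) 0, dg n (fun t => eb (bent_prod b (x :: l) t)) (p + q + r) &
   dg n (fun t => ed (bent_prod b (x :: l) t)) s].
Proof.
elim: l b x => [|y l ih] b x [hx nx hl] /=.
  have c0 : ec (bent 0 x) <> 0 by move=> /(cusp hx).
  exists (ea (bent 0 x) * sgn b), 0, 0, (ec (bent 0 x) * sgn b); split.
    by rewrite /sgn; case: (b); rewrite ?mulr1 ?mulrN1 // => /eqP; rewrite oppr_eq0 => /eqP.
  have [o1 o2 o3 o4] := oneE R; split.
  - by apply: dg_ext (dg_weak (dg_cst (ea (bent 0 x)))) _ => t; rewrite twistbE /matU !entr ?o1 ?o2 ?o3 ?o4; ring.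
  - by apply: dg_ext (dg_weak (dg_cst (ec (bent 0 x)))) _ => t; rewrite twistbE /matU !entr ?o1 ?o2 ?o3 ?o4; ring.
  - rewrite !addr0.
    by apply: dg_ext (dg_lin (eb (bent 0 x)) _) _ => t; rewrite twistbE /matU !entr ?o1 ?o2 ?o3 ?o4; ring.
  - by apply: dg_ext (dg_lin (ed (bent 0 x)) _) _ => t; rewrite twistbE /matU !entr ?o1 ?o2 ?o3 ?o4; ring.
have [p [q [r [s [s0 [d1 d2 d3 d4]]]]]] := ih (~~ b) y hl.
have c0 : ec (bent 0 x) <> 0 by move=> /(cusp hx).
have L1 := dg_lin (eb (bent 0 x)) (ea (bent 0 x) * sgn b).
have L2 := dg_lin (ed (bent 0 x)) (ec (bent 0 x) * sgn b).
have C1 := dg_cst (ea (bent 0 x)); have C2 := dg_cst (ec (bent 0 x)).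
have e1 k f a c : dg k f a -> dg k.+1 (fun t => c * f t) 0.
  by move=> h; have := dg_weak (dg_mul (dg_cst c) h); rewrite addn0.
have e2 k f g a c : dg 1 g c -> dg k f a -> dg k.+1 (fun t => g t * f t) (c * a).
  by move=> hg hf; have := dg_mul hg hf; rewrite addn1.
have N := (size l).+2.
exists 0, (ea (bent 0 x) * sgn b * s), 0, (ec (bent 0 x) * sgn b * s); split.
  move/eqP; rewrite !mulf_eq0 => /orP[/orP[]|] /eqP //.
  by rewrite /sgn; case: (b) => /eqP; rewrite ?oppr_eq0 oner_eq0.
split.
- have := dg_add (e1 _ _ _ (ea (bent 0 x)) d1) (e2 _ _ _ _ _ L1 d2); rewrite mulr0 addr0.
  by move/dg_ext; apply => t; rewrite twistbE /matU !entr /=; ring.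
- have := dg_add (e1 _ _ _ (ec (bent 0 x)) d1) (e2 _ _ _ _ _ L2 d2); rewrite mulr0 addr0.
  by move/dg_ext; apply => t; rewrite twistbE /matU !entr /=; ring.
- rewrite add0r addr0; have := dg_add (e1 _ _ _ (ea (bent 0 x)) d3) (e2 _ _ _ _ _ L1 d4); rewrite add0r.
  by move/dg_ext; apply => t; rewrite twistbE /matU !entr /=; ring.
have := dg_add (e1 _ _ _ (ec (bent 0 x)) d3) (e2 _ _ _ _ _ L2 d4); rewrite add0r.
by move/dg_ext; apply => t; rewrite twistbE /matU !entr /=; ring.
Qed.

Definition bend_periodic (c : R) (x : Gamma2) := forall t, tr2 (bent t x) = tr2 (bent (t + c) x).

(** For an even word the two outer bending matrices are inverse to each other, so the trace is that
    of [bent_prod]: a polynomial of positive degree with nonzero leading coefficient, which cannot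
    be periodic. *)
Lemma alt_not_periodic c b l : c <> 0 -> l <> [::] -> ~~ odd (size l) -> alt b l ->
  ~ bend_periodic c (prodg l).
Proof.
move=> c0; case: l => // x l _ el hl per.
have [p [q [r [s [s0 [d1 _ _ d4]]]]]] := bent_prod_degree hl.
apply: s0; apply: (dg_periodic (c := c) (f := fun t => tr2 (bent t (prodg (x :: l)))) (n := size l)) => //.
have := dg_add d1 d4; rewrite add0r => /dg_ext; apply => t.
by rewrite (bent_prodE _ hl) (negPf el) addbF tr2_conj tr2E.
Qed.
End Bending.

End BentRepresentations.
Import BentRepresentations.

(** * Image of the separating curve under a central automorphism *)

Module CentralAutomorphisms.
Local Open Scope ring_scope.

Local Notation z := (gcomm a1 b1).

Lemma zpowP x : zpow x -> exists n : nat, x = (z ^+ n)%g \/ x = ((z ^+ n)^-1)%g.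
Proof.
elim=> [|u _ [n [->|->]]|u _ [n [->|->]]].
- by exists 0%N; left.
- by exists n.+1; left; rewrite expgS.
- case: n => [|n]; first by exists 1%N; left; rewrite expg0 invg1 mulg1 expg1.
  by exists n; right; rewrite expgSr; move: (z ^+ n)%g z => p q; rewrite !gnorm.
- case: n => [|n]; first by exists 1%N; right; rewrite expg0 mulg1 expg1.
  by exists n; left; rewrite expgS mulgA mulVg mul1g.
by exists n.+1; right; rewrite expgSr; move: (z ^+ n)%g z => p q; rewrite !gnorm.
Qed.

(** The integral Heisenberg group. The third coordinate of a commutator is the determinant of the
    two abelianised elements, so the exponent of z, invisible in homology, can be read there. *)
Record heis := Heis { hx : int; hy : int; hz : int }.
HB.instance Definition _ := gen_eqMixin heis.
HB.instance Definition _ := gen_choiceMixin heis.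
Definition heis_mul g h := Heis (hx g + hx h) (hy g + hy h) (hz g + hz h + hx g * hy h).
Definition heis_inv g := Heis (- hx g) (- hy g) (- hz g + hx g * hy g).
Definition heis_one := Heis 0 0 0.
Lemma heis_mulA : associative heis_mul.
Proof. by move=> [a b c] [a' b' c'] [a'' b'' c'']; rewrite /heis_mul /=; congr Heis; ring. Qed.
Lemma heis_mul1 : left_id heis_one heis_mul.
Proof. by move=> [a b c]; rewrite /heis_mul /=; congr Heis; ring. Qed.
Lemma heis_mulr1 : right_id heis_one heis_mul.
Proof. by move=> [a b c]; rewrite /heis_mul /=; congr Heis; ring. Qed.
Lemma heis_mulV : left_inverse heis_one heis_inv heis_mul.
Proof. by move=> [a b c]; rewrite /heis_mul /=; congr Heis; rewrite /=; ring. Qed.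
Lemma heis_mulrV : right_inverse heis_one heis_inv heis_mul.
Proof. by move=> [a b c]; rewrite /heis_mul /=; congr Heis; rewrite /=; ring. Qed.
HB.instance Definition _ := isGroup.Build heis heis_mulA heis_mul1 heis_mulr1 heis_mulV heis_mulrV.

Lemma heisM (g h : heis) : (g * h)%g = Heis (hx g + hx h) (hy g + hy h) (hz g + hz h + hx g * hy h).
Proof. by []. Qed.
Lemma heisV (g : heis) : (g^-1)%g = Heis (- hx g) (- hy g) (- hz g + hx g * hy g).
Proof. by []. Qed.
Lemma heis_comm (g h : heis) : gcomm g h = Heis 0 0 (hx g * hy h - hx h * hy g).
Proof. by rewrite /gcomm !heisM !heisV /=; congr Heis; ring. Qed.

Lemma exponent_ex (i : 'I_4) : exists f : {multiplicative Gamma2 -> heis},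
  forall j, f (gamma_gen j) = Heis (i == j)%:Z 0 0.
Proof.
apply: gamma_ext_ex; rewrite /surface_relation !heis_comm heisM /=.
by congr Heis; ring.
Qed.
Definition exponent i := projT1 (cid (exponent_ex i)).
Lemma exponentE i j : exponent i (gamma_gen j) = Heis (i == j)%:Z 0 0.
Proof. exact: (projT2 (cid (exponent_ex i))). Qed.
Definition expo i x := hx (exponent i x).
Lemma expoM i x y : expo i (x * y)%g = expo i x + expo i y.
Proof. by rewrite /expo morM. Qed.
Lemma expoV i x : expo i x^-1%g = - expo i x.
Proof. by rewrite /expo morV. Qed.
Lemma expo_conj i g x : expo i (g * x * g^-1)%g = expo i x.
Proof. by rewrite !expoM expoV; ring. Qed.
Lemma expo_gen i j : expo i (gamma_gen j) = (i == j)%:Z.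
Proof. by rewrite /expo exponentE. Qed.

Section Centre.
Variable R : realType.
Variable f : {multiplicative Gamma2 -> Gamma2}.
Hypothesis central : forall h : {multiplicative Gamma2 -> Gamma2}, aut_plus h ->
  exists g, forall x, f (h x) = (g * h (f x) * g^-1)%g.

Definition commutes (h : Gamma2 -> Gamma2) := exists g, forall x, f (h x) = (g * h (f x) * g^-1)%g.

Lemma commutes_comp (h k : {multiplicative Gamma2 -> Gamma2}) : commutes h -> commutes k -> commutes (h \o k).
Proof.
move=> [g hg] [g' hg']; exists (g * h g')%g => x /=.
by rewrite hg hg' !morM morV invgM !mulgA.
Qed.

Lemma commutes_inv (h k : {multiplicative Gamma2 -> Gamma2}) : cancel h k -> cancel k h ->
  commutes h -> commutes k.
Proof.
move=> hk kh [g hg]; exists (k g)^-1%g => x.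
have := hg (k x); rewrite kh => ->.
by rewrite !morM morV hk invgK !gnorm.
Qed.

Lemma auto_pair (s s' : 'I_4 -> Gamma2) : surface_relation s -> surface_relation s' ->
  (forall g : {multiplicative Gamma2 -> Gamma2}, (forall i, g (gamma_gen i) = s' i) ->
    forall i, g (s i) = gamma_gen i) ->
  (forall g : {multiplicative Gamma2 -> Gamma2}, (forall i, g (gamma_gen i) = s i) ->
    forall i, g (s' i) = gamma_gen i) ->
  homologous (surface_chain (s ia1) (s ib1) (s ia2) (s ib2)) (surface_chain a1 b1 a2 b2) ->
  exists t t' : {multiplicative Gamma2 -> Gamma2},
    [/\ forall i, t (gamma_gen i) = s i, forall i, t' (gamma_gen i) = s' i, commutes t & commutes t'].
Proof.
move=> hs hs' h h' hom; have [t ht] := gamma_ext_ex hs; have [t' ht'] := gamma_ext_ex hs'.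
have c1 : cancel t t'.
  by move=> x; apply: (multiplicative_ext (f := t' \o t) (g := idfun)) => i /=; rewrite ht h.
have c2 : cancel t' t.
  by move=> x; apply: (multiplicative_ext (f := t \o t') (g := idfun)) => i /=; rewrite ht' h'.
have ct : commutes t.
  by apply: central; apply: aut_plusP; [exists t'|rewrite !ht].
by exists t, t'; split => //; exact: commutes_inv ct.
Qed.

Let rel : (gcomm a1 b1 * gcomm a2 b2 = 1)%g := gamma_relation.

Lemma twist_a : exists t t' : {multiplicative Gamma2 -> Gamma2},
  [/\ forall i, t (gamma_gen i) = tup a1 (b1 * a1)%g a2 b2 i,
      forall i, t' (gamma_gen i) = tup a1 (b1 * a1^-1)%g a2 b2 i, commutes t & commutes t'].
Proof.
apply: auto_pair; rewrite /surface_relation /tup /= ?gcomm_Ta ?gcomm_TaV //.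
- by move=> g hg; apply: ord4P; rewrite /= ?morM !hg //= -mulgA mulVg mulg1.
- by move=> g hg; apply: ord4P; rewrite /= ?morM ?morV !hg //= -mulgA mulgV mulg1.
exact: surface_chain_Ta.
Qed.

Lemma twist_b : exists t t' : {multiplicative Gamma2 -> Gamma2},
  [/\ forall i, t (gamma_gen i) = tup (a1 * b1)%g b1 a2 b2 i,
      forall i, t' (gamma_gen i) = tup (a1 * b1^-1)%g b1 a2 b2 i, commutes t & commutes t'].
Proof.
apply: auto_pair; rewrite /surface_relation /tup /= ?gcomm_Tb ?gcomm_TbV //.
- by move=> g hg; apply: ord4P; rewrite /= ?morM !hg //= -mulgA mulVg mulg1.
- by move=> g hg; apply: ord4P; rewrite /= ?morM ?morV !hg //= -mulgA mulgV mulg1.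
exact: surface_chain_Tb.
Qed.

Let rel' : (gcomm a2 b2 * gcomm a1 b1 = 1)%g.
Proof.
move: rel; move: (gcomm a1 b1) (gcomm a2 b2) => x y e.
by rewrite -[y]mul1g -(mulVg x) -(mulgA x^-1%g) e mulg1 mulVg.
Qed.

Lemma swap_handles : exists t : {multiplicative Gamma2 -> Gamma2},
  (forall i, t (gamma_gen i) = tup a2 b2 a1 b1 i) /\ commutes t.
Proof.
suff [t [_ [h _ h' _]]] : exists t t' : {multiplicative Gamma2 -> Gamma2},
  [/\ forall i, t (gamma_gen i) = tup a2 b2 a1 b1 i,
      forall i, t' (gamma_gen i) = tup a2 b2 a1 b1 i, commutes t & commutes t'] by exists t.
apply: auto_pair; rewrite /surface_relation /tup /= ?rel' //.
- by move=> g hg; apply: ord4P; rewrite /= !hg.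
- by move=> g hg; apply: ord4P; rewrite /= !hg.
exact: surface_chain_swap.
Qed.

(** The composite [e] of two twists acts with order six on the homology of the handle; its sixth
    power is the Dehn twist along z, that is, conjugation of the first handle by z. *)
Lemma boundary_twist : exists t : {multiplicative Gamma2 -> Gamma2},
  (forall i, t (gamma_gen i) = tup (z * a1 * z^-1)%g (z * b1 * z^-1)%g a2 b2 i) /\ commutes t.
Proof.
have [_ [ta [_ ha _ ca]]] := twist_a; have [tb [_ [hb _ cb _]]] := twist_b.
have [e [[h1 h2 h3 h4] ce]] : exists e : {multiplicative Gamma2 -> Gamma2},
    [/\ e a1 = (a1 * b1)%g, e b1 = a1^-1%g, e a2 = a2 & e b2 = b2] /\ commutes e.
  exists (tb \o ta); split; last exact: commutes_comp.
  by rewrite /= !ha /tup /= morM morV !hb /tup /= !gnorm.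
have [e3 [[k1 k2 k3 k4] c3]] : exists e3 : {multiplicative Gamma2 -> Gamma2},
    [/\ e3 a1 = (a1 * b1 * a1^-1 * b1^-1 * a1^-1)%g, e3 b1 = (a1 * b1^-1 * a1^-1)%g, e3 a2 = a2 & e3 b2 = b2]
    /\ commutes e3.
  exists (e \o (e \o e)); split; last by apply: commutes_comp => //; exact: commutes_comp.
  by rewrite /= !(h1, h2, h3, h4, morM, morV) !gnorm.
exists (e3 \o e3); split; last exact: commutes_comp.
by apply: ord4P; rewrite /tup /= /gcomm !(k1, k2, k3, k4, morM, morV) ?gnorm.
Qed.

(** [bent] sends z to a central element times [matU c], hence composing [bent s] with the twist
    along z is, up to conjugation, a translation of s by -c. The twist fixes z and commutes with f
    up to an inner automorphism, so the trace of f z is periodic in s. *)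
Lemma image_periodic : exists2 c : R, c <> 0 & bend_periodic c (f z).
Proof.
have [c c0 [e [ce hc]]] := comm_AB R.
exists (- c); first by move=> /eqP; rewrite oppr_eq0 => /eqP.
have [t [ht [g hg]]] := boundary_twist.
have tz : t z = z by rewrite mor_comm !ht /tup /= /gcomm !gnorm.
have fz : f z = (g * t (f z) * g^-1)%g by rewrite -hg tz.
have bz (s : R) : bent s z = (e * matU c)%g by rewrite mor_comm !bent_gen -hc.
have key (s : R) y : bent s (t y) = ((e * matU c) * bent (s - c) y * (e * matU c)^-1)%g.
  pose M := (e * matU c)%g.
  rewrite -(cls_repr y) -weval_gen; elim: (repr y) => [|l w ih] /=; first by rewrite !mor1 mulg1 mulgV.
  rewrite !morM ih.
  have gen i : bent s (t (gamma_gen i)) = (M * bent (s - c) (gamma_gen i) * M^-1)%g.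
    have cU u X : (M * (matU u * X * (matU u)^-1) * M^-1 = matU (c + u) * X * (matU (c + u))^-1)%g.
      rewrite -matUD /M -!mulgA !invgM !mulgA.
      have -> : (e * matU c * matU u * X / matU u / matU c / e = e * (matU c * matU u * X / matU u / matU c) / e)%g by rewrite !mulgA.
      have ee A : (e * A * e^-1 = A)%g by rewrite ce -mulgA mulgV mulg1.
      by rewrite ee ?invgM ?mulgA.
    rewrite ht; move: i; apply: ord4P; rewrite /tup /= ?morM ?morV ?bz ?bent_gen /bent_tup /tup /= //.
    + by rewrite /M -hc /gcomm !gnorm.
    + by rewrite /M -hc /gcomm !gnorm.
    + by rewrite cU addrC subrK.
    + by rewrite cU addrC subrK.
  have -> : bent s (t (leval gamma_gen l)) = (M * bent (s - c) (leval gamma_gen l) * M^-1)%g.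
    by case: l => i []; rewrite /leval /=; [exact: gen|rewrite !morV gen; move: (M) => M'; rewrite !gnorm].
  by rewrite -/M !gnorm.
by move: (f z) fz => y fz s; rewrite {1}fz !morM !morV tr2_conj key tr2_conj.
Qed.

(** Periodicity puts a conjugate p of f z into one side. The exchange t of the handles sends z to
    z^-1, which makes p^-1 conjugate to t p, an element of the other side; [malnormal] then leads to
    a power of z. *)
Lemma image_boundary : exists g x, zpow x /\ f z = (g * x * g^-1)%g.
Proof.
have [c c0 per] := image_periodic.
have Kconj g x : bend_periodic c x -> bend_periodic c (g * x * g^-1)%g.
  by move=> h t; rewrite !morM !morV !tr2_conj.
have K1 : bend_periodic c 1%g by move=> t; rewrite !mor1.
have Kalt b l (n0 : l <> [::]) el hl := @alt_not_periodic R c b l c0 n0 el hl.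
have [g [b hb]] := elliptic_conj in_sideM zpowM zpowV zpow_side zpow1 gamma_side_ind Kconj Kalt per.
have [t [ht [k hk]]] := swap_handles.
have tz : t z = z^-1%g.
  rewrite mor_comm !ht /tup /=; move: rel; move: (gcomm a1 b1) (gcomm a2 b2) => x y e.
  by rewrite -[y]mul1g -(mulVg x) -(mulgA x^-1%g) e mulg1.
have side c' x : in_side c' x -> in_side (~~ c') (t x).
  case=> w <-; rewrite -weval_gen; elim: w => [|l w ih] /=.
    by rewrite mor1 => _; exact: in_side1.
  case/andP => hl /ih h; rewrite morM; apply: in_sideM => //.
  suff gen (i : 'I_4) : in_side (~~ (i < 2)%N) (t (gamma_gen i)).
    rewrite -(eqP hl) /first_side; case: l {hl} => i [] /=; rewrite /leval /= ?morV; first exact: gen.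
    by apply: in_sideV; exact: gen.
  rewrite ht; move: i; apply: ord4P; rewrite /tup /=.
  - exact: (in_side_gen (ia2, true)).
  - exact: (in_side_gen (ib2, true)).
  - exact: (in_side_gen (ia1, true)).
  - exact: (in_side_gen (ib1, true)).
pose p := (g * f z * g^-1)%g; have ht' := side _ _ hb.
have rp : (p^-1 = (g * k * (t g)^-1) * t p * (g * k * (t g)^-1)^-1)%g.
  have := hk z; rewrite tz [f z^-1%g]morV /p; move: (f z) => y e.
  by rewrite !morM morV !invgM invgK e !gnorm.
have mal := malnormal in_sideM in_sideV zpowM zpowV zpow_side zpow1 gamma_side_ind K1 Kalt.
have fin x : zpow x -> (exists h, p^-1 = h * x * h^-1)%g -> exists g x, zpow x /\ f z = (g * x * g^-1)%g.
  move=> zx [h e]; exists (g^-1 * h)%g, x^-1%g; split; first exact: zpowV.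
  have -> : f z = (g^-1 * (p^-1)^-1 * g)%g by rewrite invgK /p; move: (f z) => y; rewrite !gnorm.
  by rewrite e !gnorm.
case: b hb ht' => hb ht'.
  have [h hh] := mal _ _ _ (in_sideV hb) ht' rp.
  by apply: fin hh _; exists h^-1%g; rewrite -/p !gnorm.
have rp' : t p = ((g * k * (t g)^-1)^-1 * p^-1 * ((g * k * (t g)^-1)^-1)^-1)%g.
  by rewrite rp !gnorm.
have [h hh] := mal _ _ _ ht' (in_sideV hb) rp'.
apply: fin hh _; exists (g * k * (t g)^-1 * h^-1)%g; rewrite rp.
by move: (g * k * (t g)^-1)%g (t p) => u v; rewrite !gnorm.
Qed.

(** The second handle is sent to the same two generators in the opposite order, so that the two
    commutators cancel. *)
Lemma heis_ex : exists f : {multiplicative Gamma2 -> heis},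
  forall i, f (gamma_gen i) = tup (Heis 1 0 0) (Heis 0 1 0) (Heis 0 1 0) (Heis 1 0 0) i.
Proof.
by apply: gamma_ext_ex; rewrite /surface_relation /tup /= !heis_comm heisM /=; congr Heis; ring.
Qed.

Lemma image_boundary_power : exists g (n : nat), f z = (g * z ^+ n * g^-1)%g.
Proof.
have [g [x [zx e]]] := image_boundary; have [chi hchi] := heis_ex.
have hxE y : hx (chi y) = expo ia1 y + expo ib2 y /\ hy (chi y) = expo ib1 y + expo ia2 y.
  rewrite -(cls_repr y) -weval_gen; elim: (repr y) => [|l w [ih1 ih2]] /=.
    by rewrite mor1 /expo !mor1.
  rewrite morM !expoM heisM /= ih1 ih2.
  have gen i : hx (chi (gamma_gen i)) = expo ia1 (gamma_gen i) + expo ib2 (gamma_gen i) /\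
     hy (chi (gamma_gen i)) = expo ib1 (gamma_gen i) + expo ia2 (gamma_gen i).
    by rewrite hchi !expo_gen; move: i; apply: ord4P.
  have [g1 g2] := gen l.1.
  case: l g1 g2 => i [] /= g1 g2; rewrite /leval /= ?morV ?heisV ?expoV /= g1 g2; split; ring.
have [ta [_ [ha _ [ga hga] _]]] := twist_a; have [tb [_ [hb _ [gb hgb] _]]] := twist_b.
have Ea i y : expo i (ta y) = expo i y + (if i == ia1 then expo ib1 y else 0).
  rewrite -(cls_repr y) -weval_gen; elim: (repr y) => [|l w ih] /=.
    by rewrite mor1 /expo !mor1; case: ifP.
  rewrite morM !expoM ih.
  have gen j : expo i (ta (gamma_gen j)) = expo i (gamma_gen j) + (if i == ia1 then expo ib1 (gamma_gen j) else 0).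
    by rewrite ha; move: i j {ih}; do 2![apply: ord4P]; rewrite /tup /= ?expoM !expo_gen.
  have -> : expo i (ta (leval gamma_gen l)) = expo i (leval gamma_gen l) +
      (if i == ia1 then expo ib1 (leval gamma_gen l) else 0).
    by case: l => j []; rewrite /leval /= ?morV ?expoV gen //; case: ifP => _; ring.
  by case: ifP => _; ring.
have Eb i y : expo i (tb y) = expo i y + (if i == ib1 then expo ia1 y else 0).
  rewrite -(cls_repr y) -weval_gen; elim: (repr y) => [|l w ih] /=.
    by rewrite mor1 /expo !mor1; case: ifP.
  rewrite morM !expoM ih.
  have gen j : expo i (tb (gamma_gen j)) = expo i (gamma_gen j) + (if i == ib1 then expo ia1 (gamma_gen j) else 0).
    by rewrite hb; move: i j {ih}; do 2![apply: ord4P]; rewrite /tup /= ?expoM !expo_gen.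
  have -> : expo i (tb (leval gamma_gen l)) = expo i (leval gamma_gen l) +
      (if i == ib1 then expo ia1 (leval gamma_gen l) else 0).
    by case: l => j []; rewrite /leval /= ?morV ?expoV gen //; case: ifP => _; ring.
  by case: ifP => _; ring.
(* The twist sends b_1 to b_1 a_1. Comparing exponents on both sides shows that f a_1 has only an
   a_1 component, equal to the b_1 component of f b_1. *)
have A i : expo i (f b1) + expo i (f a1) = expo i (f b1) + (if i == ia1 then expo ib1 (f b1) else 0).
  by have := congr1 (expo i) (hga b1); rewrite expo_conj Ea ha /tup /= morM expoM.
have B i : expo i (f a1) + expo i (f b1) = expo i (f a1) + (if i == ib1 then expo ia1 (f a1) else 0).
  by have := congr1 (expo i) (hgb a1); rewrite expo_conj Eb hb /tup /= morM expoM.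
have := A ia1; have := A ib1; have := A ia2; have := A ib2.
have := B ia1; have := B ib1; have := B ia2; have := B ib2.
rewrite /= => B4 B3 B2 B1 A4 A3 A2 A1.
have hf : chi (f z) = Heis 0 0 (expo ia1 (f a1) * expo ia1 (f a1)).
  rewrite mor_comm mor_comm heis_comm.
  have [-> ->] := hxE (f a1); have [-> ->] := hxE (f b1); congr Heis.
  have -> : expo ib1 (f b1) = expo ia1 (f a1) by lia.
  have -> : expo ib2 (f a1) = 0 by lia.
  have -> : expo ia2 (f a1) = 0 by lia.
  have -> : expo ib1 (f a1) = 0 by lia.
  have -> : expo ib2 (f b1) = 0 by lia.
  have -> : expo ia1 (f b1) = 0 by lia.
  have -> : expo ia2 (f b1) = 0 by lia.
  ring.
have zn (n : nat) : chi (z ^+ n)%g = Heis 0 0 n%:Z.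
  elim: n => [|n ih]; first by rewrite expg0 mor1.
  by rewrite expgS morM ih mor_comm !hchi /tup /= heis_comm heisM /=; congr Heis; lia.
have cconj u : chi (g * x * g^-1)%g = Heis 0 0 u -> chi x = Heis 0 0 u.
  rewrite !morM morV !heisM heisV; case: (chi g) => p q r; case: (chi x) => p' q' r' /= [e1 e2 e3].
  have p0 : p' = 0 by lia.
  have q0 : q' = 0 by lia.
  by congr Heis => //; rewrite -e3 p0 q0; ring.
exists g; have [n [ex|ex]] := zpowP zx; first by exists n; rewrite e ex.
move: hf; rewrite e => /cconj; rewrite ex morV zn heisV /= => -[h].
(* Here -n is a square, hence n = 0. *)
have n0 : n = 0%N by have := sqr_ge0 (expo ia1 (f a1)); rewrite expr2; lia.
by exists 0%N; rewrite n0 !expg0 invg1.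
Qed.
End Centre.

End CentralAutomorphisms.
Import CentralAutomorphisms.

(** * Orientation-reversing isometries of the half-plane *)

Module HyperbolicIsometries.
Local Open Scope ring_scope.

Section Isometries.
Variable R : realType.
Local Notation SL2 := (SL2 R).
Local Notation C := R[i].
Local Notation H := (@Hplane R).
Local Notation rc x := (x%:C)%C.
Implicit Types (A B M : SL2) (z w : C) (x y u v : R).

Definition nsq z : R := complex.Re z ^+ 2 + complex.Im z ^+ 2.

Lemma nsqM z w : nsq (z * w) = nsq z * nsq w.
Proof. by case: z => a b; case: w => c d; rewrite /nsq /=; ring. Qed.

Lemma nsq_eq0 z : z != 0 -> nsq z != 0.
Proof.
case: z => a b; rewrite eq_complex /nsq /= => h; apply: contra h.
by rewrite paddr_eq0 ?sqr_ge0 // !sqrf_eq0.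
Qed.

Lemma nsqV z : z != 0 -> nsq z^-1 = (nsq z)^-1.
Proof.
move=> z0; apply: (mulIf (nsq_eq0 z0)); rewrite mulVf ?nsq_eq0 // -nsqM mulVf //.
by rewrite /nsq /= expr1n expr0n addr0.
Qed.

Definition den A z : C := rc (ec A) * z + rc (ed A).
Definition num A z : C := rc (ea A) * z + rc (eb A).

Lemma den_neq0 A z : H z -> den A z != 0.
Proof.
case: z => x y; rewrite /Hplane /= => y0; rewrite /den eq_complex /=.
rewrite !mul0r !subr0 !addr0; apply/negP => /andP[/eqP h1 /eqP h2].
have c0 : ec A = 0.
  by move/eqP: h2; rewrite mulf_eq0 (gt_eqF y0) orbF => /eqP.
have := detE A; rewrite c0; move: h1; rewrite c0 mul0r add0r => ->.
by rewrite !mulr0 subrr => /eqP; rewrite eq_sym oner_eq0.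
Qed.

Lemma mobE A z : moebius (psl A) z = num A z / den A z.
Proof.
rewrite /moebius /num /den /ea /eb /ec /ed; case: (repr_psl A) => -> //.
by rewrite !mxE !rmorphN /= !mulNr -!opprD invrN mulrNN.
Qed.

Lemma mob_im A z : H z -> complex.Im (moebius (psl A) z) = complex.Im z / nsq (den A z).
Proof.
move=> hz; have d0 := den_neq0 A hz; rewrite mobE.
have n0 := nsq_eq0 d0.
apply: (mulIf n0); rewrite divfK //.
have e : num A z = num A z / den A z * den A z by rewrite divfK.
have D := detE A.
move: e n0; move: (num A z / den A z) => q; case: q => p r; case: z hz d0 => x y hz d0.
rewrite /num /den /nsq /= !mul0r !subr0 !addr0 => -[e1 e2] _.
rewrite !(mul0r, subr0, addr0) in e1 e2.
rewrite -[RHS]mul1r -D.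
have -> : (ea A * ed A - eb A * ec A) * y = (ec A * x + ed A) * (ea A * y) - (ec A * y) * (ea A * x + eb A) by ring.
by rewrite e1 e2; ring.
Qed.

Lemma mob_H A z : H z -> H (moebius (psl A) z).
Proof.
move=> hz; rewrite /Hplane /= mob_im // divr_gt0 //.
rewrite lt_neqAle eq_sym nsq_eq0 ?den_neq0 //=.
by rewrite addr_ge0 ?sqr_ge0.
Qed.

Lemma mob_comp A B z : H z -> moebius (psl (A * B)%g) z = moebius (psl A) (moebius (psl B) z).
Proof.
move=> hz; have d1 := den_neq0 B hz; have d2 := den_neq0 A (mob_H B hz).
have d3 := den_neq0 (A * B)%g hz; move: d2; rewrite !mobE => d2.
have e1 : num (A * B)%g z = num A (num B z / den B z) * den B z.
  rewrite /num mulrDl -[rc (ea A) * _ * _]mulrA divfK // !entr !rmorphD !rmorphM /= /den; ring.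
have e2 : den (A * B)%g z = den A (num B z / den B z) * den B z.
  rewrite {1 2}/den mulrDl -[rc (ec A) * _ * _]mulrA divfK // !entr !rmorphD !rmorphM /= /num /den; ring.
by rewrite e1 e2 -mulf_div divff // mulr1.
Qed.

Lemma mob1 z : H z -> moebius (psl 1%g) z = z.
Proof.
move=> hz; have [o1 o2 o3 o4] := oneE R.
by rewrite mobE /num /den o1 o2 o3 o4 mul1r mul0r addr0 add0r divr1.
Qed.

(** B^-1 A acts trivially; its fixing i and 2i already makes the matrix scalar. *)
Lemma mob_faithful A B : (forall z, H z -> moebius (psl A) z = moebius (psl B) z) -> psl A = psl B.
Proof.
move=> h; move eD : (B^-1 * A)%g => D.
have hD z : H z -> moebius (psl D) z = z.
  by move=> hz; rewrite -eD mob_comp // h // -mob_comp // mulVg mob1.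
have fixE x y : 0 < y -> num D (x +i* y)%C = (x +i* y)%C * den D (x +i* y)%C.
  move=> y0; have hz : H (x +i* y)%C by [].
  by rewrite -{2}(hD _ hz) mobE divfK // den_neq0.
have := fixE 0 1 ltr01; have := fixE 0 2 (ltr0n _ 2).
rewrite /num /den => -[] /= e1 e2 [e3 e4].
have b0 : eb D = 0 by lra.
have c0 : ec D = 0 by lra.
have ad : ea D = ed D by lra.
have := detE D; rewrite b0 c0 mulr0 subr0 ad -expr2 => d1.
have psD : psl D = 1%g.
  apply/eqP/pslP; have [o1 o2 o3 o4] := oneE R.
  have : ed D = 1 \/ ed D = -1.
    have /orP[/eqP|/eqP] : (ed D == 1) || (ed D == -1); [|by left|by right].
    by rewrite -eqf_sqr expr1n d1.
  have he : -1 * -1 - 0 * 0 = 1 :> R by ring.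
  case=> d; [left|right].
    have -> : D = 1%g by apply: SL2_ext; rewrite ?o1 ?o2 ?o3 ?o4 ?ad ?b0 ?c0.
    by [].
  have -> : D = mk2 he by apply: SL2_ext; rewrite ?entr ?ad ?b0 ?c0.
  apply/matrixP => a b; rewrite !mxE.
  by case: a => [[|[|//]] ?]; case: b => [[|[|//]] ?]; rewrite //= ?oppr0.
have -> : A = (B * D)%g by rewrite -eD mulgA mulgV mul1g.
by rewrite -psl_mulE psD; exact: mulg1.
Qed.

(** This is 2 (cosh d - 1) for the hyperbolic distance d, a rational function of the coordinates. *)
Definition dl z w : R := nsq (z - w) / (complex.Im z * complex.Im w).

Lemma mob_dl A z w : H z -> H w -> dl (moebius (psl A) z) (moebius (psl A) w) = dl z w.
Proof.
move=> hz hw; have d1 := den_neq0 A hz; have d2 := den_neq0 A hw.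
rewrite /dl !mob_im // !mobE.
have -> : num A z / den A z - num A w / den A w = (z - w) / (den A z * den A w).
  apply: (mulIf (mulf_neq0 d1 d2)); rewrite divfK ?mulf_neq0 // mulrBl mulrA divfK //.
  rewrite [den A z * _]mulrC mulrA divfK //.
  have D : rc (ea A) * rc (ed A) - rc (eb A) * rc (ec A) = 1 :> C.
    by rewrite -!rmorphM -rmorphB /= detE.
  by rewrite /num /den -[RHS]mul1r -D; ring.
rewrite nsqM nsqV ?mulf_neq0 // nsqM.
have n1 := nsq_eq0 d1; have n2 := nsq_eq0 d2.
have y1 : complex.Im z != 0 by rewrite gt_eqF.
have y2 : complex.Im w != 0 by rewrite gt_eqF.
move: (complex.Im z) (complex.Im w) (nsq (den A z)) (nsq (den A w)) (nsq (z - w)) n1 n2 y1 y2 => p q r s t n1 n2 y1 y2.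
by field; rewrite n1 n2 y1 y2.
Qed.

Lemma hdist_dl z w z' w' : H z -> H w -> H z' -> H w' ->
  hdist z w = hdist z' w' -> dl z w = dl z' w'.
Proof.
move=> hz hw hz' hw'.
(* [E] is the exponential of half the distance, and 4 sinh^2 (d / 2) = (E - E^-1)^2 is [dl]. *)
pose E z w := (Normc.normc (z - w) + Normc.normc (z - conjc w))
          / (2 * Num.sqrt (complex.Im z * complex.Im w)) : R.
have key z0 w0 : H z0 -> H w0 -> 0 < E z0 w0 /\ dl z0 w0 = (E z0 w0 - (E z0 w0)^-1) ^+ 2.
  case: z0 => x y; case: w0 => u v; rewrite /Hplane /= => y0 v0.
  rewrite /E /dl /nsq /=.
  set a2 := (x - u) ^+ 2 + (y - v) ^+ 2; set b2 := _ + (y - - v) ^+ 2.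
  have m0 : 0 < y * v by rewrite mulr_gt0.
  have s0 : 0 < Num.sqrt (y * v) by rewrite sqrtr_gt0.
  have a20 : 0 <= a2 by rewrite addr_ge0 ?sqr_ge0.
  have eb2 : b2 = a2 + 4 * (y * v) by rewrite /b2 /a2; ring.
  have b20 : 0 < b2 by rewrite eb2 ltr_wpDl // mulr_gt0.
  have sa := sqr_sqrtr a20; have sb := sqr_sqrtr (ltW b20); have sm := sqr_sqrtr (ltW m0).
  have a0 := sqrtr_ge0 a2; have b0 : 0 < Num.sqrt b2 by rewrite sqrtr_gt0.
  have ed : a2 / (y * v) = Num.sqrt a2 ^+ 2 / Num.sqrt (y * v) ^+ 2 by rewrite sa sm.
  have {}sb : Num.sqrt b2 ^+ 2 = Num.sqrt a2 ^+ 2 + 4 * Num.sqrt (y * v) ^+ 2 by rewrite sb sa sm.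
  rewrite ed; move: sb; move: (Num.sqrt a2) (Num.sqrt b2) (Num.sqrt (y * v)) a0 b0 s0 {sa sm ed} => a b s a0 b0 s0 sb.
  have q0 : 0 < a + b by rewrite ltr_wpDl.
  split; first by rewrite divr_gt0 // mulr_gt0.
  have i : ((a + b) / (2 * s))^-1 = (b - a) / (2 * s).
    apply: (@mulfI _ ((a + b) / (2 * s))); first by rewrite gt_eqF // divr_gt0 // mulr_gt0.
    rewrite mulfV ?gt_eqF ?divr_gt0 ?mulr_gt0 //.
    have -> : (a + b) / (2 * s) * ((b - a) / (2 * s)) = (b ^+ 2 - a ^+ 2) / (4 * s ^+ 2) by field; rewrite gt_eqF.
    by rewrite sb addrAC subrr add0r divff // mulf_neq0 ?pnatr_eq0 // expf_neq0 // gt_eqF.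
  by rewrite i; field; rewrite gt_eqF.
have [p1 ->] := key _ _ hz hw; have [p2 ->] := key _ _ hz' hw'.
rewrite /hdist -/(E z w) -/(E z' w') => h.
suff -> : E z w = E z' w' by [].
by apply: ln_inj => //; apply: (@mulfI _ 2); rewrite ?pnatr_eq0.
Qed.

Definition refl z : C := - conjc z.

(** The distances to i and 2i determine the imaginary part, and the real part up to sign; the image
    of 1 + i then decides the sign for all points at once. *)
Lemma fix_or_reflect (k : C -> C) : (forall z, H z -> H (k z)) ->
  (forall z w, H z -> H w -> dl (k z) (k w) = dl z w) ->
  k (0 +i* 1)%C = (0 +i* 1)%C -> k (0 +i* 2)%C = (0 +i* 2)%C ->
  (forall z, H z -> k z = z) \/ (forall z, H z -> k z = refl z).
Proof.
move=> kH kd k1 k2.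
have H1 : H (0 +i* 1)%C by rewrite /Hplane /= ltr01.
have H2 : H (0 +i* 2)%C by rewrite /Hplane /= ltr0n.
have coord x y : 0 < y -> exists u, u ^+ 2 = x ^+ 2 /\ k (x +i* y)%C = (u +i* y)%C.
  move=> y0; have hz : H (x +i* y)%C by [].
  have := kd _ _ hz H1; have := kd _ _ hz H2; rewrite k1 k2; have := kH _ hz.
  case: (k _) => u v; rewrite /Hplane /dl /nsq /= !subr0 !mulr1 => v0.
  have [ny nv] : y != 0 /\ v != 0 by rewrite !gt_eqF.
  move/eqP; rewrite eqr_div ?mulf_neq0 ?pnatr_eq0 // => /eqP h2.
  move/eqP; rewrite eqr_div // => /eqP h1.
  have e : v = y by lra.
  exists u; rewrite e; split => //; rewrite e in h1.
  by move/(mulIf ny): h1; lra.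
have [u [hu ku]] := coord 1 1 ltr01.
have W : H (1 +i* 1)%C by rewrite /Hplane /= ltr01.
have third x y : 0 < y -> exists u', [/\ u' ^+ 2 = x ^+ 2, (u' - u) ^+ 2 = (x - 1) ^+ 2 & k (x +i* y)%C = (u' +i* y)%C].
  move=> y0; have hz : H (x +i* y)%C by [].
  have [u' [h1 h2]] := coord x y y0; exists u'; split => //.
  have := kd _ _ hz W; rewrite ku h2 /dl /nsq /= mulr1 => /divIf; rewrite gt_eqF // => /(_ isT).
  by move/addIr.
have : u = 1 \/ u = -1.
  by move/eqP: hu; rewrite eqf_sqr => /orP[]/eqP; [left|right].
case=> eu; [left|right]; case=> x y; rewrite /Hplane /= => y0; have [u' [h1 h2 ->]] := third x y y0; rewrite eu in h2.
  by congr Complex; nra.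
have eu' : u' = - x by nra.
by apply/eqP; rewrite eq_complex /refl /= opprK eu' !eqxx.
Qed.

(** The value 1/2 is [dl] of i and 2i. The matrix is a rotation about i followed by the affine map
    taking i to p. The rotation with entries c, s, -s, c sends 2i to a point with imaginary part 2 /
    (1 + 3 s^2) and real part -3 s c / (1 + 3 s^2), from which s and c are found. *)
Lemma two_transitive p q : H p -> H q -> dl p q = 1 / 2 ->
  exists M, moebius (psl M) (0 +i* 1)%C = p /\ moebius (psl M) (0 +i* 2)%C = q.
Proof.
case: p => x0 y0; case: q => u v; rewrite /Hplane /= => py0 pv; rewrite /dl /nsq /= => hd.
have H1 : H (0 +i* 1)%C by rewrite /Hplane /= ltr01.
have H2 : H (0 +i* 2)%C by rewrite /Hplane /= ltr0n.
pose r := Num.sqrt y0; have r0 : 0 < r by rewrite sqrtr_gt0.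
have rn : r != 0 by rewrite gt_eqF.
have r2 : r ^+ 2 = y0 by rewrite sqr_sqrtr // ltW.
have hT : r * r^-1 - x0 / r * 0 = 1 by rewrite mulr0 subr0 divff.
have TE x y : 0 < y -> moebius (psl (mk2 hT)) (x +i* y)%C = ((y0 * x + x0) +i* (y0 * y))%C.
  move=> hy; have hz : H (x +i* y)%C by [].
  rewrite mobE; apply: (mulIf (den_neq0 (mk2 hT) hz)); rewrite divfK ?den_neq0 //.
  rewrite /num /den !entr /=; apply/eqP; rewrite eq_complex /=; apply/andP; split; apply/eqP.
    by rewrite -r2; field.
  by rewrite -r2; field.
pose u' := (u - x0) / y0; pose v' := v / y0.
have ny : y0 != 0 by rewrite gt_eqF.
have v0' : 0 < v' by rewrite divr_gt0.
have eu : u = y0 * u' + x0 by rewrite /u' mulrC divfK // subrK.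
have ev : v = y0 * v' by rewrite /v' mulrC divfK.
have hd' : u' ^+ 2 + v' ^+ 2 + 1 = 5 / 2 * v'.
  have vn : v' != 0 by rewrite gt_eqF.
  move: hd; rewrite eu ev => /(congr1 (fun t => t * (y0 * (y0 * v')))).
  have nn : y0 * (y0 * v') != 0 by rewrite gt_eqF // (mulr_gt0 py0) // (mulr_gt0 py0).
  rewrite divfK // => {}hd.
  apply: (@mulfI _ (y0 ^+ 2)); first by rewrite expf_neq0.
  by move: hd; lra.
have bound : (v' - 2) * (v' - 1 / 2) <= 0 by have := sqr_ge0 u'; nra.
have [b1 b2] : 1 / 2 <= v' /\ v' <= 2 by split; nra.
pose s2 := (2 - v') / (3 * v'); pose c2 := (4 * v' - 2) / (3 * v').
have v3 : 0 < 3 * v' by rewrite mulr_gt0.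
have s20 : 0 <= s2 by rewrite divr_ge0 ?(ltW v3) //; lra.
have c20 : 0 <= c2 by rewrite divr_ge0 ?(ltW v3) //; lra.
have vn : v' != 0 by rewrite gt_eqF.
have cs2 : c2 + s2 = 1 by rewrite /c2 /s2; field.
have [s [c [hs hc hsc]]] : exists s c, [/\ s ^+ 2 = s2, c ^+ 2 = c2 & - 3 * s * c * v' / 2 = u'].
  pose s := Num.sqrt s2; pose c := Num.sqrt c2.
  have hs : s ^+ 2 = s2 by rewrite sqr_sqrtr.
  have hc : c ^+ 2 = c2 by rewrite sqr_sqrtr.
  have : (3 * s * c * v' / 2) ^+ 2 = u' ^+ 2.
    have -> : (3 * s * c * v' / 2) ^+ 2 = 9 / 4 * s ^+ 2 * c ^+ 2 * v' ^+ 2 by field.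
    rewrite hs hc; have -> : 9 / 4 * s2 * c2 * v' ^+ 2 = (2 - v') * (v' - 1 / 2) by rewrite /s2 /c2; field.
    lra.
  move/eqP; rewrite eqf_sqr => /orP[]/eqP h.
    by exists s, (- c); rewrite sqrrN; split => //; rewrite -h; ring.
  by exists s, c; split => //; rewrite -[u']opprK -h; ring.
have hK : c * c - s * - s = 1 by rewrite -cs2 -hs -hc; ring.
have q0 : 1 + 3 * s ^+ 2 = 2 / v' by rewrite hs /s2; field.
exists (mk2 hT * mk2 hK)%g; rewrite !mob_comp //.
have K1 : moebius (psl (mk2 hK)) (0 +i* 1)%C = (0 +i* 1)%C.
  rewrite mobE; apply: (mulIf (den_neq0 (mk2 hK) H1)); rewrite divfK ?den_neq0 //.
  by rewrite /num /den !entr /=; apply/eqP; rewrite eq_complex /=; apply/andP; split; apply/eqP; ring.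
have K2 : moebius (psl (mk2 hK)) (0 +i* 2)%C = (u' +i* v')%C.
  rewrite mobE; apply: (mulIf (den_neq0 (mk2 hK) H2)); rewrite divfK ?den_neq0 //.
  rewrite /num /den !entr /=; apply/eqP; rewrite eq_complex /=; apply/andP; split; apply/eqP.
    rewrite -hsc; have h4 : v' * (1 + 3 * s ^+ 2) = 2 by rewrite q0 mulrC divfK.
    have cc : c ^+ 2 + s ^+ 2 = 1 by rewrite hs hc.
    have h5 : 2 * s * v' = s * c ^+ 2 * v' * 2 + s * s ^+ 2 * v' * 2 by rewrite -[LHS]mulr1 -cc; ring.
    have h6 : s = s * (v' * (1 + 3 * s ^+ 2)) / 2 by rewrite h4 mulfK ?pnatr_eq0.
    have h7 : s = s * v' * (c ^+ 2 + 4 * s ^+ 2) / 2 by rewrite {1}h6 -{1}cc; ring.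
    by move: h5 h7; lra.
  rewrite -hsc; have h4 : v' * (1 + 3 * s ^+ 2) = 2 by rewrite q0 mulrC divfK.
  have cc : c ^+ 2 + s ^+ 2 = 1 by rewrite hs hc.
  have h7 : c * (v' * (1 + 3 * s ^+ 2)) = c * 2 by rewrite h4.
  by move: h7; lra.
by rewrite K1 K2 !TE // ?ltr01 // eu ev; split; congr Complex; ring.
Qed.

Lemma reversing_isometry (g : C -> C) : hisometry g -> ~ orientation_preserving g ->
  exists M, forall z, H z -> g z = moebius (psl M) (refl z).
Proof.
move=> [gH _ gd] nop.
have gH' z : H z -> H (g z) by exact: gH.
have gdl z w : H z -> H w -> dl (g z) (g w) = dl z w.
  by move=> hz hw; apply: hdist_dl; rewrite ?gd //; exact: gH'.
have H1 : H (0 +i* 1)%C by rewrite /Hplane /= ltr01.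
have H2 : H (0 +i* 2)%C by rewrite /Hplane /= ltr0n.
have [|M [M1 M2]] := two_transitive (gH' _ H1) (gH' _ H2).
  by rewrite gdl // /dl /nsq /=; field.
pose k z := moebius (psl M^-1%g) (g z).
have back z : H z -> g z = moebius (psl M) (k z).
  by move=> hz; rewrite /k -mob_comp ?mulgV ?mob1 //; exact: gH'.
have kf z : H z -> moebius (psl M^-1%g) (moebius (psl M) z) = z.
  by move=> hz; rewrite -mob_comp // mulVg mob1.
have := @fix_or_reflect k; case.
- by move=> z hz; apply: mob_H; exact: gH'.
- by move=> z w hz hw; rewrite /k mob_dl ?gdl //; exact: gH'.
- by rewrite /k -M1 kf.
- by rewrite /k -M2 kf.
- by move=> h; case: nop; exists (psl M) => z hz; rewrite back // h.
by move=> h; exists M => z hz; rewrite back // h.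
Qed.

Lemma flip_sub A : ea A * ed A - (- eb A) * (- ec A) = 1.
Proof. by rewrite -(detE A); ring. Qed.
(** Conjugation by diag (1, -1), the matrix counterpart of the reflection [refl]. *)
Definition flip A := mk2 (flip_sub A).

Lemma refl_mob A z : H z -> refl (moebius (psl A) z) = moebius (psl (flip A)) (refl z).
Proof.
move=> hz; rewrite !mobE /refl.
have e1 : num (flip A) (- conjc z) = - conjc (num A z).
  by rewrite /num !entr; case: z {hz} => x y; apply/eqP; rewrite eq_complex /=; apply/andP; split; apply/eqP; ring.
have e2 : den (flip A) (- conjc z) = conjc (den A z).
  by rewrite /den !entr; case: z {hz e1} => x y; apply/eqP; rewrite eq_complex /=; apply/andP; split; apply/eqP; ring.
by rewrite e1 e2 rmorphM fmorphV /= mulNr.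
Qed.

Lemma refl_H z : H z -> H (refl z).
Proof. by case: z => x y; rewrite /Hplane /refl /= opprK. Qed.

Lemma reversing_conj (g : C -> C) : hisometry g -> ~ orientation_preserving g ->
  exists M, forall A B, (forall z, H z -> g (moebius (psl A) z) = moebius (psl B) (g z)) ->
    psl B = (psl M * psl (flip A) * (psl M)^-1)%g.
Proof.
move=> hg nop; have [M hM] := reversing_isometry hg nop; exists M => A B h.
have e : psl (M * flip A)%g = psl (B * M)%g.
  apply: mob_faithful => w hw.
  have ew : w = refl (refl w) by case: w {hw} => x y; apply/eqP; rewrite eq_complex /refl /= !opprK !eqxx.
  have hr := refl_H hw.
  have := h _ hr; rewrite (hM _ (mob_H A hr)) (hM _ hr) (refl_mob A hr) -ew.
  by rewrite !mob_comp.
move: e; rewrite -!psl_mulE => e.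
have e' : (psl M * psl (flip A) = psl B * psl M)%g by exact: e.
by rewrite e' -mulgA mulgV mulg1.
Qed.
End Isometries.

End HyperbolicIsometries.
Import HyperbolicIsometries.

(** * Gluing of continuous maps *)

Module ContinuityTools.
Local Open Scope ring_scope.
Local Open Scope classical_set_scope.

Section Gluing.
Variables (X Y : topologicalType).

Lemma closed_cover_continuous (A B : set X) (f f1 f2 : X -> Y) :
  closed A -> closed B -> (forall x, A x \/ B x) ->
  continuous f1 -> continuous f2 ->
  (forall x, A x -> f x = f1 x) -> (forall x, B x -> f x = f2 x) -> continuous f.
Proof.
move=> cA cB AB c1 c2 e1 e2 x U nU.
have side (C D : set X) (g h : X -> Y) : closed C -> closed D ->
    (forall x, C x \/ D x) -> continuous g -> continuous h ->
    (forall x, C x -> f x = g x) -> (forall x, D x -> f x = h x) -> C x ->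
    nbhs x (f @^-1` U).
  move=> {A B cA cB AB c1 c2 e1 e2 f1 f2} cC cD CD cg ch eg eh Cx.
  have ng : nbhs x (g @^-1` U) by apply: cg; rewrite -eg.
  have [Dx|nDx] := pselect (D x).
    have nh : nbhs x (h @^-1` U) by apply: ch; rewrite -eh.
    apply: filterS2 ng nh => y /= gy hy.
    by have [Cy|Dy] := CD y; [rewrite eg|rewrite eh].
  have nD : nbhs x (~` D) by apply: open_nbhs_nbhs; split => //; exact: closed_openC.
  by apply: filterS2 ng nD => y /= gy nDy; have [Cy|//] := CD y; rewrite eg.
have [Ax|Bx] := AB x; first exact: (@side A B f1 f2).
by apply: (@side B A f2 f1) => // y; case: (AB y); [right|left].
Qed.
End Gluing.

Section IntegerPieces.
Variables (R : realType) (X Y : topologicalType).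

(** Near a given point at most two consecutive pieces occur, and where u takes an integer value both
    agree with f. *)
Lemma integer_pieces_continuous (u : X -> R) (f : X -> Y) (F : int -> X -> Y) :
  continuous u -> (forall k, continuous (F k)) ->
  (forall k x, k%:~R <= u x <= (k + 1)%:~R -> f x = F k x) -> continuous f.
Proof.
move=> cu cF e x U nU.
pose k := Num.floor (u x).
have k1 : k%:~R <= u x by rewrite ge_floor.
have k2 : u x < (k + 1)%:~R by rewrite floorD1_gt.
have ex : f x = F k x by apply: e; rewrite k1 ltW.
have n0 : nbhs x (F k @^-1` U) by apply: cF; rewrite -ex.
have n2 : nbhs x [set y | u y < (k + 1)%:~R].
  by apply: (cu x [set z | z < (k + 1)%:~R]); exact: lt_nbhsl.
move: k1; rewrite le_eqVlt => /orP[/eqP k1|k1].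
  have e1 : ((k - 1) + 1)%:~R = u x by rewrite subrK.
  have ex' : f x = F (k - 1) x.
    by apply: e; rewrite e1 lexx andbT -k1 ler_int; lia.
  have n1 : nbhs x (F (k - 1) @^-1` U) by apply: cF; rewrite -ex'.
  have n3 : nbhs x [set y | (k - 1)%:~R < u y].
    by apply: (cu x [set z | (k - 1)%:~R < z]); apply: lt_nbhsr; rewrite -k1 ltr_int; lia.
  change (nbhs x (f @^-1` U)); near=> y.
  have y2 : u y < (k + 1)%:~R by near: y.
  have y3 : (k - 1)%:~R < u y by near: y.
  have [y1|y1] := leP k%:~R (u y).
    by rewrite /= (e k) ?y1 ?ltW //; near: y.
  rewrite /= (e (k - 1)); first by near: y.
  by rewrite subrK !ltW.
have n3 : nbhs x [set y | k%:~R < u y] by apply: (cu x [set z | k%:~R < z]); exact: lt_nbhsr.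
change (nbhs x (f @^-1` U)); near=> y.
have y2 : u y < (k + 1)%:~R by near: y.
have y3 : k%:~R < u y by near: y.
by rewrite /= (e k) ?ltW //; near: y.
Unshelve. all: by end_near.
Qed.
End IntegerPieces.

(* A folded form of continuity, for syntax-directed proofs. *)
Definition ctn (X Y : topologicalType) (f : X -> Y) : Prop := continuous f.

Section ContinuityRules.
Variables (R : realType) (X : topologicalType).
Implicit Types f g : X -> R.

Lemma cont_cst (Y : topologicalType) (y : Y) : ctn (fun _ : X => y).
Proof. by move=> x; exact: cvg_cst. Qed.
Lemma cont_id : ctn (fun x : X => x).
Proof. by move=> x; exact: cvg_id. Qed.
Lemma cont_comp (Y Z : topologicalType) (h : Y -> Z) (f : X -> Y) :
  ctn h -> ctn f -> ctn (fun x => h (f x)).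
Proof. by move=> ch cf x; apply: continuous_comp; [exact: cf|exact: ch]. Qed.
Lemma contD f g : ctn f -> ctn g -> ctn (fun x => f x + g x).
Proof. by move=> cf cg x; apply: cvgD; [exact: cf|exact: cg]. Qed.
Lemma contN f : ctn f -> ctn (fun x => - f x).
Proof. by move=> cf x; apply: cvgN; exact: cf. Qed.
Lemma contM f g : ctn f -> ctn g -> ctn (fun x => f x * g x).
Proof. by move=> cf cg x; apply: cvgM; [exact: cf|exact: cg]. Qed.
Lemma contX f n : ctn f -> ctn (fun x => f x ^+ n).
Proof.
move=> cf; elim: n => [|n ih].
  by rewrite (_ : (fun _ => _) = fun=> 1); [exact: cont_cst|apply/funext].
rewrite (_ : (fun _ => _) = fun x => f x * f x ^+ n); first exact: contM.
by apply/funext => x; rewrite exprS.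
Qed.
Lemma contV f : (forall x, f x != 0) -> ctn f -> ctn (fun x => (f x)^-1).
Proof. by move=> f0 cf x; apply: cvgV; [exact: f0|exact: cf]. Qed.
Lemma cont_max f g : ctn f -> ctn g -> ctn (fun x => Num.max (f x) (g x)).
Proof. by move=> cf cg x; exact: (continuous_max (cf x) (cg x)). Qed.
Lemma cont_min f g : ctn f -> ctn g -> ctn (fun x => Num.min (f x) (g x)).
Proof. by move=> cf cg x; exact: (continuous_min (cf x) (cg x)). Qed.
Lemma cont_sqrt f : ctn f -> ctn (fun x => Num.sqrt (f x)).
Proof. by move=> cf; apply: cont_comp => //; exact: sqrt_continuous. Qed.
Lemma cont_cos f : ctn f -> ctn (fun x => cos (f x)).
Proof. by move=> cf; apply: cont_comp => //; exact: continuous_cos. Qed.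
Lemma cont_sin f : ctn f -> ctn (fun x => sin (f x)).
Proof. by move=> cf; apply: cont_comp => //; exact: continuous_sin. Qed.
Lemma cont_atan f : ctn f -> ctn (fun x => atan (f x)).
Proof. by move=> cf; apply: cont_comp => // x; exact: continuous_atan. Qed.
Lemma cont_pair (Y Z : topologicalType) (f : X -> Y) (g : X -> Z) :
  ctn f -> ctn g -> ctn (fun x => (f x, g x)).
Proof. by move=> cf cg x; apply: cvg_pair; [exact: cf|exact: cg]. Qed.
Lemma cont_fst (Y Z : topologicalType) (f : X -> (Y * Z)%type) :
  ctn f -> ctn (fun x => (f x).1).
Proof. by move=> cf; apply: (cont_comp (h := fst)) => // x; exact: cvg_fst. Qed.
Lemma cont_snd (Y Z : topologicalType) (f : X -> (Y * Z)%type) :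
  ctn f -> ctn (fun x => (f x).2).
Proof. by move=> cf; apply: (cont_comp (h := snd)) => // x; exact: cvg_snd. Qed.

(** Clamping extends a map from an interval to the whole line, so that continuity can be stated
    without subspaces. *)
Definition clamp (a b x : R) : R := Num.max a (Num.min b x).
Lemma cont_clamp a b f : ctn f -> ctn (fun x => clamp a b (f x)).
Proof.
move=> cf; apply: (@cont_max (fun=> a) (fun x => Num.min b (f x))); first exact: cont_cst.
by apply: (@cont_min (fun=> b)) => //; exact: cont_cst.
Qed.
End ContinuityRules.

Ltac cont_step := lazymatch goal with
  | |- ctn (fun _ => ?y) => exact: cont_cst
  | |- ctn (fun x => x) => exact: cont_id
  | |- ctn (fun x => @?f x + @?g x) => apply: (contD (f := f) (g := g))
  | |- ctn (fun x => - @?f x) => apply: (contN (f := f))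
  | |- ctn (fun x => @?f x * @?g x) => apply: (contM (f := f) (g := g))
  | |- ctn (fun x => @?f x ^+ ?n) => apply: (contX (f := f))
  | |- ctn (fun x => Num.max (@?f x) (@?g x)) => apply: (cont_max (f := f) (g := g))
  | |- ctn (fun x => Num.min (@?f x) (@?g x)) => apply: (cont_min (f := f) (g := g))
  | |- ctn (fun x => clamp ?a ?b (@?f x)) => apply: (cont_clamp (f := f))
  | |- ctn (fun x => Num.sqrt (@?f x)) => apply: (cont_sqrt (f := f))
  | |- ctn (fun x => cos (@?f x)) => apply: (cont_cos (f := f))
  | |- ctn (fun x => sin (@?f x)) => apply: (cont_sin (f := f))
  | |- ctn (fun x => atan (@?f x)) => apply: (cont_atan (f := f))
  | |- ctn (fun x => (@?f x, @?g x)) => apply: (cont_pair (f := f) (g := g))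
  | |- ctn (fun x => (@?f x).1) => apply: (cont_fst (f := f))
  | |- ctn (fun x => (@?f x).2) => apply: (cont_snd (f := f))
  | |- ctn fst => apply: (@cont_fst _ _ _ (fun z => z)); exact: cont_id
  | |- ctn snd => apply: (@cont_snd _ _ _ (fun z => z)); exact: cont_id
  | |- ctn id => exact: cont_id
  | |- ctn cos => exact: continuous_cos
  | |- ctn sin => exact: continuous_sin
  | |- ctn _ => assumption
  end.
Ltac cont := repeat cont_step.

Section Clamp.
Variable R : realType.
Lemma clamp_in (a b x : R) : a <= b -> a <= clamp a b x <= b.
Proof. by move=> ab; rewrite /clamp le_max lexx /= ge_max ab ge_min lexx. Qed.
Lemma clamp_id (a b x : R) : a <= x <= b -> clamp a b x = x.
Proof. by move=> /andP[ax xb]; rewrite /clamp min_r // max_r. Qed.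
Lemma clamp_lo (a b x : R) : a <= b -> x <= a -> clamp a b x = a.
Proof. by move=> ab xa; rewrite /clamp min_r ?max_l // (le_trans xa). Qed.
Lemma clamp_hi (a b x : R) : a <= b -> b <= x -> clamp a b x = b.
Proof. by move=> ab bx; rewrite /clamp min_l // max_r. Qed.

End Clamp.

End ContinuityTools.
Import ContinuityTools.

(** * Loops as cyclic concatenations of paths *)

Module PathLoops.
Local Open Scope ring_scope.
Local Open Scope classical_set_scope.

Section Loops.
Variables (R : realType) (Y : topologicalType) (star : Y).
Implicit Types (p q c d e : R -> Y) (ps qs : seq (R -> Y)).

Definition dpath : R -> Y := fun=> star.
Definition good p := [/\ ctn p, p 0 = star & p 1 = star].
Definition goods ps := forall i, (i < size ps)%N -> good (nth dpath ps i).

Definition fhtpy (c c' : R -> Y) : Prop :=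
  exists H : (R * R)%type -> Y,
    [/\ ctn H, forall s t, H (s, t + 1) = H (s, t),
        forall t, H (0, t) = c t & forall t, H (1, t) = c' t].

Lemma fhtpy_refl c : ctn c -> (forall t, c (t + 1) = c t) -> fhtpy c c.
Proof.
move=> cc per; exists (fun z => c z.2); split => //.
by apply: (cont_comp cc); cont.
Qed.

Lemma fhtpy_trans c d e : fhtpy c d -> fhtpy d e -> fhtpy c e.
Proof.
move=> [H [cH pH H0 H1]] [K [cK pK K0 K1]].
pose G (z : R * R) := if z.1 <= 1 / 2 then H (2 * z.1, z.2) else K (2 * z.1 - 1, z.2).
have cH' : ctn H by [].
have cK' : ctn K by [].
have c1 : ctn (fun z : R * R => z.1) by cont.
exists G; split; rewrite /G /=.
- apply: (@closed_cover_continuous _ _ [set z : R * R | z.1 <= 1 / 2]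
    [set z : R * R | 1 / 2 <= z.1] _ (fun z => H (2 * z.1, z.2))
    (fun z => K (2 * z.1 - 1, z.2))).
  + by apply: (@closed_comp _ _ _ [set x : R | x <= 1 / 2]); [move=> ? _; exact: c1|exact: closed_le].
  + by apply: (@closed_comp _ _ _ [set x : R | 1 / 2 <= x]); [move=> ? _; exact: c1|exact: closed_ge].
  + by move=> z /=; case: (leP z.1 (1 / 2)) => h; [left|right; exact: ltW].
  + by apply: (cont_comp cH'); cont.
  + by apply: (cont_comp cK'); cont.
  + by move=> z /= ->.
  + move=> z /= h; case: ifP => // h'.
    have e1 : z.1 = 1 / 2 by lra.
    by rewrite e1 (_ : 2 * (1 / 2) = 1) ?subrr ?H1 ?K0 //; field.
- by move=> s t; case: ifP => _; rewrite ?pH ?pK.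
- by move=> t; rewrite mulr0 divr_ge0 // ?ler01 // H0.
- by move=> t; rewrite ifF; [rewrite mulr1 (_ : 2 - 1 = 1) ?K1 //; ring|lra].
Qed.

(** Paths are functions on the line that are compared on [0, 1] only, whereas the homotopy is
    continuous everywhere. *)
Definition path_htpy p q := exists K : R * R -> Y,
  [/\ ctn K, forall s, K (s, 0) = star, forall s, K (s, 1) = star,
      forall t, 0 <= t <= 1 -> K (0, t) = p t & forall t, 0 <= t <= 1 -> K (1, t) = q t].

Lemma path_htpy_sym p q : path_htpy p q -> path_htpy q p.
Proof.
move=> [K [cK K0 K1 Kp Kq]]; exists (fun z => K (1 - z.1, z.2)); split => //=.
- by apply: (cont_comp cK); cont.
- by move=> t ht; rewrite subr0 Kq.
- by move=> t ht; rewrite subrr Kp.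
Qed.

Lemma path_htpy_rev p q : path_htpy p q -> path_htpy (fun t => p (1 - t)) (fun t => q (1 - t)).
Proof.
move=> [K [cK K0 K1 Kp Kq]]; exists (fun z => K (z.1, 1 - z.2)); split => //=.
- by apply: (cont_comp cK); cont.
- by move=> s; rewrite subr0 K1.
- by move=> s; rewrite subrr K0.
- by move=> t ht; rewrite Kp //; lra.
- by move=> t ht; rewrite Kq //; lra.
Qed.

Lemma path_htpy_eq p q q' : path_htpy p q -> (forall t, 0 <= t <= 1 -> q t = q' t) ->
  path_htpy p q'.
Proof.
move=> [K [cK K0 K1 Kp Kq]] e; exists K; split => // t ht.
by rewrite Kq // e.
Qed.

Lemma path_htpy_refl p : good p -> path_htpy p p.
Proof.
move=> [cp p0 p1]; exists (fun z => p z.2); split => //=.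
by apply: (cont_comp cp); cont.
Qed.

(* The concatenation of the paths of [ps], as a loop on R / Z. *)
Definition loop_of ps (t : R) : Y :=
  let u := t * (size ps)%:R in
  let k := Num.floor u in
  nth dpath ps `|(k %% size ps)%Z|%N (u - k%:~R).

Lemma modz_bound (k : int) (n : nat) : (0 < n)%N -> (`|(k %% n)%Z|%N < n)%N.
Proof. by move=> n0; lia. Qed.

(** Consecutive pieces meet at [star]; clamping the fractional part turns them into globally
    continuous maps that agree with the family on closed unit intervals. *)
Lemma loop_family_ctn (X : topologicalType) n (K : nat -> X * R -> Y) (u : X -> R) (v : X -> X) :
  (0 < n)%N -> ctn u -> ctn v ->
  (forall i, (i < n)%N -> [/\ ctn (K i), forall x, K i (x, 0) = star & forall x, K i (x, 1) = star]) ->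
  ctn (fun x => K `|(Num.floor (u x) %% n)%Z|%N (v x, u x - (Num.floor (u x))%:~R)).
Proof.
move=> n0 cu cv hK.
pose F (k : int) x := K `|(k %% n)%Z|%N (v x, clamp 0 1 (u x - k%:~R)).
apply: (integer_pieces_continuous (F := F) cu).
  move=> k; have [cK _ _] := hK _ (modz_bound k n0).
  by apply: (cont_comp cK); cont.
move=> k x /andP[h1 h2]; rewrite /F.
have [e|ne] := eqVneq (u x) (k + 1)%:~R.
  rewrite e intrKfloor subrr.
  have [_ -> _] := hK _ (modz_bound (k + 1) n0).
  rewrite rmorphD /= addrAC subrr add0r clamp_id ?lexx ?ler01 //.
  by have [_ _ ->] := hK _ (modz_bound k n0).
have -> : Num.floor (u x) = k by apply/eqP; rewrite floor_eq h1 lt_neqAle ne h2.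
by rewrite clamp_id // subr_ge0 h1 /= lerBlDr addrC -[1%R]/(1%:~R) -rmorphD.
Qed.

Lemma loop_of_ctn ps : goods ps -> ctn (loop_of ps).
Proof.
move=> g; have [s0|s0] := posnP (size ps).
  have -> : loop_of ps = fun=> star by apply/funext => t; rewrite /loop_of (size0nil s0) nth_nil.
  exact: cont_cst.
apply: (@loop_family_ctn R (size ps) (fun i z => nth dpath ps i z.2)
  (fun t => t * (size ps)%:R) id s0); [by cont|exact: cont_id|].
move=> i /g[ci h0 h1]; split => //.
by apply: (cont_comp ci); cont.
Qed.

Lemma loop_of_periodic ps t : loop_of ps (t + 1) = loop_of ps t.
Proof.
rewrite /loop_of mulrDl mul1r.
have -> : Num.floor (t * (size ps)%:R + (size ps)%:R) =
    Num.floor (t * (size ps)%:R) + (size ps)%:Z.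
  by rewrite [X in Num.floor (_ + X)]pmulrn floorDrz ?intr_int // intrKfloor.
rewrite modzDr rmorphD /=; congr (nth _ _ _ _); ring.
Qed.

Lemma loop_of_htpy ps qs : size ps = size qs ->
  (forall i, (i < size ps)%N -> path_htpy (nth dpath ps i) (nth dpath qs i)) ->
  fhtpy (loop_of ps) (loop_of qs).
Proof.
move=> es h; have [s0|s0] := posnP (size ps).
  have -> : loop_of ps = fun=> star by apply/funext => t; rewrite /loop_of (size0nil s0) nth_nil.
  have -> : loop_of qs = fun=> star.
    by apply/funext => t; rewrite /loop_of (@size0nil _ qs) -?es // nth_nil.
  by apply: fhtpy_refl => //; exact: cont_cst.
have /choice[K hK] : forall i, exists K : R * R -> Y, (i < size ps)%N ->
    [/\ ctn K, forall s, K (s, 0) = star, forall s, K (s, 1) = star,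
      forall t, 0 <= t <= 1 -> K (0, t) = nth dpath ps i t &
      forall t, 0 <= t <= 1 -> K (1, t) = nth dpath qs i t].
  move=> i; have [hi|hi] := boolP (i < size ps)%N; last by exists (fun=> star).
  by have [K hK] := h i hi; exists K.
pose n := size ps.
pose H (z : R * R) := K `|(Num.floor (z.2 * n%:R) %% n)%Z|%N
   (z.1, z.2 * n%:R - (Num.floor (z.2 * n%:R))%:~R).
have frac (x : R) : 0 <= x - (Num.floor x)%:~R <= 1.
  by rewrite subr_ge0 ge_floor /= lerBlDr addrC -[1%R]/(1%:~R) -rmorphD ltW // floorD1_gt.
exists H; split.
- apply: (@loop_family_ctn _ n (fun i (z : (R * R) * R) => K i (z.1.1, z.2))
    (fun z : R * R => z.2 * n%:R) id s0); [by cont|exact: cont_id|].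
  move=> i /hK[ci h0 h1 _ _]; split => //.
  by apply: (cont_comp ci); cont.
- move=> s t; rewrite /H /= mulrDl mul1r.
  have -> : Num.floor (t * n%:R + n%:R) = Num.floor (t * n%:R) + n%:Z.
    by rewrite [X in Num.floor (_ + X)]pmulrn floorDrz ?intr_int // intrKfloor.
  rewrite modzDr rmorphD /=; congr (K _ (_, _)); ring.
- move=> t; rewrite /H /loop_of /=.
  by have [_ _ _ -> //] := hK _ (modz_bound (Num.floor (t * n%:R)) s0).
- move=> t; rewrite /H /loop_of /= -es.
  by have [_ _ _ _ -> //] := hK _ (modz_bound (Num.floor (t * n%:R)) s0).
Qed.

End Loops.

End PathLoops.
Import PathLoops.

(** * Subdivision and reparametrisation of loops *)

Module LoopReparametrization.
Local Open Scope ring_scope.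
Local Open Scope classical_set_scope.

Section Flatten.
Variables (R : realType) (Y : topologicalType) (star : Y).
Local Notation dpath := (@dpath R Y star).
Local Notation loop_of := (@loop_of R Y star).

Definition is_concat (D : R -> Y) (ps : seq (R -> Y)) :=
  forall j t, (j < size ps)%N -> 0 <= t <= 1 ->
    D ((j%:R + t) / (size ps)%:R) = nth dpath ps j t.

Lemma is_concat_rev D ps : is_concat D ps ->
  is_concat (fun t => D (1 - t)) [seq (fun t => p (1 - t)) | p <- rev ps].
Proof.
move=> h j t; rewrite size_map size_rev => hj ht.
have s0 : (size ps)%:R != 0 :> R by rewrite pnatr_eq0; case: (size ps) hj.
rewrite (nth_map dpath) ?size_rev // nth_rev // -h; last lra; last first.
  by rewrite ltn_subrL; case: (size ps) hj.
congr D; rewrite natrB // -addn1 natrD; by field.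
Qed.

Variables (qss : seq (seq (R -> Y))) (Ds : seq (R -> Y)).
Hypothesis size_Ds : size Ds = size qss.
Hypothesis concat_Ds : forall i, (i < size qss)%N -> is_concat (nth dpath Ds i) (nth [::] qss i).
Hypothesis qss_pos : forall i, (i < size qss)%N -> (0 < size (nth [::] qss i))%N.
Hypothesis good_qss : goods star (flatten qss).

Let n := size qss.
Let N := size (flatten qss).
Let m i := size (nth [::] qss i).
Let M i := sumn (take i (shape qss)).

Lemma block_end i : (i < n)%N -> M i.+1 = (M i + m i)%N.
Proof.
move=> hi; rewrite /M (take_nth 0%N) ?size_map // sumn_rcons; congr (_ + _)%N.
by rewrite /shape (nth_map [::]).
Qed.

Lemma block_total : M n = N.
Proof. by rewrite /M take_oversize ?size_map // /N size_flatten. Qed.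

(** The position in the flattened list where the k-th block begins, continued to all integers: it
    grows by N when k grows by n. *)
Definition block_start (k : int) : int := (M `|(k %% n)%Z|%N)%:Z + N%:Z * (k %/ n)%Z.

Lemma block_startS k : (0 < n)%N ->
  block_start (k + 1) = block_start k + (m `|(k %% n)%Z|%N)%:Z.
Proof.
move=> n0; rewrite /block_start.
have e := divz_eq k n; have r0 : 0 <= (k %% n)%Z by rewrite modz_ge0 //; lia.
have r1 : (k %% n)%Z < n%:Z by rewrite ltz_pmod //; lia.
move: (k %/ n)%Z (k %% n)%Z e r0 r1 => a b e r0 r1.
case: b e r0 r1 => // i e _ hi; rewrite e /=.
have [hn|hn] := eqVneq i.+1 n.
  have -> : a * n%:Z + i + 1 = (a + 1) * n%:Z by lia.
  rewrite modzMl mulzK; last by lia.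
  by rewrite /M take0 /= -[in RHS]/(M i) -addrA [_ * a + _]addrC addrA -PoszD -block_end
    ?hn ?block_total //; lia.
have hi' : (i.+1 < n)%N by lia.
have -> : a * n%:Z + i + 1 = a * n%:Z + i.+1%:Z by lia.
rewrite divzMDl; last by lia.
rewrite modzMDl modz_small; last by lia.
rewrite divz_small; last by lia.
by rewrite addr0 /= block_end //; lia.
Qed.

Definition reparam (t : R) : R :=
  let k := Num.floor (t * n%:R) in
  ((block_start k)%:~R + (m `|(k %% n)%Z|%N)%:R * (t * n%:R - k%:~R)) / N%:R.

Lemma reparam_ctn : (0 < n)%N -> ctn reparam.
Proof.
move=> n0.
apply: (@integer_pieces_continuous R _ _ (fun t : R => t * n%:R) _ (fun k t =>
  ((block_start k)%:~R + (m `|(k %% n)%Z|%N)%:R * (t * n%:R - k%:~R)) / N%:R)).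
- by change (ctn (fun t : R => t * n%:R)); cont.
- by move=> k; match goal with |- continuous ?f => change (ctn f) end; cont.
move=> k t /andP[h1 h2]; rewrite /reparam.
have [e|ne] := eqVneq (t * n%:R) (k + 1)%:~R.
  rewrite e intrKfloor subrr mulr0 addr0 block_startS // !rmorphD /=; congr (_ / _).
  by rewrite pmulrn; ring.
have -> // : Num.floor (t * n%:R) = k.
by apply/eqP; rewrite floor_eq h1 lt_neqAle ne h2.
Qed.

Lemma flat_pos : (0 < n)%N -> (0 < N)%N.
Proof.
move=> n0; rewrite -block_total -(prednK n0) block_end ?prednK //.
by have := @qss_pos n.-1; rewrite -/n prednK // leqnn => /(_ isT); rewrite /m; lia.
Qed.

Lemma reparamS t : (0 < n)%N -> reparam (t + 1) = reparam t + 1.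
Proof.
move=> n0; rewrite /reparam [(t + 1) * _]mulrDl mul1r.
have -> : Num.floor (t * n%:R + n%:R) = Num.floor (t * n%:R) + n%:Z.
  by rewrite [X in Num.floor (_ + X)]pmulrn floorDrz ?intr_int // intrKfloor.
move: (Num.floor _) => k; rewrite /block_start modzDr.
have -> : ((k + n) %/ n)%Z = ((k %/ n)%Z + 1)%R.
  have e : k + n = 1 * n%:Z + k by lia.
  by rewrite e divzMDl; lia.
have N0 : N%:R != 0 :> R by rewrite pnatr_eq0 -lt0n flat_pos.
rewrite !rmorphD /= !rmorphM /= rmorphD /=.
have -> : (N%:Z)%:~R = N%:R :> R by [].
have -> : (n%:Z)%:~R = n%:R :> R by [].
by field.
Qed.

Lemma loop_of_reparam t : loop_of Ds t = loop_of (flatten qss) (reparam t).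
Proof.
have [n0|n0] := posnP n.
  by rewrite /loop_of (size0nil n0) (@size0nil _ Ds) ?size_Ds // !nth_nil.
have N0 : (0 < N)%N by exact: flat_pos.
have N0r : N%:R != 0 :> R by rewrite pnatr_eq0 -lt0n.
rewrite /loop_of size_Ds -/n -/N /reparam.
set k := Num.floor _; set r := _ - k%:~R.
have r0 : 0 <= r by rewrite subr_ge0 ge_floor.
have r1 : r < 1.
  by rewrite /r ltrBlDr addrC -[1%R]/(1%:~R) -rmorphD /= floorD1_gt.
rewrite divfK //; rewrite /block_start.
have ki := modz_bound k n0.
move: (`|(k %% n)%Z|%N) ki => i hi.
have mi0 : (0 < m i)%N by exact: qss_pos.
have mi0r : 0 < (m i)%:R :> R by rewrite ltr0n.
pose j := Num.trunc ((m i)%:R * r).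
have mr0 : 0 <= (m i)%:R * r by rewrite mulr_ge0 // ltW.
have /andP[j1 j2] : j%:R <= (m i)%:R * r < j.+1%:R by exact: trunc_itv.
have jm : (j < m i)%N by rewrite -(ltr_nat R); apply: le_lt_trans j1 _; rewrite gtr_pMr.
pose x := (m i)%:R * r - j%:R.
have x0 : 0 <= x by rewrite subr_ge0.
have x1 : x < 1 by rewrite -natr1 in j2; rewrite /x; lra.
have er : r = (j%:R + x) / (m i)%:R.
  by rewrite /x addrC subrK mulrC mulKf // gt_eqF.
rewrite {1}er concat_Ds //; last by rewrite x0 ltW.
set u := _ + _ * r.
have eu : u = ((M i + j)%N%:Z + N%:Z * (k %/ n)%Z)%:~R + x.
  rewrite /u /x PoszD !rmorphD /= -!pmulrn; ring.
have fu : Num.floor u = (M i + j)%N%:Z + N%:Z * (k %/ n)%Z.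
  apply/eqP; rewrite floor_eq eu lerDl x0 /=.
  by rewrite [X in _ < X]rmorphD ltrD2l.
have Mj : (M i + j < N)%N.
  have hj : (j < nth 0%N (shape qss) i)%N by rewrite /shape (nth_map [::]).
  by have := flatten_indexP hj; rewrite -size_flatten.
rewrite fu eu; set w := (_ + _ : int).
have -> : w%:~R + x - w%:~R = x by ring.
have -> : (w %% N)%Z = (M i + j)%N.
  by rewrite /w addrC (mulrC N%:Z) modzMDl modz_small //; lia.
rewrite /= nth_flatten.
have hj : (j < nth 0%N (shape qss) i)%N by rewrite /shape (nth_map [::]).
by rewrite -[(M i + j)%N]/(flatten_index (shape qss) i j) flatten_indexKl // flatten_indexKr.
Qed.

(** [reparam] lifts a map of degree one of the circle, so the straight-line homotopy from the
    identity to it is compatible with the period. *)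
Lemma loop_of_flatten : fhtpy (loop_of (flatten qss)) (loop_of Ds).
Proof.
have [n0|n0] := posnP n.
  rewrite (size0nil n0) (@size0nil _ Ds) ?size_Ds //.
  apply: fhtpy_refl; last by move=> t; exact: loop_of_periodic.
  by apply: loop_of_ctn.
exists (fun z => loop_of (flatten qss) ((1 - z.1) * z.2 + z.1 * reparam z.2)).
have c1 : ctn (fun z : R * R => reparam z.2) by apply: (cont_comp (reparam_ctn n0)); cont.
split => /=.
- by apply: (cont_comp (loop_of_ctn good_qss)); cont.
- move=> s t; rewrite reparamS //.
  have -> : (1 - s) * (t + 1) + s * (reparam t + 1) = (1 - s) * t + s * reparam t + 1 by ring.
  exact: loop_of_periodic.
- by move=> t; rewrite subr0 mul1r mul0r addr0.
- by move=> t; rewrite subrr mul0r mul1r add0r -loop_of_reparam.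
Qed.

End Flatten.

End LoopReparametrization.
Import LoopReparametrization.

(** * The octagon and its identifications *)

Module Octagon.
Local Open Scope ring_scope.
Local Open Scope classical_set_scope.
Local Open Scope quotient_scope.

Section Disc.
Variable R : realType.
Local Notation disc := (@disc R).
Local Notation Sg := (Sigma2 R).
Implicit Types (z : (R * R)%type) (s t u : R).

(** Used for the radial retraction of the plane onto the disc, thanks to which maps to the surface
    can be given by formulas on the whole plane. *)
Definition rad z : R := Num.max 1 (Num.sqrt (z.1 ^+ 2 + z.2 ^+ 2)).
Definition retr z : (R * R)%type := (z.1 * (rad z)^-1, z.2 * (rad z)^-1).

Lemma rad_gt0 z : 0 < rad z.
Proof. by rewrite /rad lt_max ltr01. Qed.

Lemma retr_disc z : retr z \in disc.
Proof.
rewrite inE /Defs.disc /=.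
have n0 : 0 <= z.1 ^+ 2 + z.2 ^+ 2 by rewrite addr_ge0 ?sqr_ge0.
have r0 := rad_gt0 z.
have h : z.1 ^+ 2 + z.2 ^+ 2 <= rad z ^+ 2.
  rewrite -[leLHS]sqr_sqrtr // ler_pXn2r ?nnegrE ?sqrtr_ge0 ?(ltW r0) //.
  by rewrite /rad le_max lexx orbT.
rewrite !exprMn -mulrDl exprVn ler_pdivrMr ?exprn_gt0 // mul1r.
exact: h.
Qed.

Lemma retr_id z : disc z -> retr z = z.
Proof.
move=> hz; have e : rad z = 1.
  by rewrite /rad max_l // -sqrtr1 ler_wsqrtr.
by rewrite /retr e invr1 !mulr1; case: z {hz e}.
Qed.

Definition to_disc z : set_type disc := @exist _ (fun z => z \in disc) _ (retr_disc z).

Lemma retr_ctn : ctn retr.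
Proof.
have c : ctn (fun z : R * R => (rad z)^-1).
  apply: (@contV _ _ rad); first by move=> z; rewrite gt_eqF // rad_gt0.
  by rewrite /rad; cont.
by rewrite /retr; cont.
Qed.

Definition P z : Sg := \pi_Sg (to_disc z).

Lemma P_ctn : ctn P.
Proof.
apply: (cont_comp (h := \pi_Sg)); first exact: pi_continuous.
have : ctn (set_val \o to_disc) by exact: retr_ctn.
exact: continuous_comp_initial.
Qed.

Lemma P_val (x : set_type disc) : \pi_Sg x = P (val x).
Proof.
congr (\pi_Sg _); apply: val_inj; rewrite /= retr_id //.
by have := valP x; rewrite inE.
Qed.

Lemma P_surj (y : Sg) : exists2 z, disc z & y = P z.
Proof.
exists (val (repr y)); first by have := valP (repr y); rewrite inE.
by rewrite -P_val reprK.
Qed.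

Definition circ s : (R * R)%type := (cos (s * pi / 4), sin (s * pi / 4)).

Lemma circ_disc s : disc (circ s).
Proof. by rewrite /Defs.disc /= cos2Dsin2. Qed.

Lemma circ_ctn (X : topologicalType) (f : X -> R) : ctn f -> ctn (fun x => circ (f x)).
Proof. by move=> cf; rewrite /circ; cont. Qed.

Lemma P_circ s : P (circ s) = \pi_Sg (oct_boundary s).
Proof. by rewrite P_val. Qed.

Lemma letter_pathE (l : letter) t : letter_path l t =
  P (circ (edge_start R l.1 + if l.2 then t else 1 - t)).
Proof. by rewrite P_circ. Qed.

Lemma circD8 s (k : int) : circ (s + 8 * k%:~R) = circ s.
Proof.
have step s' : circ (s' + 8) = circ s'.
  rewrite /circ; have -> : (s' + 8) * pi / 4 = s' * pi / 4 + pi *+ 2 by rewrite mulr2n; field.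
  by rewrite cosD2pi sinD2pi.
have nat_case (n : nat) s' : circ (s' + 8 * n%:R) = circ s'.
  elim: n => [|n ih]; first by rewrite mulr0 addr0.
  have -> : s' + 8 * n.+1%:R = s' + 8 * n%:R + 8 by rewrite -(natr1 n); ring.
  by rewrite step.
case: k => n; first exact: nat_case.
rewrite NegzE -[LHS](nat_case n.+1); congr circ.
rewrite rmorphN /= -pmulrn; ring.
Qed.

Lemma cos_eq1 s : `|s| < 2 * pi -> cos s = 1 -> s = 0.
Proof.
move=> hs c1; pose d := `|s| / 2.
have cd : cos `|s| = 1 by rewrite cos_norm.
have : sin d ^+ 2 = 0.
  have : cos (d *+ 2) = 1.
    by rewrite -[RHS]cd; congr cos; rewrite /d mulr2n; field.
  by rewrite cos_mulr2n cos2sin2 mulr2n => h; lra.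
move/eqP; rewrite sqrf_eq0 => /eqP sd.
have [d0|d0] := leP d 0.
  by apply/eqP; rewrite -normr_eq0 eq_le normr_ge0 andbT; move: d0; rewrite /d; lra.
have : 0 < sin d by apply: sin_gt0_pi; rewrite d0 /d /=; lra.
by rewrite sd ltxx.
Qed.

Lemma circ_inj s t : circ s = circ t -> exists k : int, s = t + 8 * k%:~R.
Proof.
move=> e; pose k := Num.floor ((s - t) / 8).
exists k; pose t' := t + 8 * k%:~R.
have e' : circ s = circ t' by rewrite e /t' circD8.
have h1 : 0 <= s - t'.
  have : k%:~R <= (s - t) / 8 by exact: ge_floor.
  by rewrite /t'; lra.
have h2 : s - t' < 8.
  have : (s - t) / 8 < (k + 1)%:~R by exact: floorD1_gt.
  by rewrite rmorphD /= rmorph1 /t'; lra.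
have pi0 := pi_gt0 R.
have : cos ((s - t') * pi / 4) = 1.
  have -> : (s - t') * pi / 4 = s * pi / 4 - t' * pi / 4 by field.
  by rewrite cosB; case: e' => -> ->; rewrite -!expr2 cos2Dsin2.
move=> c1; suff h : `|(s - t') * pi / 4| < 2 * pi.
  move: (cos_eq1 h c1) => /eqP; rewrite !mulf_eq0 (gt_eqF pi0) invr_eq0 pnatr_eq0 !orbF subr_eq0.
  by move/eqP.
rewrite ger0_norm; last by rewrite divr_ge0 // mulr_ge0 // ltW.
rewrite ltr_pdivrMr //.
have -> : 2 * pi * 4 = 8 * pi :> R by ring.
by rewrite ltr_pM2r.
Qed.

Definition edges : seq nat := [:: 0; 1; 4; 5]%N.

Lemma edge_startE (i : 'I_4) : edge_start R i = (nth 0 edges i)%:R /\ (nth 0 edges i \in edges)%N.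
Proof. by case: i => [[|[|[|[|//]]]] ?]. Qed.

Definition vertex z := exists n : int, z = circ n%:~R.
Definition glued z z' := exists e u, [/\ (e \in edges)%N, 0 < u < 1, z = circ (e%:R + u) &
  z' = circ (e%:R + 3 - u)].
(** A closed form of the equivalence generated by the gluing: the vertices form one class, and an
    interior point of an edge is paired with exactly one other. *)
Definition identified z z' :=
  [\/ z = z', vertex z /\ vertex z', glued z z' | glued z' z].

Lemma int_unit_interval (a b : int) u : a%:~R + u = b%:~R -> 0 < u < 1 -> False.
Proof.
move=> h /andP[u0 u1].
have h1 : 0 < ((b - a)%:~R : R) < 1.
  have -> : (b - a)%:~R = u by rewrite rmorphB /= -h; ring.
  by rewrite u0 u1.
by move: h1; rewrite ltr0z ltrz1 => /andP[]; lia.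
Qed.

Lemma int_frac_inj (a b : int) u u' : a%:~R + u = b%:~R + u' -> 0 < u < 1 -> 0 < u' < 1 ->
  a = b /\ u = u'.
Proof.
move=> h /andP[u0 u1] /andP[v0 v1].
have h1 : ((-1)%:~R : R) < (a - b)%:~R by rewrite rmorphB /= rmorphN1; lra.
have h2 : ((a - b)%:~R : R) < 1%:~R by rewrite rmorphB /=; lra.
rewrite !ltr_int in h1 h2.
have ab : a = b by lia.
by split => //; move: h; rewrite ab => /addrI.
Qed.

Lemma vertex_not_glued z z' : vertex z -> glued z z' -> False.
Proof.
move=> [n ->] [e [u [_ hu /circ_inj[k h] _]]].
apply: (@int_unit_interval e%:Z (n - 8 * k) u) hu.
by rewrite rmorphB rmorphM /= h -pmulrn; ring.
Qed.

Lemma vertex_not_gluedr z z' : vertex z' -> glued z z' -> False.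
Proof.
move=> [n ->] [e [u [_ /andP[u0 u1] _ /circ_inj[k h]]]].
apply: (@int_unit_interval e.+2%:Z (n - 8 * k) (1 - u)); last by apply/andP; split; lra.
by rewrite rmorphB rmorphM /= h -pmulrn -addn2 natrD; ring.
Qed.

Lemma edge_circ_inj (e e' : nat) u u' : (e < 8)%N -> (e' < 8)%N ->
  0 < u < 1 -> 0 < u' < 1 -> circ (e%:R + u) = circ (e'%:R + u') -> e = e' /\ u = u'.
Proof.
move=> he he' hu hu' /circ_inj[k h].
have [] := @int_frac_inj e%:Z (e'%:Z + 8 * k) u u' _ hu hu'.
  by rewrite rmorphD rmorphM /= -!pmulrn h; ring.
by move=> h1 ->; split => //; lia.
Qed.

Lemma gluedP z z' : glued z z' -> exists e u, [/\ (e \in edges)%N, 0 < u < 1,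
  z = circ (e%:R + u) & z' = circ (e.+2%:R + (1 - u))].
Proof.
move=> [e [u [he hu -> ->]]]; exists e, u; split => //; congr circ.
by rewrite -addn2 natrD; ring.
Qed.

Lemma edges_lt e : (e \in edges)%N -> (e.+2 < 8)%N.
Proof. by rewrite !inE => /or4P[] /eqP ->. Qed.

Lemma edges_disjoint e e' : (e \in edges)%N -> (e' \in edges)%N -> e <> e'.+2.
Proof. by rewrite !inE => /or4P[] /eqP -> /or4P[] /eqP ->. Qed.

Lemma edges_lt2 e : (e \in edges)%N -> (e < 8)%N.
Proof. by move/edges_lt; lia. Qed.

Lemma unit_flip u : 0 < u < 1 -> 0 < 1 - u < 1.
Proof. by lra. Qed.

Lemma glued_fun x y y' : glued x y -> glued x y' -> y = y'.
Proof.
move=> /gluedP[e [u [he hu -> ->]]] /gluedP[e' [u' [he' hu' h ->]]].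
by have [<- <-] := edge_circ_inj (edges_lt2 he) (edges_lt2 he') hu hu' h.
Qed.

Lemma glued_inj x x' y : glued x y -> glued x' y -> x = x'.
Proof.
move=> /gluedP[e [u [he hu -> e1]]] /gluedP[e' [u' [he' hu' -> e2]]].
have h := etrans (esym e1) e2.
have [[<-] h'] := edge_circ_inj (edges_lt he) (edges_lt he') (unit_flip hu) (unit_flip hu') h.
by have -> : u = u' by move/addrI/oppr_inj: h'.
Qed.

Lemma glued_not_chain x y y' : glued x y -> glued y y' -> False.
Proof.
move=> /gluedP[e [u [he hu _ e1]]] /gluedP[e' [u' [he' hu' e2 _]]].
have h := etrans (esym e1) e2.
have [h1 _] := edge_circ_inj (edges_lt he) (edges_lt2 he') (unit_flip hu) hu' h.
by have := edges_disjoint he' he; rewrite h1.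
Qed.

Lemma identified_sym x y : identified x y -> identified y x.
Proof.
by case=> [->|[hx hy]|h|h]; [exact: Or41|exact: Or42|exact: Or44|exact: Or43].
Qed.

(** Chains of gluings collapse, since every open edge takes part in a single gluing, either as
    source or as target. *)
Lemma identified_trans x y z : identified x y -> identified y z -> identified x z.
Proof.
move=> h1 h2; case: h1 => [xy|[hx hy]|h|h]; first by rewrite xy.
all: case: h2 => [yz|[hy' hz]|h'|h']; rewrite -?yz.
- exact: Or42.
- exact: Or42.
- by have := vertex_not_glued hy h'.
- by have := vertex_not_gluedr hy h'.
- exact: Or43.
- by have := vertex_not_gluedr hy' h.
- by have := glued_not_chain h h'.
- by rewrite (glued_inj h h'); exact: Or41.
- exact: Or44.
- by have := vertex_not_glued hy' h.
- by rewrite (glued_fun h h'); exact: Or41.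
- by have := glued_not_chain h' h.
Qed.

Lemma edge_glue_identified (x y : set_type disc) :
  edge_glue x y -> identified (val x) (val y).
Proof.
move=> [i [t [/andP[t0 t1] -> ->]]]; have [-> he] := edge_startE i.
rewrite -[val _]/(circ _) -[X in identified _ X]/(circ _).
move: (nth _ _ _) he => e he.
have [t00|tn0] := eqVneq t 0.
  apply: Or42; rewrite t00 addr0 subr0; split; first by exists e%:Z.
  by exists e.+3%:Z; congr circ; rewrite -[_%:~R]/(e.+3%:R) -addn3 natrD; ring.
have [t11|tn1] := eqVneq t 1.
  apply: Or42; rewrite t11 subrr addr0; split.
    by exists e.+1%:Z; congr circ; rewrite -[_%:~R]/(e.+1%:R) -addn1 natrD; ring.
  by exists e.+2%:Z; congr circ; rewrite -[_%:~R]/(e.+2%:R) -addn2 natrD; ring.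
apply: Or43; exists e, t; split => //; last by congr circ; ring.
by rewrite !lt_neqAle eq_sym tn0 t0 tn1.
Qed.

Lemma P_eq z z' : disc z -> disc z' -> P z = P z' -> identified z z'.
Proof.
move=> hz hz' e.
have /gen_quotP h : \pi_(gen_quot (@edge_glue R)) (to_disc z) ==
    \pi_(gen_quot (@edge_glue R)) (to_disc z') by apply/eqP; exact: e.
rewrite -(retr_id hz) -(retr_id hz') -[retr z]/(val (to_disc z)) -[retr z']/(val (to_disc z')).
move: h => {e} h; elim: h => {z z' hz hz'} [x y|x|x y _|x y z _ h1 _ h2].
- exact: edge_glue_identified.
- exact: Or41.
- exact: identified_sym.
- exact: identified_trans h1 h2.
Qed.

Lemma P_glue e t : (e \in edges)%N -> 0 <= t <= 1 ->
  P (circ (e%:R + t)) = P (circ (e%:R + 3 - t)).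
Proof.
move=> he ht; rewrite !P_circ.
suff /gen_quotP/eqP : clos_refl_sym_trans _ (@edge_glue R) (oct_boundary (e%:R + t))
  (oct_boundary (e%:R + 3 - t)) by [].
apply: rst_step.
have [i hi] : exists i : 'I_4, edge_start R i = e%:R.
  by move: he; rewrite !inE => /or4P[] /eqP ->;
    [exists ia1|exists ib1|exists ia2|exists ib2].
exists i, t; split => //; first by rewrite hi.
by congr oct_boundary; rewrite hi; ring.
Qed.

Definition base : Sg := P (circ 0).

Lemma P_vertex (n : int) : P (circ n%:~R) = base.
Proof.
have g0 (e : nat) : (e \in edges)%N -> P (circ e%:R) = P (circ e.+3%:R).
  move=> he; have := @P_glue e 0 he; rewrite lexx ler01 addr0 subr0 => /(_ isT) ->.
  by rewrite -[e.+3]addn3 natrD.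
have g1 (e : nat) : (e \in edges)%N -> P (circ e.+1%:R) = P (circ e.+2%:R).
  move=> he; have := @P_glue e 1 he; rewrite lexx ler01 => /(_ isT).
  have -> : e%:R + 1 = e.+1%:R :> R by rewrite -natr1.
  by have -> : e%:R + 3 - 1 = e.+2%:R :> R by rewrite -[e.+2]addn2 natrD; ring.
have c8 : circ 8 = circ 0 by have := circD8 0 1; rewrite mulr1 add0r.
have all8 (k : nat) : (k < 8)%N -> P (circ k%:R) = base.
  have v3 : P (circ 3%:R) = base by rewrite -g0.
  have v2 : P (circ 2%:R) = base by rewrite (g1 1%N).
  have v1 : P (circ 1%:R) = base by rewrite (g1 0%N).
  have v4 : P (circ 4%:R) = base by rewrite -g0.
  have v7 : P (circ 7%:R) = base by rewrite -g0.
  have v6 : P (circ 6%:R) = base by rewrite (g1 5%N).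
  have v5 : P (circ 5%:R) = base by rewrite (g1 4%N).
  by case: k => [|[|[|[|[|[|[|[|//]]]]]]]].
have -> : circ n%:~R = circ `|(n %% 8)%Z|%N%:R.
  rewrite -[RHS](circD8 _ (n %/ 8)%Z); congr circ.
  have e : ((n %% 8)%Z)%:~R = `|(n %% 8)%Z|%N%:R :> R.
    by rewrite -{1}[(n %% 8)%Z]gez0_abs ?modz_ge0.
  have e' : n%:~R = (n %/ 8)%Z%:~R * 8 + (n %% 8)%Z%:~R :> R.
    by rewrite {1}(divz_eq n 8) rmorphD rmorphM.
  by rewrite -e e'; ring.
by apply: all8; apply: modz_bound.
Qed.

Lemma P_identified z z' : disc z -> disc z' -> identified z z' -> P z = P z'.
Proof.
have gl x y : glued x y -> P x = P y.
  move=> [e [u [he /andP[u0 u1] -> ->]]]; rewrite P_glue // ?ltW //.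
move=> hz hz' [->//|[[n ->] [m ->]]|/gl//|/gl//].
by rewrite !P_vertex.
Qed.
End Disc.

End Octagon.
Import Octagon.

(** * Fibres of the projection onto the surface *)

Module OctagonFibers.
Local Open Scope ring_scope.
Local Open Scope classical_set_scope.
Local Open Scope quotient_scope.

Section Fibers.
Variable R : realType.
Local Notation disc := (@disc R).
Local Notation circ := (@circ R).
Implicit Types (z : (R * R)%type) (s t u : R).

Definition ang u : R := u * pi / 4.

Lemma circE u : circ u = (cos (ang u), sin (ang u)).
Proof. by []. Qed.

Lemma P_inner z z' : disc z -> disc z' -> z.1 ^+ 2 + z.2 ^+ 2 < 1 -> P z = P z' -> z = z'.
Proof.
move=> hz hz' h /(P_eq hz hz') [//|[[n e] _]|[e [v [_ _ ez _]]]|[e [v [_ _ _ ez]]]].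
- by move: h; rewrite e /= cos2Dsin2 ltxx.
- by move: h; rewrite ez /= cos2Dsin2 ltxx.
- by move: h; rewrite ez /= cos2Dsin2 ltxx.
Qed.

Lemma P_edge (e : nat) s : (e \in edges)%N -> e%:R <= s <= e%:R + 1 ->
  P (circ s) = P (circ (2 * e%:R + 3 - s)).
Proof.
move=> he hs; have := @P_glue R e (s - e%:R) he.
have -> : e%:R + (s - e%:R) = s by ring.
have -> : e%:R + 3 - (s - e%:R) = 2 * e%:R + 3 - s by ring.
by apply; lra.
Qed.

Lemma P_edge_fiber (e : nat) s z : (e \in edges)%N ->
  e%:R < s < e%:R + 1 \/ e%:R + 2 < s < e%:R + 3 -> disc z ->
  P (circ s) = P z -> z = circ s \/ z = circ (2 * e%:R + 3 - s).
Proof.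
move=> he hs hz /(P_eq (circ_disc s) hz).
have [k [v [hk hv es hke]]] : exists (k : nat) v,
    [/\ (k < 8)%N, 0 < v < 1, s = k%:R + v & k = e \/ k = e.+2].
  case: hs => hs; [exists e, (s - e%:R)|exists e.+2, (s - e.+2%:R)].
    by rewrite edges_lt2 //; split => //; [lra|ring|left].
  rewrite edges_lt // -[e.+2]addn2 natrD; split => //; [lra|ring|by right].
case=> [->|[[n hn] _]|g|g]; first by left.
- exfalso; move: hn; rewrite es => /circ_inj[j hj].
  apply: (@int_unit_interval R k%:Z (n + 8 * j) v) hv.
  by rewrite rmorphD rmorphM /= -hj -pmulrn.
- right; have [e' [v' [he' hv' h1 h2]]] := gluedP g.
  rewrite es in h1; have [h3 h4] := edge_circ_inj hk (edges_lt2 he') hv hv' h1.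
  case: hke => hke; last by case: (edges_disjoint he' he); rewrite -hke h3.
  by rewrite h2 es -h4 -h3 hke -[e.+2]addn2 natrD; congr circ; ring.
- right; have [e' [v' [he' hv' h1 h2]]] := gluedP g.
  rewrite es in h2; have [h3 h4] := edge_circ_inj hk (edges_lt he') hv (unit_flip hv') h2.
  case: hke => hke; first by case: (edges_disjoint he he'); rewrite -hke h3.
  have ee : e' = e by rewrite h3 in hke; case: hke.
  rewrite h1 es hke ee h4 -[e.+2]addn2 natrD; congr circ; ring.
Qed.

Variable m : R.
(** Rotation by m eighths of a turn. In the rotated coordinates the chords along which twists are
    made become vertical. *)
Definition spin z : (R * R)%type :=
  (z.1 * cos (ang m) - z.2 * sin (ang m), z.1 * sin (ang m) + z.2 * cos (ang m)).
Definition unspin z : (R * R)%type :=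
  (z.1 * cos (ang m) + z.2 * sin (ang m), z.2 * cos (ang m) - z.1 * sin (ang m)).

Lemma spinK : cancel spin unspin.
Proof.
case=> x y; rewrite /spin /unspin /=; have h := cos2Dsin2 (ang m).
congr (_, _).
  by rewrite -[RHS]mulr1 -h; ring.
by rewrite -[RHS]mulr1 -h; ring.
Qed.

Lemma unspinK : cancel unspin spin.
Proof.
case=> x y; rewrite /spin /unspin /=; have h := cos2Dsin2 (ang m).
congr (_, _).
  by rewrite -[RHS]mulr1 -h; ring.
by rewrite -[RHS]mulr1 -h; ring.
Qed.

Lemma spin_norm z : (spin z).1 ^+ 2 + (spin z).2 ^+ 2 = z.1 ^+ 2 + z.2 ^+ 2.
Proof. by rewrite -[RHS]mulr1 -(cos2Dsin2 (ang m)) /spin /=; ring. Qed.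

Lemma spin_circ u : spin (circ u) = circ (m + u).
Proof.
have e : (m + u) * pi / 4 = ang m + ang u by rewrite /ang; ring.
by rewrite /spin /circ /= e cosD sinD; congr (_, _); rewrite /ang; ring.
Qed.

Lemma spin_ctn : ctn spin.
Proof. by change (ctn (fun z => spin z)); rewrite /spin; cont. Qed.
Lemma unspin_ctn : ctn unspin.
Proof. by change (ctn (fun z => unspin z)); rewrite /unspin; cont. Qed.

Lemma circ_opp u : circ (u + 4) = (- cos (ang u), - sin (ang u)).
Proof.
have e : (u + 4) * pi / 4 = ang u + pi by rewrite /ang; field.
by rewrite /circ e cosDpi sinDpi.
Qed.
End Fibers.

End OctagonFibers.
Import OctagonFibers.

(** * Annuli swept by chords of the octagon *)

Module TwistChart.
Local Open Scope ring_scope.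
Local Open Scope classical_set_scope.
Local Open Scope quotient_scope.

Section Chart.
Variable R : realType.
Local Notation disc := (@disc R).
Local Notation circ := (@circ R).
Local Notation Sg := (Sigma2 R).
Implicit Types (z : (R * R)%type) (e u v x y : R) (k n : int).

Variables (m : R) (tw : bool).
Local Notation d := (if tw then 4 else 0 : R).
Local Notation Pm z := (P (spin m z)).

(** The chords joining m - u to m + u for 1/2 <= u <= 3/2 sweep a strip. If [tw] holds there is a
    second strip, opposite to it, and [j] selects one of the two: the end of each is glued to the
    beginning of the other, so that together they form one annulus. Otherwise d = 0 and the two ends
    of the single strip are glued together. *)
Definition fiber_eq := forall (e : R) (j : bool) u, e = 1 \/ e = -1 -> 1 / 2 <= u <= 3 / 2 ->
  P (circ (m + d * j%:R + e * u)) = P (circ (m + d * (~~ j)%:R - e * u)).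
Definition fiber_only := forall (e : R) (j : bool) u z, e = 1 \/ e = -1 -> 1 / 2 < u < 3 / 2 ->
  disc z -> P (circ (m + d * j%:R + e * u)) = P z ->
  z = circ (m + d * j%:R + e * u) \/ z = circ (m + d * (~~ j)%:R - e * u).
Hypothesis fib1 : fiber_eq.
Hypothesis fib2 : fiber_only.

Local Notation C u := (cos (@ang R u)).
Local Notation S u := (sin (@ang R u)).

Definition oddz k : bool := (k %% 2)%Z == 1.
Definition sg k : R := if tw && oddz k then -1 else 1.
Definition prd : int := if tw then 2 else 1.

Lemma oddzS k : oddz (k + 1) = ~~ oddz k.
Proof. by rewrite /oddz; lia. Qed.

Lemma sg_period k n : sg (k + prd * n) = sg k.
Proof.
rewrite /sg /prd; case: tw => //=; congr (if _ then _ else _).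
by rewrite /oddz; lia.
Qed.

Lemma sg_inj k n : sg k = sg n -> exists j, k = n + prd * j.
Proof.
rewrite /sg /prd; case: tw => /= h; last by exists (k - n); ring.
exists ((k - n) %/ 2)%Z; have e : oddz k = oddz n.
  by move: h; case: (oddz k); case: (oddz n) => //= ?; exfalso; lra.
by move: e; rewrite /oddz; lia.
Qed.

Lemma sg_sqr k : sg k = 1 \/ sg k = -1.
Proof. by rewrite /sg; case: ifP; [right|left]. Qed.

Lemma sg_eq k n : 0 < sg k * sg n -> sg k = sg n.
Proof. by case: (sg_sqr k) => ->; case: (sg_sqr n) => -> //; lra. Qed.

Lemma sg_circ k e u : e = 1 \/ e = -1 ->
  spin m (sg k * C u, sg k * (e * S u)) = circ (m + d * (oddz k)%:R + e * u).
Proof.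
move=> he; have -> : m + d * (oddz k)%:R + e * u = m + (e * u + d * (oddz k)%:R) by ring.
rewrite -spin_circ; congr spin.
have E : circ (e * u) = (C u, e * S u).
  case: he => ->; first by rewrite !mul1r.
  rewrite /circ -[(-1 * u) * pi / 4]/(ang (-1 * u)).
  have -> : ang (-1 * u) = - ang u by rewrite /ang; ring.
  by rewrite cosN sinN mulN1r.
rewrite /sg; case: tw => /=; last by rewrite !mul1r mul0r addr0 E.
case: (oddz k); last by rewrite !mul1r mulr0 addr0 E.
rewrite mulr1 circ_opp; case: E; rewrite -!/(ang _) => -> ->.
by rewrite !mulN1r.
Qed.

Lemma ang_bound u : 1 / 2 <= u <= 3 / 2 -> 0 < ang u < pi / 2.
Proof.
move=> hu; have p0 := pi_gt0 R; rewrite /ang.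
have h1 : 0 < u * pi by rewrite mulr_gt0 //; lra.
have h2 : u * pi <= 3 / 2 * pi by rewrite ler_pM2r //; lra.
by apply/andP; split; lra.
Qed.

Lemma C_gt0 u : 1 / 2 <= u <= 3 / 2 -> 0 < C u.
Proof.
move=> /ang_bound h; apply: cos_gt0_pihalf; have := pi_gt0 R; lra.
Qed.

Lemma S_gt0 u : 1 / 2 <= u <= 3 / 2 -> 0 < S u.
Proof. by move=> /ang_bound; exact: sin_gt0_pihalf. Qed.

Lemma C_inj u v : 1 / 2 <= u <= 3 / 2 -> 1 / 2 <= v <= 3 / 2 -> C u = C v -> u = v.
Proof.
move=> /ang_bound hu /ang_bound hv e; have p0 := pi_gt0 R.
have : ang u = ang v.
  by apply: cos_inj e; rewrite in_itv /=; apply/andP; split; lra.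
rewrite /ang => h; have : u * pi = v * pi by lra.
by apply: mulIf; rewrite gt_eqF.
Qed.

(** The k-th passage through a strip, used for v within 1 of 2 k, so that each passage has length 2.
    [sg k] is -1 on the opposite strip, reached by central symmetry. *)
Definition piece k (z : R * R) : Sg :=
  let u := clamp (1 / 2) (3 / 2) z.1 in
  Pm (sg k * C u, sg k * (S u * (z.2 - 2 * k%:~R))).

Definition W u v : Sg := piece (Num.floor ((v + 1) / 2)) (u, v).

Lemma clampB u : 1 / 2 <= clamp (1 / 2) (3 / 2) u <= 3 / 2.
Proof. by apply: clamp_in; lra. Qed.

Lemma piece_step k u v : v = 2 * k%:~R + 1 -> piece k (u, v) = piece (k + 1) (u, v).
Proof.
move=> ->; rewrite /piece /=; have hu := clampB u; move: (clamp _ _ u) hu => {}u hu.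
have -> : 2 * k%:~R + 1 - 2 * k%:~R = 1 :> R by ring.
have -> : 2 * k%:~R + 1 - 2 * (k + 1)%:~R = -1 :> R by rewrite rmorphD /=; ring.
rewrite ![S u * _]mulrC !sg_circ; [|by right|by left].
by rewrite fib1 ?oddzS //; [congr (P (circ _)); ring|left].
Qed.

Lemma W_piece k u v : 2 * k%:~R - 1 <= v <= 2 * k%:~R + 1 -> W u v = piece k (u, v).
Proof.
move=> /andP[h1 h2]; rewrite /W.
have [e|ne] := eqVneq v (2 * k%:~R + 1).
  rewrite (piece_step _ e); congr (piece _ _); rewrite e.
  have -> : (2 * k%:~R + 1 + 1) / 2 = (k + 1)%:~R :> R by rewrite rmorphD /=; field.
  exact: intrKfloor.
congr (piece _ _); apply/eqP; rewrite floor_eq rmorphD /=.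
have h3 : v < 2 * k%:~R + 1 by rewrite lt_neqAle ne.
apply/andP; split; lra.
Qed.

Lemma W_ctn : ctn (fun z => W z.1 z.2).
Proof.
apply: (@integer_pieces_continuous R _ _ (fun z => (z.2 + 1) / 2) _ piece).
- by change (ctn (fun z : R * R => (z.2 + 1) / 2)); cont.
- move=> k; change (ctn (piece k)); rewrite /piece.
  apply: (cont_comp (@P_ctn R)); apply: (cont_comp (spin_ctn (m := m))).
  by rewrite /ang; cont.
move=> k [u v] /= hk; apply: W_piece; move: hk; rewrite rmorphD /= => /andP[h1 h2].
by apply/andP; split; lra.
Qed.

Lemma piece_period k n u v : piece (k + prd * n) (u, v + 2 * prd%:~R * n%:~R) = piece k (u, v).
Proof.
rewrite /piece sg_period /= rmorphD rmorphM /=; congr (Pm (_, _)).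
by congr (_ * (_ * _)); ring.
Qed.

Lemma floor_window v : exists k, 2 * k%:~R - 1 <= v < 2 * k%:~R + 1.
Proof.
exists (Num.floor ((v + 1) / 2)).
have h1 : (Num.floor ((v + 1) / 2))%:~R <= (v + 1) / 2 by exact: ge_floor.
have h2 : (v + 1) / 2 < (Num.floor ((v + 1) / 2) + 1)%:~R by exact: floorD1_gt.
by rewrite rmorphD /= in h2; apply/andP; split; lra.
Qed.

Lemma W_period n u v : W u (v + 2 * prd%:~R * n%:~R) = W u v.
Proof.
have [k /andP[h1 h2]] := floor_window v.
rewrite (@W_piece (k + prd * n)) ?piece_period; last first.
  by rewrite rmorphD rmorphM /=; apply/andP; split; lra.
by rewrite -W_piece // h1 ltW.
Qed.

Lemma in_disc k u w : -1 <= w <= 1 -> disc (spin m (sg k * C u, sg k * (S u * w))).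
Proof.
move=> /andP[w1 w2]; rewrite /Defs.disc /= -/(spin m (_, _)).
have := spin_norm m (sg k * C u, sg k * (S u * w)); rewrite /spin /= => ->.
have s2 : sg k ^+ 2 = 1 by case: (sg_sqr k) => ->; rewrite ?sqrrN expr1n.
rewrite !exprMn s2 !mul1r -(cos2Dsin2 (ang u)) lerD2l ler_piMr ?sqr_ge0 //.
by nra.
Qed.

(* A point of an open chord is determined by its image, up to the gluing of the
   endpoints of the chord. *)
Lemma chord_fiber k u w z : 1 / 2 < u < 3 / 2 -> -1 <= w <= 1 -> disc (spin m z) ->
  Pm (sg k * C u, sg k * (S u * w)) = Pm z ->
  [\/ z = (sg k * C u, sg k * (S u * w)),
      w = 1 /\ z = (sg (k + 1) * C u, sg (k + 1) * - S u) |
      w = -1 /\ z = (sg (k + 1) * C u, sg (k + 1) * S u)].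
Proof.
move=> hu hw hz.
have hu' : 1 / 2 <= u <= 3 / 2 by case/andP: hu => ? ?; rewrite !ltW.
have s2 : sg k ^+ 2 = 1 by case: (sg_sqr k) => ->; rewrite ?sqrrN expr1n.
have [ew|nw] := pselect (w = 1 \/ w = -1).
  rewrite [S u * w]mulrC sg_circ // => h.
  have [e|e] := fib2 ew hu hz h.
    by apply: Or31; apply: (can_inj (spinK m)); rewrite sg_circ.
  have ew' : - w = 1 \/ - w = -1 by case: ew => ->; [right|left; rewrite opprK].
  have e2 : z = (sg (k + 1) * C u, sg (k + 1) * (- w * S u)).
    by apply: (can_inj (spinK m)); rewrite sg_circ // oddzS e; congr circ; ring.
  case: ew e2 => -> ->; [apply: Or32|apply: Or33]; split => //.
    by rewrite mulN1r.
  by rewrite opprK mul1r.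
move=> /(P_inner (in_disc _ _ hw) hz) h; apply: Or31; apply/esym/(can_inj (spinK m))/h.
rewrite spin_norm /= !exprMn s2 !mul1r -(cos2Dsin2 (ang u)) ltrD2l gtr_pMr ?exprn_gt0 ?S_gt0 //.
case/andP: hw => w1 w2.
have n1 : w != 1 by apply/eqP => ?; apply: nw; left.
have n2 : -1 != w by apply/eqP => ?; apply: nw; right.
have l1 : w < 1 by rewrite lt_neqAle n1.
have l2 : -1 < w by rewrite lt_neqAle n2.
by nra.
Qed.

(** Taking v in half-open windows leaves one representative for each chord end, which rules out the
    exceptional cases of [chord_fiber]. *)
Lemma W_inj u u' v v' : 1 / 2 < u < 3 / 2 -> 1 / 2 <= u' <= 3 / 2 -> W u v = W u' v' ->
  u = u' /\ exists j, v = v' + 2 * prd%:~R * j%:~R.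
Proof.
move=> hu hu'.
have hu1 : 1 / 2 <= u <= 3 / 2 by case/andP: hu => ? ?; rewrite !ltW.
have [k /andP[k1 k2]] := floor_window v; have [k' /andP[k1' k2']] := floor_window v'.
rewrite (@W_piece k) ?k1 ?ltW // (@W_piece k') ?k1' ?ltW // /piece /= !clamp_id //.
have [C0 C0'] := (C_gt0 hu1, C_gt0 hu'); have [S0 S0'] := (S_gt0 hu1, S_gt0 hu').
set w := v - _; set w' := v' - _.
have [w1 w2] : -1 <= w /\ w < 1 by rewrite /w; split; lra.
have [w1' w2'] : -1 <= w' /\ w' < 1 by rewrite /w'; split; lra.
have wb : -1 <= w <= 1 by rewrite w1 ltW.
have wb' : -1 <= w' <= 1 by rewrite w1' ltW.
have aux n : sg k' * C u' = sg n * C u -> sg n = sg k' /\ u = u'.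
  move=> e; have se : sg n = sg k'.
    apply: sg_eq; rewrite -(pmulr_lgt0 _ C0') -mulrA e.
    by case: (sg_sqr n) => ->; rewrite ?mul1r ?mulN1r ?opprK.
  split => //; move: e; rewrite se => e; apply: C_inj => //.
  by case: (sg_sqr k') e => ->; rewrite ?mul1r ?mulN1r // => /oppr_inj.
case/(chord_fiber hu wb (in_disc k' u' wb')) => [[/aux[se eu] e2]|[h _]|[h [/aux[se eu] e2]]].
- split => //; have [j hj] := sg_inj se; exists j.
  have ww : w' = w.
    have : S u * w' = S u * w.
      move: e2; rewrite -se -eu; case: (sg_sqr k) => ->; rewrite ?mul1r ?mulN1r //.
      exact: oppr_inj.
    by apply: mulfI; rewrite gt_eqF.
  by move: ww; rewrite /w /w' hj rmorphD rmorphM /=; lra.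
- by move: w2; rewrite h ltxx.
- exfalso; have : S u * w' = S u.
    move: e2; rewrite -se -eu; case: (sg_sqr (k + 1)) => ->; rewrite ?mul1r ?mulN1r //.
    exact: oppr_inj.
  rewrite -[RHS]mulr1 => /mulfI; rewrite gt_eqF // => /(_ isT) ee.
  by move: w2'; rewrite ee ltxx.
Qed.
End Chart.

End TwistChart.
Import TwistChart.

(** * Dehn twists of the surface *)

Module DehnTwist.
Local Open Scope ring_scope.
Local Open Scope classical_set_scope.
Local Open Scope quotient_scope.

Section Twist.
Variable R : realType.
Local Notation disc := (@disc R).
Local Notation circ := (@circ R).
Local Notation Sg := (Sigma2 R).
Implicit Types (z : (R * R)%type) (e u v x : R) (k n : int).

Variables (m : R) (tw : bool).
Local Notation Pm z := (P (spin m z)).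
Hypothesis fib1 : fiber_eq m tw.
Hypothesis fib2 : fiber_only m tw.
Local Notation W := (W m tw).
Local Notation sg := (sg R tw).
Local Notation per := (2 * (prd tw)%:~R : R).
Local Notation C u := (cos (@ang R u)).
Local Notation S u := (sin (@ang R u)).

(** The fraction of a full turn: 0 on the chord u = 3/2 and 1 on the chord u = 1/2, so that the
    twist is the identity on the boundary of the annulus. *)
Definition lam u : R := clamp 0 1 (3 / 2 - u).

Lemma W_per n u v : W u (v + per * n%:~R) = W u v.
Proof. exact: W_period. Qed.

Definition in_strip (y : Sg) := exists u v, 1 / 2 < u < 3 / 2 /\ y = W u v.

Definition twist_rel n (y y' : Sg) :=
  (exists u v, [/\ 1 / 2 < u < 3 / 2, y = W u v & y' = W u (v + per * n%:~R * lam u)])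
  \/ (~ in_strip y /\ y' = y).

Lemma twist_ex n (y : Sg) : exists y', twist_rel n y y'.
Proof.
have [[u [v [hu ->]]]|h] := pselect (in_strip y); last by exists y; right.
by exists (W u (v + per * n%:~R * lam u)); left; exists u, v.
Qed.

Definition twist n : Sg -> Sg := projT1 (choice (twist_ex n)).
Lemma twistP n (y : Sg) : twist_rel n y (twist n y).
Proof. exact: projT2 (choice (twist_ex n)) y. Qed.

Lemma lam0 : lam (3 / 2) = 0.
Proof. by rewrite /lam subrr clamp_lo ?ler01. Qed.
Lemma lam1 : lam (1 / 2) = 1.
Proof. by rewrite /lam clamp_hi ?ler01 //; lra. Qed.

(** The formula extends to the boundary chords, where the shift is a multiple of the period. *)
Lemma twist_W n u v : 1 / 2 <= u <= 3 / 2 ->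
  twist n (W u v) = W u (v + per * n%:~R * lam u).
Proof.
move=> hu; case: (twistP n (W u v)) => [[u' [v' [hu' e ->]]]|[h ->]].
  have [eu [j ej]] := W_inj fib1 fib2 hu' hu (esym e).
  by rewrite ej eu -[RHS](W_per j); congr (TwistChart.W _ _ _ _); ring.
case/andP: hu => u1 u2.
have [e1|n1] := eqVneq u (1 / 2).
  by rewrite e1 lam1 mulr1 W_per.
have [e2|n2] := eqVneq u (3 / 2).
  by rewrite e2 lam0 mulr0 addr0.
case: h; exists u, v; split => //.
by rewrite !lt_neqAle eq_sym n1 u1 n2 u2.
Qed.

Lemma twist_out n z : disc z -> (forall k u, 1 / 2 < u < 3 / 2 -> (unspin m z).1 <> sg k * C u) ->
  twist n (P z) = P z.
Proof.
move=> hz h; case: (twistP n (P z)) => [[u [v [hu e _]]]|[_ //]].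
exfalso; have [k /andP[k1 k2]] := floor_window v.
have hu1 : 1 / 2 <= u <= 3 / 2 by case/andP: hu => ? ?; rewrite !ltW.
move: e; rewrite (W_piece fib1 (k := k)) ?k1 ?ltW // /piece /= clamp_id // => /esym e.
have wb : -1 <= v - 2 * k%:~R <= 1 by apply/andP; split; lra.
have hz' : disc (spin m (unspin m z)) by rewrite unspinK.
rewrite -(unspinK m z) in e.
by case: (chord_fiber fib2 hu wb hz' e) => [ez|[_ ez]|[_ ez]];
  (apply: (h _ _ hu); rewrite ez).
Qed.

Lemma twistK n : cancel (twist n) (twist (- n)).
Proof.
move=> y; case: (twistP n y) => [[u [v [hu -> ->]]]|[h ->]].
  rewrite twist_W; last by case/andP: hu => ? ?; rewrite !ltW.
  by congr (TwistChart.W _ _ _ _); rewrite rmorphN /=; ring.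
case: (twistP (- n) y) => [[u [v [hu e _]]]|[_ //]].
by case: h; exists u, v.
Qed.

Lemma angK u : ang (u * 4 / pi) = u.
Proof. by rewrite /ang divfK ?gt_eqF ?pi_gt0 // mulfK ?pnatr_eq0. Qed.

Local Notation X0 := (C (3 / 2)).
Local Notation X1 := (C (1 / 2)).
Let h32 : 1 / 2 <= (3 / 2 : R) <= 3 / 2. Proof. by lra. Qed.
Let h12 : 1 / 2 <= (1 / 2 : R) <= 3 / 2. Proof. by lra. Qed.

Lemma ang_in u : 1 / 2 <= u <= 3 / 2 -> ang u \in `[0, pi]%R.
Proof.
move=> /ang_bound /andP[a0 a1]; have p0 := pi_gt0 R.
by rewrite in_itv /=; apply/andP; split; lra.
Qed.

Lemma X0_gt0 : 0 < X0. Proof. exact: C_gt0. Qed.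
Lemma X1_lt1 : X1 < 1.
Proof.
have h0 : (0 : R) \in `[0, pi]%R by rewrite in_itv /= lexx ltW ?pi_gt0.
have e := @ltr_cos R _ _ h0 (ang_in h12); rewrite cos0 in e.
by rewrite e; case/andP: (ang_bound h12).
Qed.
Lemma X01 : X0 <= X1.
Proof.
have e := @ltr_cos R _ _ (ang_in h12) (ang_in h32).
rewrite ltW // e /ang ltr_pM2r ?invr_gt0 // ltr_pM2r ?pi_gt0 //; lra.
Qed.

(** The inverse of u |-> cos (ang u) on [1/2, 3/2], extended to the line by clamping. *)
Definition uang x : R := acos (clamp X0 X1 x) * 4 / pi.

Lemma clampX x : -1 < clamp X0 X1 x < 1.
Proof.
have /andP[c1 c2] := clamp_in x X01.
have := X0_gt0; have := X1_lt1 => ? ?; apply/andP; split; lra.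
Qed.

Lemma clampX' x : clamp X0 X1 x \in `[-1, 1]%R.
Proof. by rewrite in_itv /=; case/andP: (clampX x) => ? ?; rewrite !ltW. Qed.

Lemma C_uang x : C (uang x) = clamp X0 X1 x.
Proof. by rewrite /uang angK acosK // clampX'. Qed.

Lemma uang_bound x : 1 / 2 <= uang x <= 3 / 2.
Proof.
have /andP[c1 c2] := clamp_in x X01; move: c1 c2.
have p0 := pi_gt0 R.
have hin : acos (clamp X0 X1 x) \in `[0, pi]%R.
  by rewrite in_itv /= acos_ge0 ?acos_lepi //; have := clampX' x; rewrite in_itv.
have ea : ang (uang x) = acos (clamp X0 X1 x) by rewrite /uang angK.
have hin' : ang (uang x) \in `[0, pi]%R by rewrite ea.
rewrite -C_uang => c1 c2; apply/andP; split.
  rewrite leNgt; apply/negP => h.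
  have : X1 < C (uang x).
    rewrite ltr_cos ?hin' ?ang_in // /ang.
    by rewrite ltr_pM2r ?invr_gt0 // ltr_pM2r.
  by rewrite ltNge c2.
rewrite leNgt; apply/negP => h.
have : C (uang x) < X0.
  rewrite ltr_cos ?hin' ?ang_in // /ang.
  by rewrite ltr_pM2r ?invr_gt0 // ltr_pM2r.
by rewrite ltNge c1.
Qed.

Lemma uang_ctn (X : topologicalType) (f : X -> R) : ctn f -> ctn (fun p => uang (f p)).
Proof.
move=> cf; rewrite /uang.
have ca : ctn (fun p => acos (clamp X0 X1 (f p))).
  move=> p; apply: (@continuous_comp _ _ _ (fun p => clamp X0 X1 (f p)) (@acos R)).
    by apply: cont_clamp.
  by apply: continuous_acos; exact: clampX.
by cont.
Qed.

Lemma uang_X0 : uang X0 = 3 / 2.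
Proof. by apply: C_inj => //; [exact: uang_bound|rewrite C_uang clamp_id // lexx X01]. Qed.
Lemma uang_X1 : uang X1 = 1 / 2.
Proof. by apply: C_inj => //; [exact: uang_bound|rewrite C_uang clamp_id // lexx X01]. Qed.

Lemma chord_height x (y : R) : disc (x, y) -> X0 <= x <= X1 -> -1 <= y / S (uang x) <= 1.
Proof.
rewrite /Defs.disc /= => h hx.
have S0 := S_gt0 (uang_bound x).
have e : S (uang x) ^+ 2 = 1 - x ^+ 2.
  by have := cos2Dsin2 (ang (uang x)); rewrite C_uang clamp_id // => <-; ring.
rewrite -ler_norml -(@ler_pXn2r _ 2) ?nnegrE // expr1n real_normK ?num_real //.
rewrite exprMn exprVn ler_pdivrMr ?exprn_gt0 // mul1r e; lra.
Qed.

Lemma W_disc x (y : R) : disc (x, y) -> X0 <= x <= X1 -> Pm (x, y) = W (uang x) (y / S (uang x)).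
Proof.
move=> hd hx; have /andP[h1 h2] := chord_height hd hx.
have S0 := S_gt0 (uang_bound x).
rewrite (W_piece fib1 (k := 0)) ?mulr0 ?add0r ?sub0r ?h1 ?h2 // /piece /= clamp_id ?uang_bound //.
rewrite C_uang clamp_id // mulr0 subr0 /TwistChart.sg /oddz /= andbF !mul1r.
by rewrite mulrC divfK ?gt_eqF.
Qed.

Lemma W_disc_opp x (y : R) : tw -> disc (x, y) -> X0 <= - x <= X1 ->
  Pm (x, y) = W (uang (- x)) (2 - y / S (uang (- x))).
Proof.
move=> htw hd hx.
have hd' : disc (- x, y) by move: hd; rewrite /Defs.disc /= sqrrN.
have /andP[h1 h2] := chord_height hd' hx.
have S0 := S_gt0 (uang_bound (- x)).
rewrite (W_piece fib1 (k := 1)) ?mulr1; last by apply/andP; split; lra.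
rewrite /piece /= clamp_id ?uang_bound // C_uang clamp_id // /TwistChart.sg htw /=.
rewrite !mulN1r opprK mulr1 (_ : 2 - _ - 2 = - (y / S (uang (- x)))); last by ring.
by rewrite mulrN opprK mulrC divfK ?gt_eqF.
Qed.

Lemma lam_ctn (X : topologicalType) (f : X -> R) : ctn f -> ctn (fun p => lam (f p)).
Proof. by move=> cf; rewrite /lam; cont. Qed.

(** In rotated coordinates there is one formula on each strip and the identity elsewhere; these
    closed regions meet along the boundary chords, where the formulas agree. *)
Lemma twist_ctn n : ctn (twist n).
Proof.
pose r z := retr (unspin m z).
have cr : ctn r by apply: (cont_comp (@retr_ctn R)); exact: unspin_ctn.
have dr z : disc ((r z).1, (r z).2) by have := retr_disc (unspin m z); rewrite inE -surjective_pairing.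
have cr1 : ctn (fun z => (r z).1) by cont.
have cr2 : ctn (fun z => (r z).2) by cont.
pose q (s : R) (w : R * R -> R) z :=
  W (uang (s * (r z).1)) (w z + per * n%:~R * lam (uang (s * (r z).1))).
have cq s w : ctn w -> ctn (q s w).
  move=> cw; rewrite /q.
  apply: (cont_comp (h := fun z => W z.1 z.2)
    (f := fun z => (uang (s * (r z).1), w z + per * n%:~R * lam (uang (s * (r z).1))))).
    exact: W_ctn.
  by cont; [apply: uang_ctn; cont|apply: lam_ctn; apply: uang_ctn; cont].
have cS s : ctn (fun z => (S (uang (s * (r z).1)))^-1).
  apply: contV => [z|]; first by rewrite gt_eqF // S_gt0 // uang_bound.
  by apply: cont_sin; rewrite /ang; cont; apply: uang_ctn; cont.
pose f1 := q 1 (fun z => (r z).2 / S (uang (1 * (r z).1))).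
pose f2 := q (-1) (fun z => 2 - (r z).2 / S (uang (-1 * (r z).1))).
have cf1 : ctn f1 by apply: cq; cont; exact: cS.
have cf2 : ctn f2 by apply: cq; cont; exact: cS.
have cid : ctn (fun z => P (spin m (r z))).
  by apply: (cont_comp (@P_ctn R)); apply: (cont_comp (spin_ctn (m := m))).
pose f3 z := if tw && (X0 <= - (r z).1 <= X1) then f2 z else P (spin m (r z)).
have cle (f g : R * R -> R) : ctn f -> ctn g -> closed [set z | f z <= g z].
  move=> cf cg; rewrite (_ : [set z | _] = (fun z => g z - f z) @^-1` [set x | 0 <= x]).
    by apply: closed_comp; [move=> z _; have : ctn (fun z => g z - f z) by cont|exact: closed_ge].
  by apply/seteqP; split => z /=; rewrite subr_ge0.
have edge s w z : (s * (r z).1 = X0 \/ s * (r z).1 = X1) -> q s w z = W (uang (s * (r z).1)) (w z).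
  rewrite /q => -[] ->.
    by rewrite uang_X0 lam0 mulr0 addr0.
  by rewrite uang_X1 lam1 mulr1 W_per.
have cover (s : R) (w : R * R -> R) (g : R * R -> Sg) : ctn (q s w) -> ctn g ->
    (forall z, X0 <= s * (r z).1 <= X1 -> W (uang (s * (r z).1)) (w z) = Pm (r z)) ->
    (forall z, s * (r z).1 = X0 \/ s * (r z).1 = X1 -> g z = Pm (r z)) ->
    ctn (fun z => if X0 <= s * (r z).1 <= X1 then q s w z else g z).
  move=> cqs cg hq hg.
  apply: (@closed_cover_continuous _ _ ([set z | X0 <= s * (r z).1] `&` [set z | s * (r z).1 <= X1])
    ([set z | s * (r z).1 <= X0] `|` [set z | X1 <= s * (r z).1]) _ (q s w) g) => //.
  - by apply: closedI; apply: cle; cont.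
  - by apply: closedU; apply: cle; cont.
  - move=> z /=; case: (leP X0 (s * (r z).1)) => h1; case: (leP (s * (r z).1) X1) => h2.
    + by left.
    + by right; right; exact: ltW.
    + by right; left; exact: ltW.
    + by right; left; exact: ltW.
  - by move=> z /= [-> ->].
  move=> z hz; case: ifP => // hb; case/andP: (hb) => h1 h2.
  have hz' : s * (r z).1 = X0 \/ s * (r z).1 = X1.
    by case: hz => /= hz; [left|right]; apply/eqP; rewrite eq_le ?h1 ?h2 hz.
  by rewrite edge // hg // hq.
have eqr z : Pm (r z) = Pm ((r z).1, (r z).2) by rewrite -surjective_pairing.
have cf3 : ctn f3.
  rewrite /f3; case htw : tw => //=.
  have := @cover (-1) (fun z => 2 - (r z).2 / S (uang (-1 * (r z).1))) _ cf2 cid.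
  rewrite (_ : (fun z => if _ then q _ _ z else _) =
    (fun z => if X0 <= - (r z).1 <= X1 then f2 z else Pm (r z))); last first.
    by apply/funext => z; rewrite mulN1r.
  apply => // z; rewrite mulN1r => hz.
  by rewrite eqr W_disc_opp ?htw.
have cf : ctn (fun z => if X0 <= 1 * (r z).1 <= X1 then f1 z else f3 z).
  apply: cover => // z.
    by rewrite mul1r => hz; rewrite eqr W_disc.
  rewrite mul1r /f3 => hz; rewrite ifF //; apply/negP => /and3P[_ h1 h2].
  by case: hz => hz; have := X0_gt0; have := X01; lra.
have -> : twist n = (fun y => twist n y) by [].
apply/quotient_continuous.
rewrite (_ : _ \o _ = (fun z => if X0 <= 1 * (r z).1 <= X1 then f1 z else f3 z) \o val).
  by move=> x; apply: continuous_comp; [exact: initial_continuous|exact: cf].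
apply/funext => x /=; rewrite P_val.
have hx : disc (val x) by have := valP x; rewrite inE.
have hu : disc (unspin m (val x)).
  by move: hx; rewrite /Defs.disc /= -{1 2}(unspinK m (val x)) spin_norm.
have er : r (val x) = unspin m (val x) by rewrite /r retr_id.
have ex : P (val x) = Pm (r (val x)) by rewrite er unspinK.
rewrite [1 * (r _).1]mul1r; case: ifP => h1.
  by rewrite ex eqr W_disc // twist_W ?uang_bound // /f1 /q mul1r.
rewrite /f3; case: ifP => h2.
  case/andP: h2 => htw h2.
  by rewrite ex eqr W_disc_opp // twist_W ?uang_bound // /f2 /q mulN1r.
rewrite -ex; apply: twist_out => // k u hu' e; rewrite -er in e.
have hu1 : 1 / 2 <= u <= 3 / 2 by case/andP: hu' => ? ?; rewrite !ltW.
have b : X0 <= C u <= X1.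
  by rewrite !leNgt !ltr_cos ?ang_in // -!leNgt /ang !ler_pM2r ?invr_gt0 ?pi_gt0 //; case/andP: hu1 => -> ->.
move: e; rewrite /TwistChart.sg; case: ifP => [/andP[htw _] e|_ e].
  by move: h2; rewrite e mulN1r opprK htw b.
by move: h1; rewrite e (_ : 1 * C u = C u) ?b // mul1r.
Qed.
End Twist.

End DehnTwist.
Import DehnTwist.

(** * Action of surface maps on edge words *)

Module LetterPaths.
Local Open Scope ring_scope.
Local Open Scope classical_set_scope.
Local Open Scope quotient_scope.

Section Letters.
Variable R : realType.
Local Notation Sg := (Sigma2 R).
Local Notation base := (base R).
Local Notation lp := (@letter_path R).
Local Notation path_htpy := (@path_htpy R Sg base).
Local Notation dpath := (@dpath R Sg base).
Local Notation good := (@good R Sg base).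
Local Notation l0 := (ia1, true).
Implicit Types (l : letter) (u w : word) (p q : R -> Sg) (ps qs : seq (R -> Sg)).

Lemma letter_path_good l : good (lp l).
Proof.
have e : exists k : nat, edge_start R l.1 = k%:R by exists (nth 0%N edges l.1); case: (edge_startE R l.1).
have [k ek] := e.
have vert (n : nat) : P (circ (k%:R + n%:R)) = base by rewrite -natrD; exact: (P_vertex R (k + n)%:Z).
have v0 := vert 0%N; have v1 := vert 1%N; rewrite addr0 in v0.
split.
- rewrite (_ : lp l = fun t => P (circ (edge_start R l.1 + if l.2 then t else 1 - t))).
    apply: (cont_comp (@P_ctn R)); apply: circ_ctn; cont.
    by case: l.2; cont.
  by apply/funext => t; exact: letter_pathE.
- by rewrite letter_pathE ek; case: l.2; rewrite ?addr0 ?subr0.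
- by rewrite letter_pathE ek; case: l.2; rewrite ?subrr ?addr0.
Qed.

Lemma letter_path_inv l : lp (linv l) = fun t => lp l (1 - t).
Proof.
apply/funext => t; rewrite !letter_pathE /=; case: l.2 => //=.
by rewrite subKr.
Qed.

Lemma word_loopE w : @word_loop R w = loop_of base (map lp w).
Proof.
apply/funext => t; rewrite /word_loop /loop_of size_map.
have [w0|w0] := posnP (size w).
  rewrite (size0nil w0) /= nth_nil mulr0 floor0 /=.
  have -> : 0%:~R = 0 :> R by [].
  by rewrite subrr; case: (letter_path_good l0).
by rewrite (nth_map l0) // modz_bound.
Qed.

Definition seq_htpy ps qs := size ps = size qs /\
  forall i, (i < size ps)%N -> path_htpy (nth dpath ps i) (nth dpath qs i).

Lemma seq_htpy_cat ps qs ps' qs' : seq_htpy ps qs -> seq_htpy ps' qs' ->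
  seq_htpy (ps ++ ps') (qs ++ qs').
Proof.
move=> [e h] [e' h']; split; first by rewrite !size_cat e e'.
move=> i; rewrite size_cat !nth_cat -e => hi'; case: ltnP => hi; first exact: h.
by apply: h'; rewrite ltn_subLR.
Qed.

(* The map [T] sends the edge of [l] to a path homotopic to the concatenation of
   the edges of [u]. *)
Definition maps_letter (T : Sg -> Sg) l u := exists (D : R -> Sg) ps,
  [/\ path_htpy (T \o lp l) D, is_concat base D ps, seq_htpy (map lp u) ps,
      (0 < size u)%N & goods base ps].

Lemma maps_letter_inv T l u : maps_letter T l u -> maps_letter T (linv l) (winv u).
Proof.
move=> [D [ps [hD cD [es hs] su gps]]].
exists (fun t => D (1 - t)), [seq (fun t => p (1 - t)) | p <- rev ps].
rewrite size_map in es hs.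
split.
- have := path_htpy_rev hD; rewrite (_ : (fun t => (T \o lp l) (1 - t)) = T \o lp (linv l)) //.
  by rewrite letter_path_inv.
- exact: is_concat_rev.
- split; first by rewrite !size_map !size_rev size_map.
  move=> i; rewrite size_map /winv size_rev size_map => hi.
  rewrite (nth_map l0) ?size_rev ?size_map // nth_rev ?size_map // (nth_map l0); last first.
    by rewrite ltn_subrL; case: (size u) hi.
  rewrite (nth_map dpath) ?size_rev -?es // nth_rev -?es // letter_path_inv.
  have hj : (size u - i.+1 < size u)%N by lia.
  by have := path_htpy_rev (hs _ hj); rewrite (nth_map l0).
- by rewrite /winv size_rev size_map.
- move=> i; rewrite size_map size_rev => hi.
  rewrite (nth_map dpath) ?size_rev // nth_rev //.
  have [|cp p0 p1] := gps (size ps - i.+1)%N; first by rewrite ltn_subrL; case: (size ps) hi.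
  split; rewrite ?subr0 ?subrr //.
  by apply: (cont_comp cp); cont.
Qed.

(** The edges of the substituted word are deformed into the paths [ps], these are merged into the
    paths [D] by [loop_of_flatten], and each [D] is deformed into the image of an edge. *)
Lemma maps_word T (tau : letter -> word) w : ctn T -> T base = base ->
  (forall l, maps_letter T l (tau l)) ->
  fhtpy (@word_loop R (flatten (map tau w))) (T \o @word_loop R w).
Proof.
move=> cT T0 /choice[D /choice[ps h]].
have goodD l : good (T \o lp l).
  by have [c h0 h1] := letter_path_good l; split; [exact: (cont_comp cT)|rewrite /= h0|rewrite /= h1].
have e1 : seq_htpy (map lp (flatten (map tau w))) (flatten (map ps w)).
  elim: w => [|l w ih]; first by split.
  by rewrite /= map_cat; apply: seq_htpy_cat ih; case: (h l).
have e2 : loop_of base (map (fun l => T \o lp l) w) = T \o @word_loop R w.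
  apply/funext => t; rewrite word_loopE /loop_of /= !size_map.
  have [w0|w0] := posnP (size w); first by rewrite (size0nil w0) /= !nth_nil.
  by rewrite !(nth_map l0) // modz_bound.
rewrite word_loopE -e2.
apply: fhtpy_trans (loop_of_htpy e1.1 e1.2) _.
apply: fhtpy_trans (@loop_of_flatten _ _ base (map ps w) (map D w) _ _ _ _) _.
- by rewrite !size_map.
- by move=> i; rewrite size_map => hi; rewrite !(nth_map l0) //; case: (h (nth l0 w i)).
- move=> i; rewrite size_map => hi; rewrite !(nth_map l0) //.
  by case: (h (nth l0 w i)) => _ _ [+ _]; rewrite size_map => <-.
- elim: w {e1 e2} => [|l w ih] //= i; rewrite nth_cat size_cat => hi'.
  case: ltnP => hi; first by case: (h l) => _ _ _ _; apply.
  by apply: ih; rewrite ltn_subLR.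
apply: loop_of_htpy; first by rewrite !size_map.
move=> i; rewrite size_map => hi; rewrite !(nth_map l0) //.
by apply: path_htpy_sym; case: (h (nth l0 w i)).
Qed.

Definition geometric (f : Gamma2 -> Gamma2) := forall (c : R -> Sg) g,
  simple_closed_curve c -> represents c g ->
  exists c' : R -> Sg, simple_closed_curve c' /\ represents c' (f g).

(** Injectivity of T transports simplicity, and composing T with the homotopy from a word loop
    transports the free homotopy class. *)
Lemma maps_geometric T (s : 'I_4 -> word) (f : {multiplicative Gamma2 -> Gamma2}) :
  ctn T -> injective T -> T base = base -> (forall i, maps_letter T (i, true) (s i)) ->
  (forall i, f (gamma_gen i) = cls (s i)) -> geometric f.
Proof.
move=> cT iT T0 hs hf c g [[cc pc] sc] [w wg hw].
pose tau l := if l.2 then s l.1 else winv (s l.1).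
have htau l : maps_letter T l (tau l).
  by case: l => i [] //=; exact: (@maps_letter_inv T (i, true)).
exists (T \o c); split; first split.
- by split; [exact: (cont_comp cT)|move=> t /=; rewrite pc].
- by move=> x y /iT; exact: sc.
exists (flatten (map tau w)).
  rewrite -wg multiplicative_cls -weval_gen.
  elim: {hw wg} w => [|[i b] w ih] //=; rewrite weval_cat ih; congr (_ * _)%g.
  rewrite /tau /leval /= hf; case: b; rewrite ?weval_winv ?weval_gen //.
apply: fhtpy_trans (maps_word w cT T0 htau) _.
case: hw => [H [cH pH H0 H1]].
exists (T \o H); split => /=.
- exact: (cont_comp cT).
- by move=> x t; rewrite pH.
- by move=> t; rewrite H0.
- by move=> t; rewrite H1.
Qed.

Lemma maps_letter_id T l (u : letter) :
  (forall t, 0 <= t <= 1 -> T (lp l t) = lp u t) -> maps_letter T l [:: u].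
Proof.
move=> e; exists (lp u), [:: lp u]; split => //.
- apply: path_htpy_sym; apply: path_htpy_eq (path_htpy_refl (letter_path_good u)) _.
  by move=> t ht; rewrite /= e.
- by case=> [|//] t _ _; rewrite add0r divr1.
- split => // -[|//] _; apply: path_htpy_refl; exact: letter_path_good.
- by case=> [|//] _; exact: letter_path_good.
Qed.
End Letters.

End LetterPaths.
Import LetterPaths.

(** * Effect of a twist on the edges *)

Module TwistedLetters.
Local Open Scope ring_scope.
Local Open Scope classical_set_scope.
Local Open Scope quotient_scope.

Section TwistLetters.
Variable R : realType.
Local Notation disc := (@disc R).
Local Notation circ := (@circ R).
Local Notation Sg := (Sigma2 R).
Local Notation base := (base R).
Local Notation lp := (@letter_path R).
Local Notation l0 := (ia1, true).
Local Notation good := (@good R Sg base).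
Local Notation dpath := (@dpath R Sg base).
Implicit Types (z : (R * R)%type) (e u v x t : R) (k n : int).

Variables (mi : int) (tw : bool).
Local Notation m := (mi%:~R + 1 / 2 : R).
Local Notation dz := (if tw then 4 else 0 : int).
Local Notation d := (if tw then 4 else 0 : R).
Local Notation Pm z := (P (spin m z)).
Hypothesis fib1 : fiber_eq m tw.
Hypothesis fib2 : fiber_only m tw.
Local Notation W := (W m tw).
Local Notation sg := (sg R tw).
Local Notation per := (2 * (prd tw)%:~R : R).
Local Notation C u := (cos (@ang R u)).
Local Notation S u := (sin (@ang R u)).

Lemma piece_side k e u : e = 1 \/ e = -1 -> 1 / 2 <= u <= 3 / 2 ->
  W u (2 * k%:~R + e) = P (circ (m + d * (oddz k)%:R + e * u)).
Proof.
move=> he hu; rewrite (W_piece fib1 (k := k)); last by case: he => ->; apply/andP; split; lra.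
rewrite /piece /= clamp_id // -sg_circ // addrAC subrr add0r.
by rewrite [S u * e]mulrC.
Qed.

Lemma dzE (b : bool) : d * b%:R = (dz * b%:Z)%:~R :> R.
Proof. by case: tw; case: b; rewrite /= ?mulr1 ?mulr0 ?mul0r. Qed.

(** The open strips end on the edges mi + 1 and mi - 1, and on their opposites if [tw] holds; the
    excluded values of i are exactly these. *)
Lemma twist_edge n (i : nat) s : i%:R <= s <= i%:R + 1 ->
  (forall (j : bool) k, i%:Z <> mi + 1 + dz * j + 8 * k /\ i%:Z <> mi - 1 + dz * j + 8 * k) ->
  twist m tw n (P (circ s)) = P (circ s).
Proof.
move=> hs hi; apply: twist_out => //; first exact: circ_disc.
move=> k u hu; set Q := unspin _ _ => e.
have [f hf h] : exists2 f : R, f = 1 \/ f = -1 & circ s = circ (m + d * (oddz k)%:R + f * u).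
  have eQ : spin m Q = circ s by rewrite unspinK.
  have s2 : sg k ^+ 2 = 1 by case: (sg_sqr R tw k) => ->; rewrite ?sqrrN expr1n.
  have e1 : Q.2 ^+ 2 = S u ^+ 2.
    have := spin_norm m Q; rewrite eQ.
    rewrite e exprMn s2 mul1r => h; have := cos2Dsin2 (ang u).
    by have := cos2Dsin2 (ang s); move: h; rewrite /= -!/(ang _); lra.
  have [g hg eg] : exists2 g : R, g = 1 \/ g = -1 & Q.2 = sg k * (g * S u).
    have := eqf_sqr Q.2 (S u); rewrite e1 eqxx => /esym/orP[]/eqP ->.
      by exists (sg k); [exact: sg_sqr|case: (sg_sqr R tw k) => ->; rewrite ?mulN1r ?mul1r ?opprK].
    exists (- sg k); first by case: (sg_sqr R tw k) => ->; [right|left; rewrite opprK].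
    by case: (sg_sqr R tw k) => ->; rewrite ?opprK ?mulN1r ?mul1r.
  exists g => //; rewrite -sg_circ // -eQ -eg -e.
  by rewrite -surjective_pairing.
have [j hj] := circ_inj h; rewrite dzE in hj.
have [u1 u2] := andP hu; have [s1 s2] := andP hs.
have key (a b : int) x : s = a%:~R + x -> b%:~R = i%:R :> R -> 0 < x < 1 -> a = b.
  move=> ea eb /andP[x1 x2].
  have h1 : (a%:~R : R) < (b + 1)%:~R by rewrite rmorphD /= eb; lra.
  have h2 : (b%:~R : R) < (a + 1)%:~R by rewrite rmorphD /= eb; lra.
  by rewrite !ltr_int in h1 h2; lia.
have [n1 n2] := hi (oddz k) j.
case: hf hj => -> hj.
  have ea : s = (mi + 1 + dz * oddz k + 8 * j)%:~R + (u - 1 / 2).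
    by rewrite hj !rmorphD rmorphM /=; field.
  by apply: n1; rewrite (key _ i%:Z _ ea) //; apply/andP; split; lra.
have ea : s = (mi - 1 + dz * oddz k + 8 * j)%:~R + (3 / 2 - u).
  by rewrite hj !rmorphD rmorphM /= rmorphN1; field.
by apply: n2; rewrite (key _ i%:Z _ ea) //; apply/andP; split; lra.
Qed.

Definition mix (s : R) (a b : R * R) : (R * R)%type :=
  ((1 - s) * a.1 + s * b.1, (1 - s) * a.2 + s * b.2).
Lemma mix0 a b : mix 0 a b = a.
Proof. by rewrite /mix subr0 !mul0r !mul1r !addr0 -surjective_pairing. Qed.
Lemma mix1 a b : mix 1 a b = b.
Proof. by rewrite /mix subrr !mul0r !mul1r !add0r -surjective_pairing. Qed.
Lemma mixxx s a : mix s a a = a.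
Proof. by rewrite /mix -!mulrDl !subrK !mul1r -surjective_pairing. Qed.
Arguments mix : simpl never.

(** The chord u = 1/2 has the same ends as the edge mi, or as the opposite edge, and a straight-line
    homotopy in the disc relates the two. *)
Lemma chord_edge k (c : R -> Sg) :
  (forall t, 0 <= t <= 1 -> c t = P (circ ((mi + dz * oddz k)%:~R + t))) ->
  path_htpy base c (fun t => W (1 / 2) (2 * k%:~R - 1 + 2 * t)).
Proof.
move=> hc; have h12 : 1 / 2 <= (1 / 2 : R) <= 3 / 2 by lra.
pose r := (mi + dz * oddz k)%:~R : R.
have er : r = m + d * (oddz k)%:R + -1 * (1 / 2) by rewrite dzE /r rmorphD /=; field.
have er1 : r + 1 = m + d * (oddz k)%:R + 1 * (1 / 2) by rewrite dzE /r rmorphD /=; field.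
pose A := sg k * C (1 / 2); pose B := sg k * S (1 / 2).
have c0 : circ r = spin m (A, - B).
  rewrite er -sg_circ; [|by right]; congr (spin _ (_, _)); rewrite /B; ring.
have c1 : circ (r + 1) = spin m (A, B).
  rewrite er1 -sg_circ; [|by left]; congr (spin _ (_, _)); rewrite /B; ring.
pose ch (t : R) := spin m (A, B * (2 * t - 1)).
pose K (z : R * R) := P (mix z.1 (circ (r + z.2)) (ch z.2)).
exists K; split.
- by rewrite /K /mix /ch /spin /ang /Octagon.circ /=; apply: (cont_comp (@P_ctn R)); cont.
- move=> s; rewrite /K /ch [(_, _).2]/= mulr0 sub0r mulrN1 -c0 addr0 mixxx.
  exact: P_vertex.
- move=> s; rewrite /K /ch [(_, _).2]/= mulr1 (_ : 2 - 1 = 1 :> R); last by ring.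
  rewrite mulr1 -c1 mixxx /r -[X in _ + X]/(1%:~R) -rmorphD; exact: P_vertex.
- by move=> t ht; rewrite /K mix0 hc.
move=> t ht; rewrite /K mix1.
rewrite (W_piece fib1 (k := k)); last by apply/andP; split; lra.
rewrite /piece /= clamp_id // /ch; congr (Pm (_, _)); rewrite /B; ring.
Qed.

Lemma W_base k : W (1 / 2) (2 * k%:~R - 1) = base.
Proof.
rewrite -[_ - 1]/(_ + -1) piece_side //; [|by right|by lra].
rewrite dzE; have -> : m + (dz * oddz k)%:~R + -1 * (1 / 2) = (mi + dz * oddz k)%:~R.
  by rewrite rmorphD /=; field.
exact: P_vertex.
Qed.

Variables (n : int) (l : letter) (k0 : int) (ls : word).
Hypothesis n_unit : n = 1 \/ n = -1.
Hypothesis crossing : forall t, 0 <= t <= 1 -> lp l t = W (3 / 2 - t) (2 * k0%:~R - 1).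
Hypothesis size_ls : (size ls)%:Z = prd tw.
Hypothesis chords : forall j t, (j < size ls)%N -> 0 <= t <= 1 ->
  lp (nth l0 ls j) t = if n == 1 then P (circ ((mi + dz * oddz (k0 + j%:Z))%:~R + t))
   else P (circ ((mi + dz * oddz (k0 - j%:Z - 1))%:~R + (1 - t))).

Let ch j t := W (1 / 2) (2 * k0%:~R - 1 + 2 * n%:~R * (j%:R + t)).

Lemma chord_htpy j : (j < size ls)%N -> path_htpy base (lp (nth l0 ls j)) (ch j).
Proof.
move=> hj; have := chords hj; rewrite /ch; case: n_unit => ->.
  rewrite eqxx => h; have := chord_edge h; congr (path_htpy _ _ _).
  apply/funext => t; congr (TwistChart.W _ _ _ _); rewrite rmorphD /=; ring.
have -> : (-1 == 1 :> int) = false by []. move=> h.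
have h' t : 0 <= t <= 1 -> lp (nth l0 ls j) (1 - t) =
    P (circ ((mi + dz * oddz (k0 - j%:Z - 1))%:~R + t)).
  by move=> ht; rewrite h; [congr (P (circ _)); ring|lra].
have := path_htpy_rev (chord_edge h'); congr (path_htpy _ _ _); apply/funext => t.
  by congr letter_path; ring.
congr (TwistChart.W _ _ _ _); rewrite !rmorphB /= rmorphN1; ring.
Qed.

Lemma ch_good j : good (ch j).
Proof.
have odd_int (a : int) : 2 * k0%:~R - 1 + 2 * n%:~R * a%:~R = 2 * (k0 + n * a)%:~R - 1 :> R.
  by rewrite rmorphD rmorphM /=; ring.
split; rewrite /ch.
- apply: (cont_comp (h := fun z => W z.1 z.2)
    (f := fun t => (1 / 2, 2 * k0%:~R - 1 + 2 * n%:~R * (j%:R + t)))); first exact: W_ctn.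
  by cont.
- by rewrite addr0 (odd_int j%:Z) W_base.
- by rewrite natr1 (odd_int j.+1%:Z) W_base.
Qed.

(** The image of an edge crossing the strip from u = 3/2 to u = 1/2 turns once around the annulus,
    in the direction n. Postponing the turn to the end of the crossing gives the edge followed by
    chords u = 1/2, hence by the letters of [ls]. *)
Lemma maps_letter_twist : maps_letter (twist m tw n) l (l :: ls).
Proof.
pose N := size ls; have N0 : (0 < N)%N by have := size_ls; rewrite /prd -/N; case: tw; lia.
pose q : R := N.+1%:R.
have N1 : 1 <= N%:R :> R by rewrite ler1n.
have q0 : 0 < q by rewrite ltr0n.
have eqq : q = N%:R + 1 by rewrite /q natr1.
have eper : per = 2 * N%:R by rewrite -size_ls.
pose v0 : R := 2 * k0%:~R - 1.
(* [D] crosses the strip during the first of N + 1 equal intervals of time and follows the chords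
   during the others. *)
pose D t := W (3 / 2 - clamp 0 1 (q * t)) (v0 + 2 * n%:~R * clamp 0 N%:R (q * t - 1)).
have cbx (s a : R) : (1 - s) * a + s * a = a by ring.
have cb0 (a b : R) : (1 - 0) * a + 0 * b = a by ring.
have cb1 (a b : R) : (1 - 1) * a + 1 * b = b by ring.
have hc u t : 0 <= t <= 1 -> 1 / 2 <= 3 / 2 - t <= 3 / 2 by lra.
pose K (z : R * R) := W ((1 - z.1) * (3 / 2 - clamp 0 1 z.2) + z.1 * (3 / 2 - clamp 0 1 (q * z.2)))
  (v0 + (1 - z.1) * (per * n%:~R * lam (3 / 2 - clamp 0 1 z.2)) +
    z.1 * (2 * n%:~R * clamp 0 N%:R (q * z.2 - 1))).
exists D, (lp l :: [seq ch j | j <- iota 0 N]); split.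
- exists K; split.
  + apply: (cont_comp (h := fun z => W z.1 z.2) (f := fun z : R * R =>
    ((1 - z.1) * (3 / 2 - clamp 0 1 z.2) + z.1 * (3 / 2 - clamp 0 1 (q * z.2)),
    v0 + (1 - z.1) * (per * n%:~R * lam (3 / 2 - clamp 0 1 z.2)) +
      z.1 * (2 * n%:~R * clamp 0 N%:R (q * z.2 - 1))))); first exact: W_ctn.
    by rewrite /lam; cont.
  + move=> s; rewrite /K /= mulr0 (clamp_lo (x := 0)) ?ler01 // (clamp_lo (b := N%:R)) ?ler0n //; last by lra.
    rewrite !subr0 lam0 !mulr0 !addr0 cbx.
    have := @crossing 0; rewrite -/v0 subr0 lexx ler01 => /(_ isT) <-.
    by case: (letter_path_good R l).
  + move=> s; rewrite /K /= mulr1 (clamp_hi (x := 1)) ?ler01 // (clamp_hi (b := 1)) ?ler01 //; last by lra.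
    rewrite (clamp_hi (b := N%:R)) ?ler0n //; last by lra.
    have -> : 3 / 2 - 1 = 1 / 2 :> R by field.
    rewrite lam1 mulr1 cbx.
    have -> : v0 + (1 - s) * (per * n%:~R) + s * (2 * n%:~R * N%:R) = v0 + per * n%:~R.
      by rewrite eper; ring.
    by rewrite (W_period fib1); exact: W_base.
  + move=> t ht; rewrite /K /= -addrA !cb0 clamp_id //.
    by rewrite crossing // (twist_W fib1 fib2) ?hc.
  + by move=> t ht; rewrite /K /= -addrA !cb1.
- move=> j t; rewrite /= size_map size_iota -/q => hj ht; rewrite /D.
  have -> : q * ((j%:R + t) / q) = j%:R + t by rewrite mulrC divfK // gt_eqF.
  case: j hj => [|j] hj /=.
    rewrite add0r clamp_id // clamp_lo ?ler0n //; last by lra.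
    by rewrite mulr0 addr0 crossing.
  rewrite ltnS in hj.
  have j1 : j.+1%:R <= N%:R :> R by rewrite ler_nat.
  have j0 : 0 <= j%:R :> R by rewrite ler0n.
  rewrite -natr1 in j1 *.
  rewrite (nth_map 0%N) ?size_iota // nth_iota // clamp_hi ?ler01 //; last by lra.
  rewrite clamp_id; last by apply/andP; split; lra.
  rewrite /ch /=; have -> : 3 / 2 - 1 = 1 / 2 :> R by field.
  by congr (TwistChart.W _ _ _ _); rewrite /v0; ring.
- split; first by rewrite /= !size_map size_iota.
  case=> [|j] hj /=; first by apply: path_htpy_refl; exact: letter_path_good.
  rewrite /= size_map ltnS in hj.
  by rewrite !(nth_map l0) // (nth_map 0%N) ?size_iota // nth_iota //; exact: chord_htpy.
- by [].
case=> [|j] hj /=; first exact: letter_path_good.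
rewrite /= size_map size_iota ltnS in hj.
by rewrite (nth_map 0%N) ?size_iota // nth_iota //; exact: ch_good.
Qed.
End TwistLetters.

End TwistedLetters.
Import TwistedLetters.

(** * Geometric realisation of the moves *)

Module GeometricTwists.
Local Open Scope ring_scope.
Local Open Scope classical_set_scope.
Local Open Scope quotient_scope.

Section Instances.
Variable R : realType.
Local Notation disc := (@disc R).
Local Notation circ := (@circ R).
Local Notation Sg := (Sigma2 R).
Local Notation base := (base R).
Local Notation lp := (@letter_path R).
Implicit Types (z : (R * R)%type) (e u v x t : R) (k n : int).

(** The strip ends on the edges e0 and e0 + 2, which are glued by reflection about the middle M of
    the edge e0 + 1. *)
Lemma fib_plain (e0 : nat) (mi : int) : (e0 \in edges)%N -> mi = e0.+1%:Z ->
  fiber_eq (mi%:~R + 1 / 2 : R) false /\ fiber_only (mi%:~R + 1 / 2 : R) false.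
Proof.
move=> he ->; pose M : R := e0%:R + 3 / 2.
have -> : (e0.+1%:Z)%:~R + 1 / 2 = M :> R by rewrite -pmulrn -natr1 /M; field.
have refl_m u : 2 * e0%:R + 3 - (M + u) = M - u by rewrite /M; field.
have refl_m' u : 2 * e0%:R + 3 - (M - u) = M + u by rewrite /M; field.
split=> [f j u|f j u z] hf hu; rewrite !mul0r !addr0.
  have lower : P (circ (M - u)) = P (circ (M + u)).
    by rewrite (P_edge he) ?refl_m' // /M; lra.
  by case: hf => ->; rewrite ?mul1r ?mulN1r ?opprK lower.
move=> hz; case: hf => ->; rewrite ?mul1r ?mulN1r ?opprK => h.
  have [|->|->] := P_edge_fiber (s := M + u) he _ hz h; rewrite ?refl_m; [|by left|by right].
  by right; rewrite /M; lra.
have [|->|->] := P_edge_fiber (s := M - u) he _ hz h; rewrite ?refl_m'; [|by left|by right].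
by left; rewrite /M; lra.
Qed.

(** The two strips end on the edges 7, 1 and 3, 5. As 1 is glued to 3 and 5 to 7, they form a single
    annulus crossing both handles. *)
Lemma fib_flip : fiber_eq (0%:~R + 1 / 2 : R) true /\ fiber_only (0%:~R + 1 / 2 : R) true.
Proof.
have e1 : (1 \in edges)%N by [].
have e5 : (5 \in edges)%N by [].
have wrap u : circ (0%:~R + 1 / 2 + 4 * 0%:R + -1 * u) = circ (17 / 2 - u).
  by rewrite -[LHS](circD8 _ 1); congr circ; field.
have wrap' u : circ (0%:~R + 1 / 2 + 4 * 0%:R - 1 * u) = circ (17 / 2 - u).
  by rewrite -wrap; congr circ; ring.
have s10 u : 0%:~R + 1 / 2 + 4 * 0%:R + 1 * u = 1 / 2 + u by field.
have s10' u : 0%:~R + 1 / 2 + 4 * 0%:R - -1 * u = 1 / 2 + u by field.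
have s11 u : 0%:~R + 1 / 2 + 4 * 1%:R + 1 * u = 9 / 2 + u by field.
have s11' u : 0%:~R + 1 / 2 + 4 * 1%:R - -1 * u = 9 / 2 + u by field.
have s01 u : 0%:~R + 1 / 2 + 4 * 1%:R + -1 * u = 9 / 2 - u by field.
have s01' u : 0%:~R + 1 / 2 + 4 * 1%:R - 1 * u = 9 / 2 - u by field.
have p1 u : 2 * 1%:R + 3 - (1 / 2 + u) = 9 / 2 - u by field.
have p2 u : 2 * 1%:R + 3 - (9 / 2 - u) = 1 / 2 + u by field.
have p3 u : 2 * 5%:R + 3 - (9 / 2 + u) = 17 / 2 - u by field.
have p4 u : 2 * 5%:R + 3 - (17 / 2 - u) = 9 / 2 + u by field.
split=> [f j u|f j u z] hf hu.
  have P1 : P (circ (1 / 2 + u)) = P (circ (9 / 2 - u)) by rewrite (P_edge e1) ?p1 //; lra.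
  have P2 : P (circ (9 / 2 + u)) = P (circ (17 / 2 - u)) by rewrite (P_edge e5) ?p3 //; lra.
  by case: hf => ->; case: j; rewrite /= ?wrap ?wrap' ?s10 ?s10' ?s11 ?s11' ?s01 ?s01' ?P1 ?P2.
move=> hz; case: hf => ->; case: j; rewrite /= ?wrap ?wrap' ?s10 ?s10' ?s11 ?s11' ?s01 ?s01' => h.
- have [|->|->] := P_edge_fiber e5 _ hz h; rewrite ?p3; [|by left|by right].
  by left; lra.
- have [|->|->] := P_edge_fiber e1 _ hz h; rewrite ?p1; [|by left|by right].
  by left; lra.
- have [|->|->] := P_edge_fiber e1 _ hz h; rewrite ?p2; [|by left|by right].
  by right; lra.
- have [|->|->] := P_edge_fiber e5 _ hz h; rewrite ?p4; [|by left|by right].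
  by right; lra.
Qed.

Definition words (u0 u1 u2 u3 : word) (i : 'I_4) : word := nth [::] [:: u0; u1; u2; u3] i.

Local Notation gm := (@geometric R).

Lemma geometric_Ta (f : {multiplicative Gamma2 -> Gamma2}) (b : bool) :
  f a1 = a1 -> f b1 = (b1 * (if b then a1 else a1^-1))%g -> f a2 = a2 -> f b2 = b2 -> gm f.
Proof.
move=> fa fb fc fd; have [f1 f2] := @fib_plain 1 2 isT erefl.
(* The core of the annulus follows the edge 2, which is a_1 traversed backwards; hence the sign. *)
pose n : int := if b then -1 else 1.
pose T := twist (2%:~R + 1 / 2 : R) false n.
have fix_edge (i : nat) s : (i \in [:: 0; 4; 5]%N)%N -> i%:R <= s <= i%:R + 1 -> T (P (circ s)) = P (circ s).
  move=> hi hs; apply: (twist_edge f1 f2 _ hs) => j k /=.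
  by move: hi; rewrite !inE => /or3P[] /eqP ->; lia.
have fixl (i : 'I_4) : i != ib1 -> maps_letter T (i, true) [:: (i, true)].
  move=> hi; apply: maps_letter_id => t ht; rewrite !letter_pathE /=.
  case: i hi => [[|[|[|[|//]]]] ?] hi //=; rewrite /edge_start /=.
  - by rewrite (fix_edge 0%N) //; lra.
  - by rewrite (fix_edge 4%N) //; lra.
  - by rewrite (fix_edge 5%N) //; lra.
apply: (@maps_geometric R T (words [:: (ia1, true)] [:: (ib1, true); (ia1, b)] [:: (ia2, true)] [:: (ib2, true)])).
- exact: twist_ctn.
- exact: can_inj (twistK f1 f2 n).
- by rewrite /base (fix_edge 0%N) // lexx add0r ler01.
- apply: ord4P; rewrite /words /=; try exact: fixl.
  apply: (@maps_letter_twist R 2 false f1 f2 n (ib1, true) 0 [:: (ia1, b)]) => //.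
  + by rewrite /n; case: (b); [right|left].
  + move=> t ht; rewrite letter_pathE /= /edge_start /= mulr0 sub0r.
    have := @piece_side R 2 false f1 0 (-1) (3 / 2 - t); rewrite mulr0 add0r => ->; [|by right|by lra].
    by congr (P (circ _)); rewrite /=; field.
  case=> // t _ ht; rewrite letter_pathE /= /edge_start /= /n.
  case: (b) => /=; last by rewrite (P_edge (e := 0%N)) //; [congr (P (circ _)); rewrite /=; ring|lra].
  by rewrite (P_edge (e := 0%N)) //; [congr (P (circ _)); rewrite /=; ring|lra].
apply: ord4P; rewrite ?fa ?fb ?fc ?fd -?weval_gen /words /= /leval ?mulg1 //=.
Qed.

Lemma geometric_Tb (f : {multiplicative Gamma2 -> Gamma2}) (b : bool) :
  f a1 = (a1 * (if b then b1 else b1^-1))%g -> f b1 = b1 -> f a2 = a2 -> f b2 = b2 -> gm f.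
Proof.
move=> fa fb fc fd; have [f1 f2] := @fib_plain 0 1 isT erefl.
pose n : int := if b then 1 else -1.
pose T := twist (1%:~R + 1 / 2 : R) false n.
have fix_edge (i : nat) s : (i \in [:: 1; 4; 5]%N)%N -> i%:R <= s <= i%:R + 1 -> T (P (circ s)) = P (circ s).
  move=> hi hs; apply: (twist_edge f1 f2 _ hs) => j k /=.
  by move: hi; rewrite !inE => /or3P[] /eqP ->; lia.
have fixl (i : 'I_4) : i != ia1 -> maps_letter T (i, true) [:: (i, true)].
  move=> hi; apply: maps_letter_id => t ht; rewrite !letter_pathE /=.
  case: i hi => [[|[|[|[|//]]]] ?] hi //=; rewrite /edge_start /=.
  - by rewrite (fix_edge 1%N) //; lra.
  - by rewrite (fix_edge 4%N) //; lra.
  - by rewrite (fix_edge 5%N) //; lra.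
apply: (@maps_geometric R T (words [:: (ia1, true); (ib1, b)] [:: (ib1, true)] [:: (ia2, true)] [:: (ib2, true)])).
- exact: twist_ctn.
- exact: can_inj (twistK f1 f2 n).
- by rewrite -[base](P_vertex R 1) (fix_edge 1%N) // lexx lerDl ler01.
- apply: ord4P; rewrite /words /=; try exact: fixl.
  apply: (@maps_letter_twist R 1 false f1 f2 n (ia1, true) 0 [:: (ib1, b)]) => //.
  + by rewrite /n; case: (b); [left|right].
  + move=> t ht; rewrite letter_pathE /= /edge_start /= mulr0 sub0r.
    have := @piece_side R 1 false f1 0 (-1) (3 / 2 - t); rewrite mulr0 add0r => ->; [|by right|by lra].
    by congr (P (circ _)); rewrite /=; field.
  case=> // t _ ht; rewrite letter_pathE /= /edge_start /= /n.
  by case: (b) => /=; congr (P (circ _)); ring.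
apply: ord4P; rewrite ?fa ?fb ?fc ?fd -?weval_gen /words /= /leval ?mulg1 //=.
Qed.

Lemma geometric_Tc (f : {multiplicative Gamma2 -> Gamma2}) :
  f a1 = a1 -> f b1 = ((a2 * a1)^-1 * b1)%g -> f a2 = a2 -> f b2 = ((a1 * a2)^-1 * b2)%g -> gm f.
Proof.
move=> fa fb fc fd; have [f1 f2] := fib_flip.
pose T := twist (0%:~R + 1 / 2 : R) true 1.
have fix_edge (i : nat) s : (i \in [:: 0; 4]%N)%N -> i%:R <= s <= i%:R + 1 -> T (P (circ s)) = P (circ s).
  move=> hi hs; apply: (twist_edge f1 f2 _ hs) => j k /=.
  by move: hi; rewrite !inE => /orP[] /eqP ->; case: j; lia.
pose wb1 := [:: (ia1, false); (ia2, false); (ib1, true)].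
pose wb2 := [:: (ia2, false); (ia1, false); (ib2, true)].
have arc (i : 'I_4) t : lp (i, true) t = P (circ (edge_start R i + t)) by rewrite letter_pathE.
have per8 (j : int) s t : s + 8 * j%:~R = t -> P (circ s) = P (circ t).
  by move=> <-; rewrite circD8.
apply: (@maps_geometric R T (words [:: (ia1, true)] wb1 [:: (ia2, true)] wb2)).
- exact: twist_ctn.
- exact: can_inj (twistK f1 f2 1).
- by rewrite /base (fix_edge 0%N) // lexx add0r ler01.
- apply: ord4P; rewrite /words /=.
  + apply: maps_letter_id => t ht; rewrite !arc /edge_start /=.
    by rewrite (fix_edge 0%N) //; lra.
  (* The inverses of b_1 and b_2 cross the strips from u = 3/2 to u = 1/2; their images are computed
     and then inverted. *)
  + apply: (@maps_letter_inv R T (ib1, false) [:: (ib1, false); (ia2, true); (ia1, true)]).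
    apply: (@maps_letter_twist R 0 true f1 f2 1 (ib1, false) 1 [:: (ia2, true); (ia1, true)]) => //.
    * by left.
    * move=> t ht; rewrite letter_pathE /= /edge_start /=.
      have -> : 2 * 1%:~R - 1 = 2 * 0%:~R + 1 :> R by rewrite mulr1 mulr0; ring.
      rewrite (piece_side f1); [|by left|by lra].
      by congr (P (circ _)); rewrite /oddz /=; field.
    case=> [|[|//]] t _ ht; rewrite arc /edge_start /= /oddz /=.
      by congr (P (circ _)); ring.
    by congr (P (circ _)); ring.
  + apply: maps_letter_id => t ht; rewrite !arc /edge_start /=.
    by rewrite (fix_edge 4%N) //; lra.
  + apply: (@maps_letter_inv R T (ib2, false) [:: (ib2, false); (ia1, true); (ia2, true)]).
    apply: (@maps_letter_twist R 0 true f1 f2 1 (ib2, false) 2 [:: (ia1, true); (ia2, true)]) => //.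
    * by left.
    * move=> t ht; rewrite letter_pathE /= /edge_start /=.
      have -> : 2 * 2%:~R - 1 = 2 * 1%:~R + 1 :> R by rewrite mulr1; ring.
      rewrite (piece_side f1); [|by left|by lra].
      by congr (P (circ _)); rewrite /oddz /=; field.
    case=> [|[|//]] t _ ht; rewrite arc /edge_start /= /oddz /=.
      by congr (P (circ _)); ring.
    by congr (P (circ _)); ring.
apply: ord4P; rewrite ?fa ?fb ?fc ?fd -?weval_gen /words /= /leval ?mulg1 ?invgM ?mulgA //=.
Qed.
End Instances.

End GeometricTwists.
Import GeometricTwists.

(** * Simple closed curves along the orbit *)

Module SimpleCurves.
Local Open Scope ring_scope.
Local Open Scope classical_set_scope.
Local Open Scope quotient_scope.

Section Base.
Variable R : realType.
Local Notation disc := (@disc R).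
Local Notation circ := (@circ R).
Local Notation Sg := (Sigma2 R).
Local Notation base := (base R).
Local Notation lp := (@letter_path R).
Implicit Types (z : (R * R)%type) (e u v x t : R) (k n : int).

Definition opp z : (R * R)%type := (- z.1, - z.2).

Lemma opp_disc z : disc z -> disc (opp z).
Proof. by rewrite /Defs.disc /= !sqrrN. Qed.

Lemma opp_circ s : opp (circ s) = circ (s + 4).
Proof. by rewrite circ_opp. Qed.

Lemma opp_identified z z' : identified z z' -> identified (opp z) (opp z').
Proof.
have vx y : vertex y -> vertex (opp y).
  by move=> [n ->]; exists (n + 4); rewrite opp_circ rmorphD.
have gl y y' : glued y y' -> glued (opp y) (opp y').
  move=> [e [u [he hu -> ->]]]; rewrite !opp_circ.
  exists ((e + 4) %% 8)%N, u; split => //.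
  - by move: he; rewrite !inE => /or4P[] /eqP ->.
  - rewrite -(circD8 (((e + 4) %% 8)%N%:R + u) ((e + 4) %/ 8)%N%:Z) -[_%:~R]/(_%:R).
    congr circ; have := divn_eq (e + 4) 8; move: (_ %/ _)%N (_ %% _)%N => p q h.
    by move/(congr1 (fun i : nat => i%:R : R)): h; rewrite !natrD natrM; lra.
  - rewrite -(circD8 (((e + 4) %% 8)%N%:R + 3 - u) ((e + 4) %/ 8)%N%:Z) -[_%:~R]/(_%:R).
    congr circ; have := divn_eq (e + 4) 8; move: (_ %/ _)%N (_ %% _)%N => p q h.
    by move/(congr1 (fun i : nat => i%:R : R)): h; rewrite !natrD natrM; lra.
case=> [->|[/vx hx /vx hy]|/gl h|/gl h]; [exact: Or41|exact: Or42|exact: Or43|exact: Or44].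
Qed.

(** The central symmetry of the octagon shifts edges by four and so exchanges the two handles. *)
Definition half_turn (y : Sg) : Sg := P (opp (val (repr y))).

Lemma half_turn_P z : disc z -> half_turn (P z) = P (opp z).
Proof.
move=> hz; have hr : disc (val (repr (P z))) by have := valP (repr (P z)); rewrite inE.
apply: P_identified; [exact: opp_disc|exact: opp_disc|apply: opp_identified].
by apply: P_eq => //; rewrite -P_val reprK.
Qed.

Lemma half_turnK : involutive half_turn.
Proof.
move=> y; have [z hz ->] := P_surj y; rewrite !half_turn_P //; last exact: opp_disc.
by rewrite /opp /= !opprK -surjective_pairing.
Qed.

Lemma half_turn_ctn : ctn half_turn.
Proof.
apply/quotient_continuous.
rewrite (_ : _ \o _ = (fun z => P (opp z)) \o val).
  move=> x; apply: continuous_comp; first exact: initial_continuous.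
  suff c : ctn (fun z => P (opp z)) by exact: c.
  by apply: (cont_comp (@P_ctn R)); rewrite /opp; cont.
apply/funext => x /=; rewrite P_val half_turn_P //.
by have := valP x; rewrite inE.
Qed.

Lemma geometric_swap (f : {multiplicative Gamma2 -> Gamma2}) :
  f a1 = a2 -> f b1 = b2 -> f a2 = a1 -> f b2 = b1 -> geometric R f.
Proof.
move=> fa fb fc fd.
apply: (@maps_geometric R half_turn (words [:: (ia2, true)] [:: (ib2, true)] [:: (ia1, true)] [:: (ib1, true)])).
- exact: half_turn_ctn.
- exact: inv_inj half_turnK.
- rewrite /Octagon.base half_turn_P ?opp_circ; last exact: circ_disc.
  by rewrite add0r; exact: (P_vertex R 4).
- have key (i j : 'I_4) (k : int) : edge_start R i + 4 = edge_start R j + 8 * k%:~R ->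
    maps_letter half_turn (i, true) [:: (j, true)].
    move=> h; apply: maps_letter_id => t ht; rewrite !letter_pathE /= half_turn_P ?opp_circ; last exact: circ_disc.
    by rewrite -(circD8 (edge_start R j + t) k); congr (P (circ _)); rewrite addrAC h; ring.
  apply: ord4P; rewrite /words /=.
  + by apply: (key _ _ 0); rewrite /edge_start /=; ring.
  + by apply: (key _ _ 0); rewrite /edge_start /=; ring.
  + by apply: (key _ _ 1); rewrite /edge_start /=; ring.
  + by apply: (key _ _ 1); rewrite /edge_start /=; ring.
by apply: ord4P; rewrite ?fa ?fb ?fc ?fd -?weval_gen /words /= /leval ?mulg1.
Qed.

Lemma loop1E (p : R -> Sg) t : loop_of base [:: p] t = p (t - (Num.floor t)%:~R).
Proof. by rewrite /loop_of /= mulr1; case: (`|_|)%N (modz_bound (Num.floor t) (ltn0Sn 0)) => [|[]]. Qed.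

Lemma frac_bound t : 0 <= t - (Num.floor t)%:~R < 1.
Proof.
rewrite subr_ge0 ge_floor /= ltrBlDr addrC.
by have := floorD1_gt t; rewrite rmorphD.
Qed.

Lemma loop1_simple (p : R -> Sg) : good base p ->
  (forall u v, 0 <= u < 1 -> 0 <= v < 1 -> p u = p v -> u = v) ->
  simple_closed_curve (loop_of base [:: p]).
Proof.
move=> gp h; split; first split.
- by apply: loop_of_ctn => -[|//] _.
- by move=> t; exact: loop_of_periodic.
move=> s t; rewrite !loop1E => /(h _ _ (frac_bound s) (frac_bound t)) e.
by exists (Num.floor s - Num.floor t); rewrite rmorphB /=; lra.
Qed.

Lemma a1_simple : exists c : R -> Sg, simple_closed_curve c /\ represents c a1.
Proof.
have ga := letter_path_good R (ia1, true).
exists (loop_of base [:: lp (ia1, true)]); split.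
  apply: loop1_simple => //.
  have key u v : 0 < u < 1 -> 0 <= v < 1 -> P (circ u) = P (circ v) -> u = v.
    move=> hu hv; have h0 : 0%:R < u < 0%:R + 1 by rewrite add0r.
    move=> /(P_edge_fiber (e := 0) isT (or_introl h0) (circ_disc _)) [] /circ_inj[k hk].
      have k1 : ((-1)%:~R : R) < k%:~R by rewrite rmorphN1; lra.
      have k2 : (k%:~R : R) < 1%:~R by rewrite rmorph1; lra.
      rewrite !ltr_int in k1 k2; have k0 : k = 0 by lia.
      by move: hk; rewrite k0 mulr0 addr0.
    have k1 : ((-1)%:~R : R) < k%:~R by rewrite rmorphN1; lra.
    have k2 : (k%:~R : R) < 0%:~R by rewrite rmorph0; lra.
    by rewrite !ltr_int in k1 k2; lia.
  move=> u v /andP[u0 u1] /andP[v0 v1]; rewrite !letter_pathE /edge_start /= !add0r.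
  have [->|un0] := eqVneq u 0; last by apply: key; rewrite ?v0 // u1 lt_neqAle eq_sym un0 u0.
  have [-> //|vn0] := eqVneq v 0.
  by move/esym/key => e; apply/esym/e; rewrite ?lexx ?ltr01 // v1 lt_neqAle eq_sym vn0 v0.
exists [:: (ia1, true)] => //; rewrite -(word_loopE R [:: (ia1, true)]) /=.
apply: fhtpy_refl; last by move=> t; rewrite word_loopE loop_of_periodic.
by rewrite word_loopE; apply: loop_of_ctn => -[|//] _.
Qed.

(** The diameter from vertex 0 to vertex 4 closes up to a simple curve, and a straight-line homotopy
    in the disc relates it to the boundary arc reading a_1 b_1 a_1^-1 b_1^-1. *)
Lemma comm_simple : exists c : R -> Sg, simple_closed_curve c /\ represents c (gcomm a1 b1).
Proof.
pose p t : Sg := P (1 - 2 * t, 0).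
have c0 : circ 0 = (1, 0) by rewrite /Octagon.circ !mul0r cos0 sin0.
have c4 : circ 4 = (-1, 0) by rewrite /Octagon.circ (_ : 4 * pi / 4 = pi) ?cospi ?sinpi //; field.
have gp : good base p.
  split; rewrite /p.
  - by apply: (cont_comp (@P_ctn R)); cont.
  - by rewrite mulr0 subr0 -c0.
  - rewrite mulr1 (_ : 1 - 2 = -1 :> R); last by ring.
    by rewrite -c4; exact: (P_vertex R 4).
exists (loop_of base [:: p]); split.
  apply: loop1_simple => //.
  have key u v : 0 < u < 1 -> 0 <= v < 1 -> p u = p v -> u = v.
    move=> hu hv h.
    have l1 : (1 - 2 * u) ^+ 2 < 1 by clear - hu; nra.
    have l2 : (1 - 2 * v) ^+ 2 <= 1 by clear - hv; nra.
    have d1 : disc (1 - 2 * u, 0) by rewrite /Defs.disc /= expr0n addr0 ltW.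
    have d2 : disc (1 - 2 * v, 0) by rewrite /Defs.disc /= expr0n addr0.
    have lt1 : (1 - 2 * u, 0 : R).1 ^+ 2 + (1 - 2 * u, 0 : R).2 ^+ 2 < 1.
      by rewrite /= expr0n addr0.
    by case: (P_inner d1 d2 lt1 h) => e; clear - e; lra.
  move=> u v /andP[u0 u1] /andP[v0 v1].
  have [->|un0] := eqVneq u 0; last by apply: key; rewrite ?v0 // u1 lt_neqAle eq_sym un0 u0.
  have [-> //|vn0] := eqVneq v 0.
  by move/esym/key => e; apply/esym/e; rewrite ?lexx ?ltr01 // v1 lt_neqAle eq_sym vn0 v0.
pose w := [:: (ia1, true); (ib1, true); (ia1, false); (ib1, false)].
exists w.
  by rewrite -weval_gen /= /leval /= /gcomm mulg1 !mulgA.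
pose D (t : R) : Sg := P (circ (4 * t)).
rewrite -[freely_homotopic _ _]/(fhtpy _ _) word_loopE.
have -> : map lp w = flatten [:: map lp w] by [].
apply: fhtpy_trans (@loop_of_flatten _ _ base [:: map lp w] [:: D] _ _ _ _) _ => //.
- case=> [|//] _ j t /= hj ht; rewrite /D; have -> : 4 * ((j%:R + t) / 4) = j%:R + t by field.
  case: j hj => [|[|[|[|//]]]] _ /=; rewrite letter_pathE /edge_start /= ?add0r //.
  + by rewrite [in RHS](P_edge (e := 0)) //; [congr (P (circ _)); ring|lra].
  + by rewrite [in RHS](P_edge (e := 1)) //; [congr (P (circ _)); ring|lra].
- by case.
- move=> i hi; have -> : nth (PathLoops.dpath base) (flatten [:: map lp w]) i = lp (nth (ia1, true) w i).
    by rewrite -(nth_map _ (PathLoops.dpath base)).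
  exact: letter_path_good.
apply: loop_of_htpy => // -[|//] _ /=.
exists (fun z => P (mix z.1 (circ (4 * z.2)) (1 - 2 * z.2, 0))); split.
- by rewrite /mix /Octagon.circ /=; apply: (cont_comp (@P_ctn R)); cont.
- by move=> s; rewrite /= !mulr0 subr0 c0 mixxx -c0.
- move=> s; rewrite /= !mulr1 (_ : 1 - 2 = -1 :> R); last by ring.
  by rewrite c4 mixxx -c4; exact: (P_vertex R 4).
- by move=> t ht; rewrite /= mix0.
by move=> t ht; rewrite /= mix1.
Qed.

End Base.


(** Every tuple (s, t, t, s) satisfies the relation; two non-commuting unipotent matrices detect the
    commutator. *)
Lemma comm_neq1 (R : realType) : gcomm a1 b1 <> 1%g.
Proof.
have hs : 1 * 1 - 1 * 0 = 1 :> R by ring.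
have ht : 1 * 1 - 0 * 1 = 1 :> R by ring.
pose s := mk2 hs; pose t := mk2 ht.
have [f hf] : exists f : {multiplicative Gamma2 -> SL2 R},
    forall i, f (gamma_gen i) = tup s t t s i.
  by apply: gamma_ext_ex; rewrite /surface_relation /tup /= /gcomm !gnorm.
move=> /(congr1 f); rewrite mor_comm mor1 !hf /tup /= => h.
have : ea (s * t)%g = ea (t * s)%g.
  by rewrite -[(t * s)%g]mul1g -h /gcomm !gnorm.
have [-> _ _ _] := mulE s t; have [-> _ _ _] := mulE t s.
have [-> -> -> _] := mk2E hs; have [-> -> -> _] := mk2E ht; lra.
Qed.

Section Orbit.
Variable R : realType.
Local Open Scope group_scope.

Definition symmetry (f : {multiplicative Gamma2 -> Gamma2}) := geometric R f /\ injective f.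

Lemma symmetry_comp (f t : {multiplicative Gamma2 -> Gamma2}) : symmetry f -> symmetry t ->
  symmetry (f \o t).
Proof.
move=> [gf jf] [gt jt]; split; last exact: inj_comp.
move=> c g hc hg; have [c' [hc' hg']] := gt c g hc hg.
exact: gf hc' hg'.
Qed.

Lemma symmetry_ex (s s' : 'I_4 -> Gamma2) : surface_relation s -> surface_relation s' ->
  (forall g : {multiplicative Gamma2 -> Gamma2}, (forall i, g (gamma_gen i) = s' i) ->
    forall i, g (s i) = gamma_gen i) ->
  (forall f : {multiplicative Gamma2 -> Gamma2}, (forall i, f (gamma_gen i) = s i) -> geometric R f) ->
  exists t : {multiplicative Gamma2 -> Gamma2}, symmetry t /\ forall i, t (gamma_gen i) = s i.
Proof.
move=> hs hs' h hg; have [t [jt ht]] := auto_ex hs hs' h.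
by exists t; split => //; split => //; exact: hg.
Qed.

(** If f realises a tuple and t realises a move on the standard generators, then f o t realises the
    moved tuple. Moves need thus be realised on the standard generators only. *)
Lemma horbit_symmetry a b c d : horbit a1 b1 a2 b2 a b c d ->
  exists f : {multiplicative Gamma2 -> Gamma2},
    symmetry f /\ [/\ f a1 = a, f b1 = b, f a2 = c & f b2 = d].
Proof.
have rel := gamma_relation; rewrite /surface_relation in rel.
have step (s s' : 'I_4 -> Gamma2) := @symmetry_ex s s'.
have comp (f t : {multiplicative Gamma2 -> Gamma2}) s : symmetry f -> symmetry t ->
    (forall i, t (gamma_gen i) = s i) -> exists g : {multiplicative Gamma2 -> Gamma2},
    symmetry g /\ [/\ g a1 = f (s ia1), g b1 = f (s ib1), g a2 = f (s ia2) & g b2 = f (s ib2)].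
  move=> sf st ht; exists (f \o t); split; first exact: symmetry_comp.
  by rewrite /= !ht.
elim=> {a b c d} [|a b c d _|a b c d _|a b c d _|a b c d _|a b c d _|a b c d _].
- exists idfun; split => //; split => // c g hc hg; by exists c.
all: move=> [f [sf [<- <- <- <-]]].
- have [t [st ht]] : exists t : {multiplicative Gamma2 -> Gamma2},
      symmetry t /\ forall i, t (gamma_gen i) = tup a1 (b1 * a1) a2 b2 i.
    apply: (step _ (tup a1 (b1 * a1^-1) a2 b2)); rewrite /surface_relation /tup /=.
    + by rewrite gcomm_Ta.
    + by rewrite gcomm_TaV.
    + by move=> g hg; apply: ord4P; rewrite /= ?morM !hg //= -mulgA mulVg mulg1.
    by move=> g hg; apply: (@geometric_Ta R g true); rewrite hg.
  by have := comp _ _ _ sf st ht; rewrite /tup /= morM.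
- have [t [st ht]] : exists t : {multiplicative Gamma2 -> Gamma2},
      symmetry t /\ forall i, t (gamma_gen i) = tup a1 (b1 * a1^-1) a2 b2 i.
    apply: (step _ (tup a1 (b1 * a1) a2 b2)); rewrite /surface_relation /tup /=.
    + by rewrite gcomm_TaV.
    + by rewrite gcomm_Ta.
    + by move=> g hg; apply: ord4P; rewrite /= ?morM ?morV !hg //= -mulgA mulgV mulg1.
    by move=> g hg; apply: (@geometric_Ta R g false); rewrite hg.
  by have := comp _ _ _ sf st ht; rewrite /tup /= morM morV.
- have [t [st ht]] : exists t : {multiplicative Gamma2 -> Gamma2},
      symmetry t /\ forall i, t (gamma_gen i) = tup (a1 * b1) b1 a2 b2 i.
    apply: (step _ (tup (a1 * b1^-1) b1 a2 b2)); rewrite /surface_relation /tup /=.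
    + by rewrite gcomm_Tb.
    + by rewrite gcomm_TbV.
    + by move=> g hg; apply: ord4P; rewrite /= ?morM !hg //= -mulgA mulVg mulg1.
    by move=> g hg; apply: (@geometric_Tb R g true); rewrite hg.
  by have := comp _ _ _ sf st ht; rewrite /tup /= morM.
- have [t [st ht]] : exists t : {multiplicative Gamma2 -> Gamma2},
      symmetry t /\ forall i, t (gamma_gen i) = tup (a1 * b1^-1) b1 a2 b2 i.
    apply: (step _ (tup (a1 * b1) b1 a2 b2)); rewrite /surface_relation /tup /=.
    + by rewrite gcomm_TbV.
    + by rewrite gcomm_Tb.
    + by move=> g hg; apply: ord4P; rewrite /= ?morM ?morV !hg //= -mulgA mulgV mulg1.
    by move=> g hg; apply: (@geometric_Tb R g false); rewrite hg.
  by have := comp _ _ _ sf st ht; rewrite /tup /= morM morV.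
- have rel' : gcomm a2 b2 * gcomm a1 b1 = 1.
    move: rel; move: (gcomm a1 b1) (gcomm a2 b2) => x y e.
    by rewrite -[y]mul1g -(mulVg x) -(mulgA x^-1) e mulg1 mulVg.
  have [t [st ht]] : exists t : {multiplicative Gamma2 -> Gamma2},
      symmetry t /\ forall i, t (gamma_gen i) = tup a2 b2 a1 b1 i.
    apply: (step _ (tup a2 b2 a1 b1)) => //.
    + by move=> g hg; apply: ord4P; rewrite /= !hg.
    by move=> g hg; apply: geometric_swap; rewrite hg.
  exact: comp _ _ _ sf st ht.
have [t [st ht]] : exists t : {multiplicative Gamma2 -> Gamma2},
    symmetry t /\ forall i, t (gamma_gen i) = tup a1 ((a2 * a1)^-1 * b1) a2 ((a1 * a2)^-1 * b2) i.
  apply: (step _ (tup a1 (a2 * a1 * b1) a2 (a1 * a2 * b2))); rewrite /surface_relation /tup /=.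
  - by rewrite gcomm_Tc rel mulg1 mulVg.
  - have -> : gcomm a1 (a2 * a1 * b1) * gcomm a2 (a1 * a2 * b2) =
      (a1 * a2) * (gcomm a1 b1 * gcomm a2 b2) * (a1 * a2)^-1 by rewrite /gcomm !gnorm.
    by rewrite rel mulg1 mulgV.
  - by move=> g hg; apply: ord4P; rewrite /= ?morM ?morV ?morM !hg //= /tup /= !gnorm.
  by move=> g hg; apply: (@geometric_Tc R g); rewrite hg.
by have := comp _ _ _ sf st ht; rewrite /tup /= !morM !morV !morM.
Qed.

Lemma horbit_curves a b c d : horbit a1 b1 a2 b2 a b c d ->
  forall g, g = a \/ g = gcomm a b ->
  g <> 1 /\ exists c : R -> Sigma2 R, simple_closed_curve c /\ represents c g.
Proof.
move=> /horbit_symmetry[f [[gf jf] [<- <- _ _]]] g.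
have z1 := @comm_neq1 R.
have a1n : a1 <> 1 by move=> e; apply: z1; rewrite e /gcomm !gnorm.
have nf x : x <> 1 -> f x <> 1 by move=> nx e; apply/nx/jf; rewrite e mor1.
case=> ->; rewrite -?mor_comm; split; try exact: nf.
- by have [c' [hc hr]] := a1_simple R; exact: gf hc hr.
by have [c' [hc hr]] := comm_simple R; exact: gf hc hr.
Qed.
End Orbit.

End SimpleCurves.
Import SimpleCurves.

(** * Explicit lifts and displacements in the universal cover *)

Module CoverDisplacement.
Local Open Scope ring_scope.

Section Cover.
Variable R : realType.
Local Notation SL2 := (SL2 R).
Local Notation ucover := (ucover R).
Implicit Types (A B : SL2) (s t : R) (l : ucover).

(** Positivity of the factor fixes the angle modulo 2 pi and so distinguishes A from - A, whereas
    [lifts_action] sees angles modulo pi. *)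
Definition lifts_at A t s := exists2 c : R, 0 < c &
  ea A * cos t + eb A * sin t = c * cos s /\ ec A * cos t + ed A * sin t = c * sin s.

Lemma proj_vecE A t s (c : R) : (val A *m proj_vec t = c *: proj_vec s) <->
  (ea A * cos t + eb A * sin t = c * cos s /\ ec A * cos t + ed A * sin t = c * sin s).
Proof.
have E i : (val A *m proj_vec t) i 0 = val A i 0 * cos t + val A i 1 * sin t.
  by rewrite mxE sum_ord2 !mxE.
split=> [h|[h1 h2]].
  have h0 := congr1 (fun M : 'cV[R]_2 => M 0 0) h; have h1 := congr1 (fun M : 'cV[R]_2 => M 1 0) h.
  by move: h0 h1; rewrite /= !E !mxE /=.
apply/matrixP => i j; rewrite (ord1 j) E !mxE; case: i => [[|[|//]] hi].
- by rewrite (_ : Ordinal hi = 0) //; exact: val_inj.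
by rewrite (_ : Ordinal hi = 1) //; exact: val_inj.
Qed.

(** [frx] and [fry] are the coordinates of A v in the frame made of v = (cos t, sin t) and its
    quarter turn. *)
Definition frx A t : R := (ea A * cos t + eb A * sin t) * cos t + (ec A * cos t + ed A * sin t) * sin t.
Definition fry A t : R := (ec A * cos t + ed A * sin t) * cos t - (ea A * cos t + eb A * sin t) * sin t.
Definition frr A t : R := Num.sqrt (frx A t ^+ 2 + fry A t ^+ 2).
(** By the half-angle formula, the term added to t is the argument of (frx, fry) in (-pi, pi). This
    breaks down on the negative axis, which a nonnegative trace excludes. *)
Definition rotF A t : R := t + 2 * atan (fry A t / (frx A t + frr A t)).

Lemma frr_sqr A t : frr A t ^+ 2 = frx A t ^+ 2 + fry A t ^+ 2.
Proof. by rewrite sqr_sqrtr // addr_ge0 ?sqr_ge0. Qed.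

Lemma frameX A t : ea A * cos t + eb A * sin t = frx A t * cos t - fry A t * sin t.
Proof. by rewrite -[LHS]mulr1 -(cos2Dsin2 t) /frx /fry; ring. Qed.
Lemma frameY A t : ec A * cos t + ed A * sin t = frx A t * sin t + fry A t * cos t.
Proof. by rewrite -[LHS]mulr1 -(cos2Dsin2 t) /frx /fry; ring. Qed.

(** A vanishing [fry] makes (cos t, sin t) an eigenvector, so [frx] is a root of the characteristic
    polynomial. *)
Lemma eigen_trace A t : fry A t = 0 -> frx A t ^+ 2 + 1 = tr2 A * frx A t.
Proof.
move=> y0; have := frameX A t; have := frameY A t; rewrite y0 !mul0r subr0 addr0.
move: (frx A t) => x h2 h1; have D := detE A; rewrite tr2E.
have cs := cos2Dsin2 t; move: (cos t) (sin t) h1 h2 cs => c s h1 h2 cs.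
have e1 : ((ea A - x) * (ed A - x) - eb A * ec A) * c = 0.
  have -> : ((ea A - x) * (ed A - x) - eb A * ec A) * c =
    (ed A - x) * ((ea A * c + eb A * s) - x * c) - eb A * ((ec A * c + ed A * s) - x * s) by ring.
  by rewrite h1 h2 !subrr !mulr0 subrr.
have e2 : ((ea A - x) * (ed A - x) - eb A * ec A) * s = 0.
  have -> : ((ea A - x) * (ed A - x) - eb A * ec A) * s =
    (ea A - x) * ((ec A * c + ed A * s) - x * s) - ec A * ((ea A * c + eb A * s) - x * c) by ring.
  by rewrite h1 h2 !subrr !mulr0 subrr.
have e3 : (ea A - x) * (ed A - x) - eb A * ec A = 0.
  rewrite -[LHS]mulr1 -cs mulrDr !expr2 !mulrA e1 e2 !mul0r; ring.
by move: e3 D; set p := ea A; set q := ed A; set r := eb A * ec A; lra.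
Qed.

Lemma frr_gt0 A t : 0 < frr A t.
Proof.
rewrite sqrtr_gt0 lt_neqAle addr_ge0 ?sqr_ge0 // andbT eq_sym; apply/negP.
rewrite paddr_eq0 ?sqr_ge0 // !sqrf_eq0 => /andP[/eqP x0 /eqP y0].
by have := eigen_trace y0; rewrite x0 expr0n mulr0 add0r => /eqP; rewrite oner_eq0.
Qed.

Lemma rotF_den A t : 0 <= tr2 A -> 0 < frx A t + frr A t.
Proof.
move=> tr0; have r0 := frr_gt0 A t; have r2 := frr_sqr A t.
have [y0|ny] := eqVneq (fry A t) 0.
  have := eigen_trace y0 => e.
  have [x0|x0] := leP 0 (frx A t); first by rewrite ltr_wpDl.
  by have := sqr_ge0 (frx A t); nra.
have y2 : 0 < fry A t ^+ 2 by rewrite exprn_even_gt0.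
by nra.
Qed.

Lemma rotF_lifts A t : 0 <= tr2 A -> lifts_at A t (rotF A t).
Proof.
move=> tr0; have r0 := frr_gt0 A t; have q0 := rotF_den t tr0; have r2 := frr_sqr A t.
exists (frr A t) => //; rewrite frameX frameY /rotF cosD sinD.
set al := atan _; have c0 : cos al != 0 by rewrite gt_eqF // cos_gt0_pihalf // atan_gtNpi2 atan_ltpi2.
have sE : sin al = fry A t / (frx A t + frr A t) * cos al.
  by have := atanK (fry A t / (frx A t + frr A t)); rewrite -/al /tan => <-; rewrite divfK.
have -> : 2 * al = al *+ 2 by rewrite mulr_natl.
rewrite cos_mulr2n sin_mulr2n.
have cs := cos2Dsin2 al; move: sE cs; move: (cos al) (sin al) => c s sE cs.
move: sE; move: (frx A t) (fry A t) (frr A t) r0 q0 r2 => x y r r0 q0 r2 sE.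
have sq : s * (x + r) = y * c by rewrite sE; field; rewrite gt_eqF.
have k1 : c ^+ 2 * (2 * r) = x + r.
  apply: (@mulIf _ (x + r)); first by rewrite gt_eqF.
  have h : s ^+ 2 * (x + r) ^+ 2 = y ^+ 2 * c ^+ 2 by rewrite -exprMn sq exprMn.
  have y2 : y ^+ 2 = r ^+ 2 - x ^+ 2 by rewrite r2; ring.
  have cs2 : (c ^+ 2 + s ^+ 2) * (x + r) ^+ 2 = (x + r) ^+ 2 by rewrite cs mul1r.
  by rewrite mulrDl h y2 in cs2; rewrite -[RHS]expr2 -[RHS]cs2; ring.
have k2 : r * (c * s *+ 2) = y.
  apply: (@mulIf _ (x + r)); first by rewrite gt_eqF.
  have -> : r * (c * s *+ 2) * (x + r) = r * c *+ 2 * (s * (x + r)) by rewrite mulr2n; ring.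
  by rewrite sq -k1 mulr2n; ring.
have k3 : r * (c ^+ 2 *+ 2 - 1) = x.
  have -> : r * (c ^+ 2 *+ 2 - 1) = c ^+ 2 * (2 * r) - r by rewrite mulr2n; ring.
  by rewrite k1; ring.
split.
  have -> : r * (cos t * (c ^+ 2 *+ 2 - 1) - sin t * (c * s *+ 2)) =
    r * (c ^+ 2 *+ 2 - 1) * cos t - r * (c * s *+ 2) * sin t by ring.
  by rewrite k2 k3.
have -> : r * (sin t * (c ^+ 2 *+ 2 - 1) + cos t * (c * s *+ 2)) =
  r * (c ^+ 2 *+ 2 - 1) * sin t + r * (c * s *+ 2) * cos t by ring.
by rewrite k2 k3.
Qed.

Lemma rotF_pi A t : rotF A (t + pi) = rotF A t + pi.
Proof.
rewrite /rotF /frr.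
have -> : frx A (t + pi) = frx A t by rewrite /frx cosDpi sinDpi; ring.
have -> : fry A (t + pi) = fry A t by rewrite /fry cosDpi sinDpi; ring.
ring.
Qed.

Lemma rotF_ctn A : 0 <= tr2 A -> ctn (rotF A).
Proof.
move=> tr0; change (ctn (fun t => rotF A t)); rewrite /rotF.
have ci : ctn (fun t => (frx A t + frr A t)^-1).
  apply: (contV (f := fun t => frx A t + frr A t)); first by move=> t; rewrite gt_eqF // rotF_den.
  by rewrite /frr /frx /fry; cont.
by cont; rewrite /fry; cont.
Qed.

Lemma cos_sin_angle s t : cos s = cos t -> sin s = sin t -> exists k : int, s = t + 2 * k%:~R * pi.
Proof.
move=> hc hs; have p0 := pi_gt0 R.
have e u : u * 4 / pi * pi / 4 = u :> R by rewrite divfK ?gt_eqF // mulfK ?pnatr_eq0.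
have [k hk] : exists k : int, s * 4 / pi = t * 4 / pi + 8 * k%:~R.
  by apply: circ_inj; rewrite /circ !e hc hs.
by exists k; rewrite -(e s) hk !mulrDl e; congr (_ + _); field.
Qed.

Lemma lifts_at_uniq A t s s' (c c' : R) : 0 < c ->
  ea A * cos t + eb A * sin t = c * cos s /\ ec A * cos t + ed A * sin t = c * sin s ->
  ea A * cos t + eb A * sin t = c' * cos s' /\ ec A * cos t + ed A * sin t = c' * sin s' ->
  c' != 0 -> exists k : int, s' = s + k%:~R * pi /\ (0 < c' -> exists j : int, s' = s + 2 * j%:~R * pi).
Proof.
move=> c0 [h1 h2] [h1' h2'] nc'.
have e1 : c * cos s = c' * cos s' by rewrite -h1.
have e2 : c * sin s = c' * sin s' by rewrite -h2.
have e3 : c ^+ 2 = c' ^+ 2.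
  have -> : c ^+ 2 = (c * cos s) ^+ 2 + (c * sin s) ^+ 2 by rewrite !exprMn -mulrDr cos2Dsin2 mulr1.
  by rewrite e1 e2 !exprMn -mulrDr cos2Dsin2 mulr1.
have [e|e] : c' = c \/ c' = - c.
  by move/eqP: e3; rewrite eq_sym eqf_sqr => /orP[]/eqP; [left|right].
  have nc : c != 0 by rewrite gt_eqF.
  have [||j hj] := @cos_sin_angle s' s.
  - by apply: (mulfI nc); rewrite e1 e.
  - by apply: (mulfI nc); rewrite e2 e.
  exists (2 * j); split; last by exists j.
  by rewrite hj rmorphM.
have nc : c != 0 by rewrite gt_eqF.
have [||j hj] := @cos_sin_angle s' (s + pi).
- by apply: (mulfI nc); rewrite cosDpi mulrN e1 e mulNr opprK.
- by apply: (mulfI nc); rewrite sinDpi mulrN e2 e mulNr opprK.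
exists (2 * j + 1); split; last by rewrite e; move=> ?; exfalso; lra.
by rewrite hj rmorphD rmorphM /=; ring.
Qed.

Lemma integer_valued_constant (d : R -> R) : ctn d -> (forall t, exists k : int, d t = k%:~R) ->
  forall s t, d s = d t.
Proof.
move=> cd hd.
suff key s t : s <= t -> d s = d t.
  by move=> s t; case: (leP s t) => [/key //|/ltW/key].
move=> st; have [k hk] := hd s; have [k' hk'] := hd t.
have [-> // |ne] := eqVneq (d s) (d t); exfalso.
have nk : k != k' by apply: contra ne => /eqP e; rewrite hk hk' e.
have noint (q : int) : Num.min (d s) (d t) <= q%:~R + 1 / 2 <= Num.max (d s) (d t) -> False.
  move=> mm; have [c _ hc] := IVT st (continuous_subspaceT cd) mm.
  have [j hj] := hd c; rewrite hj in hc.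
  by apply: (@int_unit_interval R q j (1 / 2)); [rewrite hc|lra].
have [lt|le] := ltP k k'.
  have h : (k + 1)%:~R <= (k'%:~R : R) by rewrite ler_int; lia.
  rewrite rmorphD /= in h; apply: (noint k); apply/andP; split.
    by rewrite ge_min hk; apply/orP; left; lra.
  by rewrite le_max hk'; apply/orP; right; lra.
have lt : k' < k by rewrite lt_neqAle eq_sym nk le.
have h : (k' + 1)%:~R <= (k%:~R : R) by rewrite ler_int; lia.
rewrite rmorphD /= in h; apply: (noint k'); apply/andP; split.
  by rewrite ge_min hk'; apply/orP; right; lra.
by rewrite le_max hk; apply/orP; left; lra.
Qed.

(* Every element of the universal cover is the explicit lift [rotF A] followed by
   a translation by a multiple of [pi]. *)
Lemma ucover_rotF l A : 0 <= tr2 A -> psl A = uc_proj l ->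
  exists k : int, forall t, l t = rotF A t + k%:~R * pi.
Proof.
move=> tr0 hA; have p0 := pi_gt0 R.
have hl t : exists k : int, l t = rotF A t + k%:~R * pi.
  have hc := @uc_covers _ l; rewrite -hA in hc.
  have [c nc /proj_vecE h'] := (coversE A l).1 hc t.
  have [c0 c00 h] := rotF_lifts t tr0.
  by have [k [hk _]] := lifts_at_uniq c00 h h' nc; exists k.
have [k hk] := hl 0; exists k => t.
pose d u := (l u - rotF A u) / pi.
have cl : ctn (fun u => l u) by exact: uc_continuous.
have cF : ctn (fun u => rotF A u) by exact: rotF_ctn.
have cd : ctn d by rewrite /d; cont.
have di u : exists k : int, d u = k%:~R.
  by have [k' hk'] := hl u; exists k'; rewrite /d hk' addrAC subrr add0r mulfK // gt_eqF.
have := integer_valued_constant cd di t 0; rewrite /d hk [rotF A 0 + _]addrC addrK mulfK ?gt_eqF //.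
by move=> e; rewrite -e divfK ?gt_eqF // addrC subrK.
Qed.

Lemma nonneg_trace_lift (x : PSL2 R) : exists A : SL2, psl A = x /\ 0 <= tr2 A.
Proof.
have [h|h] := leP 0 (tr2 (repr x)); first by exists (repr x); rewrite psl_repr.
have he : -1 * -1 - 0 * 0 = 1 :> R by ring.
exists (mk2 he * repr x)%g; split; last by rewrite tr2E !entr -/(tr2 _); move: h; rewrite tr2E; lra.
rewrite -[RHS]psl_repr; apply/eqP/pslP; right.
suff -> : val (mk2 he * repr x)%g = - 1%:M * val (repr x) by rewrite mulNr mul1r.
rewrite /= -!mulmxE; congr (_ *m _); apply/matrixP => i j; rewrite !mxE.
by case: i => [[|[|//]] ?]; case: j => [[|[|//]] ?]; rewrite //= ?oppr0.
Qed.

Lemma ucover_pi l t : l (t + pi) = l t + pi.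
Proof.
have [A [hA tr0]] := nonneg_trace_lift (uc_proj l).
have [k hk] := ucover_rotF tr0 hA.
by rewrite !hk rotF_pi; ring.
Qed.

Lemma ucover_pi_int l t (k : int) : l (t + k%:~R * pi) = l t + k%:~R * pi.
Proof.
have nat_case (n : nat) u : l (u + n%:R * pi) = l u + n%:R * pi.
  elim: n => [|n ih]; first by rewrite mul0r !addr0.
  have e : n.+1%:R * pi = n%:R * pi + pi :> R by rewrite -natr1; ring.
  by rewrite e (addrA u) (addrA (l u)) -ih; exact: (ucover_pi l (u + n%:R * pi)).
case: k => n; first exact: nat_case.
rewrite NegzE rmorphN /= -pmulrn mulNr.
have := nat_case n.+1 (t - n.+1%:R * pi); rewrite subrK => ->.
by rewrite addrK.
Qed.

(** A lift is injective and commutes with translations by n pi. If it failed to increase from s to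
    t, the intermediate value theorem would give the value l s again beyond t. *)
Lemma ucover_lt l s t : s < t -> l s < l t.
Proof.
move=> st; have p0 := pi_gt0 R; rewrite ltNge; apply/negP => h.
have [n hn] : exists n : nat, t < s + n%:R * pi.
  exists (Num.trunc ((t - s) / pi)).+1.
  by have := trunc_itv (x := (t - s) / pi) (divr_ge0 _ _) => /(_ _ _)/andP[||_]; rewrite ?subr_ge0 ?ltW // ltr_pdivrMr // ltrBlDl.
have tn := ltW hn.
have ls : l (s + n%:R * pi) = l s + n%:R * pi by exact: (ucover_pi_int l s n%:Z).
have np : 0 <= n%:R * pi :> R by rewrite mulr_ge0 // ltW.
have mm : Num.min (l t) (l (s + n%:R * pi)) <= l s <= Num.max (l t) (l (s + n%:R * pi)).
  by rewrite ge_min le_max h ls lerDl np orbT.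
have [c + hc] := IVT tn (continuous_subspaceT (@uc_continuous _ l)) mm.
have -> : c = s by rewrite -(uc_funK l c) hc uc_funK.
by rewrite in_itv /= leNgt st.
Qed.

(* A displacement by an integer multiple of [pi] is a conjugacy invariant of an
   element of the universal cover. *)
Lemma ucover_displacement l s t (a b : int) : l s = s + a%:~R * pi -> l t = t + b%:~R * pi -> a = b.
Proof.
move=> hs ht; have p0 := pi_gt0 R.
have mono u v : u <= v -> l u <= l v by rewrite le_eqVlt => /orP[/eqP -> //|/ucover_lt/ltW].
pose k := Num.floor ((t - s) / pi).
have k1 : k%:~R * pi <= t - s by rewrite -ler_pdivlMr //; exact: ge_floor.
have k2 : t - s < (k%:~R + 1) * pi.
  by rewrite -ltr_pdivrMr //; have := floorD1_gt ((t - s) / pi); rewrite rmorphD.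
have := mono (s + k%:~R * pi) t; rewrite ucover_pi_int hs ht => /(_ _) h1.
have := @ucover_lt l t (s + (k + 1)%:~R * pi); rewrite ucover_pi_int hs ht rmorphD /= => /(_ _) h2.
have h1' : s + a%:~R * pi + k%:~R * pi <= t + b%:~R * pi by apply: h1; lra.
have h2' : t + b%:~R * pi < s + a%:~R * pi + (k%:~R + 1) * pi by apply: h2; lra.
have g1 : (a - b)%:~R * pi < 1%:~R * pi :> R by rewrite rmorphB /=; lra.
have g2 : (b - a)%:~R * pi < 1%:~R * pi :> R by rewrite rmorphB /=; lra.
by rewrite !ltr_pM2r // !ltr_int in g1 g2; lia.
Qed.

(** The explicit lift of A^-1 inverts that of A up to a translation by k pi, which is subtracted to
    obtain the inverse map. *)
Lemma ucover_ex (x : PSL2 R) : exists l, uc_proj l = x.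
Proof.
have [A [hA tr0]] := nonneg_trace_lift x.
have p0 := pi_gt0 R.
have trV : 0 <= tr2 A^-1%g by rewrite tr2E !entr addrC -tr2E.
have cA : ctn (rotF A) by exact: rotF_ctn.
have cV : ctn (rotF A^-1%g) by exact: rotF_ctn.
have inv_const (B : SL2) : 0 <= tr2 B -> 0 <= tr2 B^-1%g ->
    exists k : int, forall t, rotF B^-1%g (rotF B t) = t + k%:~R * pi.
  move=> tB tV.
  have hl t : exists k : int, rotF B^-1%g (rotF B t) = t + k%:~R * pi.
    have [c c0 [h1 h2]] := rotF_lifts t tB; have [c' c0' [h1' h2']] := rotF_lifts (rotF B t) tV.
    rewrite !entr in h1' h2'.
    have nc : c' != 0 by rewrite gt_eqF.
    have i0 : 0 < c^-1 by rewrite invr_gt0.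
    have nc0 : c != 0 by rewrite gt_eqF.
    have D := detE B.
    have u1 : c' * cos (rotF B^-1%g (rotF B t)) = c^-1 * cos t.
      rewrite -h1'; apply: (mulfI nc0); rewrite mulVKf //.
      have -> : c * (ed B * cos (rotF B t) + - eb B * sin (rotF B t)) =
        ed B * (c * cos (rotF B t)) - eb B * (c * sin (rotF B t)) by ring.
      by rewrite -h1 -h2 -[RHS]mul1r -D; ring.
    have u2 : c' * sin (rotF B^-1%g (rotF B t)) = c^-1 * sin t.
      rewrite -h2'; apply: (mulfI nc0); rewrite mulVKf //.
      have -> : c * (- ec B * cos (rotF B t) + ea B * sin (rotF B t)) =
        ea B * (c * sin (rotF B t)) - ec B * (c * cos (rotF B t)) by ring.
      by rewrite -h1 -h2 -[RHS]mul1r -D; ring.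
    have H1 : ea B^-1%g * cos (rotF B t) + eb B^-1%g * sin (rotF B t) = c^-1 * cos t /\
        ec B^-1%g * cos (rotF B t) + ed B^-1%g * sin (rotF B t) = c^-1 * sin t.
      by rewrite !entr h1' h2' u1 u2.
    have H2 : ea B^-1%g * cos (rotF B t) + eb B^-1%g * sin (rotF B t) = c' * cos (rotF B^-1%g (rotF B t)) /\
        ec B^-1%g * cos (rotF B t) + ed B^-1%g * sin (rotF B t) = c' * sin (rotF B^-1%g (rotF B t)).
      by rewrite !entr h1' h2'.
    have [k [hk _]] := lifts_at_uniq i0 H1 H2 nc.
    by exists k.
  have [k hk] := hl 0; exists k => t.
  pose d u := (rotF B^-1%g (rotF B u) - u) / pi.
  have cd : ctn d.
    rewrite /d; have : ctn (fun u => rotF B^-1%g (rotF B u)) by apply: cont_comp; exact: rotF_ctn.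
    by move=> c; cont.
  have di u : exists k : int, d u = k%:~R.
    by have [k' hk'] := hl u; exists k'; rewrite /d hk' addrAC subrr add0r mulfK // gt_eqF.
  have := integer_valued_constant cd di t 0; rewrite /d hk add0r subr0 mulfK ?gt_eqF //.
  by move=> e; rewrite -e divfK ?gt_eqF // addrC subrK.
have [k hk] := inv_const _ tr0 trV.
have [k' hk'] : exists k : int, forall t, rotF A (rotF A^-1%g t) = t + k%:~R * pi.
  by have := inv_const A^-1%g trV; rewrite invgK => /(_ tr0).
have shift B (j : int) t : rotF B (t + j%:~R * pi) = rotF B t + j%:~R * pi.
  have nat_case (n : nat) u : rotF B (u + n%:R * pi) = rotF B u + n%:R * pi.
    elim: n => [|n ih]; first by rewrite mul0r !addr0.
    have e : n.+1%:R * pi = n%:R * pi + pi :> R by rewrite -natr1; ring.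
    by rewrite e (addrA u) (addrA (rotF B u)) -ih; exact: (rotF_pi B (u + n%:R * pi)).
  case: j => n; first exact: nat_case.
  rewrite NegzE rmorphN /= -pmulrn mulNr.
  have := nat_case n.+1 (t - n.+1%:R * pi); rewrite subrK => ->.
  by rewrite addrK.
pose G s := rotF A^-1%g s - k%:~R * pi.
have shift' B (j : int) t : rotF B (t - j%:~R * pi) = rotF B t - j%:~R * pi.
  by have := shift B (- j) t; rewrite rmorphN mulNr.
have kk : k = k'.
  have := hk' (rotF A 0); rewrite hk shift => /addrI/mulIf e.
  by apply/eqP; rewrite -(eqr_int R); apply/eqP/e; rewrite gt_eqF.
have GK : cancel (rotF A) G by move=> t; rewrite /G hk addrK.
have GK' : cancel G (rotF A) by move=> t; rewrite /G shift' hk' kk addrK.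
have cG : continuous G by change (ctn (fun s => rotF A^-1%g s - k%:~R * pi)); cont.
have cov : lifts_action x (rotF A).
  rewrite -hA; apply/coversE => t; have [c c0 h] := rotF_lifts t tr0.
  by exists c; [rewrite gt_eqF|apply/proj_vecE].
by exists (@UCover R x (rotF A) G GK GK' cA cG cov).
Qed.

Lemma positive_lift l : exists A : SL2, psl A = uc_proj l /\ forall t, lifts_at A t (l t).
Proof.
have [A [hA tr0]] := nonneg_trace_lift (uc_proj l).
have [k hk] := ucover_rotF tr0 hA.
have he : -1 * -1 - 0 * 0 = 1 :> R by ring.
have par (j : int) (u : R) : (cos (u + (2 * j)%:~R * pi) = cos u) /\ (sin (u + (2 * j)%:~R * pi) = sin u).
  have := circD8 (u * 4 / pi) j; rewrite /circ => -[].
  have p0 : (pi : R) != 0 by rewrite gt_eqF // pi_gt0.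
  have e : u * 4 / pi * pi / 4 = u by rewrite (divfK p0) mulfK ?pnatr_eq0.
  have -> : (u * 4 / pi + 8 * j%:~R) * pi / 4 = u + (2 * j)%:~R * pi.
    rewrite rmorphM /= [(_ + _) * pi]mulrDl [(_ + _) / 4]mulrDl e; congr (_ + _); by field.
  rewrite e.
  by [].
have [[j hj]|[j hj]] : (exists j, k = 2 * j) \/ (exists j, k = 2 * j + 1).
  have := divz_eq k 2; have := modz_ge0 k (isT : (2 : int) != 0); have := ltz_pmod k (isT : (0 : int) < 2).
  move: (k %/ 2)%Z (k %% 2)%Z => q r r1 r2 e.
  have [r0|r0] : r = 0 \/ r = 1 by lia.
    by left; exists q; lia.
  by right; exists q; lia.
- exists A; split => // t; have [c c0 [h1 h2]] := rotF_lifts t tr0; exists c => //.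
  by rewrite hk hj; have [-> ->] := par j (rotF A t).
exists (mk2 he * A)%g; split.
  rewrite -hA; apply/eqP/pslP; right.
  suff -> : val (mk2 he * A)%g = - 1%:M * val A by rewrite mulNr mul1r.
  rewrite /= -!mulmxE; congr (_ *m _); apply/matrixP => a b; rewrite !mxE.
  by case: a => [[|[|//]] ?]; case: b => [[|[|//]] ?]; rewrite //= ?oppr0.
move=> t; have [c c0 [h1 h2]] := rotF_lifts t tr0; exists c => //.
have -> : l t = rotF A t + (2 * j)%:~R * pi + pi by rewrite hk hj rmorphD /=; ring.
rewrite cosDpi sinDpi; have [-> ->] := par j (rotF A t).
by rewrite !mulrN -h1 -h2 !entr; split; ring.
Qed.
End Cover.

End CoverDisplacement.
Import CoverDisplacement.

(** * The lifted relation and the displacement of the boundary curve *)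

Module Assembly.
Local Open Scope ring_scope.

Section Lifts.
Variable R : realType.
Local Notation SL2 := (SL2 R).
Local Notation ucover := (ucover R).
Implicit Types (A B : SL2) (s t : R) (l m : ucover).

HB.instance Definition _ := isMultiplicative.Build ucover (PSL2 R) (@uc_proj R) (fun _ _ => erefl).

Definition Lift A l := forall t, lifts_at A t (l t).

Lemma Lift_mul A B l m : Lift A l -> Lift B m -> Lift (A * B)%g (l * m)%g.
Proof.
move=> hA hB t; have [c c0 [h1 h2]] := hB t; have [d d0 [h3 h4]] := hA (m t).
exists (c * d); first exact: mulr_gt0.
have -> : (l * m)%g t = l (m t) by [].
rewrite -!mulrA -h3 -h4 !entr; split.
  have -> : c * (ea A * cos (m t) + eb A * sin (m t)) = ea A * (c * cos (m t)) + eb A * (c * sin (m t)) by ring.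
  by rewrite -h1 -h2; ring.
have -> : c * (ec A * cos (m t) + ed A * sin (m t)) = ec A * (c * cos (m t)) + ed A * (c * sin (m t)) by ring.
by rewrite -h1 -h2; ring.
Qed.

Lemma Lift_inv A l : Lift A l -> Lift A^-1%g l^-1%g.
Proof.
move=> h t; have [c c0 [h1 h2]] := h (l^-1%g t).
have e : l (l^-1%g t) = t by exact: uc_funinvK.
rewrite e in h1 h2; have nc : c != 0 by rewrite gt_eqF.
exists c^-1; first by rewrite invr_gt0.
have D := detE A; rewrite !entr; split; apply: (mulfI nc); rewrite mulVKf //.
  have -> : c * (ed A * cos t + - eb A * sin t) = ed A * (c * cos t) - eb A * (c * sin t) by ring.
  by rewrite -h1 -h2 -[RHS]mul1r -D; ring.
have -> : c * (- ec A * cos t + ea A * sin t) = ea A * (c * sin t) - ec A * (c * cos t) by ring.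
by rewrite -h1 -h2 -[RHS]mul1r -D; ring.
Qed.

Lemma Lift_comm A B l m : Lift A l -> Lift B m -> Lift (gcomm A B) (gcomm l m).
Proof.
move=> hA hB; apply: Lift_mul; last exact: Lift_inv.
by apply: Lift_mul; [exact: Lift_mul|exact: Lift_inv].
Qed.

(** The directions 0 and pi / 2 make A diagonal, the direction pi / 4 makes its two scalars equal,
    and the determinant normalises them. *)
Lemma Lift_scalar A (e : R) : e = 1 \/ e = -1 ->
  (forall t, exists2 c : R, 0 < c & ea A * cos t + eb A * sin t = c * (e * cos t) /\
     ec A * cos t + ed A * sin t = c * (e * sin t)) ->
  [/\ ea A = e, eb A = 0, ec A = 0 & ed A = e].
Proof.
move=> he h; have ee : e * e = 1 by case: he => ->; ring.
have [c c0 []] := h 0; rewrite cos0 sin0 !mulr1 !mulr0 !addr0 => a1 a2.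
have [d d0 []] := h (pi / 2); rewrite cos_pihalf sin_pihalf !mulr1 !mulr0 !add0r => a3 a4.
have p0 := pi_gt0 R.
have s0 : 0 < sin (pi / 4 : R) by apply: sin_gt0_pihalf; lra.
have k0 : 0 < cos (pi / 4 : R) by apply: cos_gt0_pihalf; lra.
have [q q0 []] := h (pi / 4); rewrite a1 a2 a3 a4 !mul0r addr0 add0r !mulrA => a5 a6.
have en : e != 0 by apply/eqP => e0; move: ee; rewrite e0 mul0r => /eqP; rewrite eq_sym oner_eq0.
have cq : c = q by move/(mulIf (lt0r_neq0 k0)): a5 => /(mulIf en).
have dq : d = q by move/(mulIf (lt0r_neq0 s0)): a6 => /(mulIf en).
have := detE A; rewrite a1 a2 a3 a4 mulr0 subr0 cq dq => D.
have q1 : q = 1.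
  have : q ^+ 2 = 1 by rewrite -D -[LHS]mulr1 -ee; ring.
  by move=> h2; clear - h2 q0; nra.
by split; rewrite ?a1 ?a4 ?cq ?dq ?q1 ?mul1r.
Qed.

Lemma same_proj l m : uc_proj l = uc_proj m -> exists k : int, forall t, l t = m t + k%:~R * pi.
Proof.
move=> h; have [A [hA tr0]] := nonneg_trace_lift (uc_proj m).
have [k hk] := ucover_rotF tr0 (etrans hA (esym h)); have [k' hk'] := ucover_rotF tr0 hA.
by exists (k - k') => t; rewrite hk hk' rmorphB /=; ring.
Qed.

Lemma same_proj_inv l m (k : int) : (forall t, l t = m t + k%:~R * pi) ->
  forall t, l^-1%g t = m^-1%g t - k%:~R * pi.
Proof.
move=> h t; have lK : cancel l l^-1%g by exact: uc_funK.
rewrite -{1}(uc_funinvK m t) -[X in l^-1%g X](_ : l (m^-1%g t - k%:~R * pi) = _) ?lK //.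
rewrite h -mulNr -rmorphN ucover_pi_int rmorphN mulNr subrK.
by [].
Qed.

Lemma gcomm_fun l m t : gcomm l m t = l (m (l^-1%g (m^-1%g t))).
Proof. by []. Qed.

(** Two lifts differ by a translation by a multiple of pi, which commutes with the whole cover and
    cancels in a commutator. *)
Lemma same_proj_comm l m l' m' : uc_proj l = uc_proj l' -> uc_proj m = uc_proj m' ->
  forall t, gcomm l m t = gcomm l' m' t.
Proof.
move=> /same_proj[k hk] /same_proj[j hj] t; rewrite !gcomm_fun.
have hk' := same_proj_inv hk; have hj' := same_proj_inv hj.
have sub (u : ucover) x (i : int) : u (x - i%:~R * pi) = u x - i%:~R * pi.
  by have := ucover_pi_int u x (- i); rewrite rmorphN mulNr.
pose X := l'^-1%g (m'^-1%g t).
have e1 : l^-1%g (m^-1%g t) = X - (j + k)%:~R * pi.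
  by rewrite hj' hk' sub /X rmorphD /=; ring.
rewrite e1 hj sub.
have -> : m' X - (j + k)%:~R * pi + j%:~R * pi = m' X - k%:~R * pi by rewrite rmorphD /=; ring.
by rewrite hk sub subrK.
Qed.

Lemma ucover_power l t (a : int) (n : nat) : l t = t + a%:~R * pi ->
  (l ^+ n)%g t = t + (n%:Z * a)%:~R * pi.
Proof.
move=> h; elim: n => [|n ih]; first by rewrite expg0 mul0r mul0r addr0.
rewrite expgS -[LHS]/(l ((l ^+ n)%g t)) ih ucover_pi_int h.
by rewrite -[n.+1]addn1 PoszD mulrDl mul1r rmorphD /=; ring.
Qed.

Lemma ucover_conj l m t (a : int) : l t = t + a%:~R * pi ->
  (m * l * m^-1)%g (m t) = m t + a%:~R * pi.
Proof.
move=> h; have -> : (m * l * m^-1)%g (m t) = m (l (m^-1%g (m t))) by [].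
have -> : m^-1%g (m t) = t by exact: uc_funK.
by rewrite h ucover_pi_int.
Qed.

Lemma reverse_ex l : exists m, uc_proj m = psl (flip (repr (uc_proj l))) /\ forall t, m t = - l (- t).
Proof.
pose f t := - l (- t); pose h t := - uc_funinv l (- t).
have fK : cancel f h by move=> t; rewrite /f /h opprK uc_funK opprK.
have hK : cancel h f by move=> t; rewrite /f /h opprK uc_funinvK opprK.
have cf : continuous f.
  have c : ctn (fun t => l t) by exact: uc_continuous.
  change (ctn (fun t => - l (- t))).
  apply: (contN (f := fun t => l (- t))); apply: (cont_comp c).
  by change (ctn (fun t : R => - t)); cont.
have ch : continuous h.
  have c : ctn (fun t => uc_funinv l t) by exact: uc_inv_continuous.
  change (ctn (fun t => - uc_funinv l (- t))).
  apply: (contN (f := fun t => uc_funinv l (- t))); apply: (cont_comp c).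
  by change (ctn (fun t : R => - t)); cont.
have cov : lifts_action (psl (flip (repr (uc_proj l)))) f.
  apply/coversE => t; have := @uc_covers _ l; rewrite -{1}(psl_repr (uc_proj l)) => /coversE/(_ (- t)).
  move=> [c nc /proj_vecE[h1 h2]]; exists c => //; apply/proj_vecE.
  move: h1 h2; rewrite /flip !entr /f !cosN !sinN => h1 h2; split.
    by rewrite -h1; ring.
  by rewrite mulrN -h2; ring.
by exists (@UCover R _ f h fK hK cf ch cov).
Qed.

Lemma horbit_lift (rho : {multiplicative Gamma2 -> PSL2 R}) (s : 'I_4 -> SL2) a b c d :
  (forall i, psl (s i) = rho (gamma_gen i)) ->
  horbit (s ia1) (s ib1) (s ia2) (s ib2) a b c d ->
  exists a' b' c' d', horbit a1 b1 a2 b2 a' b' c' d' /\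
    [/\ rho a' = psl a, rho b' = psl b, rho c' = psl c & rho d' = psl d].
Proof.
move=> hs; have pM x y : psl (x * y)%g = (psl x * psl y)%g by symmetry; exact: psl_mulE.
have pV x : psl x^-1%g = (psl x)^-1%g by symmetry; exact: psl_invE.
elim=> {a b c d} [|a b c d _ [a' [b' [c' [d' [o [e1 e2 e3 e4]]]]]]
  |a b c d _ [a' [b' [c' [d' [o [e1 e2 e3 e4]]]]]]|a b c d _ [a' [b' [c' [d' [o [e1 e2 e3 e4]]]]]]
  |a b c d _ [a' [b' [c' [d' [o [e1 e2 e3 e4]]]]]]|a b c d _ [a' [b' [c' [d' [o [e1 e2 e3 e4]]]]]]
  |a b c d _ [a' [b' [c' [d' [o [e1 e2 e3 e4]]]]]]].
- exists a1, b1, a2, b2; split; first exact: horbit_refl.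
  by split; rewrite hs.
- exists a', (b' * a')%g, c', d'; split; first exact: horbit_Ta.
  by rewrite morM e1 e2 e3 e4 !pM.
- exists a', (b' * a'^-1)%g, c', d'; split; first exact: horbit_TaV.
  by rewrite morM morV e1 e2 e3 e4 !pM !pV.
- exists (a' * b')%g, b', c', d'; split; first exact: horbit_Tb.
  by rewrite morM e1 e2 e3 e4 !pM.
- exists (a' * b'^-1)%g, b', c', d'; split; first exact: horbit_TbV.
  by rewrite morM morV e1 e2 e3 e4 !pM !pV.
- by exists c', d', a', b'; split; first exact: horbit_swap.
exists a', ((c' * a')^-1 * b')%g, c', ((a' * c')^-1 * d')%g; split; first exact: horbit_Tc.
by rewrite !morM !morV !morM e1 e2 e3 e4 !pM !pV !pM.
Qed.

Lemma hyperbolic_psl A : hyperbolic (psl A) -> 2 < `|tr2 A|.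
Proof.
rewrite /hyperbolic /tr2; case: (repr_psl A) => -> //.
by rewrite raddfN /= normrN.
Qed.

Lemma cos_sin_shift t (k : int) (e : R) : (k = 0 /\ e = 1) \/ ((k = 1 \/ k = -1) /\ e = -1) ->
  cos (t + k%:~R * pi) = e * cos t /\ sin (t + k%:~R * pi) = e * sin t.
Proof.
case=> [[-> ->]|[[->|->] ->]]; first by rewrite mul0r addr0 !mul1r.
  by rewrite mul1r cosDpi sinDpi !mulN1r.
have h : t = t + -1 * pi + pi by ring.
have -> : (-1)%:~R = -1 :> R by rewrite rmorphN1.
by rewrite [in X in _ = X /\ _]h [in X in _ /\ _ = X]h cosDpi sinDpi !mulN1r !opprK.
Qed.

(* If all the curves of the orbit are hyperbolic, the Euler class is even and the
   boundary of the first handle lifts to an odd translation at some point. *)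
Lemma hyperbolic_euler (rho : {multiplicative Gamma2 -> PSL2 R}) (k : int) (l : 'I_4 -> ucover) (e : R) :
  (k = 0 /\ e = 1) \/ ((k = 1 \/ k = -1) /\ e = -1) ->
  (forall i, uc_proj (l i) = rho (gamma_gen i)) ->
  (forall t, (gcomm (l ia1) (l ib1) * gcomm (l ia2) (l ib2))%g t = t + k%:~R * pi) ->
  (forall a b c d, horbit a1 b1 a2 b2 a b c d -> hyperbolic (rho a) /\ hyperbolic (rho (gcomm a b))) ->
  e = 1 /\ exists t (j : int), gcomm (l ia1) (l ib1) t = t + (2 * j + 1)%:~R * pi.
Proof.
move=> hk hl hw hyp; have he : e = 1 \/ e = -1 by case: hk => [[]|[]]; [left|right].
have /choice[s hs] : forall i, exists A, psl A = uc_proj (l i) /\ Lift A (l i).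
  by move=> i; exact: positive_lift.
have hsl i : psl (s i) = rho (gamma_gen i) by rewrite -hl; case: (hs i).
have hL i : Lift (s i) (l i) by case: (hs i).
pose W := (gcomm (s ia1) (s ib1) * gcomm (s ia2) (s ib2))%g.
have LW : Lift W (gcomm (l ia1) (l ib1) * gcomm (l ia2) (l ib2))%g.
  by apply: Lift_mul; exact: Lift_comm.
have hW : [/\ ea W = e, eb W = 0, ec W = 0 & ed W = e].
  apply: Lift_scalar => // t; have [c c0 []] := LW t; rewrite hw.
  by have [-> ->] := cos_sin_shift t hk; exists c.
have [|e1 tr] := no_hyperbolic_horbit he hW (erefl W).
  move=> a b c d /(horbit_lift hsl)[a' [b' [c' [d' [o [ra rb _ _]]]]]].
  have [h1 h2] := hyp _ _ _ _ o; split; first by apply: hyperbolic_psl; rewrite -ra.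
  have -> : gcomm a b = (a * b * a^-1 * b^-1)%g by [].
  apply: hyperbolic_psl; move: h2; rewrite mor_comm ra rb.
  have pM x y : psl (x * y)%g = (psl x * psl y)%g by symmetry; exact: psl_mulE.
  have pV x : psl x^-1%g = (psl x)^-1%g by symmetry; exact: psl_invE.
  by rewrite !pM !pV.
split => //; pose Z := gcomm (s ia1) (s ib1); pose T := tr2 Z.
have T2 : T < -2 by [].
have q0 : 0 < T ^+ 2 - 4 by nra.
pose q := Num.sqrt (T ^+ 2 - 4); have hq : q ^+ 2 = T ^+ 2 - 4 by rewrite sqr_sqrtr // ltW.
have qp : 0 < q by rewrite sqrtr_gt0.
(* The eigenvalue of Z below -1; after conjugation by [P] its eigenvector is the direction 0. *)
pose x := (T - q) / 2; have x0 : x < 0 by rewrite /x; lra.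
have xn : x != 0 by rewrite lt_eqF.
have xV : x^-1 = (T + q) / 2.
  apply: (mulfI xn); rewrite mulfV // /x.
  have -> : (T - q) / 2 * ((T + q) / 2) = (T ^+ 2 - q ^+ 2) / 4 by field.
  by rewrite hq; field.
have [||P [p1 _ p3 _]] := @diagonalize R Z x xn.
- by rewrite xV /x; apply/eqP => h; lra.
- by rewrite xV /x -/T; field.
have [p hp] := ucover_ex (psl P).
have [Q [hQ LQ]] := positive_lift p.
have LZ : Lift Z (gcomm (l ia1) (l ib1)) by exact: Lift_comm.
have LC : Lift (Q * Z * Q^-1)%g (p * gcomm (l ia1) (l ib1) * p^-1)%g.
  by apply: Lift_mul; [exact: Lift_mul|exact: Lift_inv].
have [m1 m3] : ea (Q * Z * Q^-1)%g = x /\ ec (Q * Z * Q^-1)%g = 0.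
  have : val Q = val P \/ val Q = - val P by apply/pslP; rewrite hQ hp.
  have he' : -1 * -1 - 0 * 0 = 1 :> R by ring.
  case=> hv; first by have -> : Q = P by apply: val_inj.
  have -> : Q = (mk2 he' * P)%g.
    by apply: SL2_ext; rewrite !entr /ea /eb /ec /ed hv !mxE; ring.
  have -> : (mk2 he' * P * Z * (mk2 he' * P)^-1 = mk2 he' * (P * Z * P^-1) * (mk2 he')^-1)%g by rewrite !gnorm.
  move: (P * Z * P^-1)%g p1 p3 => D p1 p3; rewrite !entr p1 p3; split; ring.
(* The matrix multiplies the direction 0 by the negative number x while a lift has a positive
   factor, so the lift turns this direction by an odd multiple of pi. *)
have := LC 0; set F := (p * _ * _)%g; move=> [c c0 []]; rewrite m1 m3 cos0 sin0 !mulr1 !mulr0 !addr0 => f1 f2.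
have sF : sin (F 0) = 0.
  by move/esym/eqP: f2; rewrite mulf_eq0 gt_eqF //= => /eqP.
have cF : cos (F 0) = -1.
  have := cos2Dsin2 (F 0); rewrite sF expr0n addr0 => h.
  have : cos (F 0) < 0 by rewrite -(pmulr_rlt0 _ c0) -f1.
  by clear - h; nra.
have [||j hj] := @cos_sin_angle R (F 0) pi; rewrite ?cospi ?sinpi //.
exists (p^-1%g 0), j.
have hF : F 0 = 0 + (2 * j + 1)%:~R * pi by rewrite hj rmorphD rmorphM /=; ring.
have := ucover_conj p^-1%g hF; have -> // : (p^-1 * F * p^-1^-1)%g = gcomm (l ia1) (l ib1).
by rewrite /F; move: (gcomm _ _) => G; rewrite !gnorm.
Qed.

(** The relation lifts without translation, so rho comes from a morphism r into the cover. Then r (f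
    z) is computed twice: as a conjugate of a power of r z, and, since commutators do not depend on
    the chosen lifts, as a conjugate of the commutator of the lifts of a_1 and b_1 reversed by t |->
    - t. *)
Lemma reversed_boundary (rho : {multiplicative Gamma2 -> PSL2 R}) (l : 'I_4 -> ucover)
    (f : {multiplicative Gamma2 -> Gamma2}) (g : R[i] -> R[i]) t (j : int) :
  (forall i, uc_proj (l i) = rho (gamma_gen i)) ->
  (forall t, (gcomm (l ia1) (l ib1) * gcomm (l ia2) (l ib2))%g t = t) ->
  gcomm (l ia1) (l ib1) t = t + j%:~R * pi ->
  hisometry g -> ~ orientation_preserving g ->
  (forall x z, Hplane z -> g (moebius (rho x) z) = moebius (rho (f x)) (g z)) ->
  forall h (n : nat), f (gcomm a1 b1) = (h * gcomm a1 b1 ^+ n * h^-1)%g -> n%:Z * j = - j.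
Proof.
move=> hl hw ht ig ng hg h n fz.
have rel : surface_relation l.
  apply: ucover_eq.
  - have -> : uc_proj (gcomm (l ia1) (l ib1) * gcomm (l ia2) (l ib2))%g =
      rho (gcomm a1 b1 * gcomm a2 b2)%g by rewrite (@morM _ _ rho) !(@mor_comm _ _ rho) -!hl.
    by have := gamma_relation; rewrite /surface_relation => ->; rewrite mor1.
  - by apply/funext => x; exact: hw.
  apply/funext => x; set w := (_ * _)%g.
  have := uc_funinvK w x; by rewrite [w _]hw.
have [r hr] := gamma_ext_ex rel.
have pr x : uc_proj (r x) = rho x.
  have := @multiplicative_ext _ (@uc_proj R \o r) rho; apply => i /=.
  by rewrite hr hl.
have [M hM] := reversing_conj ig ng.
have [m hm] := ucover_ex (psl M).
have [v1 [pv1 fv1]] := reverse_ex (l ia1); have [v2 [pv2 fv2]] := reverse_ex (l ib1).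
have pf i v : uc_proj v = psl (flip (repr (uc_proj (l i)))) ->
    uc_proj (r (f (gamma_gen i))) = uc_proj (m * v * m^-1)%g.
  move=> hv; rewrite pr.
  have -> : uc_proj (m * v * m^-1)%g = (psl M * uc_proj v * (psl M)^-1)%g by rewrite -hm.
  rewrite hv hl.
  have := hM (repr (rho (gamma_gen i))) (repr (rho (f (gamma_gen i)))); rewrite !psl_repr; apply.
  by move=> z hz; exact: hg.
have E s : r (f (gcomm a1 b1)) s = (m * gcomm v1 v2 * m^-1)%g s.
  rewrite !mor_comm (same_proj_comm (pf _ _ pv1) (pf _ _ pv2)).
  by have -> : gcomm (m * v1 * m^-1) (m * v2 * m^-1) = (m * gcomm v1 v2 * m^-1)%g by rewrite /gcomm !gnorm.
have inv_rev (v u : ucover) : (forall t, v t = - u (- t)) -> forall t, v^-1%g t = - u^-1%g (- t).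
  move=> hv s; have vK : cancel v v^-1%g by exact: uc_funK.
  have uK : u (u^-1%g (- s)) = - s by exact: uc_funinvK.
  by rewrite -[RHS]vK hv opprK uK opprK.
have rz : gcomm v1 v2 (- t) = - t + (- j)%:~R * pi.
  rewrite gcomm_fun (inv_rev _ _ fv2) opprK (inv_rev _ _ fv1) opprK fv2 opprK fv1 opprK.
  by rewrite -gcomm_fun ht opprD rmorphN mulNr.
have d2 := ucover_conj m rz; rewrite -E in d2.
have d0 : r (gcomm a1 b1) t = t + j%:~R * pi by rewrite mor_comm !hr.
have d1 := ucover_conj (r h) (ucover_power n d0).
have morX y (i : nat) : r (y ^+ i)%g = (r y ^+ i)%g.
  by elim: i => [|i ih]; rewrite ?expg0 ?mor1 // !expgS morM ih.
have eX : r (f (gcomm a1 b1)) = (r h * r (gcomm a1 b1) ^+ n * (r h)^-1)%g.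
  rewrite fz; move: (gcomm a1 b1) => y; rewrite (morM r (h * y ^+ n)%g) morM morV; congr (_ * _ * _)%g.
  exact: morX.
rewrite -eX in d1.
exact: ucover_displacement d1 d2.
Qed.
End Lifts.

End Assembly.
Import Assembly.

(** * Existence of a non-hyperbolic simple closed curve *)

Local Open Scope ring_scope.

Theorem theorem1p4 (R : realType) (rho : {multiplicative Gamma2 -> PSL2 R}) :
  Mk 1 rho \/ Mk (-1) rho \/ M0_minus rho ->
  exists (c : R -> Sigma2 R) (g : Gamma2),
    [/\ simple_closed_curve c, represents c g, g <> 1%g & ~ hyperbolic (rho g)].
Proof.
move=> H; apply: contrapT => no.
have hyp a b c d : horbit a1 b1 a2 b2 a b c d -> hyperbolic (rho a) /\ hyperbolic (rho (gcomm a b)).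
  move=> /(horbit_curves R) o; split; apply: contrapT => nh; apply: no.
    by have [n1 [cv [h1 h2]]] := o a (or_introl erefl); exists cv, a.
  by have [n1 [cv [h1 h2]]] := o _ (or_intror erefl); exists cv, (gcomm a b).
have odd_case k : k = 1 \/ k = -1 -> euler_class rho k -> False.
  move=> hk [l [hl hw]].
  have [e1 _] := @hyperbolic_euler R rho k l (-1) (or_intror (conj hk erefl)) hl hw hyp.
  by have : (0 : R) < 1 by []; move: e1; clear; lra.
case: H => [[_ e1]|[[_ e1]|[[_ [l [hl hw]]] [f [af _ cf] [g [ig ng hg]]]]]].
- by apply: odd_case e1; left.
- by apply: odd_case e1; right.
have [_ [t [j hj]]] := hyperbolic_euler (or_introl (conj erefl erefl)) hl hw hyp.
have hw0 s : (gcomm (l ia1) (l ib1) * gcomm (l ia2) (l ib2))%g s = s by rewrite hw mul0r addr0.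
have [h [n fz]] := image_boundary_power R cf.
have := reversed_boundary hl hw0 hj ig ng hg fz => e.
(* The first factor is positive because n is a natural number, and the second is odd. *)
have : (n%:Z + 1) * (2 * j + 1) = 0 by rewrite mulrDl mul1r e addNr.
by move/eqP; rewrite mulf_eq0 => /orP[] /eqP; lia.
Qed.
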